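(* Assume Assumption 1 and Assumption 2 below. Then there exist $\kappa_{\min},\beta_{\min}>0$ (depending on $X$, $\Phi_0$, $\mathcal{P}$) such that whenever $\kappa\ge\kappa_{\min}$, $\beta\ge\beta_{\min}$ and $\|\Upsilon\|_\kappa\le1$, the classical restriction $\mu^{\beta,X}$ of the (unique) equilibrium state at inverse temperature $\beta$ of $\Phi=\Phi_0+\Upsilon$ is Gibbsian. The same holds for the classical restriction of the (unique) ground state, i.e. for $\beta=\infty$.
   Context: Quantum spin system on $\mathbb{Z}^d$ with $\mathcal{H}_i\cong\mathcal{H}=\mathbb{C}^m$; interactions are translation invariant families of self-adjoint $\Phi(A)\in\mathcal{B}(\mathcal{H}_A)$, vanishing for non-connected $A$; $\|\Phi\|_\kappa=\sum_{A\ni0}e^{\kappa|A|}\|\Phi(A)\|$; $H^\Phi_\Lambda=\sum_{A\subset\Lambda}\Phi(A)$. The equilibrium state $\omega^\beta$ is the thermodynamic limit of $\omega^\beta_\Lambda(\cdot)=\mathrm{Tr}(e^{-\beta H^\Phi_\Lambda}\cdot)/\mathrm{Tr}(e^{-\beta H^\Phi_\Lambda})$ (unique in this regime), the ground state its $\beta\to\infty$ limit; $\mu^{\beta,X}=\lim_\Lambda\mu_\Lambda^{\beta,X}$ with $\mu^{\beta,X}_\Lambda(x_\Lambda)=\omega^\beta_\Lambda(Q_\Lambda(x_\Lambda))$. Assumption 1: $\Phi=\Phi_0+\Upsilon$ with $\Phi_0$ of finite range $r$, and there is a one-dimensional orthogonal projection $\mathcal{P}\in\mathcal{B}(\mathcal{H})$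 such that, with $\mathcal{P}_\Lambda(S)=(\bigotimes_{i\in S}\mathcal{P}_i^\perp)\otimes(\bigotimes_{i\in\Lambda\setminus S}\mathcal{P}_i)$, for all finite $\Lambda$ and $S\subset\Lambda$: (1) $H^{\Phi_0}_\Lambda$ commutes with $\mathcal{P}_\Lambda(S)$; (2) $H^{\Phi_0}_\Lambda\mathcal{P}_\Lambda(\emptyset)=0$; (3) there is a $\Lambda$-independent $g>0$ with $H^{\Phi_0}_\Lambda\mathcal{P}_\Lambda(S)\ge g|S|\mathcal{P}_\Lambda(S)$. Assumption 2: $X\in\mathcal{B}(\mathcal{H})$ is self-adjoint with spectral decomposition $X=\sum_xxQ(x)$ and $\mathrm{Tr}(Q(x)\mathcal{P})>0$ for all $x\in\mathrm{sp}(X)$. Classical restriction and Gibbsianness: $\mu^X(x_\Lambda)=\omega(\prod_{i\in\Lambda}Q_i(x_i))$ defines a measure on $\Omega=\mathrm{sp}(X)^{\mathbb{Z}^d}$; $\mu$ is Gibbsian if there is a translation-invariant classical potential $\Psi=\{\Psi_A:\Omega_A\to\mathbb{R}\}$ with $\sum_{A\ni0}\sup|\Psi_A|<\infty$ and $\mu(x_\Lambda\mid x_{\Lambda^c})=\mathcal{Z}_\Lambda(x_{\Lambda^c})^{-1}\exp[-\sum_{A\cap\Lambda\ne\emptyset}\Psi_A(x)]$ for all finite $\Lambda$ and $\mu$-a.e. $x_{\Lambda^c}$. *)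

(* Defs.v *)
From HB Require Import structures.
From mathcomp Require Import all_boot all_order all_algebra.
From mathcomp Require Import finmap.
From mathcomp Require Import all_classical all_reals all_analysis.
From mathcomp Require Import complex.

Set Implicit Arguments.
Unset Strict Implicit.
Unset Printing Implicit Defensive.

Import Order.TTheory GRing.Theory Num.Theory.
Import numFieldNormedType.Exports.
Local Open Scope classical_set_scope.
Local Open Scope ring_scope.

Notation site d := 'rV[int]_d.

Definition shift (d : nat) (A : {fset site d}) (a : site d) : {fset site d} :=
  [fset (s + a)%R | s in A]%fset.

Definition adjacent (d : nat) (s t : site d) : bool :=
  (\sum_(i < d) `|s ord0 i - t ord0 i| == 1 :> int).

Definition connected_region (d : nat) (A : {fset site d}) : Prop :=
  A != fset0 /\
  forall B : {fset site d}, (B `<=` A)%fset -> B != fset0 -> B != A ->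
    exists s t, [/\ s \in B, t \in A, t \notin B & adjacent s t].

Definition boxpt (d n : nat) (f : {ffun 'I_d -> 'I_(2 * n + 1)}) : site d :=
  (\row_i ((f i : nat)%:Z - n%:Z))%R.
Definition box (d n : nat) : {fset site d} :=
  [fset @boxpt d n f | f in {: {ffun 'I_d -> 'I_(2 * n + 1)}}]%fset.

(* Quantum side: H_A = (C^m)^{(x) A}, with the product basis indexed   *)
(* by configurations x : A -> 'I_m.                                    *)

Section Quantum.
Variable R : realType.
Local Notation C := R[i].

Definition rc (x : R) : C := (x%:C)%C.

Notation qconf d m A := {ffun (A : {fset site d}) -> 'I_m}.

Definition op (d m : nat) (A : {fset site d}) := 'M[C]_(#|qconf d m A|).

Definition ent (d m : nat) (A : {fset site d}) (M : op m A)
  (x y : qconf d m A) : C := M (enum_rank x) (enum_rank y).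

Definition mxof (d m : nat) (A : {fset site d})
  (f : qconf d m A -> qconf d m A -> C) : op m A :=
  \matrix_(i, j) f (enum_val i) (enum_val j).

Definition adj (p q : nat) (M : 'M[C]_(p, q)) : 'M[C]_(q, p) :=
  (map_mx (@conjc R) M)^T.
Definition hermitian (n : nat) (M : 'M[C]_n) : Prop := adj M = M.
Definition psd (n : nat) (M : 'M[C]_n) : Prop :=
  forall v : 'cV[C]_n, 0 <= (adj v *m M *m v) ord0 ord0.

Definition vnorm (n : nat) (v : 'cV[C]_n) : R :=
  Num.sqrt (\sum_i complex.Re ((v i ord0)^*%C * v i ord0)).
Definition opnorm (n : nat) (M : 'M[C]_n) : R :=
  sup [set vnorm (M *m v) | v in [set v : 'cV[C]_n | vnorm v = 1]].

Definition agree (d m : nat) (L A : {fset site d})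
  (x : qconf d m L) (x' : qconf d m A) : bool :=
  [forall a : A, forall b : L, (fsval a == fsval b) ==> (x' a == x b)].

(* embedding B |-> B (x) 1_{L \ A} of B(H_A) into B(H_L) (for A <= L) *)
Definition emb (d m : nat) (L A : {fset site d}) (B : op m A) : op m L :=
  mxof (fun x y =>
    ([forall b : L, (fsval b \notin A) ==> (x b == y b)])%:R *
    \sum_(x' : qconf d m A | agree x x') \sum_(y' : qconf d m A | agree y y')
        ent B x' y').

Definition tens (d m : nat) (L : {fset site d}) (F : L -> 'M[C]_m) : op m L :=
  mxof (fun x y => \prod_(s : L) F s (x s) (y s)).

Definition qinteraction (d m : nat) := forall A : {fset site d}, op m A.

Definition qshifted (d m : nat) (A : {fset site d}) (a : site d)
  (x0 : qconf d m A) (x : qconf d m (shift A a)) : Prop :=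
  forall (s : A) (t : shift A a), fsval t = (fsval s + a)%R -> x t = x0 s.

Definition qtransl_inv (d m : nat) (Phi : qinteraction d m) : Prop :=
  forall (A : {fset site d}) (a : site d)
         (x0 y0 : qconf d m A) (x y : qconf d m (shift A a)),
    qshifted x0 x -> qshifted y0 y ->
    ent (Phi (shift A a)) x y = ent (Phi A) x0 y0.

Definition is_interaction (d m : nat) (Phi : qinteraction d m) : Prop :=
  [/\ forall A, hermitian (Phi A),
      qtransl_inv Phi &
      forall A, ~ connected_region A -> Phi A = 0].

Definition finite_range (d m : nat) (r : nat) (Phi : qinteraction d m) : Prop :=
  forall A : {fset site d},
    (exists s t (i : 'I_d), [/\ s \in A, t \in A & (r%:Z < `|s ord0 i - t ord0 i|)%R]) ->
    Phi A = 0.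

Definition kappa_norm (d m : nat) (kappa : R) (Phi : qinteraction d m) : \bar R :=
  (\esum_(A in [set A : {fset site d} | (0%R : site d) \in A])
     (expR (kappa * (#|` A|%:R)) * opnorm (Phi A))%:E)%E.

Definition ham (d m : nat) (Phi : qinteraction d m) (L : {fset site d}) : op m L :=
  \sum_(A <- fpowerset L) emb L (Phi A).

(* Tr(e^{-beta H} B), via the exponential series *)
Definition gibbs_tr (n : nat) (beta : R) (H B : 'M[C]_n) : C :=
  let u k := \sum_(j < k) rc ((- beta) ^+ j / (j`!)%:R) * \tr (H ^+ j *m B) in
  let ur : nat -> R := fun k => complex.Re (u k) in
  let ui : nat -> R := fun k => complex.Im (u k) in
  ((limn ur) +i* (limn ui))%C.

Definition gibbs_state (d m : nat) (beta : R) (Phi : qinteraction d m)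
  (L : {fset site d}) (B : op m L) : C :=
  gibbs_tr beta (ham Phi L) B / gibbs_tr beta (ham Phi L) 1.

Definition rank_one_proj (m : nat) (P : 'M[C]_m) : Prop :=
  [/\ hermitian P, P *m P = P & \rank P = 1%N].

Definition proj_config (d m : nat) (P : 'M[C]_m) (L S : {fset site d}) : op m L :=
  tens (fun s : L => if fsval s \in S then 1%:M - P else P).

Definition assumption1 (d m : nat) (Phi0 : qinteraction d m) (r : nat)
  (P : 'M[C]_m) (g : R) : Prop :=
  [/\ is_interaction Phi0, finite_range r Phi0, rank_one_proj P, 0 < g &
    forall L S : {fset site d}, (S `<=` L)%fset ->
      [/\ ham Phi0 L *m proj_config P L S = proj_config P L S *m ham Phi0 L,
          ham Phi0 L *m proj_config P L fset0 = 0 &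
          psd (ham Phi0 L *m proj_config P L S
               - rc (g * (#|` S|%:R)) *: proj_config P L S)]].

Definition spectral_decomposition (m k : nat) (X : 'M[C]_m)
  (ev : 'I_k.+1 -> R) (Q : 'I_k.+1 -> 'M[C]_m) : Prop :=
  [/\ hermitian X /\ injective ev,
      (forall i, [/\ hermitian (Q i), Q i *m Q i = Q i & Q i != 0]),
      (forall i j, i != j -> Q i *m Q j = 0),
      \sum_i Q i = 1%:M &
      X = \sum_i rc (ev i) *: Q i].

Definition assumption2 (m k : nat) (X P : 'M[C]_m)
  (ev : 'I_k.+1 -> R) (Q : 'I_k.+1 -> 'M[C]_m) : Prop :=
  spectral_decomposition X ev Q /\ forall i, 0 < \tr (Q i *m P).

End Quantum.

(* Classical side: Omega = sp(X)^{Z^d}, eigenvalues labelled by 'I_k.+1 *)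

Definition Omega (d k : nat) := site d -> 'I_k.+1.
HB.instance Definition _ d k := Choice.on (Omega d k).
HB.instance Definition _ d k := isPointed.Build (Omega d k) (fun _ => ord0).

Notation cconf d k V := {ffun (V : {fset site d}) -> 'I_k.+1}.

Definition cyl (d k : nat) (V : {fset site d}) (x : cconf d k V) : set (Omega d k) :=
  [set w : Omega d k | forall s : V, w (fsval s) = x s].

Definition cylinders (d k : nat) : set (set (Omega d k)) :=
  [set B | exists (V : {fset site d}) (x : cconf d k V), B = cyl x].

Definition OmegaM (d k : nat) := g_sigma_algebraType (@cylinders d k).

Definition outside_sigma (d k : nat) (L : {fset site d}) : set (set (Omega d k)) :=
  <<s [set B | exists (V : {fset site d}) (x : cconf d k V),
               B = cyl x /\ forall s, s \in V -> s \notin L] >>.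

Section Classical.
Variable R : realType.

(* sum of an absolutely summable real family over a set of finite regions *)
Definition rsum (d : nat) (S : set {fset site d}) (F : {fset site d} -> R) : R :=
  fine (\esum_(A in S) (Num.max (F A) 0)%:E)%E
  - fine (\esum_(A in S) (Num.max (- F A) 0)%:E)%E.

Definition cpotential (d k : nat) := {fset site d} -> Omega d k -> R.

Definition cpot_local (d k : nat) (Psi : cpotential d k) : Prop :=
  forall A (w w' : Omega d k), (forall s, s \in A -> w s = w' s) -> Psi A w = Psi A w'.

Definition cpot_transl_inv (d k : nat) (Psi : cpotential d k) : Prop :=
  forall A (a : site d) (w : Omega d k),
    Psi (shift A a) w = Psi A (fun s => w (s + a)%R).

Definition cpot_summable (d k : nat) (Psi : cpotential d k) : Prop :=
  (\esum_(A in [set A : {fset site d} | (0%R : site d) \in A])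
     (sup (range (fun w => `|Psi A w|)))%:E < +oo)%E.

Definition energy (d k : nat) (Psi : cpotential d k) (L : {fset site d})
  (w : Omega d k) : R :=
  rsum [set A : {fset site d} | exists2 s, s \in A & s \in L] (fun A => Psi A w).

Definition glue (d k : nat) (L : {fset site d}) (x : cconf d k L) (w : Omega d k)
  : Omega d k :=
  fun s => if insub s : option L is Some t then x t else w s.

Definition gibbs_kernel (d k : nat) (Psi : cpotential d k) (L : {fset site d})
  (x : cconf d k L) (w : Omega d k) : R :=
  expR (- energy Psi L (glue x w))
  / \sum_(y : cconf d k L) expR (- energy Psi L (glue y w)).

(* mu(x_L | x_{L^c}) = gibbs_kernel ... mu-a.e.: the kernel is a version of the
   conditional probability of the cylinder {w_L = x_L} given F_{L^c}. *)
Definition gibbsian (d k : nat) (mu : probability (OmegaM d k) R) : Prop :=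
  exists Psi : cpotential d k,
    [/\ cpot_local Psi, cpot_transl_inv Psi, cpot_summable Psi &
      forall (L : {fset site d}) (x : cconf d k L),
        (forall Y : set R, measurable Y ->
           outside_sigma L (gibbs_kernel Psi x @^-1` Y)) /\
        (forall B : set (Omega d k), outside_sigma L B ->
           mu (cyl x `&` B) = (\int[mu]_(w in B) (gibbs_kernel Psi x w)%:E)%E)].

End Classical.

Section Restriction.
Variable R : realType.
Local Notation C := R[i].

Definition fv_marginal (d m k : nat) (Q : 'I_k.+1 -> 'M[C]_m) (beta : R)
  (Phi : qinteraction R d m) (n : nat) (V : {fset site d}) (x : cconf d k V) : R :=
  complex.Re (gibbs_state beta Phi
    (emb (box d n) (tens (fun s : V => Q (x s))))).

(* mu is the classical restriction mu^{beta,X} of the thermodynamic limit of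
   the Gibbs states omega^beta_{box n} *)
Definition is_restriction_eq (d m k : nat) (Q : 'I_k.+1 -> 'M[C]_m) (beta : R)
  (Phi : qinteraction R d m) (mu : probability (OmegaM d k) R) : Prop :=
  forall (V : {fset site d}) (x : cconf d k V),
    fv_marginal Q beta Phi n x @[n --> \oo] --> fine (mu (cyl x)).

(* mu is the classical restriction of the ground state, the beta -> oo
   limit of the equilibrium states *)
Definition is_restriction_gs (d m k : nat) (Q : 'I_k.+1 -> 'M[C]_m)
  (Phi : qinteraction R d m) (mu : probability (OmegaM d k) R) : Prop :=
  forall (V : {fset site d}) (x : cconf d k V),
    exists G : R -> R,
      (\forall beta \near +oo,
         fv_marginal Q beta Phi n x @[n --> \oo] --> G beta) /\
      G beta @[beta --> +oo] --> fine (mu (cyl x)).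

End Restriction.

(* Main.v *)
(** In a basis where [P] is the projection on a basis vector, [ham Phi0 L] conserves the set of
    excited sites and costs at least [g] for each of them.  Write [beta = N * tau] with [tau] in a
    fixed interval.  Expanding each of the [N] factors [exp (- tau H)] in its excited sites and in the
    bonds of [Ups] turns the weights [Tr (exp (- beta H) Q(x))] into partition functions of a polymer
    gas on sites times time slices, whose activities are small when [tau] and [kappa] are large,
    uniformly in [N] and in the volume.  The measured configuration [x] only enters through vertices
    of the time slice 0, so in the ratio of the partition functions with and without the projectors
    [Q(x)] only polymers meeting this slice survive; the Moebius coefficients of the logarithm of the
    ratio, over subsets of the volume, form a classical potential for the finite-volume weights,
    with exponentially decaying tails.  Smallness of these coefficients is proved by removing the
    vertices one by one, in a weighted norm on Moebius coefficients, rather than by a cluster expansion.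
    Along an ultrafilter refining the thermodynamic limit (the iterated limit [n -> oo], [beta -> oo]
    for the ground state) the finite-volume potentials converge, and the finite-volume DLR equations
    pass to the limit thanks to the uniform tails. *)
Require Import Defs.
From HB Require Import structures.
From mathcomp Require Import all_boot all_order all_algebra.
From mathcomp Require Import finmap.
From mathcomp Require Import all_classical all_reals all_analysis.
From mathcomp Require Import complex.
From mathcomp Require Import ring lra zify.
Require Import Defs.

Set Implicit Arguments.
Unset Strict Implicit.
Unset Printing Implicit Defensive.

Import Order.TTheory GRing.Theory Num.Theory.
Import numFieldNormedType.Exports.
Local Open Scope ring_scope.

(** * Complex modulus and Moebius inversion *)

Section ComplexModulus.
Variable R : realType.
Local Notation C := R[i].

(** Two demands on the slice length conflict: an excited site costs exp(- tau g) per slice, which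
    asks for a large [tau], while a bond weighs exp(2 tau v) - 1, which asks for a bounded one.
    Hence [tau] is fixed first, from the gap, and [kappa] afterwards, from [tau]; only the number of
    slices grows with [beta]. Partition functions of arbitrary sets of space-time vertices are
    complex, so the logarithm is taken of the squared modulus; in the full volume the trace is
    nonnegative and half of this logarithm is the true one. The one-site factors are divided by
    their vacuum entry, so that the vacuum has weight 1: here the positivity of Tr(Q(x) P) enters,
    at the price of a one-site term in the potential. Translation invariance comes from regions away
    from the boundary, whose coefficients have a formula that does not mention the volume. Only the
    marginals of [mu] are limits by assumption; for the potentials compactness suffices, since
    whatever limit the ultrafilter selects satisfies the DLR equations for the same [mu]. *)

Definition nrm (z : C) : R := Normc.normc z.

Lemma nrm_norm z : `|z| = rc (nrm z). Proof. by []. Qed.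
Lemma nrmM : {morph nrm : x y / x * y}. Proof. exact: Normc.normcM. Qed.
Lemma nrmD x y : nrm (x + y) <= nrm x + nrm y. Proof. exact: le_normcD. Qed.
Lemma nrm0 : nrm 0 = 0. Proof. exact: Normc.normc0. Qed.
Lemma nrm1 : nrm 1 = 1. Proof. exact: Normc.normc1. Qed.
Lemma nrmN x : nrm (- x) = nrm x. Proof. exact: normcN. Qed.
Lemma nrmV x : nrm x^-1 = (nrm x)^-1. Proof. exact: Normc.normcV. Qed.
Lemma nrm_ge0 x : 0 <= nrm x.
Proof. by have := normr_ge0 x; rewrite nrm_norm /rc ler0c. Qed.
Lemma nrm_eq0 x : (nrm x == 0) = (x == 0).
Proof. apply/eqP/eqP => [/Normc.eq0_normc//|->]; exact: nrm0. Qed.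

Lemma nrm_distC x y : nrm (x - y) = nrm (y - x).
Proof. by rewrite -nrmN opprB. Qed.
Lemma nrm_sum (I : Type) (r : seq I) (P : pred I) (F : I -> C) :
  nrm (\sum_(i <- r | P i) F i) <= \sum_(i <- r | P i) nrm (F i).
Proof.
elim/big_rec2: _ => [|i a b _ h]; first by rewrite nrm0.
by apply: (le_trans (nrmD _ _)); rewrite lerD2l.
Qed.
Lemma nrm_prod (I : Type) (r : seq I) (P : pred I) (F : I -> C) :
  nrm (\prod_(i <- r | P i) F i) = \prod_(i <- r | P i) nrm (F i).
Proof. by elim/big_rec2: _ => [|i a b _ h]; rewrite ?nrm1 // nrmM h. Qed.
Lemma nrmX x n : nrm (x ^+ n) = nrm x ^+ n.
Proof. by elim: n => [|n h]; rewrite ?expr0 ?nrm1 // !exprS nrmM h. Qed.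
Lemma nrm_rc (x : R) : nrm (rc x) = `|x|.
Proof. by rewrite /nrm /rc /= expr0n addr0 sqrtr_sqr. Qed.
Lemma nrm_sign n : nrm ((-1) ^+ n) = 1.
Proof. by rewrite nrmX nrmN nrm1 expr1n. Qed.
Lemma nrm_conj x : nrm (x^*)%C = nrm x.
Proof. by apply: complexI; apply: normcJ. Qed.
Lemma rc_nrm2 x : rc (nrm x ^+ 2) = x * (x^*)%C.
Proof. by rewrite -sqr_normc nrm_norm /rc rmorphXn. Qed.
Lemma Re_le_nrm x : `|complex.Re x| <= nrm x.
Proof. by rewrite -lecR; apply: normc_ge_Re. Qed.
Lemma nrm_nat n : nrm (n%:R) = n%:R.
Proof. by have := nrm_rc n%:R; rewrite /rc rmorph_nat ger0_norm // ler0n. Qed.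
Lemma nrm_bool (b : bool) : nrm (b%:R) = b%:R.
Proof. exact: nrm_nat. Qed.
End ComplexModulus.

Section Mobius.
Import fintype boot.finset.
Variables (V : finType) (K : numDomainType).
Implicit Types (f : {set V} -> K) (A B D U : {set V}).

Definition mob f D : K :=
  \sum_(U : {set V} | U \subset D) (-1) ^+ #|D :\: U| * f U.

Definition toggle (v : V) U : {set V} := if v \in U then U :\ v else v |: U.

Lemma toggleK v : involutive (toggle v).
Proof.
move=> U; have [vU|vU] := boolP (v \in U); rewrite /toggle.
  by rewrite vU setD11 setD1K.
by rewrite (negPf vU) setU11 setU1K.
Qed.

Lemma sub_toggle v U D : v \in D -> (toggle v U \subset D) = (U \subset D).
Proof.
move=> vD; rewrite /toggle; case: ifPn => vU.
  apply/idP/idP => h; last exact: subset_trans (subD1set _ _) h.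
  by rewrite -(setD1K vU) subUset sub1set vD.
by rewrite subUset sub1set vD.
Qed.

Lemma card_toggle v U D : v \in D ->
  (-1) ^+ #|D :\: toggle v U| = - (-1) ^+ #|D :\: U| :> K.
Proof.
move=> vD; rewrite /toggle; case: ifPn => vU.
  have -> : D :\: (U :\ v) = v |: (D :\: U).
    by apply/setP => u; rewrite !inE; case: eqP => [->|_]; rewrite ?vD //.
  by rewrite cardsU1 !inE vU /= add1n exprS mulN1r.
have -> : D :\: U = v |: (D :\: (v |: U)).
  by apply/setP => u; rewrite !inE; case: eqP => [->|_]; rewrite ?vD ?vU //.
by rewrite cardsU1 !inE eqxx /= add1n exprS mulN1r opprK.
Qed.

(** Toggling [v] pairs the subsets of [D] with equal values of [f] and opposite signs. The locality
    of the potential rests on this cancellation. *)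
Lemma mob_indep f v D : v \in D ->
  (forall U, f (v |: U) = f (U :\ v)) -> mob f D = 0.
Proof.
move=> vD fv; have fT U : f (toggle v U) = f U.
  rewrite /toggle; case: ifPn => vU; first by rewrite -fv (setUidPr _) ?sub1set.
  by rewrite fv; congr f; apply/setP => u; rewrite !inE; case: eqP => // ->; rewrite (negPf vU).
have : mob f D = - mob f D.
  rewrite {1}/mob (reindex_inj (inv_inj (toggleK v))) /= -sumrN.
  by apply: eq_big => [U|U _]; rewrite ?sub_toggle // fT card_toggle // mulNr.
by move/eqP; rewrite -addr_eq0 -mulr2n mulrn_eq0 /= => /eqP.
Qed.

Lemma alt_sum A D : A \subset D ->
  \sum_(U : {set V} | (A \subset U) && (U \subset D)) (-1) ^+ #|U :\: A| = (A == D)%:R :> K.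
Proof.
move=> AD; have [->|nAD] := eqVneq.
  rewrite (big_pred1 D) ?setDv ?cards0 ?expr0 // => U.
  by rewrite /= eqEsubset andbC.
have /set0Pn[v] : D :\: A != set0 by rewrite setD_eq0; apply: contra nAD => DA; rewrite eqEsubset AD.
rewrite inE => /andP[vA vD]; set S := \sum_(U | _) _.
have : S = - S.
  rewrite {1}/S (reindex_inj (inv_inj (toggleK v))) /= -sumrN.
  apply: eq_big => [U|U _].
    rewrite sub_toggle //; congr (_ && _).
    rewrite /toggle; case: ifPn => vU.
      by rewrite subsetD1 vA andbT.
    apply/idP/idP => h; last exact: subset_trans h (subsetUr _ _).
    by apply/subsetP => u uA; have := subsetP h u uA; rewrite !inE; case: eqP => // uv; rewrite -uv uA in vA.
  rewrite /toggle; case: ifPn => vU.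
    have -> : U :\: A = v |: ((U :\ v) :\: A).
      by apply/setP => u; rewrite !inE; case: eqP => [->|_]; rewrite ?vA ?vU //.
    by rewrite cardsU1 !inE eqxx andbF /= add1n exprS mulN1r opprK.
  have -> : (v |: U) :\: A = v |: (U :\: A).
    by apply/setP => u; rewrite !inE; case: eqP => [->|_]; rewrite ?vA //.
  by rewrite cardsU1 !inE (negPf vU) andbF /= add1n exprS mulN1r.
by move/eqP; rewrite -addr_eq0 -mulr2n mulrn_eq0 /= => /eqP.
Qed.

Lemma mobK f U : \sum_(D : {set V} | D \subset U) mob f D = f U.
Proof.
rewrite /mob (exchange_big_dep (fun A : {set V} => A \subset U)) /=; last first.
  by move=> D A DU AD; apply: subset_trans AD DU.
rewrite (eq_bigr (fun A => (A == U)%:R * f A)); last first.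
  move=> A AU; rewrite -(@alt_sum A U AU) mulr_suml.
  by apply: eq_bigl => D; rewrite andbC.
rewrite (bigD1 U) //= eqxx mul1r big1 ?addr0 // => A /andP[_ /negPf->].
by rewrite mul0r.
Qed.

Lemma mob_uniq f a :
  (forall U, f U = \sum_(D : {set V} | D \subset U) a D) -> mob f =1 a.
Proof.
move=> fa D; have [n] := ubnP #|D|; elim: n D => // n IH D.
rewrite ltnS => Dn; have := fa D; rewrite -mobK (bigD1 D) //= [RHS](bigD1 D) //=.
rewrite (eq_bigr a); first by move/addIr.
move=> A /andP[AD nAD]; apply: IH; apply: leq_trans Dn.
by apply: proper_card; rewrite properEneq nAD.
Qed.

Lemma eq_mob f f' D : (forall U, U \subset D -> f U = f' U) -> mob f D = mob f' D.
Proof. by move=> h; apply: eq_bigr => U /h ->. Qed.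

Lemma mobD f f' D : mob (fun U => f U + f' U) D = mob f D + mob f' D.
Proof. by rewrite /mob -big_split /=; apply: eq_bigr => U _; rewrite mulrDr. Qed.

(** Multiplying the two expansions [mobK] and collecting the pairs by their union gives an expansion
    of the product; [mob_uniq] identifies its coefficients. *)
Lemma mobM f f' D : mob (fun U => f U * f' U) D =
  \sum_(p : {set V} * {set V} | p.1 :|: p.2 == D) mob f p.1 * mob f' p.2.
Proof.
apply: (mob_uniq (a := fun D => \sum_(p : {set V} * {set V} | p.1 :|: p.2 == D)
   mob f p.1 * mob f' p.2)) => U.
rewrite -(mobK f U) -(mobK f' U) big_distrlr /= pair_big /=.
rewrite (partition_big (fun p : {set V} * {set V} => p.1 :|: p.2) (fun D => D \subset U)) /=.
  apply: eq_bigr => A AU; apply: eq_bigl => -[B1 B2] /=.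
  by case: eqP => [e|]; rewrite ?andbF // andbT -subUset e.
by move=> -[B1 B2] /=; rewrite subUset.
Qed.

Lemma mob_const c D : mob (fun=> c) D = (D == set0)%:R * c.
Proof.
apply: (mob_uniq (a := fun D => (D == set0)%:R * c)) => U.
rewrite (bigD1 set0) ?sub0set //= eqxx mul1r big1 ?addr0 //.
by move=> A /andP[_ /negPf->]; rewrite mul0r.
Qed.

Lemma mob_ind A D : mob (fun U => (A \subset U)%:R) D = (D == A)%:R.
Proof.
apply: (mob_uniq (a := fun D => (D == A)%:R)) => U.
have [AU|nAU] := boolP (A \subset U).
  by rewrite (bigD1 A) //= eqxx big1 ?addr0 // => B /andP[_ /negPf->].
by rewrite big1 // => B BU; case: eqP => // e; rewrite -e BU in nAU.
Qed.

End Mobius.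

(** * A weighted norm on Moebius coefficients, uniform in a parameter *)

Section SetNorm.
Import fintype boot.finset.
Variables (R : realType) (V X : finType) (xi : R).
Hypothesis xi1 : 1 <= xi.
Local Notation C := R[i].
Implicit Types (f g : X -> {set V} -> C) (D U : {set V}).

(** The maximum over [x] stands inside the sum, so that one majorant per set [D] serves all measured
    configurations at once. The weight with base [xi] encodes exponential decay in the size of
    [D]. *)
Definition setnorm f : R :=
  \sum_(D : {set V}) xi ^+ #|D| * \big[Num.max/0]_x nrm (mob (f x) D).

Lemma xi_ge0 : 0 <= xi. Proof. exact: le_trans xi1. Qed.

Lemma maxnrm_ge0 f D : 0 <= \big[Num.max/0]_x nrm (mob (f x) D).
Proof. by elim/big_rec: _ => // x a _ h; rewrite le_max h orbT. Qed.

Lemma le_maxnrm f x D : nrm (mob (f x) D) <= \big[Num.max/0]_x nrm (mob (f x) D).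
Proof. by rewrite (bigD1 x) //= le_max lexx. Qed.

Lemma maxnrm_le f D (b : R) : 0 <= b -> (forall x, nrm (mob (f x) D) <= b) ->
  \big[Num.max/0]_x nrm (mob (f x) D) <= b.
Proof. by move=> b0 h; elim/big_ind: _ => // u v; rewrite ge_max => -> ->. Qed.

Lemma setnorm_le f (G : {set V} -> R) c : (forall D, 0 <= G D) ->
  (forall x D, nrm (mob (f x) D) <= G D) ->
  \sum_(D : {set V}) xi ^+ #|D| * G D <= c -> setnorm f <= c.
Proof.
move=> G0 h; apply: le_trans; apply: ler_sum => D _.
by apply: ler_wpM2l; [exact: exprn_ge0 xi_ge0|exact: maxnrm_le].
Qed.

Lemma setnorm_ge0 f : 0 <= setnorm f.
Proof.
by apply: sumr_ge0 => D _; rewrite mulr_ge0 ?maxnrm_ge0 // exprn_ge0 // xi_ge0.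
Qed.

Lemma eq_setnorm f g : (forall x U, f x U = g x U) -> setnorm f = setnorm g.
Proof.
move=> h; apply: eq_bigr => D _; congr (_ * _); apply: eq_bigr => x _.
by congr nrm; apply: eq_mob.
Qed.

Lemma setnormD f g : setnorm (fun x U => f x U + g x U) <= setnorm f + setnorm g.
Proof.
rewrite /setnorm -big_split /=; apply: ler_sum => D _; rewrite -mulrDr.
apply: ler_wpM2l; first exact: exprn_ge0 xi_ge0.
apply: maxnrm_le => [|x]; first by rewrite addr_ge0 ?maxnrm_ge0.
rewrite mobD; apply: le_trans (nrmD _ _) _.
by rewrite lerD ?(le_maxnrm (fun x => f x)) ?(le_maxnrm (fun x => g x)).
Qed.

(** Coefficients of a product are convolved along unions, and [#|A :|: B| <= #|A| + #|B|] with
    [1 <= xi] makes the weight submultiplicative: the functions of [U] form a normed algebra. *)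
Lemma setnormM f g : setnorm (fun x U => f x U * g x U) <= setnorm f * setnorm g.
Proof.
pose F D := \big[Num.max/0]_x nrm (mob (f x) D).
pose G D := \big[Num.max/0]_x nrm (mob (g x) D).
apply: (@setnorm_le _ (fun D => \sum_(p : {set V} * {set V} | p.1 :|: p.2 == D) F p.1 * G p.2)).
- by move=> D; apply: sumr_ge0 => p _; rewrite mulr_ge0 ?maxnrm_ge0.
- move=> x D; rewrite mobM; apply: le_trans (nrm_sum _ _ _) _.
  apply: ler_sum => p _; rewrite nrmM ler_pM ?nrm_ge0 //.
    exact: (le_maxnrm (fun x => f x)).
  exact: (le_maxnrm (fun x => g x)).
rewrite /setnorm big_distrlr /= pair_big /=.
rewrite [leRHS](partition_big (fun p : {set V} * {set V} => p.1 :|: p.2) xpredT) //=.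
apply: ler_sum => D _; rewrite mulr_sumr; apply: ler_sum => -[A B] /= /eqP <-.
rewrite mulrACA ler_wpM2r ?mulr_ge0 ?maxnrm_ge0 // -exprD.
by rewrite ler_weXn2l // leq_card_setU.
Qed.

Lemma setnorm_const (w : X -> C) (b : R) : 0 <= b -> (forall x, nrm (w x) <= b) ->
  setnorm (fun x _ => w x) <= b.
Proof.
move=> b0 wb; apply: (@setnorm_le _ (fun D => (D == set0)%:R * b)).
- by move=> D; rewrite mulr_ge0 ?ler0n.
- by move=> x D; rewrite mob_const nrmM nrm_bool ler_wpM2l ?ler0n.
rewrite (bigD1 set0) //= eqxx mul1r cards0 expr0 mul1r big1 ?addr0 //.
by move=> D /negPf ->; rewrite mul0r mulr0.
Qed.

Lemma setnorm_ind (A : {set V}) :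
  setnorm (fun _ U => (A \subset U)%:R) <= xi ^+ #|A|.
Proof.
apply: (@setnorm_le _ (fun D => (D == A)%:R)).
- by move=> D; rewrite ler0n.
- by move=> x D; rewrite mob_ind nrm_bool.
rewrite (bigD1 A) //= eqxx mulr1 big1 ?addr0 //.
by move=> D /negPf ->; rewrite mulr0.
Qed.

Lemma setnorm_sum (I : Type) (r : seq I) (P : pred I) (F : I -> X -> {set V} -> C) :
  setnorm (fun x U => \sum_(i <- r | P i) F i x U) <= \sum_(i <- r | P i) setnorm (F i).
Proof.
elim: r => [|i r IH].
  rewrite big_nil (@eq_setnorm _ (fun x U => 0)) ?setnorm_const // => x.
    by rewrite nrm0.
  by move=> U; rewrite big_nil.
rewrite big_cons; case: ifPn => Pi.
  apply: le_trans (lerD (lexx _) IH); apply: le_trans (setnormD _ _).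
  by rewrite le_eqVlt; apply/orP; left; apply/eqP; apply: eq_setnorm => x U; rewrite big_cons Pi.
apply: le_trans IH; rewrite le_eqVlt; apply/orP; left; apply/eqP.
by apply: eq_setnorm => x U; rewrite big_cons (negPf Pi).
Qed.

Lemma nrm_le_setnorm f x U : nrm (f x U) <= setnorm f.
Proof.
rewrite -(mobK (f x) U); apply: le_trans (nrm_sum _ _ _) _.
rewrite big_mkcond /=; apply: ler_sum => D _.
have h : nrm (mob (f x) D) <= xi ^+ #|D| * \big[Num.max/0]_x nrm (mob (f x) D).
  apply: le_trans (le_maxnrm (fun x => f x) x D) _.
  by rewrite ler_peMl ?maxnrm_ge0 // exprn_ege1.
case: ifP => // _; apply: le_trans h; exact: nrm_ge0.
Qed.

(** A crude equivalence of norms in finite dimension. Its constant depends on the volume, so it is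
    applied only to errors that can be made arbitrarily small. *)
Lemma setnorm_le_sup f (b : R) : 0 <= b -> (forall x U, nrm (f x U) <= b) ->
  setnorm f <= (\sum_(D : {set V}) xi ^+ #|D| * #|{: {set V}}|%:R) * b.
Proof.
move=> b0 fb; apply: (@setnorm_le _ (fun=> #|{: {set V}}|%:R * b)).
- by move=> D; rewrite mulr_ge0 ?ler0n.
- move=> x D; apply: le_trans (nrm_sum _ _ _) _.
  apply: (@le_trans _ _ (\sum_(U : {set V} | U \subset D) b)).
    by apply: ler_sum => U _; rewrite nrmM nrm_sign mul1r.
  rewrite sumr_const -[b *+ _]mulr_natl ler_wpM2r // ler_nat.
  exact: max_card.
by rewrite mulr_suml; apply: ler_sum => D _; rewrite mulrA.
Qed.

Lemma setnorm_conj f : setnorm (fun x U => (f x U)^*%C) = setnorm f.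
Proof.
apply: eq_bigr => D _; congr (_ * _); apply: eq_bigr => x _.
rewrite -[RHS]nrm_conj; congr nrm; rewrite /mob rmorph_sum /=.
by apply: eq_bigr => U _; rewrite rmorphM rmorphXn /=; congr (_ ^+ _ * _); rewrite oppr0.
Qed.

Lemma setnormN f : setnorm (fun x U => - f x U) = setnorm f.
Proof.
apply: eq_bigr => D _; congr (_ * _); apply: eq_bigr => x _.
rewrite -[RHS]nrmN; congr nrm; rewrite /mob -sumrN.
by apply: eq_bigr => U _; rewrite mulrN.
Qed.

(** The identity 1/f = 1 - (f - 1)/f gives N <= 1 + d N for the norm N of the inverse, and N is a
    finite sum; this replaces the Neumann series. *)
Lemma setnorm_inv f (d : R) : d < 1 -> setnorm (fun x U => f x U - 1) <= d ->
  (forall x U, f x U != 0) /\ setnorm (fun x U => (f x U)^-1) <= (1 - d)^-1.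
Proof.
move=> d1 fd; have f0 x U : f x U != 0.
  apply/eqP => fxU; have := le_trans (nrm_le_setnorm (fun x U => f x U - 1) x U) fd.
  by rewrite fxU sub0r nrmN nrm1 leNgt d1.
split => //; set N := setnorm _.
have : N <= 1 + d * N.
  have {1}-> : N = setnorm (fun x U => 1 + - ((f x U - 1) * (f x U)^-1)).
    apply: eq_setnorm => x U; rewrite mulrBl mulfV // mul1r; ring.
  apply: le_trans (setnormD (fun _ _ => 1) _) _; apply: lerD.
    by apply: setnorm_const => // _; rewrite nrm1.
  rewrite (setnormN (fun x U => (f x U - 1) * (f x U)^-1)).
  apply: (le_trans (setnormM (fun x U => f x U - 1) (fun x U => (f x U)^-1))).
  by rewrite ler_wpM2r ?setnorm_ge0.
move=> h; rewrite -[leRHS]mul1r ler_pdivlMr ?subr_gt0 //; lra.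
Qed.

End SetNorm.

(** * Logarithms in the weighted norm *)

Section LogSeries.
Variable R : realType.
Implicit Types (y q : R).

Definition logp n y : R := \sum_(k < n) ((-1) ^+ k / k.+1%:R) * y ^+ k.+1.

Lemma is_derive_logp n y : is_derive y 1 (logp n) (\sum_(k < n) (- y) ^+ k).
Proof.
elim: n => [|n IH].
  have -> : logp 0 = cst 0 by apply/funext => t; rewrite /logp big_ord0.
  by rewrite big_ord0; exact: is_derive_cst.
have -> : logp n.+1 = logp n + ((-1) ^+ n / n.+1%:R) \*: (@id R) ^+ n.+1.
  by apply/funext => t; rewrite !fctE /logp big_ord_recr.
have hX : is_derive y 1 ((@id R) ^+ n.+1) _ := is_deriveX n.+1 (is_derive_id y 1).
have h := is_deriveD IH (is_deriveZ ((-1) ^+ n / n.+1%:R : R) hX).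
rewrite big_ord_recr /=. apply: (is_derive_eq h).
rewrite /= /GRing.scale /= mulr1 !mulrA -[_ / _ * _]mulrA mulVf ?pnatr_eq0 // mulr1.
by rewrite -exprNn.
Qed.

(** The derivative of the error is [(- t) ^+ n / (1 + t)], bounded by [q ^+ n / (1 - q)] on the
    interval; the mean value theorem then bounds the error uniformly. *)
Lemma ln1D_logp q : 0 <= q -> q < 1 -> forall e, 0 < e ->
  exists n, forall y, `|y| <= q -> `|ln (1 + y) - logp n y| <= e.
Proof.
move=> q0 q1 e e0.
have /cvgrPdist_le /(_ e e0) [n _ /(_ n (leqnn n)) hn] :
    ((fun n => q ^+ n / (1 - q)) @ \oo --> (0 : R))%classic.
  rewrite -[X in (_ --> X)%classic](mul0r (1 - q)^-1); apply: cvgMl.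
  by apply: cvg_expr; rewrite ger0_norm.
rewrite sub0r normrN ger0_norm in hn; last first.
  by rewrite divr_ge0 ?exprn_ge0 // subr_ge0 ltW.
exists n => y yq; apply: le_trans hn.
pose F (t : R) : R := ln (1 + t) - logp n t.
pose dF (t : R) : R := (- t) ^+ n / (1 + t).
have dFP (t : R) : `|t| <= q -> is_derive t 1 F (dF t).
  move=> tq; have t1 : 0 < 1 + t by move: tq; rewrite ler_norml; lra.
  have h1 := is_derive_logp n t.
  have hs : is_derive t 1 (cst (1 : R) + @id R) _ := is_deriveD (is_derive_cst (1 : R) t 1) (is_derive_id t 1).
  have hl : is_derive ((cst (1 : R) + @id R) t) 1 (@ln R) _ := is_derive1_ln t1.
  have h2 := is_derive1_comp hl hs.
  apply: (is_derive_eq (is_deriveB h2 h1)).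
  rewrite /GRing.scale /= add0r mulr1 /dF.
  have e1 : (1 + t) * \sum_(i < n) (- t) ^+ i = 1 - (- t) ^+ n.
    by have := subrX1 (- t) n; lra.
  apply: (mulfI (lt0r_neq0 t1)); rewrite mulrBr e1 mulfV ?lt0r_neq0 //.
  by rewrite [RHS]mulrCA mulfV ?lt0r_neq0 // mulr1; ring.
have F0 : F 0 = 0.
  rewrite /F addr0 ln1 /logp big1 ?subrr // => k _; by rewrite expr0n mulr0.
have dFb (t : R) : `|t| <= q -> `|dF t| <= q ^+ n / (1 - q).
  move=> tq; have t1 : 1 - q <= 1 + t by move: tq; rewrite ler_norml; lra.
  rewrite /dF normrM normrX normrN normfV ler_pM ?exprn_ge0 ?invr_ge0 //.
    by rewrite lerXn2r ?nnegrE.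
  rewrite (ger0_norm (x := 1 + t)); last by lra.
  by rewrite lef_pV2 ?posrE //; lra.
have cF (a b : R) : (forall t : R, a <= t <= b -> `|t| <= q) -> {within `[a, b], continuous F}%classic.
  move=> h; apply: derivable_within_continuous => t; rewrite in_itv /= => /h /dFP [] //.
have key (c : R) : `|c| <= q -> `|dF c * y| <= q ^+ n / (1 - q).
  move=> cq; rewrite normrM; apply: le_trans (dFb _ cq).
  by rewrite ler_piMr // ltW // (le_lt_trans yq).
change (`|F y| <= q ^+ n / (1 - q)).
have [y0|y0] := leP 0 y.
  have yq' : y <= q by rewrite (le_trans _ yq) // ler_norm.
  have hq (t : R) : 0 <= t <= y -> `|t| <= q by rewrite ler_norml; lra.
  have [t ty|c cy e1] := MVT_segment y0 _ (cF 0 y hq) (df := dF).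
    by apply: dFP; apply: hq; move: ty; rewrite in_itv /=; lra.
  rewrite -[F y]subr0 -F0 e1 subr0; apply: key; apply: hq.
  by move: cy; rewrite in_itv.
have yq' : - y <= q by rewrite (le_trans _ yq) // -normrN ler_norm.
have hq (t : R) : y <= t <= 0 -> `|t| <= q by rewrite ler_norml; lra.
have [t ty|c cy e1] := MVT_segment (ltW y0) _ (cF y 0 hq) (df := dF).
  by apply: dFP; apply: hq; move: ty; rewrite in_itv /=; lra.
rewrite -normrN -[- F y]add0r -[X in X - F y]F0 e1 sub0r mulrN normrN; apply: key; apply: hq.
by move: cy; rewrite in_itv.
Qed.

End LogSeries.

Section SetNormLog.
Import fintype boot.finset.
Variables (R : realType) (V X : finType) (xi : R).
Hypothesis xi1 : 1 <= xi.
Local Notation N := (@setnorm R V X xi).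

Lemma geom_sum_le (q : R) n : 0 <= q < 1 -> \sum_(k < n) q ^+ k.+1 <= q / (1 - q).
Proof.
move=> /andP[q0 q1]; rewrite ler_pdivlMr ?subr_gt0 //.
have -> : (\sum_(k < n) q ^+ k.+1) * (1 - q) = q * (1 - q ^+ n).
  rewrite (eq_bigr (fun k : 'I_n => q * q ^+ k)); last by move=> i _; rewrite exprS.
  rewrite -mulr_sumr -mulrA; congr (_ * _).
  by have := subrX1 q n; lra.
by rewrite ler_piMr // gerBl exprn_ge0.
Qed.

Lemma setnorm_expr (f : X -> {set V} -> R[i]) q n : 0 <= q ->
  N f <= q -> N (fun x U => f x U ^+ n) <= q ^+ n.
Proof.
move=> q0 fq; elim: n => [|n IH].
  rewrite (@eq_setnorm _ _ _ _ _ (fun _ _ => 1)); last by move=> x U; rewrite expr0.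
  by apply: setnorm_const => // _; rewrite nrm1.
rewrite (@eq_setnorm _ _ _ _ _ (fun x U => f x U * f x U ^+ n)); last by move=> x U; rewrite exprS.
apply: (le_trans (setnormM xi1 f (fun x U => f x U ^+ n))).
by rewrite exprS ler_pM ?setnorm_ge0.
Qed.

(** Truncations of the series are bounded by a geometric series in the algebra norm. The remainder
    is uniformly small, and the volume-dependent constant of [setnorm_le_sup] is absorbed by letting
    it tend to zero. *)
Lemma setnorm_ln (v : X -> {set V} -> R) q : q < 1 ->
  N (fun x U => rc (v x U)) <= q ->
  N (fun x U => rc (ln (1 + v x U))) <= q / (1 - q).
Proof.
move=> q1 vq; have q0 : 0 <= q by apply: le_trans vq; apply: setnorm_ge0.
have vb x U : `|v x U| <= q.
  by rewrite -nrm_rc; apply: le_trans vq; apply: (nrm_le_setnorm xi1 (fun x U => rc (v x U))).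
apply/ler_addgt0Pr => e e0.
set K0 := \sum_(D : {set V}) xi ^+ #|D| * #|{: {set V}}|%:R.
have K00 : 0 <= K0.
  by apply: sumr_ge0 => D _; rewrite mulr_ge0 ?ler0n // exprn_ge0 // (le_trans _ xi1).
have e'0 : 0 < e / (K0 + 1) by rewrite divr_gt0 // ltr_wpDl.
have [n hn] := ln1D_logp q0 q1 e'0.
rewrite (@eq_setnorm _ _ _ _ _ (fun x U => rc (logp n (v x U)) + rc (ln (1 + v x U) - logp n (v x U)))); last first.
  by move=> x U; rewrite /rc -rmorphD /=; congr (_%:C)%C; ring.
apply: (le_trans (setnormD xi1 (fun x U => rc (logp n (v x U))) (fun x U => rc (ln (1 + v x U) - logp n (v x U))))).
apply: lerD.
  apply: le_trans (geom_sum_le n (_ : 0 <= q < 1)); last by rewrite q0.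
  rewrite (@eq_setnorm _ _ _ _ _ (fun x U => \sum_(k < n) rc ((-1) ^+ k / k.+1%:R) * rc (v x U) ^+ k.+1)); last first.
    move=> x U; rewrite /logp /rc rmorph_sum; apply: eq_bigr => k _ /=.
    by rewrite rmorphM /= rmorphXn.
  apply: (le_trans (setnorm_sum xi1 _ _ _)); apply: ler_sum => k _.
  apply: (le_trans (setnormM xi1 (fun _ _ => rc ((-1) ^+ k / k.+1%:R)) (fun x U => rc (v x U) ^+ k.+1))).
  rewrite -[leRHS]mul1r ler_pM ?setnorm_ge0 ?setnorm_expr //.
  apply: setnorm_const => // _.
  by rewrite nrm_rc normrM normrX normrN1 expr1n mul1r ger0_norm ?invr_ge0 ?ler0n // invf_le1 ?ltr0n // ler1n.
apply: (@le_trans _ _ (K0 * (e / (K0 + 1)))).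
  apply: setnorm_le_sup => //; first exact: ltW.
  by move=> x U; rewrite nrm_rc hn.
rewrite mulrCA; apply: ler_piMr; first exact: ltW.
by rewrite ler_pdivrMr ?ltr_wpDl // mul1r lerDl.
Qed.

(** With u = f - 1 the function |f|^2 - 1 is the sum of u, its conjugate and their product, so its
    norm is at most 1/4 + 1/4 + 1/16 = 9/16, and [setnorm_ln] yields 9/7. *)
Lemma setnorm_ln_mod (f : X -> {set V} -> R[i]) :
  N (fun x U => f x U - 1) <= 1 / 4 ->
  N (fun x U => rc (ln (nrm (f x U) ^+ 2))) <= 2.
Proof.
move=> fN; pose u x U := f x U - 1.
pose v x U : R := nrm (f x U) ^+ 2 - 1.
have vE x U : rc (v x U) = u x U + (u x U)^*%C + u x U * (u x U)^*%C.
  have -> : rc (v x U) = rc (nrm (f x U) ^+ 2) - 1 by rewrite /rc /v rmorphB.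
  by rewrite rc_nrm2 /u !rmorphB !rmorph1; ring.
have cN : N (fun x U => (u x U)^*%C) <= 1 / 4 by rewrite (setnorm_conj _ u).
have vN : N (fun x U => rc (v x U)) <= 9 / 16.
  rewrite (eq_setnorm _ vE).
  apply: (le_trans (setnormD xi1 (fun x U => u x U + (u x U)^*%C) (fun x U => u x U * (u x U)^*%C))).
  have h1 := setnormD xi1 u (fun x U => (u x U)^*%C).
  have h2 : N (fun x U => u x U * (u x U)^*%C) <= 1 / 4 * (1 / 4).
    by apply: (le_trans (setnormM xi1 u (fun x U => (u x U)^*%C))); rewrite ler_pM ?setnorm_ge0.
  have h3 : N u <= 1 / 4 by [].
  lra.
have := setnorm_ln (_ : 9 / 16 < 1) vN.
rewrite (@eq_setnorm _ _ _ _ _ (fun x U => rc (ln (nrm (f x U) ^+ 2)))); last first.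
  by move=> x U; rewrite /v addrC subrK.
move=> h; apply: (le_trans (h _)); first lra.
by rewrite (_ : 1 - 9 / 16 = 7 / 16) ?invf_div; lra.
Qed.

End SetNormLog.

(** * Polymer gases *)

Section Polymer.
Import fintype boot.finset.
Variables (R : realType) (V X Cell : finType) (xi : R).
Hypothesis xi1 : 1 <= xi.
Variables (cs : Cell -> {set V}) (W : X -> {set Cell} -> R[i]) (z : Cell -> R).
Local Notation N := (@setnorm R V X xi).
Implicit Types (F D E : {set Cell}) (T U Y A : {set V}).

Definition csupp F : {set V} := \bigcup_(c in F) cs c.

Lemma csuppU F D : csupp (F :|: D) = csupp F :|: csupp D.
Proof. by rewrite /csupp bigcup_setU. Qed.

Lemma csupp0 : csupp set0 = set0. Proof. by rewrite /csupp big_set0. Qed.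

Lemma csupp_sub c F : c \in F -> cs c \subset csupp F.
Proof. by move=> cF; apply: (bigcup_sup c). Qed.

Hypothesis W0 : forall x, W x set0 = 1.
Hypothesis WM : forall x F D, [disjoint csupp F & csupp D] ->
  W x (F :|: D) = W x F * W x D.
Hypothesis z0 : forall c, 0 <= z c.
Hypothesis Wz : forall x F, nrm (W x F) <= \prod_(c in F) z c.
Hypothesis zsmall : forall v,
  \sum_(c | v \in cs c) z c * (4 * xi) ^+ #|cs c| <= 1 / 5.

(** [W] is multiplicative only over disjoint supports. The polymers are the clusters of overlapping
    cells, which the expansion never has to name. *)
Definition polyZ x U : R[i] := \sum_(F | csupp F \subset U) W x F.

Lemma polyZ0 x : (forall c, cs c != set0) -> polyZ x set0 = 1.
Proof.
move=> cs0; rewrite /polyZ (bigD1 set0) ?csupp0 ?sub0set //= W0 big1 ?addr0 //.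
move=> F /andP[]; rewrite subset0 => /eqP F0 /set0Pn[c cF].
by have := csupp_sub cF; rewrite F0 subset0 (negPf (cs0 c)).
Qed.

Hypothesis cs0 : forall c, cs c != set0.

(** State of an exploration: [D] are the cells already revealed, [Y] the vertices whose cells come
    next, [T] the untouched vertices, where alone [U] still acts. *)
Definition exposedZ D Y T x U : R[i] :=
  \sum_(F | csupp F \subset Y :|: (U :&: T)) W x (D :|: F).

Lemma split_cells (K : nmodType) (h : {set Cell} -> K) (y : V) A :
  \sum_(F | csupp F \subset A) h F =
  \sum_(E : {set Cell} | (E \subset [set c | y \in cs c]) && (csupp E \subset A))
     \sum_(F | csupp F \subset A :\ y) h (E :|: F).
Proof.
set Cy := [set c | y \in cs c].
rewrite (partition_big (fun F => F :&: Cy) (fun E => (E \subset Cy) && (csupp E \subset A))) /=; last first.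
  move=> F FA; rewrite subsetIr /=; apply: subset_trans FA.
  by rewrite -{2}(setUidPl (subsetIl F Cy)) csuppU subsetUr.
apply: eq_bigr => E /andP[EC EA].
rewrite (reindex_onto (fun F => E :|: F) (fun F => F :\: Cy)) /=; last first.
  by move=> F /andP[_ /eqP <-]; rewrite setID.
apply: eq_bigl => F.
have FCy : csupp F \subset A :\ y = (csupp F \subset A) && [disjoint F & Cy].
  rewrite subsetD1; congr (_ && _); apply/idP/idP.
    move=> h1; apply/pred0P => c /=; apply/negP; rewrite inE => /andP[cF yc].
    by move/negP: h1; apply; apply: subsetP (csupp_sub cF) y yc.
  move=> dj; apply/bigcupP => -[c cF yc].
  by have := disjointFr dj cF; rewrite inE yc.
rewrite FCy csuppU subUset EA /=; case FA : (csupp F \subset A) => //=.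
rewrite setIUl (setIidPl EC) setDUl.
have -> : E :\: Cy = set0 by apply/eqP; rewrite setD_eq0.
rewrite set0U; apply/andP/idP.
  by move=> [_ /eqP <-]; rewrite disjoints_subset setDE subsetIr.
move=> dj; split; last by apply/eqP/setDidPl.
by rewrite -setI_eq0 in dj; rewrite (eqP dj) setU0.
Qed.

(** All cells through [y] are revealed at once as a set [E]. Where its support meets [T] it must lie
    in [U], and these vertices become exposed in turn. *)
Lemma exposedZ_step D Y T y x U : y \in Y -> [disjoint Y & T] ->
  exposedZ D Y T x U =
  \sum_(E : {set Cell} | (E \subset [set c | y \in cs c]) && (csupp E \subset Y :|: T))
     (csupp E :&: T \subset U)%:R *
     exposedZ (D :|: E) ((Y :\ y) :|: (csupp E :&: T)) (T :\: csupp E) x U.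
Proof.
move=> yY dYT; rewrite {1}/exposedZ (split_cells (fun F => W x (D :|: F)) y).
rewrite [RHS]big_mkcondr [LHS]big_mkcondr /=; apply: eq_bigr => E _.
have yT : y \notin T by rewrite (disjointFr dYT yY).
have sE : (csupp E \subset Y :|: U :&: T) = (csupp E \subset Y :|: T) && (csupp E :&: T \subset U).
  apply/idP/andP => [h|[h1 h2]].
    split; first by apply: subset_trans h _; rewrite setUS // subsetIr.
    apply/subsetP => v; rewrite inE => /andP[vE vT]; have := subsetP h v vE.
    by rewrite !inE vT andbT (disjointFl dYT vT).
  apply/subsetP => v vE; have := subsetP h1 v vE; rewrite !inE.
  case: (v \in Y) => //= vT; rewrite vT andbT; apply: (subsetP h2).
  by rewrite inE vE.
rewrite sE; case: (csupp E \subset Y :|: T) => //=.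
have [ETU|] := boolP (csupp E :&: T \subset U); last by rewrite mul0r.
rewrite mul1r /exposedZ; apply: eq_big => [F|F _]; last by rewrite setUA.
rewrite (_ : (Y :|: U :&: T) :\ y = Y :\ y :|: csupp E :&: T :|: U :&: (T :\: csupp E)) //.
apply/setP => v; rewrite !inE.
case: eqP => [->|_] /=; first by rewrite (negPf yT) !andbF.
have h : v \in csupp E -> v \in T -> v \in U.
  by move=> a b; apply: (subsetP ETU); rewrite inE a.
by move: h; case: (v \in Y) => //=; case: (v \in csupp E); case: (v \in T); case: (v \in U) => //= h; have := h isT isT.
Qed.

Lemma sum_powerset (K : comNzRingType) (a : Cell -> K) F :
  \sum_(E : {set Cell} | E \subset F) \prod_(c in E) a c = \prod_(c in F) (1 + a c).
Proof.
rewrite [RHS]big_mkcond /=.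
rewrite (eq_bigr (fun c => (if c \in F then a c else 0) + 1)); last first.
  by move=> c _; case: ifP; rewrite ?add0r // addrC.
rewrite bigA_distr big_mkcond /=; apply: eq_bigr => E _.
have [EF|/subsetPn[c cE cF]] := boolP (E \subset F).
  rewrite [LHS]big_mkcond; apply: eq_bigr => c _.
  by case: ifP => // cE; rewrite (subsetP EF).
by rewrite (bigD1 c) //= cE (negPf cF) mul0r.
Qed.

Lemma prod1D_le (I : finType) (P : pred I) (a : I -> R) : (forall i, 0 <= a i) ->
  \sum_(i | P i) a i <= 1 / 5 -> \prod_(i | P i) (1 + a i) <= 5 / 4.
Proof.
move=> a0 sa.
(* Induction on the list; this inequality holds for sums of any size. A sum of at most 1/5 then
   gives a product of at most 1 / (1 - 1/5) = 5/4. *)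
have key : forall r : seq I, (\prod_(i <- r | P i) (1 + a i)) * (1 - \sum_(i <- r | P i) a i) <= 1.
  elim=> [|i r IH]; first by rewrite !big_nil; lra.
  rewrite !big_cons; case: ifP => // _; apply: le_trans IH.
  set p := \prod_(_ <- _ | _) _; set s := \sum_(_ <- _ | _) _.
  have p0 : 0 <= p by apply: prodr_ge0 => j _; rewrite addr_ge0.
  have s0 : 0 <= s by apply: sumr_ge0.
  have h : 0 <= p * (a i * (a i + s)) by rewrite !mulr_ge0 ?addr_ge0.
  lra.
have := key (index_enum I).
have p0 : 0 <= \prod_(i | P i) (1 + a i) by apply: prodr_ge0 => j _; rewrite addr_ge0.
have := mulr_ge0 p0 (_ : 0 <= 1 / 5 - \sum_(i | P i) a i); rewrite subr_ge0 => /(_ sa).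
lra.
Qed.

Lemma leq_card_csupp E : (#|csupp E| <= \sum_(c in E) #|cs c|)%N.
Proof.
rewrite /csupp; elim/big_rec2: _ => [|c A n _ h]; first by rewrite cards0.
by apply: leq_trans (leq_card_setU _ _) _; rewrite leq_add2l.
Qed.

Definition polyratio T s x U : R[i] := polyZ x (s |: (U :&: T)) / polyZ x (U :&: T).

(** The induction statement: attaching one vertex multiplies the partition function by a factor
    close to 1 in the algebra norm. Nonvanishing and the decay of the logarithm both follow from
    it. *)
Definition ratio_claim n := forall T s, (#|T| < n)%N -> s \notin T ->
  N (fun x U => polyratio T s x U - 1) <= 1 / 4.

(** A ratio within 1/4 of 1, taken at [U = setT], cannot vanish, hence neither can its numerator. *)
Lemma polyZ_neq0 n : ratio_claim n -> forall x U, (#|U| <= n)%N -> polyZ x U != 0.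
Proof.
move=> hn x; elim: n {-2}n (leqnn n) hn => [|k IH] n.
  rewrite leqn0 => /eqP-> _ U; rewrite leqn0 cards_eq0 => /eqP ->.
  by rewrite polyZ0 // oner_neq0.
move=> nk hn U Un; have [->|/set0Pn[s sU]] := eqVneq U set0.
  by rewrite polyZ0 // oner_neq0.
have cU : (#|U :\ s| < #|U|)%N by rewrite [X in (_ < X)%N](cardsD1 s) sU.
have h := hn (U :\ s) s (leq_trans cU Un); rewrite setD11 in h.
have q1 : 1 / 4 < 1 :> R by lra.
have := proj1 (setnorm_inv xi1 q1 (h isT)) x setT.
rewrite /polyratio setTI setD1K //.
by rewrite mulf_eq0 negb_or => /andP[].
Qed.

(** The vertices of [E] are stripped off one at a time. Each inverse ratio has norm at most (1 -
    1/4)^-1 = 4/3 <= 2, and each indicator costs [xi]. *)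
Lemma setnorm_ratio n : ratio_claim n -> forall (E T : {set V}), (#|T| <= n)%N -> E \subset T ->
  N (fun x U => (E \subset U)%:R * (polyZ x (U :&: (T :\: E)) / polyZ x (U :&: T)))
  <= (2 * xi) ^+ #|E|.
Proof.
move=> hn E; have [k] := ubnP #|E|; elim: k E => // k IH E.
rewrite ltnS => Ek T Tn ET; have [->|/set0Pn[s sE]] := eqVneq E set0.
  rewrite cards0 expr0 setD0 (@eq_setnorm _ _ _ _ _ (fun _ _ => 1)).
    by apply: setnorm_const => // _; rewrite nrm1.
  move=> x U; rewrite sub0set mul1r mulfV // (polyZ_neq0 hn) //.
  by apply: leq_trans Tn; rewrite subset_leq_card // subsetIr.
have sT : s \in T by apply: subsetP ET s sE.
have cE : #|E| = #|E :\ s|.+1 by rewrite (cardsD1 s) sE.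
have cT : #|T| = #|T :\ s|.+1 by rewrite (cardsD1 s) sT.
have sTs : s \notin T :\ s by rewrite setD11.
have Tsn : (#|T :\ s| < n)%N by rewrite -cT.
have hs := hn (T :\ s) s Tsn sTs.
have q1 : 1 / 4 < 1 :> R by lra.
have [h0 hinv] := setnorm_inv xi1 q1 hs.
have ETs : E :\ s \subset T :\ s by rewrite setSD.
have Ek' : (#|E :\ s| < k)%N by rewrite -cE.
have IHs := IH (E :\ s) Ek' (T :\ s) (ltnW Tsn) ETs.
rewrite (@eq_setnorm _ _ _ _ _ (fun x U => (([set s] \subset U)%:R * (polyratio (T :\ s) s x U)^-1) *
   ((E :\ s \subset U)%:R * (polyZ x (U :&: ((T :\ s) :\: (E :\ s))) / polyZ x (U :&: (T :\ s)))))); last first.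
  move=> x U; have -> : (E \subset U) = ([set s] \subset U) && (E :\ s \subset U).
    by rewrite -{1}(setD1K sE) subUset.
  have [sU|] := boolP ([set s] \subset U); last by rewrite !mul0r.
  rewrite !mul1r /=; case: (E :\ s \subset U); last by rewrite !mul0r mulr0.
  rewrite !mul1r /polyratio invf_div.
  have -> : (T :\ s) :\: (E :\ s) = T :\: E.
    by apply/setP => v; rewrite !inE; case: eqP => [->|_]; rewrite ?sE ?andbF //.
  have -> : s |: U :&: (T :\ s) = U :&: T.
    apply/setP => v; rewrite !inE; case: eqP => [->|_] //=.
    by rewrite sub1set in sU; rewrite sU sT.
  rewrite [RHS]mulrC mulrA divfK //.
  rewrite (polyZ_neq0 hn) // (leq_trans _ (ltnW Tsn)) //.
  by rewrite subset_leq_card // subsetIr.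
apply: (le_trans (setnormM xi1 (fun x U => (([set s] \subset U)%:R * (polyratio (T :\ s) s x U)^-1)) _)).
rewrite cE exprS ler_pM ?setnorm_ge0 //.
apply: (le_trans (setnormM xi1 (fun x U => ([set s] \subset U)%:R) _)).
rewrite mulrC ler_pM ?setnorm_ge0 //.
  apply: (le_trans hinv).
  by rewrite (_ : 1 - 1 / 4 = 3 / 4) ?invf_div; lra.
by apply: (le_trans (@setnorm_ind _ _ X _ xi1 [set s])); rewrite cards1 expr1.
Qed.

(** Each exposed vertex is allowed a factor 2. The condition on [D] keeps its cells distinct from
    those revealed later, so that the activities multiply. *)
Definition exposed_bound n k := forall D Y T, (#|T| + #|Y| <= k)%N -> (#|T| <= n)%N ->
  [disjoint Y & T] -> [disjoint csupp D & T] ->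
  (forall c, c \in D -> ~~ (cs c \subset Y :|: T)) ->
  N (fun x U => exposedZ D Y T x U / polyZ x (U :&: T)) <= (\prod_(c in D) z c) * 2 ^+ #|Y|.

(** With [S] the newly exposed vertices, the induction hypothesis gives 2^|S|, and passing from the
    denominator of [T] to that of [T :\: S] gives (2 xi)^|S|. Their product (4 xi)^|S| is the weight
    reserved in [zsmall]. *)
Lemma exposed_term n k D Y T y E : ratio_claim n -> exposed_bound n k ->
  (#|T| + #|Y| <= k.+1)%N -> (#|T| <= n)%N ->
  [disjoint Y & T] -> [disjoint csupp D & T] ->
  (forall c, c \in D -> ~~ (cs c \subset Y :|: T)) ->
  y \in Y -> E \subset [set c | y \in cs c] -> csupp E \subset Y :|: T ->
  N (fun x U => (csupp E :&: T \subset U)%:R *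
     exposedZ (D :|: E) ((Y :\ y) :|: (csupp E :&: T)) (T :\: csupp E) x U / polyZ x (U :&: T))
  <= (\prod_(c in D) z c) * 2 ^+ #|Y|.-1 * \prod_(c in E) (z c * (4 * xi) ^+ #|cs c|).
Proof.
move=> hn hk TYk Tn dYT dDT hD yY EC EYT.
have yT : y \notin T by rewrite (disjointFr dYT yY).
set S := csupp E :&: T.
have ST : S \subset T by rewrite subsetIr.
have TE : T :\: csupp E = T :\: S.
  by apply/setP => v; rewrite !inE; case: (v \in T); rewrite ?andbF ?andbT.
have cTS : #|T :\: S| = (#|T| - #|S|)%N by rewrite cardsD (setIidPr ST).
have cS : (#|S| <= #|T|)%N by rewrite subset_leq_card.
have cY : #|Y| = #|Y :\ y|.+1 by rewrite (cardsD1 y) yY.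
have dYS : [disjoint Y :\ y & S].
  by apply: disjointWl (subD1set _ _) _; apply: disjointWr ST dYT.
have cYS : #|(Y :\ y) :|: S| = (#|Y|.-1 + #|S|)%N.
  by rewrite cardsU (disjoint_setI0 dYS) cards0 subn0 cY.
rewrite TE.
have hY : [disjoint (Y :\ y) :|: S & T :\: S].
  rewrite -setI_eq0; apply/eqP/setP => v; rewrite !inE; apply/negP => /andP[/orP[/andP[_ vY]|]].
    by rewrite (disjointFr dYT vY) andbF.
  by move=> /andP[-> ->].
have hDE : [disjoint csupp (D :|: E) & T :\: S].
  rewrite -setI_eq0 csuppU; apply/eqP/setP => v; rewrite !inE; apply/negP => /andP[/orP[vD|vE]].
    by rewrite (disjointFr dDT vD) andbF.
  by rewrite vE /=; case: (v \in T).
have hD' c : c \in D :|: E -> ~~ (cs c \subset (Y :\ y :|: S) :|: (T :\: S)).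
  rewrite inE => /orP[/hD|cE].
    apply: contra => /subset_trans; apply; apply/subsetP => v; rewrite !inE.
    by case: (v \in Y) => //=; case: (v \in T); rewrite ?orbT ?andbF.
  apply/subsetPn; exists y; first by have := subsetP EC c cE; rewrite inE.
  by rewrite !inE eqxx /= (negPf yT) !andbF.
have dDE : [disjoint D & E].
  apply/pred0P => c /=; apply/negP => /andP[cD cE]; have /negP := hD c cD; apply.
  exact: subset_trans (csupp_sub cE) EYT.
have hk' := hk (D :|: E) ((Y :\ y) :|: S) (T :\: S).
rewrite (@eq_setnorm _ _ _ _ _ (fun x U =>
   ((S \subset U)%:R * (polyZ x (U :&: (T :\: S)) / polyZ x (U :&: T))) *
   (exposedZ (D :|: E) ((Y :\ y) :|: S) (T :\: S) x U / polyZ x (U :&: (T :\: S))))); last first.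
  move=> x U; have gen (a b c d : R[i]) : c != 0 -> a * b / d = a * (c / d) * (b / c).
    move=> c0; have -> : a * (c / d) * (b / c) = a * b / d * (c / c) by ring.
    by rewrite divff // mulr1.
  apply: gen; apply: (polyZ_neq0 hn); apply: leq_trans Tn; apply: subset_leq_card.
  by apply: subset_trans (subsetIr _ _) _; exact: subsetDl.
apply: (le_trans (setnormM xi1 (fun x U => (S \subset U)%:R * (polyZ x (U :&: (T :\: S)) / polyZ x (U :&: T))) _)).
have n1 := setnorm_ratio hn Tn ST.
have n2 : N (fun x U => exposedZ (D :|: E) ((Y :\ y) :|: S) (T :\: S) x U / polyZ x (U :&: (T :\: S)))
  <= (\prod_(c in D :|: E) z c) * 2 ^+ (#|Y|.-1 + #|S|).
  rewrite -cYS; apply: hk' => //.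
    rewrite cTS cYS addnCA subnK // -ltnS; apply: leq_trans TYk.
    by rewrite cY /= addnC addnS.
  by rewrite cTS; apply: leq_trans Tn; rewrite leq_subr.
apply: (le_trans (ler_pM (setnorm_ge0 xi1 _) (setnorm_ge0 xi1 _) n1 n2)).
have -> : \prod_(c in D :|: E) z c = (\prod_(c in D) z c) * \prod_(c in E) z c.
  by rewrite -bigU //; apply: eq_bigl => c; rewrite !inE.
rewrite exprD big_split /=.
set p := \prod_(c in D) z c; set q := \prod_(c in E) z c; set r := 2 ^+ _.
rewrite [leLHS](_ : _ = p * r * (q * ((2 * xi) ^+ #|S| * 2 ^+ #|S|))); last by ring.
rewrite -exprMn (_ : 2 * xi * 2 = 4 * xi); last by ring.
apply: ler_wpM2l; first by rewrite mulr_ge0 ?exprn_ge0 ?prodr_ge0.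
apply: ler_wpM2l; first by rewrite prodr_ge0.
have -> : \prod_(c in E) (4 * xi) ^+ #|cs c| = (4 * xi) ^+ \sum_(c in E) #|cs c|.
  by elim/big_rec2: _ => [|c a b _ ->]; rewrite ?expr0 // exprD.
rewrite ler_weXn2l //; first by move: xi1; lra.
apply: leq_trans (leq_card_csupp E); apply: subset_leq_card; exact: subsetIl.
Qed.

Lemma weight_ge0 c : 0 <= z c * (4 * xi) ^+ #|cs c|.
Proof. by rewrite mulr_ge0 // exprn_ge0 //; move: xi1; lra. Qed.

Lemma sum_exposed (y : V) :
  \sum_(E : {set Cell} | E \subset [set c | y \in cs c]) \prod_(c in E) (z c * (4 * xi) ^+ #|cs c|)
  <= 5 / 4.
Proof.
rewrite sum_powerset; apply: prod1D_le; first exact: weight_ge0.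
by rewrite (eq_bigl (fun c => y \in cs c)) // => c; rewrite inE.
Qed.

Lemma exposed_boundP n : ratio_claim n -> forall k, exposed_bound n k.
Proof.
move=> hn; elim=> [|k IH] D Y T TYk Tn dYT dDT hD.
all: have [Y0|/set0Pn[y yY]] := eqVneq Y set0.
(* With nothing exposed, [WM] factors [W x D] out of the sum, and the quotient is constant in
   [U]. *)
1,3: rewrite Y0 cards0 expr0 mulr1;
     rewrite (@eq_setnorm _ _ _ _ _ (fun x U => W x D));
     [by apply: setnorm_const; rewrite ?prodr_ge0
     |move=> x U; rewrite /exposedZ set0U;
      rewrite (eq_bigr (fun F => W x D * W x F));
      [by rewrite -mulr_sumr -/(polyZ x _) mulfK // (polyZ_neq0 hn) //;
          apply: leq_trans Tn; apply: subset_leq_card; exact: subsetIr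
      |by move=> F FU; apply: WM; apply: disjointWr FU _; apply: disjointWr dDT; exact: subsetIr]].
  by move: TYk; rewrite (cardsD1 y Y) yY addnC.
rewrite (@eq_setnorm _ _ _ _ _ (fun x U => \sum_(E : {set Cell} | (E \subset [set c | y \in cs c]) && (csupp E \subset Y :|: T))
     (csupp E :&: T \subset U)%:R *
     exposedZ (D :|: E) ((Y :\ y) :|: (csupp E :&: T)) (T :\: csupp E) x U / polyZ x (U :&: T))); last first.
  by move=> x U; rewrite (exposedZ_step D x U yY dYT) mulr_suml.
apply: (le_trans (setnorm_sum xi1 _ _ _)).
pose b := (\prod_(c in D) z c) * 2 ^+ #|Y|.-1.
have b0 : 0 <= b by rewrite mulr_ge0 ?exprn_ge0 ?prodr_ge0.
apply: (@le_trans _ _ (\sum_(E : {set Cell} | E \subset [set c | y \in cs c])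
   b * \prod_(c in E) (z c * (4 * xi) ^+ #|cs c|))).
  rewrite big_mkcondr /=; apply: ler_sum => E EC; case: ifP => ET.
    exact: (exposed_term hn IH TYk Tn dYT dDT hD yY EC ET).
  by rewrite mulr_ge0 // prodr_ge0 // => c _; exact: weight_ge0.
(* Removing [y] from [Y] frees one factor 2, which pays for the sum over the revealed sets, at most
   5/4. *)
rewrite -mulr_sumr; apply: (le_trans (ler_wpM2l b0 (sum_exposed y))).
have -> : #|Y| = #|Y|.-1.+1 by rewrite (cardsD1 y Y) yY.
by rewrite exprSr mulrA -/b; move: b0; lra.
Qed.

(** In the exploration started at [s], the empty set of cells contributes exactly 1, and the other
    sets at most 5/4 - 1 = 1/4. *)
Lemma ratio_claimP n : ratio_claim n.
Proof.
elim: n => // n IH T s; rewrite ltnS => Tn sT.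
have dsT : [disjoint [set s] & T] by rewrite disjoints1.
have d0T : [disjoint csupp set0 & T] by rewrite csupp0 -setI_eq0 set0I.
pose term E x U : R[i] := (csupp E :&: T \subset U)%:R *
  exposedZ (set0 :|: E) (([set s] :\ s) :|: (csupp E :&: T)) (T :\: csupp E) x U / polyZ x (U :&: T).
pose Q E := (E \subset [set c | s \in cs c]) && (csupp E \subset [set s] :|: T).
have nz x U : polyZ x (U :&: T) != 0.
  by rewrite (polyZ_neq0 IH) //; apply: leq_trans Tn; apply: subset_leq_card; exact: subsetIr.
rewrite (@eq_setnorm _ _ _ _ _ (fun x U => \sum_(E | Q E && (E != set0)) term E x U)); last first.
  move=> x U; have h : polyratio T s x U = \sum_(E | Q E) term E x U.
    rewrite /term -mulr_suml -(exposedZ_step set0 x U (set11 s) dsT) /exposedZ /polyratio.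
    by congr (_ / _); apply: eq_bigr => F _; rewrite set0U.
  rewrite h (bigD1 set0) /=; last by rewrite /Q !sub0set csupp0 sub0set.
  rewrite /term csupp0 set0I sub0set mul1r setD0 setDv setU0 /exposedZ !set0U.
  have -> : \sum_(F | csupp F \subset U :&: T) W x (set0 :|: F) = polyZ x (U :&: T).
    by apply: eq_bigr => F _; rewrite set0U.
  by rewrite divff // addrAC subrr add0r.
apply: (le_trans (setnorm_sum xi1 _ _ _)).
apply: (@le_trans _ _ (\sum_(E : {set Cell} | (E \subset [set c | s \in cs c]) && (E != set0))
   \prod_(c in E) (z c * (4 * xi) ^+ #|cs c|))).
  rewrite [leLHS]big_mkcond [leRHS]big_mkcond /=; apply: ler_sum => E _.
  rewrite /Q; case EC : (E \subset _) => //=; case E0 : (E == set0); rewrite ?andbF ?andbT //=.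
  case ET : (csupp E \subset _).
    have := @exposed_term n #|T| set0 [set s] T s E IH (@exposed_boundP n IH #|T|) _ Tn dsT d0T _ (set11 s) EC ET.
    rewrite big_set0 mul1r cards1 expr0 mul1r; apply; first by rewrite addn1.
    by move=> c; rewrite inE.
  by rewrite prodr_ge0 // => c _; exact: weight_ge0.
have := sum_exposed s; rewrite (bigD1 set0) ?sub0set //= big_set0; lra.
Qed.

Lemma polyZ_nz x U : polyZ x U != 0.
Proof. exact: (polyZ_neq0 (@ratio_claimP #|U|)). Qed.

Definition polylog x U : R := ln (nrm (polyZ x U) ^+ 2).

Lemma sum_sub_setU1 (K : zmodType) (h : {set V} -> K) (s : V) U :
  \sum_(C : {set V} | C \subset s |: U) h C - \sum_(C : {set V} | C \subset U :\ s) h C =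
  \sum_(D : {set V} | (D \subset U) && (s \notin D)) h (s |: D).
Proof.
rewrite (bigID (fun C : {set V} => s \in C)) /= addrC.
rewrite [X in X + _ - _](eq_bigl (fun C : {set V} => C \subset U :\ s)); last first.
  move=> C; rewrite subsetD1; case sC : (s \in C); rewrite ?andbF // !andbT.
  apply/idP/idP => h1; last exact: subset_trans h1 (subsetUr _ _).
  apply/subsetP => v vC; have := subsetP h1 v vC; rewrite !inE.
  by case: eqP => // vs; rewrite vs sC in vC.
rewrite addrAC subrr add0r.
rewrite (reindex_onto (fun D : {set V} => s |: D) (fun C => C :\ s)) /=; last first.
  by move=> C /andP[_ sC]; rewrite setD1K.
apply: eq_bigl => D; rewrite setU11 andbT subUset sub1set setU11 /=.
case sD : (s \in D) => /=.
  rewrite andbF; apply/negP => /andP[_ /eqP e]; by rewrite -e setD11 in sD.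
rewrite setU1K ?sD // eqxx !andbT; apply/idP/idP => h1; last exact: subset_trans h1 (subsetUr _ _).
apply/subsetP => v vC; have := subsetP h1 v vC; rewrite !inE.
by case: eqP => // vs; rewrite vs sD in vC.
Qed.

Lemma mob_rc (g : {set V} -> R) (D : {set V}) : mob (fun U : {set V} => rc (g U)) D = rc (mob g D).
Proof.
rewrite /mob /rc rmorph_sum /=; apply: eq_bigr => U _.
by rewrite rmorphM /= rmorphXn /= rmorphN1.
Qed.

(** For [s] in [C], the coefficient of the logarithm at [C] equals the coefficient at [C :\ s] of
    the logarithm of the ratio with and without [s], to which [setnorm_ln_mod] applies. Hence the
    exponent [#|C|.-1]. *)
Lemma polylog_mob_bound (s : V) :
  exists G : {set V} -> R, [/\ forall C : {set V}, 0 <= G C,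
     forall x (C : {set V}), s \in C -> `|mob (polylog x) C| <= G C &
     \sum_(C : {set V} | s \in C) xi ^+ #|C|.-1 * G C <= 2].
Proof.
pose f x U := polyratio (setT :\ s) s x U.
have fN : N (fun x U => f x U - 1) <= 1 / 4.
  by apply: (@ratio_claimP #|V|.+1); rewrite ?setD11 // ltnS max_card.
have := setnorm_ln_mod xi1 fN; rewrite /setnorm.
set M := fun D : {set V} => \big[Num.max/0]_x nrm (mob (fun U => rc (ln (nrm (f x U) ^+ 2))) D).
move=> hM; exists (fun C : {set V} => M (C :\ s)); split.
- by move=> C; exact: (maxnrm_ge0 (fun x U => rc (ln (nrm (f x U) ^+ 2)))).
- move=> x C sC; have nsD : s \notin C :\ s by rewrite setD11.
  have <- : mob (fun U => ln (nrm (f x U) ^+ 2)) (C :\ s) = mob (polylog x) C.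
    rewrite (mob_uniq (a := fun D : {set V} => if s \in D then 0 else mob (polylog x) (s |: D))).
      by rewrite (negPf nsD) setD1K.
    move=> U; rewrite (eq_bigr (fun D : {set V} => if s \notin D then mob (polylog x) (s |: D) else 0)); last by move=> D _; rewrite if_neg.
    rewrite -big_mkcondr -sum_sub_setU1 !mobK /polylog /f /polyratio.
    have -> : U :&: (setT :\ s) = U :\ s.
      by apply/setP => v; rewrite !inE andbT andbC.
    have -> : s |: U :\ s = s |: U.
      by apply/setP => v; rewrite !inE; case: eqP.
    rewrite nrmM nrmV exprMn exprVn lnM ?posrE ?invr_gt0 ?exprn_gt0 ?lt_def ?nrm_ge0 ?nrm_eq0 ?polyZ_nz //.
    by rewrite lnV // posrE exprn_gt0 // lt_def nrm_ge0 nrm_eq0 polyZ_nz.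
  rewrite -nrm_rc -mob_rc.
  exact: (le_maxnrm (fun x U => rc (ln (nrm (f x U) ^+ 2)))).
apply: le_trans hM.
rewrite (reindex_onto (fun D : {set V} => s |: D) (fun C => C :\ s)) /=; last first.
  by move=> C sC; rewrite setD1K.
rewrite big_mkcond /=; apply: ler_sum => D _; case: ifP => [/andP[_ /eqP e]|_].
  have sD : s \notin D by rewrite -e setD11.
  by rewrite e cardsU1 sD.
by rewrite mulr_ge0 ?exprn_ge0 ?(le_trans _ xi1) //; exact: (maxnrm_ge0 (fun x U => rc (ln (nrm (f x U) ^+ 2)))).
Qed.

Lemma polyZ_split x (A B : {set V}) : [disjoint A & B] ->
  (forall c, cs c \subset A :|: B -> (cs c \subset A) || (cs c \subset B)) ->
  polyZ x (A :|: B) = polyZ x A * polyZ x B.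
Proof.
move=> dAB hc; rewrite /polyZ big_distrlr /= pair_big /=.
pose inA (F : {set Cell}) := [set c in F | cs c \subset A].
rewrite (reindex_onto (fun p : {set Cell} * {set Cell} => p.1 :|: p.2)
  (fun F => ([set c in F | cs c \subset A], [set c in F | cs c \subset B]))) /=; last first.
  move=> F FAB; apply/setP => c; rewrite !inE -andb_orr; apply: andb_idr => cF.
  by apply: hc; exact: subset_trans (csupp_sub cF) FAB.
have nAB c : cs c \subset A -> cs c \subset B -> False.
  move=> cA cB; have /set0Pn[v vc] := cs0 c.
  by have := disjointFr dAB (subsetP cA v vc); rewrite (subsetP cB v vc).
have sb (F : {set Cell}) (S : {set V}) : reflect (forall c, c \in F -> cs c \subset S) (csupp F \subset S).
  exact: bigcupsP.
apply: eq_big => [[F D]|[F D]] /=.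
  apply/idP/idP.
    move=> /andP[_ /eqP [e1 e2]]; apply/andP; split; apply/sb => c.
      by rewrite -e1 inE => /andP[].
    by rewrite -e2 inE => /andP[].
  move=> /andP[/sb FA /sb DB]; apply/andP; split.
    apply/sb => c; rewrite inE => /orP[/FA|/DB] h.
      exact: subset_trans h (subsetUl _ _).
    exact: subset_trans h (subsetUr _ _).
  apply/eqP; congr pair; apply/setP => c; rewrite !inE.
    have [cF|cF] := boolP (c \in F); first by rewrite FA.
    by have [cD|//] := boolP (c \in D); apply/negP => cA; exact: nAB cA (DB _ cD).
  have [cD|cD] := boolP (c \in D); first by rewrite orbT DB.
  by rewrite orbF; have [cF|//] := boolP (c \in F); apply/negP => cB; exact: nAB (FA _ cF) cB.
move=> /andP[_ /eqP[e1 e2]]; apply: WM; rewrite -setI_eq0; apply/eqP/setP => v; rewrite !inE.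
apply/negP => /andP[/bigcupP[c cF vc] /bigcupP[c' cD vc']].
rewrite -e1 inE in cF; rewrite -e2 inE in cD.
have := disjointFr dAB (subsetP (proj2 (andP cF)) v vc).
by rewrite (subsetP (proj2 (andP cD)) v vc').
Qed.

(** When no cell straddles the two parts, the logarithm is a function of [U :&: A] plus one of
    [U :&: B], and [mob_indep] kills each of them with a vertex of the other part. *)
Lemma polylog_mob_split x (A B : {set V}) : A != set0 -> B != set0 -> [disjoint A & B] ->
  (forall c, cs c \subset A :|: B -> (cs c \subset A) || (cs c \subset B)) ->
  mob (polylog x) (A :|: B) = 0.
Proof.
move=> /set0Pn[a aA] /set0Pn[b bB] dAB hc.
have bA : b \notin A by rewrite (disjointFl dAB bB).
have aB : a \notin B by rewrite (disjointFr dAB aA).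
rewrite (@eq_mob _ _ _ (fun U => polylog x (U :&: A) + polylog x (U :&: B))).
  rewrite mobD.
  have cap v U (S : {set V}) : v \notin S -> (v |: U) :&: S = (U :\ v) :&: S.
    move=> vS; apply/setP => u; rewrite !inE; case: eqP => //= ->.
    by rewrite (negPf vS) ?andbF.
  rewrite (@mob_indep _ _ _ b) ?inE ?bB ?orbT // => [|U]; last by rewrite cap.
  by rewrite (@mob_indep _ _ _ a) ?inE ?aA ?add0r // => U; rewrite cap.
move=> U UAB; rewrite /polylog.
have -> : polyZ x U = polyZ x (U :&: A) * polyZ x (U :&: B).
  rewrite -polyZ_split -?setIUr ?(setIidPl UAB) //.
    by apply: disjointWl (subsetIr _ _) _; apply: disjointWr (subsetIr _ _) _.
  move=> c cU; have := hc c (subset_trans cU UAB).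
  by rewrite !subsetI cU.
rewrite nrmM exprMn lnM // posrE exprn_gt0 // lt_def nrm_ge0 nrm_eq0 polyZ_nz //.
Qed.

End Polymer.

(** * Matrix exponentials *)

Section CvgC.
Local Open Scope classical_set_scope.
Local Open Scope ring_scope.
Variable R : realType.
Local Notation C := R[i].
Implicit Types (u v : nat -> C) (l m : C).

Definition cvgC u l := ((fun k => nrm (u k - l)) @ \oo --> (0 : R))%classic.

Lemma cvgC_squeeze u l (e : nat -> R) : (\forall k \near \oo, nrm (u k - l) <= e k) ->
  (e @ \oo --> (0 : R))%classic -> cvgC u l.
Proof.
move=> ue e0; apply: (squeeze_cvgr _ (cvg_cst 0) e0).
by near=> k; rewrite nrm_ge0 /=; near: k.
Unshelve. all: by end_near. Qed.

Lemma cvgC_cst l : cvgC (fun=> l) l.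
Proof.
rewrite /cvgC subrr nrm0; exact: cvg_cst.
Qed.

Lemma cvgCD u v l m : cvgC u l -> cvgC v m -> cvgC (fun k => u k + v k) (l + m).
Proof.
move=> ul vm; apply: (@cvgC_squeeze _ _ (fun k => nrm (u k - l) + nrm (v k - m))).
  by near=> k; rewrite opprD addrACA; exact: nrmD.
by rewrite -[X in (_ --> X)%classic](addr0 0); apply: cvgD.
Unshelve. all: by end_near. Qed.

Lemma cvgCM u v l m : cvgC u l -> cvgC v m -> cvgC (fun k => u k * v k) (l * m).
Proof.
move=> ul vm; apply: (@cvgC_squeeze _ _ (fun k => nrm (u k - l) * nrm (v k - m) + (nrm (u k - l) * nrm m + nrm l * nrm (v k - m)))).
  near=> k; rewrite -!nrmM.
  have -> : u k * v k - l * m = (u k - l) * (v k - m) + ((u k - l) * m + l * (v k - m)) by ring.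
  by apply: (le_trans (nrmD _ _)); rewrite lerD2l; exact: nrmD.
have -> : (0 : R) = 0 * 0 + (0 * nrm m + nrm l * 0) by rewrite !mul0r mulr0 !addr0.
apply: cvgD; first exact: cvgM.
by apply: cvgD; [apply: cvgMl|apply: cvgMr].
Unshelve. all: by end_near. Qed.

Lemma cvgC_sum (I : Type) (r : seq I) (P : pred I) (u : I -> nat -> C) (l : I -> C) :
  (forall i, P i -> cvgC (u i) (l i)) ->
  cvgC (fun k => \sum_(i <- r | P i) u i k) (\sum_(i <- r | P i) l i).
Proof.
move=> h; elim: r => [|i r IH].
  rewrite big_nil (_ : (fun k => _) = fun=> 0); first exact: cvgC_cst.
  by apply/funext => k; rewrite big_nil.
rewrite big_cons (_ : (fun k => _) = fun k => if P i then u i k + \sum_(j <- r | P j) u j k else \sum_(j <- r | P j) u j k).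
  by case: ifP => // Pi; apply: cvgCD => //; exact: h.
by apply/funext => k; rewrite big_cons.
Qed.

Lemma cvgC_uniq u l m : cvgC u l -> cvgC u m -> l = m.
Proof.
move=> ul um; apply/eqP; rewrite -subr_eq0 -nrm_eq0; apply/eqP.
have h : cvgC (fun k => u k + -1 * u k) (l + -1 * m).
  by apply: cvgCD => //; apply: cvgCM => //; exact: cvgC_cst.
rewrite mulN1r (_ : (fun k => _) = fun=> 0) in h; last by apply/funext => k; rewrite mulN1r subrr.
move: h; rewrite /cvgC sub0r nrmN => h.
exact: (cvg_unique (@norm_hausdorff _ _) (cvg_cst _) h).
Qed.

Lemma cvgC_nrm u l : cvgC u l -> ((fun k => nrm (u k)) @ \oo --> nrm l)%classic.
Proof.
move=> ul; apply/subr_cvg0; apply: norm_cvg0.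
apply: (squeeze_cvgr _ (cvg_cst 0) ul); near=> k.
rewrite normr_ge0 /= ler_norml; have := nrmD (u k - l) l; have := nrmD (l - u k) (u k).
rewrite !subrK (nrm_distC l); lra.
Unshelve. all: by end_near. Qed.

Lemma cvgC_le u l (b : R) : cvgC u l -> (\forall k \near \oo, nrm (u k) <= b) -> nrm l <= b.
Proof.
move=> /cvgC_nrm ul h; have <- := cvg_lim (@Rhausdorff R) ul.
by apply: limr_le => //; apply/cvg_ex; exists (nrm l).
Qed.

Lemma nrm_Re_Im (x : C) : nrm x <= `|complex.Re x| + `|complex.Im x|.
Proof.
have e : x = rc (complex.Re x) + 'i%C * rc (complex.Im x) by exact: complexE.
rewrite {1}e; apply: (le_trans (nrmD _ _)); rewrite nrmM !nrm_rc.
have -> : nrm 'i%C = 1 :> R by rewrite /nrm /= expr0n expr1n add0r sqrtr1.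
by rewrite mul1r.
Qed.

Lemma cvgC_Re_Im u l : cvgC u l <->
  ((fun k => complex.Re (u k)) @ \oo --> complex.Re l)%classic /\
  ((fun k => complex.Im (u k)) @ \oo --> complex.Im l)%classic.
Proof.
have ReB (x y : C) : complex.Re (x - y) = complex.Re x - complex.Re y by case: x; case: y.
have ImB (x y : C) : complex.Im (x - y) = complex.Im x - complex.Im y by case: x; case: y.
split=> [ul|[ur ui]].
  split; apply/subr_cvg0; apply: norm_cvg0; apply: (squeeze_cvgr _ (cvg_cst 0) ul); near=> k.
    by rewrite normr_ge0 /= -ReB Re_le_nrm.
  rewrite normr_ge0 /= -ImB.
  have -> (x : C) : complex.Im x = complex.Re (- 'i%C * x) by case: x => a b /=; ring.
  by apply: (le_trans (Re_le_nrm _)); rewrite nrmM nrmN (_ : nrm 'i%C = 1) ?mul1r // /nrm /= expr0n expr1n add0r sqrtr1.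
apply: (@cvgC_squeeze _ _ (fun k => `|complex.Re (u k) - complex.Re l| + `|complex.Im (u k) - complex.Im l|)).
  by near=> k; rewrite -ReB -ImB nrm_Re_Im.
rewrite -[X in (_ --> X)%classic](addr0 0); apply: cvgD.
  by rewrite -(normr0 R); apply: cvg_norm; apply/subr_cvg0.
by rewrite -(normr0 R); apply: cvg_norm; apply/subr_cvg0.
Unshelve. all: by end_near. Qed.

(** Limits of the real and imaginary parts are taken separately, as in [gibbs_tr]. *)
Definition limC u : C := (limn (fun k => complex.Re (u k)) +i* limn (fun k => complex.Im (u k)))%C.

Lemma limCE u l : cvgC u l -> limC u = l.
Proof.
by move=> /cvgC_Re_Im[h1 h2]; rewrite /limC (cvg_lim (@Rhausdorff R) h1) (cvg_lim (@Rhausdorff R) h2); case: l {h1 h2}.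
Qed.

Lemma limC_series u (a : R) : (forall k, nrm (u k) <= a ^+ k / k`!%:R) ->
  let s := fun k => \sum_(p < k) u p in cvgC s (limC s).
Proof.
move=> ua s.
have key (f : nat -> R) : (forall k, `|f k| <= a ^+ k / k`!%:R) ->
   cvgn (fun k => \sum_(p < k) f p).
  move=> fa; have h : cvgn (series (exp_coeff a)) := is_cvg_series_exp_coeff a.
  rewrite (_ : (fun k => \sum_(p < k) f p) = series f); last first.
    by apply/funext => n; rewrite /series /= big_mkord.
  apply: normed_cvg.
  by apply: (@series_le_cvg _ (fun k => `|f k|) (exp_coeff a)) => // k; apply: le_trans (fa k); exact: normr_ge0.
have ReS k : complex.Re (s k) = \sum_(p < k) complex.Re (u p).
  by rewrite /s; elim/big_rec2: _ => // i x y _ <-; case: (u i); case: y.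
have ImS k : complex.Im (s k) = \sum_(p < k) complex.Im (u p).
  by rewrite /s; elim/big_rec2: _ => // i x y _ <-; case: (u i); case: y.
have ImRe (x : C) : `|complex.Im x| <= nrm x.
  have -> : complex.Im x = complex.Re (- 'i%C * x) by case: x => b c /=; ring.
  by apply: (le_trans (Re_le_nrm _)); rewrite nrmM nrmN (_ : nrm 'i%C = 1) ?mul1r // /nrm /= expr0n expr1n add0r sqrtr1.
apply/cvgC_Re_Im; split; rewrite /limC /=.
  rewrite (_ : (fun k => complex.Re (s k)) = fun k => \sum_(p < k) complex.Re (u p)); last exact/funext.
  by have h := key (fun p => complex.Re (u p)) (fun k => le_trans (Re_le_nrm _) (ua k)); exact: h.
rewrite (_ : (fun k => complex.Im (s k)) = fun k => \sum_(p < k) complex.Im (u p)); last exact/funext.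
by have h := key (fun p => complex.Im (u p)) (fun k => le_trans (ImRe _) (ua k)); exact: h.
Qed.

End CvgC.

Section ExpLimit.
Local Open Scope classical_set_scope.
Local Open Scope ring_scope.
Variable R : realType.

Lemma cvg_inv_nat : ((fun n : nat => (n%:R : R)^-1) @ \oo --> (0 : R))%classic.
Proof.
apply/gtr0_cvgV0; last exact: cvgr_idn.
by near=> n; rewrite ltr0n; near: n; exists 1%N.
Unshelve. all: by end_near. Qed.

Lemma expr1D_le_exp (a : R) n : 0 <= a -> (1 + a / n%:R) ^+ n <= expR a.
Proof.
move=> a0; case: n => [|n]; first by rewrite expr0 -(expR0 R) ler_expR.
have -> : expR a = expR (a / n.+1%:R) ^+ n.+1.
  by rewrite -expRM_natl mulrC divfK ?pnatr_eq0.
by rewrite lerXn2r ?nnegrE ?expR_ge0 ?expR_ge1Dx ?addr_ge0 ?divr_ge0 ?ler0n.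
Qed.

(** Squeezed from below by exp(a / (1 + a/n)), because 1 + x >= exp(x / (1 + x)). *)
Lemma cvg_expr1D (a : R) : 0 <= a -> ((fun n : nat => (1 + a / n%:R) ^+ n) @ \oo --> expR a)%classic.
Proof.
move=> a0.
have h : ((fun n : nat => expR (a / (1 + a / n%:R))) @ \oo --> expR a)%classic.
  have h1 : ((fun n : nat => a / (1 + a / n%:R)) @ \oo --> a)%classic.
    rewrite -[X in (_ --> X)%classic]divr1; apply: cvgMr.
    apply: cvgV; first exact: oner_neq0.
    rewrite -[X in (_ --> X)%classic](addr0 1); apply: cvgD; first exact: cvg_cst.
    by rewrite -[X in (_ --> X)%classic](mulr0 a); apply: cvgMr; exact: cvg_inv_nat.
  exact: (continuous_cvg _ (@continuous_expR R a) h1).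
apply: (squeeze_cvgr _ h (cvg_cst (expR a))); near=> n.
have n0 : (0 < n)%N by near: n; exists 1%N.
rewrite expr1D_le_exp // andbT; set x := a / n%:R.
have x0 : 0 <= x by rewrite divr_ge0 ?ler0n.
have -> : a / (1 + x) = n%:R * (x / (1 + x)) by rewrite mulrA mulrCA divff ?mulr1 ?pnatr_eq0 -?lt0n.
rewrite expRM_natl lerXn2r ?nnegrE ?expR_ge0 ?addr_ge0 //.
have := expR_ge1Dx (- (x / (1 + x))); rewrite expRN => h2.
have y1 : 1 + - (x / (1 + x)) = (1 + x)^-1.
  apply: (mulfI (_ : 1 + x != 0)); first by rewrite lt0r_neq0 ?ltr_pwDl.
  by rewrite mulrDr mulrN mulrCA !divff ?lt0r_neq0 ?ltr_pwDl //; ring.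
by rewrite y1 lef_pV2 ?posrE ?expR_gt0 ?ltr_pwDl in h2.
Unshelve. all: by end_near. Qed.

End ExpLimit.

Section MatrixExp.
Local Open Scope classical_set_scope.
Local Open Scope ring_scope.
Variable R : realType.
Local Notation C := R[i].

(** A bound on the maximal row sum: submultiplicative, and it dominates every entry. It serves
    convergence only; the quantitative estimates use [opb]. *)
Definition rowb (n p : nat) (A : 'M[C]_(n, p)) (a : R) := forall i, \sum_j nrm (A i j) <= a.

Lemma rowb_entry n p (A : 'M[C]_(n, p)) a i j : rowb A a -> nrm (A i j) <= a.
Proof.
move=> h; apply: le_trans (h i); rewrite (bigD1 j) //= lerDl.
by apply: sumr_ge0 => k _; exact: nrm_ge0.
Qed.

Lemma rowb_ge0 n p (A : 'M[C]_(n.+1, p)) a : rowb A a -> 0 <= a.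
Proof. by move=> /(_ ord0); apply: le_trans; apply: sumr_ge0 => k _; exact: nrm_ge0. Qed.

Lemma rowb_le n p (A : 'M[C]_(n, p)) a b : a <= b -> rowb A a -> rowb A b.
Proof. by move=> ab h i; apply: le_trans ab. Qed.

Lemma rowbD n p (A B : 'M[C]_(n, p)) a b : rowb A a -> rowb B b -> rowb (A + B) (a + b).
Proof.
move=> hA hB i; apply: le_trans (lerD (hA i) (hB i)); rewrite -big_split /=.
by apply: ler_sum => j _; rewrite mxE nrmD.
Qed.

Lemma rowbZ n p (A : 'M[C]_(n, p)) a (c : C) : rowb A a -> rowb (c *: A) (nrm c * a).
Proof.
move=> hA i; apply: le_trans (ler_wpM2l (nrm_ge0 c) (hA i)); rewrite mulr_sumr.
by apply: ler_sum => j _; rewrite mxE nrmM.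
Qed.

Lemma rowbM n p q (A : 'M[C]_(n, p)) (B : 'M[C]_(p, q)) a b : 0 <= b ->
  rowb A a -> rowb B b -> rowb (A *m B) (a * b).
Proof.
move=> b0 hA hB i; apply: (@le_trans _ _ (\sum_k nrm (A i k) * b)).
  apply: (@le_trans _ _ (\sum_j \sum_k nrm (A i k) * nrm (B k j))).
    apply: ler_sum => j _; rewrite mxE; apply: (le_trans (nrm_sum _ _ _)).
    by apply: ler_sum => k _; rewrite nrmM.
  rewrite exchange_big /=; apply: ler_sum => k _; rewrite -mulr_sumr.
  by rewrite ler_wpM2l ?nrm_ge0.
by rewrite -mulr_suml ler_wpM2r.
Qed.

Lemma rowb1 n : rowb (1%:M : 'M[C]_n) 1.
Proof.
move=> i; rewrite (bigD1 i) //= big1 => [|j /negPf ji]; rewrite mxE ?eqxx ?nrm1 ?addr0 //.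
by rewrite eq_sym ji nrm0.
Qed.

Lemma rowbX n (A : 'M[C]_n) a k : 0 <= a -> rowb A a -> rowb (A ^+ k) (a ^+ k).
Proof.
move=> a0 hA; elim: k => [|k IH]; first by rewrite !expr0; exact: rowb1.
by rewrite !exprS; apply: rowbM => //; exact: exprn_ge0.
Qed.

Lemma rowb_ex n p (A : 'M[C]_(n, p)) : exists2 a, 0 <= a & rowb A a.
Proof.
exists (\sum_i \sum_j nrm (A i j)).
  by apply: sumr_ge0 => i _; apply: sumr_ge0 => j _; exact: nrm_ge0.
move=> i; rewrite [leRHS](bigD1 i) //= lerDl.
by apply: sumr_ge0 => k _; apply: sumr_ge0 => j _; exact: nrm_ge0.
Qed.

Lemma rowb_subX n (X Y : 'M[C]_n) (m d : R) k : 0 <= d -> 1 <= m -> rowb X m -> rowb Y m ->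
  rowb (X - Y) d -> rowb (X ^+ k - Y ^+ k) (k%:R * d * m ^+ k).
Proof.
move=> d0 m1 hX hY hd; have m0 : 0 <= m by lra.
elim: k => [|k IH].
  rewrite !expr0 subrr !mul0r => i; rewrite big1 // => j _; by rewrite mxE nrm0.
rewrite !exprS (_ : _ - _ = X * (X ^+ k - Y ^+ k) + (X - Y) * Y ^+ k); last first.
  by rewrite mulrBr mulrBl addrA subrK.
apply: rowb_le (rowbD (rowbM _ hX IH) (rowbM _ hd (rowbX k m0 hY))); rewrite ?mulr_ge0 ?exprn_ge0 ?ler0n //.
have h : 0 <= (d * m ^+ k) * (m - 1) by rewrite !mulr_ge0 ?exprn_ge0 ?subr_ge0.
by rewrite -natr1; lra.
Qed.

Definition mexp n (A : 'M[C]_n) : 'M[C]_n :=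
  \matrix_(i, j) limC (fun k => \sum_(p < k) rc (p`!%:R^-1) * (A ^+ p) i j).

Lemma mexp_series n (A : 'M[C]_n) i j :
  cvgC (fun k => \sum_(p < k) rc (p`!%:R^-1) * (A ^+ p) i j) (mexp A i j).
Proof.
rewrite mxE; have [a a0 hA] := rowb_ex A.
apply: (@limC_series _ (fun p => rc (p`!%:R^-1) * (A ^+ p) i j) a) => k.
rewrite nrmM nrm_rc ger0_norm ?invr_ge0 ?ler0n // mulrC ler_wpM2r ?invr_ge0 ?ler0n //.
exact: rowb_entry (rowbX k a0 hA).
Qed.

Lemma mexp_entry_eq n n' (A : 'M[C]_n) (A' : 'M[C]_n') i j i' j' :
  (forall p, (A ^+ p) i j = (A' ^+ p) i' j') -> mexp A i j = mexp A' i' j'.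
Proof.
move=> h; rewrite !mxE; congr limC; apply/funext => k; apply: eq_bigr => p _.
by rewrite h.
Qed.

Lemma mexp_scalar_entry n (A : 'M[C]_n) i j :
  (forall p, (A ^+ p.+1) i j = 0) -> mexp A i j = (i == j)%:R.
Proof.
move=> h; apply: cvgC_uniq (mexp_series A i j) _.
apply: (@cvgC_squeeze _ _ _ (fun=> 0)); last exact: cvg_cst.
near=> k; have k0 : (0 < k)%N by near: k; exists 1%N.
rewrite -(prednK k0) big_ord_recl big1 => [|p _]; last by rewrite h mulr0.
by rewrite expr0 mxE invr1 mul1r addr0 subrr nrm0.
Unshelve. all: by end_near. Qed.

Lemma mxexprZ n (A : 'M[C]_n) c p : (c *: A) ^+ p = c ^+ p *: A ^+ p.
Proof.
elim: p => [|p IH]; first by rewrite !expr0 scale1r.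
by rewrite !exprS IH -mulmxE -scalemxAl -scalemxAr scalerA.
Qed.

Definition eulerp n (A : 'M[C]_n) (k : nat) : 'M[C]_n := (1%:M + rc k%:R^-1 *: A) ^+ k.

Lemma eulerpE n (A : 'M[C]_n) k i j : (eulerp A k) i j =
  \sum_(p < k.+1) rc ('C(k, p)%:R / k%:R ^+ p) * (A ^+ p) i j.
Proof.
rewrite /eulerp -[1%:M]/(1 : 'M[C]_n) exprDn_comm; last exact: commr_sym (commr1 _).
rewrite summxE; apply: eq_bigr => p _.
rewrite expr1n mul1r mxexprZ mulmxnE mxE -mulrnAl; congr (_ * _).
by rewrite /rc -rmorphXn -rmorphMn /= exprVn mulr_natl.
Qed.

Lemma rowb_eulerp n (A : 'M[C]_n) a k : 0 <= a -> rowb A a -> rowb (1%:M + rc k%:R^-1 *: A) (1 + a / k%:R).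
Proof.
move=> a0 hA; apply: rowbD; first exact: rowb1.
by apply: rowb_le (rowbZ _ hA); rewrite nrm_rc ger0_norm ?invr_ge0 ?ler0n // mulrC.
Qed.

Lemma bin_le_expn k p : ('C(k, p) * p`! <= k ^ p)%N.
Proof.
rewrite bin_ffact; elim: p => [|p IH]; first by rewrite ffactn0.
by rewrite ffactnSr expnSr leq_mul // leq_subr.
Qed.

(** Each Euler coefficient is at most 1/p!, so the entrywise error is dominated by the scalar error
    at the row bound [a], which tends to 0 by [cvg_expr1D]. *)
Lemma eulerp_cvg n (A : 'M[C]_n) i j : cvgC (fun k => (eulerp A k) i j) (mexp A i j).
Proof.
have [a a0 hA] := rowb_ex A.
pose S k := \sum_(p < k) rc (p`!%:R^-1) * (A ^+ p) i j.
have hS : cvgC (fun k => S k.+1) (mexp A i j).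
  have := mexp_series A i j; rewrite /cvgC => h.
  by move: h; rewrite -(cvg_shiftS (fun k => nrm (S k - mexp A i j))).
pose d k : R := \sum_(p < k.+1) p`!%:R^-1 * a ^+ p - (1 + a / k%:R) ^+ k.
have hd : (d @ \oo --> 0).
  rewrite -[X in (_ --> X)](subrr (expR a)); apply: cvgB; last exact: cvg_expr1D.
  have := is_cvg_series_exp_coeff a.
  move=> h.
  have h1 : (series (exp_coeff a) @ \oo --> expR a) by exact: h.
  move: h1; rewrite -cvg_shiftS; apply: cvg_trans; apply: near_eq_cvg; near=> k.
  by rewrite /series /= big_mkord; apply: eq_bigr => p _; rewrite /exp_coeff /= mulrC.
have e1 k : (1 + a / k%:R) ^+ k = \sum_(p < k.+1) ('C(k, p)%:R / k%:R ^+ p) * a ^+ p.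
  rewrite exprDn; apply: eq_bigr => p _.
  by rewrite expr1n mul1r exprMn exprVn -mulr_natl [a ^+ _ * _]mulrC mulrA.
have key : cvgC (fun k => S k.+1 + (eulerp A k i j - S k.+1)) (mexp A i j + 0).
  apply: cvgCD => //; apply: (@cvgC_squeeze _ _ _ d) => //; near=> k.
  have k0 : (0 < k)%N by near: k; exists 1%N.
  rewrite subr0 nrm_distC eulerpE /S -sumrB /d e1 -sumrB.
  apply: (le_trans (nrm_sum _ _ _)); apply: ler_sum => p _.
  rewrite -!mulrBl -rmorphB nrmM.
  have c0 : 0 <= (p`!%:R^-1 : R) - 'C(k, p)%:R / k%:R ^+ p.
    rewrite subr_ge0 ler_pdivrMr ?exprn_gt0 ?ltr0n // mulrC ler_pdivlMr ?ltr0n ?fact_gt0 //.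
    by rewrite -natrX -natrM ler_nat bin_le_expn.
  rewrite -/(rc _) nrm_rc ger0_norm // ler_wpM2l //.
  exact: rowb_entry (rowbX p a0 hA).
rewrite addr0 in key; move: key; apply: cvg_trans; apply: near_eq_cvg; near=> k.
by rewrite /= (addrC (S k.+1)) subrK.
Unshelve. all: by end_near. Qed.

(** An error of order k^-2 in each of [k] factors is of order 1/k in the product, by the telescoping
    estimate [rowb_subX]. *)
Lemma mexp_approx n (A : 'M[C]_n) (X B : nat -> 'M[C]_n) (b : R) i j :
  (forall k, (0 < k)%N -> X k = 1%:M + rc k%:R^-1 *: A + rc (k%:R ^- 2) *: B k) ->
  (forall k, rowb (B k) b) -> cvgC (fun k => ((X k) ^+ k) i j) (mexp A i j).
Proof.
move=> hX hB; have [a a0 hA] := rowb_ex A.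
have b0 : 0 <= b.
  case: n A X B i j hX hB hA => [|n] A X B i j hX hB hA; first by case: i.
  exact: rowb_ge0 (hB 0%N).
pose M k : R := 1 + (a + b) / k%:R.
have key : cvgC (fun k => eulerp A k i j + ((X k) ^+ k - eulerp A k) i j) (mexp A i j + 0).
  apply: cvgCD; first exact: eulerp_cvg.
  apply: (@cvgC_squeeze _ _ _ (fun k => k%:R^-1 * (b * expR (a + b)))); last first.
    by rewrite -[X in (_ --> X)](mul0r (b * expR (a + b))); apply: cvgMl; exact: cvg_inv_nat.
  near=> k; have k0 : (0 < k)%N by near: k; exists 1%N.
  rewrite subr0; have kR : (1 : R) <= k%:R by rewrite ler1n.
  have k2 : (k%:R ^- 2 : R) <= k%:R^-1.
    by rewrite lef_pV2 ?posrE ?exprn_gt0 ?ltr0n // expr2 ler_peMr ?ler0n.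
  have ki0 : 0 <= (k%:R^-1 : R) by rewrite invr_ge0 ler0n.
  have k20 : 0 <= (k%:R ^- 2 : R) by rewrite invr_ge0 exprn_ge0 ?ler0n.
  have hBk : rowb (rc (k%:R ^- 2) *: B k) (k%:R ^- 2 * b).
    by apply: rowb_le (rowbZ _ (hB k)); rewrite nrm_rc ger0_norm.
  have hEk := rowb_eulerp k a0 hA.
  have M1 : 1 <= M k by rewrite /M lerDl mulr_ge0 // addr_ge0.
  have hEM : rowb (1%:M + rc k%:R^-1 *: A) (M k).
    by apply: rowb_le hEk; rewrite /M lerD2l ler_wpM2r // lerDl.
  have hXM : rowb (X k) (M k).
    rewrite hX //; apply: rowb_le (rowbD hEk hBk); rewrite /M mulrDl addrA lerD2l.
    by rewrite mulrC ler_wpM2l.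
  have hXE : rowb (X k - (1%:M + rc k%:R^-1 *: A)) (k%:R ^- 2 * b).
    by rewrite hX // addrAC subrr add0r.
  have dd0 : 0 <= k%:R ^- 2 * b by rewrite mulr_ge0.
  apply: le_trans (rowb_entry i j (rowb_subX k dd0 M1 hXM hEM hXE)) _.
  rewrite (_ : k%:R * (k%:R ^- 2 * b) = k%:R^-1 * b); last first.
    by rewrite mulrA expr2 invfM mulrA divff ?mul1r // pnatr_eq0 -lt0n.
  rewrite -mulrA ler_wpM2l // ler_wpM2l //; exact: expr1D_le_exp (addr_ge0 a0 b0).
rewrite addr0 in key; move: key; apply: cvg_trans; apply: near_eq_cvg; near=> k.
have -> : (X k ^+ k - eulerp A k) i j = (X k ^+ k) i j - eulerp A k i j by rewrite !mxE.
by rewrite /= (addrC (eulerp A k i j)) subrK.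
Unshelve. all: by end_near. Qed.

(** Commutation turns the product of the two Euler approximations into the k-th power of 1 + (A +
    B)/k + AB/k^2, which tends to [mexp (A + B)] by [mexp_approx]. *)
Lemma mexpD n (A B : 'M[C]_n) : A *m B = B *m A -> mexp (A + B) = mexp A *m mexp B.
Proof.
move=> cAB; apply/matrixP => i j.
pose X k : 'M[C]_n := (1%:M + rc k%:R^-1 *: A) *m (1%:M + rc k%:R^-1 *: B).
have [c c0 hc] := rowb_ex (A *m B).
have h1 : cvgC (fun k => ((X k) ^+ k) i j) (mexp (A + B) i j).
  apply: (@mexp_approx _ _ _ (fun=> A *m B) c) => // k k0.
  rewrite /X mulmxDl mul1mx mulmxDr mulmx1 -scalemxAl -scalemxAr scalerA.
  by rewrite scalerDr -rmorphM -expr2 exprVn /= !addrA [1%:M + _ + _]addrAC.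
have h2 : cvgC (fun k => ((X k) ^+ k) i j) ((mexp A *m mexp B) i j).
  have e k : (X k) ^+ k = eulerp A k *m eulerp B k.
    rewrite /X /eulerp; apply: exprMn_comm; rewrite /GRing.comm.
    by rewrite -!mulmxE !mulmxDl !mulmxDr !mul1mx !mulmx1 -!scalemxAl -!scalemxAr cAB addrACA.
  rewrite mxE (_ : (fun k => _) = fun k => \sum_l eulerp A k i l * eulerp B k l j); last first.
    by apply/funext => k; rewrite e mxE.
  by apply: cvgC_sum => l _; apply: cvgCM; exact: eulerp_cvg.
exact: cvgC_uniq h1 h2.
Qed.

Lemma mexp0 n : mexp (0 : 'M[C]_n) = 1%:M.
Proof.
apply/matrixP => i j; rewrite mexp_scalar_entry ?mxE // => p.
by rewrite exprS mul0r mxE.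
Qed.

Lemma mexp_muln n (A : 'M[C]_n) k : mexp (A *+ k) = mexp A ^+ k.
Proof.
elim: k => [|k IH]; first by rewrite mulr0n mexp0.
rewrite mulrS mexpD ?IH ?exprS // mulmxE; apply/esym.
by elim: k {IH} => [|k IH]; rewrite ?mulr0n ?mul0r ?mulr0 // mulrS mulrDl mulrDr IH.
Qed.

Lemma mexp_trace n (A B : 'M[C]_n) :
  cvgC (fun k => \sum_(p < k) rc (p`!%:R^-1) * \tr (A ^+ p *m B)) (\tr (mexp A *m B)).
Proof.
have -> : \tr (mexp A *m B) = \sum_i \sum_j mexp A i j * B j i.
  by apply: eq_bigr => i _; rewrite mxE.
rewrite (_ : (fun k => _) = fun k => \sum_i \sum_j (\sum_(p < k) rc (p`!%:R^-1) * (A ^+ p) i j) * B j i).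
  apply: cvgC_sum => i _; apply: cvgC_sum => j _; apply: cvgCM (cvgC_cst _).
  exact: mexp_series.
apply/funext => k; rewrite (eq_bigr (fun p : 'I_k => \sum_i \sum_j rc (p`!%:R^-1) * (A ^+ p) i j * B j i)).
  rewrite exchange_big /=; apply: eq_bigr => i _; rewrite exchange_big /=.
  by apply: eq_bigr => j _; rewrite mulr_suml.
move=> p _; rewrite /mxtrace mulr_sumr; apply: eq_bigr => i _; rewrite mxE mulr_sumr.
by apply: eq_bigr => j _; rewrite mulrA.
Qed.

Lemma mexp_conj n (A U V : 'M[C]_n) : V *m U = 1%:M -> mexp (U *m A *m V) = U *m mexp A *m V.
Proof.
move=> VU; have UV := mulmx1C VU; apply/matrixP => i j.
have e p : (U *m A *m V) ^+ p = U *m A ^+ p *m V.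
  elim: p => [|p IH]; first by rewrite !expr0 mulmx1.
  rewrite !exprS IH -!mulmxE !mulmxA; congr (_ *m _ *m _).
  by rewrite -[U *m A *m V *m U]mulmxA VU mulmx1.
have e2 (M : 'M[C]_n) : (U *m M *m V) i j = \sum_l \sum_k U i k * M k l * V l j.
  by rewrite mxE; apply: eq_bigr => l _; rewrite mxE mulr_suml.
apply: cvgC_uniq (mexp_series _ i j) _.
rewrite e2 (_ : (fun k => _) = fun k => \sum_l \sum_m U i m * (\sum_(p < k) rc (p`!%:R^-1) * (A ^+ p) m l) * V l j).
  apply: cvgC_sum => l _; apply: cvgC_sum => m _; apply: cvgCM (cvgC_cst _).
  by apply: cvgCM (cvgC_cst _) _; exact: mexp_series.
apply/funext => k; rewrite (eq_bigr (fun p : 'I_k => \sum_l \sum_m U i m * (rc (p`!%:R^-1) * (A ^+ p) m l) * V l j)).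
  rewrite exchange_big /=; apply: eq_bigr => l _; rewrite exchange_big /=.
  by apply: eq_bigr => m _; rewrite mulr_sumr mulr_suml.
move=> p _; rewrite e e2 mulr_sumr; apply: eq_bigr => l _; rewrite mulr_sumr.
by apply: eq_bigr => m _; ring.
Qed.

Lemma mexp_comm n (A P : 'M[C]_n) : A *m P = P *m A -> mexp A *m P = P *m mexp A.
Proof.
move=> cAP; apply/matrixP => i j.
have e p : A ^+ p *m P = P *m A ^+ p.
  elim: p => [|p IH]; first by rewrite expr0 mulmx1 mul1mx.
  by rewrite exprS -!mulmxE -mulmxA IH !mulmxA cAP.
apply: (@cvgC_uniq _ (fun k => \sum_l (\sum_(p < k) rc (p`!%:R^-1) * (A ^+ p) i l) * P l j)).
  by rewrite mxE; apply: cvgC_sum => l _; apply: cvgCM (cvgC_cst _); exact: mexp_series.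
rewrite (_ : (fun k => _) = fun k => \sum_l P i l * (\sum_(p < k) rc (p`!%:R^-1) * (A ^+ p) l j)).
  by rewrite mxE; apply: cvgC_sum => l _; apply: cvgCM (cvgC_cst _) _; exact: mexp_series.
apply/funext => k; under eq_bigr do rewrite mulr_suml.
under [RHS]eq_bigr do rewrite mulr_sumr.
rewrite exchange_big [RHS]exchange_big /=; apply: eq_bigr => p _.
have := congr1 (fun M : 'M[C]_n => rc (p`!%:R^-1) * M i j) (e p); rewrite !mxE !mulr_sumr => h.
rewrite (eq_bigr (fun l => rc (p`!%:R^-1) * ((A ^+ p) i l * P l j))); last by move=> l _; rewrite mulrA.
by rewrite h; apply: eq_bigr => l _; rewrite mulrCA.
Qed.

End MatrixExp.

(** * Operator bounds *)

Section OperatorBound.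
Import fintype boot.finset.
Variable R : realType.
Local Notation C := R[i].

Lemma adjM n p q (A : 'M[C]_(n, p)) (B : 'M[C]_(p, q)) : adj (A *m B) = adj B *m adj A.
Proof. by rewrite /adj map_mxM trmx_mul. Qed.
Lemma adjK n p (A : 'M[C]_(n, p)) : adj (adj A) = A.
Proof. by apply/matrixP => i j; rewrite !mxE conjcK. Qed.
Lemma adjD n p (A B : 'M[C]_(n, p)) : adj (A + B) = adj A + adj B.
Proof. by apply/matrixP => i j; rewrite !mxE rmorphD. Qed.
Lemma adjN n p (A : 'M[C]_(n, p)) : adj (- A) = - adj A.
Proof. by apply/matrixP => i j; rewrite !mxE rmorphN. Qed.
Lemma adjZ n p (A : 'M[C]_(n, p)) (a : R) : adj (rc a *: A) = rc a *: adj A.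
Proof. by apply/matrixP => i j; rewrite !mxE rmorphM; congr (_ * _); exact: conjc_real. Qed.
Lemma adj1 n : adj (1%:M : 'M[C]_n) = 1%:M.
Proof. by apply/matrixP => i j; rewrite !mxE rmorph_nat eq_sym. Qed.

Definition vn2 n (v : 'cV[C]_n) : R := \sum_i nrm (v i ord0) ^+ 2.

Lemma vn2_ge0 n (v : 'cV[C]_n) : 0 <= vn2 v.
Proof. by apply: sumr_ge0 => i _; rewrite exprn_ge0 ?nrm_ge0. Qed.

Lemma vn2E n (v : 'cV[C]_n) : rc (vn2 v) = (adj v *m v) ord0 ord0.
Proof.
rewrite mxE /vn2 /rc rmorph_sum /=; apply: eq_bigr => i _.
by rewrite !mxE mulrC -rc_nrm2.
Qed.

Lemma vnormE n (v : 'cV[C]_n) : vnorm v = Num.sqrt (vn2 v).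
Proof.
rewrite /vnorm; congr Num.sqrt; apply: eq_bigr => i _.
by rewrite mulrC -rc_nrm2.
Qed.

(** Operator norm bounds stated on squared norms, free of suprema and square roots. *)
Definition opb n (M : 'M[C]_n) (c : R) := 0 <= c /\ forall v : 'cV[C]_n, vn2 (M *m v) <= c ^+ 2 * vn2 v.

Lemma opb_le n (M : 'M[C]_n) a b : a <= b -> opb M a -> opb M b.
Proof.
move=> ab [a0 h]; split; first exact: le_trans ab.
move=> v; apply: (le_trans (h v)); rewrite ler_wpM2r ?vn2_ge0 //.
by rewrite lerXn2r ?nnegrE // (le_trans a0).
Qed.

Lemma opbM n (A B : 'M[C]_n) a b : opb A a -> opb B b -> opb (A *m B) (a * b).
Proof.
move=> [a0 hA] [b0 hB]; split; first exact: mulr_ge0.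
move=> v; rewrite -mulmxA; apply: (le_trans (hA _)).
by rewrite exprMn -[leRHS]mulrA ler_wpM2l ?exprn_ge0.
Qed.

Lemma opb1 n : opb (1%:M : 'M[C]_n) 1.
Proof. by split => // v; rewrite mul1mx expr1n mul1r. Qed.

Lemma opb0 n : opb (0 : 'M[C]_n) 0.
Proof.
split => // v; rewrite mul0mx expr0n mul0r /vn2 big1 // => i _.
by rewrite mxE nrm0 expr0n.
Qed.

Lemma opbZ n (A : 'M[C]_n) a (c : C) : opb A a -> opb (c *: A) (nrm c * a).
Proof.
move=> [a0 hA]; split; first by rewrite mulr_ge0 ?nrm_ge0.
move=> v; rewrite -scalemxAl exprMn -[leRHS]mulrA.
have -> : vn2 (c *: (A *m v)) = nrm c ^+ 2 * vn2 (A *m v).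
  by rewrite /vn2 mulr_sumr; apply: eq_bigr => i _; rewrite mxE nrmM exprMn.
by rewrite ler_wpM2l ?exprn_ge0 ?nrm_ge0.
Qed.

Lemma vn2_eq0 n (v : 'cV[C]_n) : vn2 v <= 0 -> v = 0.
Proof.
move=> h; have /eqP : vn2 v = 0 by apply/eqP; rewrite eq_le h vn2_ge0.
rewrite psumr_eq0 => [/allP hv|i _]; last by rewrite exprn_ge0 ?nrm_ge0.
apply/matrixP => i j; rewrite mxE ord1; apply/eqP.
have := hv i (mem_index_enum _); rewrite /= expf_eq0 /= nrm_eq0; exact.
Qed.

Lemma opbD n (A B : 'M[C]_n) a b : opb A a -> opb B b -> opb (A + B) (a + b).
Proof.
move=> [a0 hA] [b0 hB]; split; first exact: addr_ge0.
move=> v; rewrite mulmxDl.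
have [a_0|an0] := eqVneq a 0.
  have /vn2_eq0 -> : vn2 (A *m v) <= 0 by have := hA v; rewrite a_0 expr0n mul0r.
  by rewrite add0r a_0 add0r.
have [b_0|bn0] := eqVneq b 0.
  have /vn2_eq0 -> : vn2 (B *m v) <= 0 by have := hB v; rewrite b_0 expr0n mul0r.
  by rewrite addr0 b_0 addr0.
have ap : 0 < a by rewrite lt_def an0.
have bp : 0 < b by rewrite lt_def bn0.
(* A weighted inequality of arithmetic and geometric means, entry by entry. The weights [b / a] and
   [a / b] make the two bounds add up to [(a + b) ^+ 2], which is why zero bounds were treated
   apart. *)
apply: (@le_trans _ _ ((1 + b / a) * vn2 (A *m v) + (1 + a / b) * vn2 (B *m v))).
  rewrite /vn2 !mulr_sumr -big_split /=; apply: ler_sum => i _; rewrite mxE.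
  set x := (A *m v) i ord0; set y := (B *m v) i ord0.
  apply: (@le_trans _ _ ((nrm x + nrm y) ^+ 2)).
    by rewrite lerXn2r ?nnegrE ?addr_ge0 ?nrm_ge0 ?nrmD.
  have h : 0 <= (b * nrm x - a * nrm y) ^+ 2 / (a * b) by rewrite mulr_ge0 ?sqr_ge0 ?invr_ge0 ?mulr_ge0.
  have e : (1 + b / a) * nrm x ^+ 2 + (1 + a / b) * nrm y ^+ 2 =
     (nrm x + nrm y) ^+ 2 + (b * nrm x - a * nrm y) ^+ 2 / (a * b).
    by field; rewrite an0 bn0.
  by rewrite e lerDl.
have -> : (a + b) ^+ 2 * vn2 v = (1 + b / a) * (a ^+ 2 * vn2 v) + (1 + a / b) * (b ^+ 2 * vn2 v).
  by field; rewrite an0 bn0.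
by apply: lerD; rewrite ler_wpM2l ?addr_ge0 ?divr_ge0 ?hA ?hB.
Qed.

Lemma opb_sum n (I : Type) (r : seq I) (P : pred I) (A : I -> 'M[C]_n) (a : I -> R) :
  (forall i, P i -> opb (A i) (a i)) ->
  opb (\sum_(i <- r | P i) A i) (\sum_(i <- r | P i) a i).
Proof.
move=> h; elim: r => [|i r IH]; first by rewrite !big_nil; exact: opb0.
by rewrite !big_cons; case: ifP => // Pi; apply: opbD => //; exact: h.
Qed.

Lemma opb_entry n (A : 'M[C]_n) a i j : opb A a -> nrm (A i j) <= a.
Proof.
move=> [a0 hA]; have := hA (delta_mx j ord0).
rewrite -colE (_ : vn2 (delta_mx j ord0) = 1); last first.
  rewrite /vn2 (bigD1 j) //= big1 => [|k /negPf kj].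
    by rewrite mxE !eqxx nrm1 expr1n addr0.
  by rewrite mxE kj nrm0 expr0n.
rewrite mulr1 => h; rewrite -ler_sqr ?nnegrE ?nrm_ge0 //; apply: le_trans h.
rewrite /vn2 (bigD1 i) //= mxE lerDl; apply: sumr_ge0 => k _.
by rewrite exprn_ge0 ?nrm_ge0.
Qed.

Definition qform n (M : 'M[C]_n) (v : 'cV[C]_n) : C := (adj v *m M *m v) ord0 ord0.

Lemma qformD n (A B : 'M[C]_n) v : qform (A + B) v = qform A v + qform B v.
Proof. by rewrite /qform mulmxDr mulmxDl mxE. Qed.
Lemma qformZ n (A : 'M[C]_n) c v : qform (c *: A) v = c * qform A v.
Proof. by rewrite /qform -scalemxAr -scalemxAl mxE. Qed.
Lemma qformN n (A : 'M[C]_n) v : qform (- A) v = - qform A v.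
Proof. by rewrite -scaleN1r qformZ mulN1r. Qed.
Lemma qform1 n v : qform (1%:M : 'M[C]_n) v = rc (vn2 v).
Proof. by rewrite /qform mulmx1 vn2E. Qed.
Lemma qform_conj n (A B : 'M[C]_n) v : adj B = B -> qform (B *m A *m B) v = qform A (B *m v).
Proof. by move=> hB; rewrite /qform adjM hB !mulmxA. Qed.
Lemma qform_sq n (B : 'M[C]_n) v : adj B = B -> qform (B *m B) v = rc (vn2 (B *m v)).
Proof. by move=> hB; rewrite -qform1 -(qform_conj _ _ hB) mulmx1. Qed.

Lemma qform_bound n (A : 'M[C]_n) : exists2 s, 0 <= s & forall v, nrm (qform A v) <= s * vn2 v.
Proof.
exists (\sum_j \sum_i nrm (A i j)).
  by apply: sumr_ge0 => i _; apply: sumr_ge0 => j _; exact: nrm_ge0.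
move=> v; rewrite /qform mxE; apply: (le_trans (nrm_sum _ _ _)).
rewrite mulr_suml; apply: ler_sum => j _; rewrite nrmM mxE mulr_suml.
apply: (@le_trans _ _ ((\sum_i nrm (v i ord0) * nrm (A i j)) * nrm (v j ord0))).
  rewrite ler_wpM2r ?nrm_ge0 //; apply: (le_trans (nrm_sum _ _ _)).
  by apply: ler_sum => i _; rewrite nrmM !mxE nrm_conj.
rewrite mulr_suml; apply: ler_sum => i _.
rewrite mulrAC mulrC ler_wpM2l ?nrm_ge0 //.
have h k : nrm (v k ord0) ^+ 2 <= vn2 v.
  by rewrite /vn2 (bigD1 k) //= lerDl; apply: sumr_ge0 => l _; rewrite exprn_ge0 ?nrm_ge0.
have := h i; have := h j; have := sqr_ge0 (nrm (v i ord0) - nrm (v j ord0)); lra.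
Qed.

(** From 0 <= B <= a to B^2 <= a B <= a^2. The first inequality comes from B A B + A B A = a (a B -
    B^2) with A = a - B, whose left side is nonnegative. *)
Lemma psd_opb n (B : 'M[C]_n) (a : R) : 0 < a -> adj B = B -> psd B ->
  psd (rc a *: 1%:M - B) -> opb B a.
Proof.
move=> a0 hB pB paB; split; first exact: ltW.
move=> v; set A := rc a *: 1%:M - B.
have hA : adj A = A by rewrite /A adjD adjN adjZ adj1 hB.
have e : B *m A *m B + A *m B *m A = rc a *: (rc a *: B - B *m B).
  have AE : A = rc a *: 1%:M - B by [].
  have BA : B *m A = rc a *: B - B *m B by rewrite AE mulmxBr -scalemxAr mulmx1.
  have AB : A *m B = rc a *: B - B *m B by rewrite AE mulmxBl -scalemxAl mul1mx.
  by rewrite AB BA -mulmxDr [X in _ *m X](_ : _ = rc a *: 1%:M) ?[B + A]addrC ?subrK // -scalemxAr mulmx1.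
have h1 : 0 <= rc a * (rc a * qform B v - rc (vn2 (B *m v))).
  rewrite -(qform_sq v hB) -!qformZ -qformN -qformD -qformZ -e qformD !qform_conj //.
  by rewrite addr_ge0 //; [exact: paB|exact: pB].
have ra0 : 0 < rc a by rewrite /rc ltcR.
have h2 : 0 <= rc a * qform B v - rc (vn2 (B *m v)) by rewrite pmulr_rge0 in h1.
have h3 : 0 <= rc a * rc (vn2 v) - qform B v.
  by rewrite -qform1 -qformZ -qformN -qformD; exact: paB.
rewrite -lecR; rewrite subr_ge0 in h2; apply: (le_trans h2).
rewrite subr_ge0 in h3; rewrite expr2 -mulrA rmorphM /=.
apply: ler_wpM2l; first exact: ltW.
by rewrite rmorphM; exact: h3.
Qed.

(** An Euler factor of exp(- tau H) on the range of [P]. For large [k] it is nonnegative because [H]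
    is bounded, and the gap bounds it above, so [psd_opb] applies. Its k-th power will produce exp(-
    tau gam). *)
Lemma gap_opb n (H P : 'M[C]_n) (tau gam : R) : 0 <= tau -> 0 <= gam ->
  adj H = H -> adj P = P -> P *m P = P -> H *m P = P *m H ->
  psd (H *m P - rc gam *: P) ->
  (\forall k \near \oo, 1 / 2 <= 1 - tau * gam / k%:R /\
     opb ((1%:M - rc (tau / k%:R) *: H) *m P) (1 - tau * gam / k%:R))%classic.
Proof.
move=> t0 g0 hH hP PP HP gap; have [s s0 hs] := qform_bound H.
have hPv v : 0 <= qform P v by rewrite -{1}PP qform_sq // /rc ler0c vn2_ge0.
have [k0 _ hk0] : (\forall k \near \oo, (2 * (tau * gam) + tau * s + 1 <= k%:R :> R))%classic.
  by apply: nbhs_infty_ger.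
exists k0 => //= k /hk0 /= hk; have kp : 0 < k%:R :> R by apply: lt_le_trans hk; nra.
have a1 : 1 / 2 <= 1 - tau * gam / k%:R.
  by rewrite lerBrDl -lerBrDr ler_pdivrMr //; nra.
have ts : tau / k%:R * s <= 1 by rewrite mulrAC ler_pdivrMr // mul1r; nra.
have tk0 : 0 <= tau / k%:R by rewrite divr_ge0 // ltW.
split => //; set B := _ *m P.
have HPP : H *m P = P *m H *m P by rewrite -HP -mulmxA PP.
have BE : B = P - rc (tau / k%:R) *: (H *m P) by rewrite /B mulmxBl mul1mx -scalemxAl.
have hHP : adj (H *m P) = H *m P by rewrite adjM hH hP HP.
apply: psd_opb.
- lra.
- by rewrite BE adjD adjN adjZ hP hHP.
- move=> v; rewrite -/(qform B v) BE qformD qformN qformZ HPP qform_conj // -{1}PP qform_sq //.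
  rewrite subr_ge0; move: (P *m v) => w.
  have qH : adj H = H -> qform H w = rc (complex.Re (qform H w)).
    move=> _; have : (qform H w)^*%C = qform H w.
      have : adj (adj w *m H *m w) = adj w *m H *m w by rewrite !adjM adjK hH mulmxA.
      by move=> /matrixP /(_ ord0 ord0); rewrite mxE mxE; exact.
    case: (qform H w) => x y [] e; have -> : y = 0 by lra.
    by [].
  rewrite qH // /rc -rmorphM lecR /=.
  have h1 := le_trans (ler_norm _) (le_trans (Re_le_nrm (qform H w)) (hs w)).
  apply: (le_trans (ler_wpM2l tk0 h1)); rewrite mulrA ler_piMl ?vn2_ge0 //.
- move=> v; set a := 1 - _; rewrite -/(qform _ v) BE.
  have e2 : tau / k%:R * gam = 1 - a by rewrite /a; ring.
  rewrite -/a in a1; clearbody a.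
  (* With a = 1 - tau gam / k, the difference a - B splits into the nonnegative terms a (1 - P) and
     (tau / k) (H P - gam P). *)
  have -> : rc a *: 1%:M - (P - rc (tau / k%:R) *: (H *m P)) =
     rc a *: ((1%:M - P) *m (1%:M - P)) + rc (tau / k%:R) *: (H *m P - rc gam *: P).
    rewrite mulmxBl mul1mx mulmxBr mulmx1 PP subrr subr0.
    rewrite !scalerBr scalerA /rc -rmorphM /= e2.
    have -> : (1 - a)%:C%C *: P = P - rc a *: P.
      by rewrite rmorphB scalerBl; congr (_ - _); exact: scale1r.
    rewrite !opprB; set X := _ *: (H *m P); set Y := _ *: P.
    by rewrite [X + (Y - P)]addrCA [RHS]addrA subrK.
  rewrite qformD !qformZ qform_sq; last by rewrite adjD adjN adj1 hP.
  rewrite addr_ge0 // mulr_ge0 //; rewrite /rc ?ler0c ?vn2_ge0 //; first by lra.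
  exact: gap.
Qed.

End OperatorBound.

(** * Moebius coefficients of exponentials with respect to the bonds *)

Section MobiusExp.
Import fintype boot.finset.
Variables (R : realType) (n : nat) (Bd : finType).
Local Notation C := R[i].
Implicit Types (D U : {set Bd}) (M : 'M[C]_n).

Definition mobmx (F : {set Bd} -> 'M[C]_n) D : 'M[C]_n :=
  \sum_(U : {set Bd} | U \subset D) (-1) ^+ #|D :\: U| *: F U.

Lemma mobmx_entry F D i j : mobmx F D i j = mob (fun U => F U i j) D.
Proof. by rewrite /mobmx summxE; apply: eq_bigr => U _; rewrite mxE. Qed.

(** The operator [Vb b] is present only if [b] lies in [U]. Adding the coefficient at [D :\ b]
    cancels the subsets without [b] and keeps exactly those containing it. *)
Lemma mobM_step (A0 : 'M[C]_n) (Vb : Bd -> 'M[C]_n) (F : {set Bd} -> 'M[C]_n) D :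
  mobmx (fun U => (A0 + \sum_(b in U) Vb b) *m F U) D =
  A0 *m mobmx F D + \sum_(b in D) Vb b *m (mobmx F D + mobmx F (D :\ b)).
Proof.
have h b : b \in D -> mobmx F D + mobmx F (D :\ b) =
    \sum_(U : {set Bd} | (U \subset D) && (b \in U)) (-1) ^+ #|D :\: U| *: F U.
  move=> bD; rewrite /mobmx (bigID (fun U : {set Bd} => b \in U)) /= -addrA.
  rewrite [X in _ + X](_ : _ = 0) ?addr0 //.
  rewrite (eq_bigl (fun U => U \subset D :\ b)); last by move=> U; rewrite subsetD1.
  rewrite -big_split /= big1 // => U; rewrite subsetD1 => /andP[UD bU].
  have -> : D :\: U = b |: ((D :\ b) :\: U).
    by apply/setP => u; rewrite !inE; case: eqP => [->|]; rewrite ?bD ?bU //= andbC.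
  by rewrite cardsU1 !inE eqxx /= andbF /= add1n exprS mulN1r scaleNr addNr.
rewrite (eq_bigr (fun b => \sum_(U : {set Bd} | (U \subset D) && (b \in U)) (-1) ^+ #|D :\: U| *: (Vb b *m F U))); last first.
  by move=> b /h ->; rewrite mulmx_sumr; apply: eq_bigr => U _; rewrite scalemxAr.
rewrite (exchange_big_dep (fun U : {set Bd} => U \subset D)) /=; last by move=> b U _ /andP[].
rewrite /mobmx mulmx_sumr -big_split /=; apply: eq_bigr => U UD.
rewrite mulmxDl scalerDr scalemxAr; congr (_ + _).
rewrite mulmx_suml scaler_sumr; apply: eq_bigl => b.
by rewrite UD /= andbC; case bU : (b \in U) => //=; rewrite (subsetP UD).
Qed.

(** The coefficient collects the words of length [k] in which every letter of [D] occurs. The bound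
    lets each letter choose a nonempty set of positions independently of the others. *)
Lemma opb_mobmx (A0 : 'M[C]_n) (Vb : Bd -> 'M[C]_n) (a : R) (v : Bd -> R) k D :
  0 < a -> opb A0 a -> (forall b, opb (Vb b) (v b)) ->
  opb (mobmx (fun U => (A0 + \sum_(b in U) Vb b) ^+ k) D)
    (a ^+ k * \prod_(b in D) ((1 + v b / a) ^+ k - 1)).
Proof.
move=> a0 hA hV; have v0 b : 0 <= v b by case: (hV b).
have a0' := ltW a0.
have va0 b : 0 <= v b / a by rewrite divr_ge0.
have cv0 b k' : 0 <= (1 + v b / a) ^+ k' by rewrite exprn_ge0 // addr_ge0.
have c1 b k' : 1 <= (1 + v b / a) ^+ k'.
  by rewrite exprn_ege1 // lerDl divr_ge0 // ltW.
elim: k D => [|k IH] D.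
  have [->|/set0Pn[b bD]] := eqVneq D set0.
    rewrite big_set0 expr0 mulr1 /mobmx (big_pred1 set0) => [|U]; last by rewrite subset0.
    by rewrite setDv cards0 !expr0 scale1r; exact: opb1.
  have -> : mobmx (fun U => (A0 + \sum_(b in U) Vb b) ^+ 0) D = 0.
    apply/matrixP => i j; apply: etrans (mobmx_entry _ _ _ _) _; rewrite [RHS]mxE.
    by apply: (mob_indep bD) => U; rewrite !expr0.
  apply: opb_le (opb0 _ _); rewrite expr0 mul1r prodr_ge0 // => c _; by rewrite expr0 subrr.
have -> : mobmx (fun U => (A0 + \sum_(b in U) Vb b) ^+ k.+1) D =
    mobmx (fun U => (A0 + \sum_(b in U) Vb b) *m (A0 + \sum_(b in U) Vb b) ^+ k) D.
  by apply: eq_bigr => U _; rewrite exprS mulmxE.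
rewrite mobM_step.
pose p (E : {set Bd}) := \prod_(b in E) ((1 + v b / a) ^+ k - 1).
have hb b : b \in D -> opb (Vb b *m (mobmx (fun U => (A0 + \sum_(b in U) Vb b) ^+ k) D +
       mobmx (fun U => (A0 + \sum_(b in U) Vb b) ^+ k) (D :\ b)))
     (v b * (a ^+ k * ((1 + v b / a) ^+ k * p (D :\ b)))).
  move=> bD; apply: opbM; first exact: hV.
  apply: opb_le (opbD (IH D) (IH (D :\ b))).
  rewrite -/(p D) -/(p (D :\ b)) -mulrDr; apply: ler_wpM2l; first exact: exprn_ge0.
  have -> : p D = ((1 + v b / a) ^+ k - 1) * p (D :\ b) by rewrite /p (big_setD1 b).
  by rewrite mulrBl mul1r subrK.
have hs := @opb_sum _ _ _ (index_enum Bd) (fun b => b \in D) _ _ hb.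
apply: opb_le (opbD (opbM hA (IH D)) hs).
rewrite -/(p D) exprS -!mulrA.
have -> : \sum_(b in D) v b * (a ^+ k * ((1 + v b / a) ^+ k * p (D :\ b))) =
   a * (a ^+ k * \sum_(b in D) (v b / a) * (1 + v b / a) ^+ k * p (D :\ b)).
  rewrite !mulr_sumr; apply: eq_bigr => b _.
  rewrite [RHS](_ : _ = (v b * (a ^+ k * ((1 + v b / a) ^+ k * p (D :\ b)))) * (a / a)); last by ring.
  by rewrite divff ?mulr1 // lt0r_neq0.
rewrite -!mulrDr; apply: ler_wpM2l => //; apply: ler_wpM2l; first exact: exprn_ge0.
(* Only the terms with at most one factor [y] are kept from the expanded product. With t = v b / a
   it is used for x = (1 + t)^k - 1 and y = t (1 + t)^k, whose sum is (1 + t)^(k+1) - 1. *)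
have key (x y : Bd -> R) (r : seq Bd) : uniq r -> (forall b, 0 <= x b) -> (forall b, 0 <= y b) ->
    \prod_(b <- r) x b + \sum_(b <- r) y b * \prod_(c <- r | c != b) x c <= \prod_(b <- r) (x b + y b).
  move=> ur x0 y0; elim: r ur => [|b r IHr]; first by rewrite !big_nil addr0.
  rewrite /= => /andP[br ur]; rewrite !big_cons eqxx /=.
  have P0 : 0 <= \prod_(c <- r) x c by rewrite prodr_ge0.
  have -> : \prod_(c <- r | c != b) x c = \prod_(c <- r) x c.
    by rewrite big_seq_cond [RHS]big_seq; apply: eq_bigl => c; case cr : (c \in r) => //=; apply: contraNneq br => <-.
  have -> : \sum_(j <- r) y j * \prod_(c <- b :: r | c != j) x c = x b * \sum_(j <- r) y j * \prod_(c <- r | c != j) x c.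
    rewrite mulr_sumr big_seq [RHS]big_seq; apply: eq_bigr => j jr.
    rewrite big_cons ifT; first by rewrite mulrCA.
    by apply: contraNneq br => ->.
  set S := \sum_(j <- r) _; set P := \prod_(c <- r) x c in P0 *.
  have S0 : 0 <= S by apply: sumr_ge0 => c _; rewrite mulr_ge0 ?prodr_ge0.
  have := ler_wpM2l (_ : 0 <= x b + y b) (IHr ur); rewrite -/S -/P => /(_ (addr_ge0 (x0 b) (y0 b))).
  apply: le_trans; rewrite -subr_ge0.
  rewrite (_ : _ - _ = y b * S); last by ring.
  exact: mulr_ge0.
have := key (fun b => (1 + v b / a) ^+ k - 1) (fun b => v b / a * (1 + v b / a) ^+ k) (enum D) (enum_uniq _).
rewrite !big_enum /= => h.
apply: (le_trans (le_trans _ (h _ _))).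
- rewrite lerD2l; apply: ler_sum => b bD; apply: ler_wpM2l; first exact: mulr_ge0.
  rewrite /p big_enum_cond /= le_eqVlt; apply/orP; left; apply/eqP; apply: eq_bigl => c.
  by rewrite !inE andbC.
- by move=> b; rewrite subr_ge0.
- by move=> b; rewrite mulr_ge0.
- apply: ler_prod => b _; rewrite addr_ge0 ?subr_ge0 ?mulr_ge0 ?invr_ge0 //=.
  rewrite exprS mulrDl mul1r; lra.
Qed.

(** Limit of [opb_mobmx] along Euler approximations. The operators commute with [P] and are cut down
    to its range, where [gap_opb] controls the free factor. The 2 in the exponent comes from the
    lower bound 1/2 on that factor's norm bound [a]. *)
Lemma mob_mexp_bound (H P : 'M[C]_n) (Vb : Bd -> 'M[C]_n) (v : Bd -> R) (tau gam : R) D i j :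
  0 <= tau -> 0 <= gam -> adj H = H -> adj P = P -> P *m P = P -> H *m P = P *m H ->
  psd (H *m P - rc gam *: P) ->
  (forall b, b \in D -> Vb b *m P = P *m Vb b) -> (forall b, opb (Vb b) (v b)) ->
  (forall M, (M *m P) i j = M i j) ->
  nrm (mob (fun U => mexp (- rc tau *: (H + \sum_(b in U) Vb b)) i j) D)
  <= expR (- (tau * gam)) * \prod_(b in D) (expR (2 * tau * v b) - 1).
Proof.
move=> t0 g0 hH hP PP HP gap cV hV hij.
have v0 b : 0 <= v b by case: (hV b).
have PP' : opb P 1.
  split => // u; rewrite expr1n mul1r -lecR.
  have -> : ((vn2 u)%:C)%C = qform P u + qform (1%:M - P) u.
    by rewrite -qformD addrC subrK qform1.
  have -> : ((vn2 (P *m u))%:C)%C = qform P u by rewrite -{2}PP qform_sq.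
  rewrite lerDl (_ : 1%:M - P = (1%:M - P) *m (1%:M - P)).
    by rewrite qform_sq ?adjD ?adjN ?adj1 ?hP // /rc ler0c vn2_ge0.
  by rewrite mulmxBl mul1mx mulmxBr mulmx1 PP subrr subr0.
pose Y k U : 'M[C]_n := 1%:M + rc k%:R^-1 *: (- rc tau *: (H + \sum_(b in U) Vb b)).
have cvg1 : cvgC (fun k => mobmx (fun U => (Y k U) ^+ k) D i j)
   (mob (fun U => mexp (- rc tau *: (H + \sum_(b in U) Vb b)) i j) D).
  rewrite (_ : (fun k => _) = fun k => mob (fun U => (Y k U ^+ k) i j) D); last first.
    by apply/funext => k; rewrite mobmx_entry.
  by apply: cvgC_sum => U _; apply: cvgCM (cvgC_cst _) _; exact: eulerp_cvg.
apply: (cvgC_le cvg1).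
have hg := gap_opb t0 g0 hH hP PP HP gap.
near=> k.
have k0 : (0 < k)%N by near: k; exists 1%N.
have [a1 hB] : 1 / 2 <= 1 - tau * gam / k%:R /\
     opb ((1%:M - rc (tau / k%:R) *: H) *m P) (1 - tau * gam / k%:R) by near: k.
set a := 1 - _ in a1 hB; set A0 := _ *m P in hB.
have a0 : 0 < a by lra.
have tk0 : 0 <= tau / k%:R by rewrite divr_ge0.
pose Wb b : 'M[C]_n := if b \in D then - rc (tau / k%:R) *: (Vb b *m P) else 0.
have hW b : opb (Wb b) (tau / k%:R * v b).
  rewrite /Wb; case: ifP => _; last by apply: opb_le (opb0 _ _); rewrite mulr_ge0.
  have := opbZ (- rc (tau / k%:R)) (opbM (hV b) PP').
  by rewrite mulr1 nrmN nrm_rc ger0_norm.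
have YP U : U \subset D -> Y k U *m P = A0 + \sum_(b in U) Wb b.
  move=> UD; rewrite /Y mulmxDl mul1mx /A0 mulmxBl mul1mx -addrA; congr (_ + _).
  rewrite -!scalemxAl scalerA mulrN -rmorphM [_^-1 * _]mulrC /= mulmxDl scalerDr.
  rewrite scaleNr; congr (_ + _); rewrite mulmx_suml scaler_sumr; apply: eq_bigr => b bU.
  by rewrite /Wb (subsetP UD).
have cY U : U \subset D -> Y k U *m P = P *m Y k U.
  move=> UD; rewrite /Y mulmxDl mulmxDr mul1mx mulmx1; congr (_ + _).
  rewrite -!scalemxAl -!scalemxAr; do 2!congr (_ *: _).
  rewrite mulmxDl mulmxDr HP; congr (_ + _); rewrite mulmx_suml mulmx_sumr.
  by apply: eq_bigr => b bU; rewrite cV // (subsetP UD).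
have powP U : U \subset D -> (Y k U) ^+ k *m P = (A0 + \sum_(b in U) Wb b) ^+ k.
  move=> UD; rewrite -(YP U UD).
  have gen l : (Y k U) ^+ l.+1 *m P = (Y k U *m P) ^+ l.+1.
    elim: l => [|l IHl]; first by rewrite !expr1.
    rewrite exprS [RHS]exprS -IHl -!mulmxE -!mulmxA; congr (_ *m _).
    rewrite [RHS]mulmxA; have -> : P *m Y k U ^+ l.+1 = Y k U ^+ l.+1 *m P.
      elim: l.+1 => [|q IHq]; first by rewrite expr0 mulmx1 mul1mx.
      by rewrite exprS -!mulmxE mulmxA -cY // -mulmxA IHq mulmxA.
    by rewrite -mulmxA PP.
  by have := gen k.-1; rewrite prednK.
have -> : mobmx (fun U => Y k U ^+ k) D i j = mobmx (fun U => (A0 + \sum_(b in U) Wb b) ^+ k) D i j.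
  by rewrite !mobmx_entry; apply: eq_mob => U UD; rewrite -powP // hij.
apply: le_trans (opb_entry i j (opb_mobmx k D a0 hB hW)) _.
have a0' := ltW a0.
have vp b : 0 <= (tau / k%:R * v b) / a by rewrite divr_ge0 ?mulr_ge0.
apply: ler_pM; first exact: exprn_ge0.
- by apply: prodr_ge0 => b _; rewrite subr_ge0 exprn_ege1 // lerDl.
- have -> : expR (- (tau * gam)) = expR (- (tau * gam) / k%:R) ^+ k.
    by rewrite -expRM_natl [k%:R * _]mulrC divfK // pnatr_eq0 -lt0n.
  by rewrite lerXn2r ?nnegrE ?expR_ge0 // /a -mulNr expR_ge1Dx.
- apply: ler_prod => b _; apply/andP; split.
    by rewrite subr_ge0 exprn_ege1 // lerDl.
  rewrite lerD2r; have h1 : 0 <= 2 * tau * v b by rewrite !mulr_ge0.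
  apply: le_trans (expr1D_le_exp k h1); rewrite lerXn2r ?nnegrE ?addr_ge0 ?vp ?divr_ge0 //.
  rewrite lerD2l ler_pdivrMr //.
  rewrite (_ : 2 * tau * v b / k%:R * a = (tau / k%:R * v b) * (2 * a)); last by ring.
  by rewrite ler_peMr ?mulr_ge0 //; lra.
Unshelve. all: by end_near. Qed.

End MobiusExp.

(** * Time slicing *)

Section CyclicProduct.
Import fintype boot.finset.
Variables (R : comPzRingType) (p : nat).
Local Open Scope ring_scope.

Definition ffcons (T : Type) n (x : T) (g : {ffun 'I_n -> T}) : {ffun 'I_n.+1 -> T} :=
  [ffun i => oapp g x (unlift ord0 i)].

Lemma big_ffcons (K : nmodType) (T : finType) n (F : {ffun 'I_n.+1 -> T} -> K) :
  \sum_f F f = \sum_x \sum_(g : {ffun 'I_n -> T}) F (ffcons x g).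
Proof.
rewrite pair_big /=.
rewrite (reindex (fun q : T * {ffun 'I_n -> T} => ffcons q.1 q.2)) //=.
exists (fun f : {ffun 'I_n.+1 -> T} => (f ord0, [ffun i => f (lift ord0 i)])).
  move=> [x g] _ /=; congr pair; first by rewrite ffunE unlift_none.
  by apply/ffunP => i; rewrite !ffunE liftK.
move=> f _; apply/ffunP => i; rewrite ffunE.
by case: unliftP => [j ->|->] /=; rewrite ?ffunE.
Qed.

(** [insub] fails only at the last index, where the default [a] closes the chain. *)
Definition nxt (T : Type) n (f : {ffun 'I_n.+1 -> T}) (a : T) (i : 'I_n.+1) : T :=
  oapp f a (insub i.+1).

Lemma nxt_ffcons (T : Type) n (b : T) (g : {ffun 'I_n.+1 -> T}) a j :
  nxt (ffcons b g) a (lift ord0 j) = nxt g a j.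
Proof.
rewrite /nxt; case: insubP => [u _ eu|]; case: insubP => [v _ ev|] /=.
- rewrite ffunE (_ : u = lift ord0 v) ?liftK //; apply: ord_inj.
  by move: eu ev; rewrite /= /bump !leq0n !add1n => -> ->.
- by move=> h; have := ltn_ord u; move: eu; rewrite /= /bump leq0n add1n => ->; rewrite ltnS (negPf h).
- by move=> h; have := ltn_ord v; move: ev => /= ->; rewrite /bump leq0n add1n ltnS in h; rewrite (negPf h).
- by [].
Qed.

Lemma nxt_ffcons0 (T : Type) n (b : T) (g : {ffun 'I_n.+1 -> T}) a :
  nxt (ffcons b g) a ord0 = g ord0.
Proof.
rewrite /nxt; case: insubP => [u _ eu|] //=.
by rewrite ffunE (_ : u = lift ord0 ord0) ?liftK //; apply: ord_inj.
Qed.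

Lemma open_chain n (B : 'I_n.+1 -> 'M[R]_p) (b a : 'I_p) :
  \sum_(f : {ffun 'I_n.+1 -> 'I_p} | f ord0 == b) \prod_i B i (f i) (nxt f a i) =
  (\prod_i B i) b a.
Proof.
elim: n B b => [|n IH] B b.
  rewrite big_ord1 (big_pred1 [ffun=> b]) => [|f /=].
    by rewrite big_ord1 /nxt insubF //= ffunE.
  apply/eqP/eqP => [<-|->]; last by rewrite ffunE.
  by apply/ffunP => i; rewrite ffunE ord1.
rewrite big_ord_recl -mulmxE mxE big_mkcond big_ffcons /=.
rewrite (bigD1 b) //= [X in _ + X]big1 ?addr0; last first.
  move=> x /negPf xb; rewrite big1 // => g _; by rewrite ffunE unlift_none /= xb.
rewrite (partition_big (fun g : {ffun 'I_n.+1 -> 'I_p} => g ord0) xpredT) //=.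
apply: eq_bigr => c _; rewrite -IH mulr_sumr; apply: eq_bigr => g /eqP gc.
rewrite ffunE unlift_none /= eqxx big_ord_recl nxt_ffcons0 gc ffunE unlift_none /=.
congr (_ * _); apply: eq_bigr => i _.
by rewrite nxt_ffcons ffunE liftK.
Qed.

Lemma cyclic_chain n (B : 'I_n.+1 -> 'M[R]_p) :
  \sum_(f : {ffun 'I_n.+1 -> 'I_p}) \prod_i B i (f i) (f (ordS i)) = \tr (\prod_i B i).
Proof.
rewrite (partition_big (fun f : {ffun 'I_n.+1 -> 'I_p} => f ord0) xpredT) //=.
apply: eq_bigr => a _; rewrite -open_chain; apply: eq_bigr => f /eqP fa.
apply: eq_bigr => i _; congr (B i _ _).
rewrite /nxt; case: insubP => [u _ eu|h] /=.
  congr (f _); apply: val_inj; rewrite /= eu modn_small // -eu; exact: ltn_ord.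
rewrite -fa; congr (f _); apply: val_inj => /=.
have -> : i.+1 = n.+1 by apply/eqP; rewrite eqn_leq ltn_ord /= leqNgt.
by rewrite modnn.
Qed.

End CyclicProduct.

(** * A path model of cells on sites times slices *)

Section LayerModel.
Import fintype boot.finset.
Variables (R : realType) (I LC X : finType) (m N' : nat) (o : 'I_m).
Local Notation C := R[i].
Local Notation N := N'.+1.
Local Notation conf := {ffun I -> 'I_m}.
Local Notation V := (I * 'I_N)%type.
Local Notation Cell := (LC * 'I_N)%type.
Local Notation path := {ffun V -> 'I_m * 'I_m}.

Variables (lsupp : LC -> {set I}) (L : {set LC} -> conf -> conf -> C) (zeta : LC -> R).
Variables (q : X -> V -> 'I_m -> 'I_m -> C) (kap : R).

Definition rst (S : {set I}) (x : conf) : conf := [ffun i => if i \in S then x i else o].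
Definition vac : conf := [ffun=> o].
Definition lsupps (F : {set LC}) : {set I} := \bigcup_(c in F) lsupp c.

Hypothesis L0 : forall x y, L set0 x y = ((x == vac) && (y == vac))%:R.
Hypothesis L1 : forall F x y, L F x y != 0 ->
  (rst (lsupps F) x == x) && (rst (lsupps F) y == y).
Hypothesis L2 : forall F D (S S' : {set I}) x y, lsupps F \subset S :&: S' ->
  lsupps D \subset ~: S :&: ~: S' ->
  L (F :|: D) x y = L F (rst S x) (rst S' y) * L D (rst (~: S) x) (rst (~: S') y).
Hypothesis L3 : forall F x y, nrm (L F x y) <= \prod_(c in F) zeta c.
Hypothesis q1 : forall x v, q x v o o = 1.
Hypothesis kap1 : 1 <= kap.
Hypothesis qk : forall x v a b, nrm (q x v a b) <= kap.
Hypothesis lsupp0 : forall c, lsupp c != set0.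
Hypothesis zeta0 : forall c, 0 <= zeta c.

(** A cell of slice [t] propagates from time [t] to time [t + 1], cyclically, and occupies its sites
    at both times. *)
Definition cellsupp (c : Cell) : {set V} := setX (lsupp c.1) [set c.2; ordS c.2].
Definition slice (F : {set Cell}) (t : 'I_N) : {set LC} := [set c | (c, t) \in F].
Definition fwd (s : path) (t : 'I_N) : conf := [ffun i => (s (i, t)).2].
Definition bwd (s : path) (t : 'I_N) : conf := [ffun i => (s (i, t)).1].
Definition rstp (S : {set V}) (s : path) : path := [ffun v => if v \in S then s v else (o, o)].

(** Each vertex carries the states before and after the factor [q]; the operator of slice [t] leads
    from second components at time [t] to first components at time [t + 1]. *)
Definition pathw x (F : {set Cell}) (s : path) : C :=
  (\prod_v q x v (s v).1 (s v).2) *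
  \prod_t L (slice F t) (fwd s t) (bwd s (ordS t)).

Definition layerW x (F : {set Cell}) : C := \sum_s pathw x F s.

Local Notation csup := (csupp cellsupp).

Lemma cellsupp_neq0 c : cellsupp c != set0.
Proof.
have /set0Pn[i ic] := lsupp0 c.1; apply/set0Pn; exists (i, c.2).
by rewrite !inE /= ic eqxx.
Qed.

Lemma csup_slice (F : {set Cell}) t i : i \in lsupps (slice F t) ->
  ((i, t) \in csup F) && ((i, ordS t) \in csup F).
Proof.
move=> /bigcupP[c]; rewrite inE => cF ic.
by apply/andP; split; apply/bigcupP; exists (c, t) => //; rewrite !inE /= ic eqxx ?orbT.
Qed.

Lemma pathw_neq0 x F s : pathw x F s != 0 -> rstp (csup F) s = s.
Proof.
rewrite /pathw mulf_eq0 negb_or => /andP[_ /prodf_neq0 h].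
apply/ffunP => -[i t]; rewrite ffunE; case: ifPn => // itF.
rewrite [s (i, t)]surjective_pairing; congr pair.
  have /L1/andP[_ /eqP/ffunP/(_ i)] := h (ord_pred t) isT.
  by rewrite !ffunE ord_predK; case: ifPn => [/csup_slice/andP[_]|//]; rewrite ord_predK (negPf itF).
have /L1/andP[/eqP/ffunP/(_ i) + _] := h t isT.
by rewrite !ffunE; case: ifPn => [/csup_slice/andP[]|//]; rewrite (negPf itF).
Qed.

Lemma layerW0 x : layerW x set0 = 1.
Proof.
have s0 t : slice set0 t = set0 by apply/setP => c; rewrite !inE.
rewrite /layerW (bigD1 [ffun=> (o, o)]) //= [X in _ + X]big1 ?addr0.
  rewrite /pathw !big1 ?mulr1 // => [t _|v _]; last by rewrite ffunE q1.
  rewrite s0 L0; have -> : fwd [ffun=> (o, o)] t = vac by apply/ffunP => i; rewrite !ffunE.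
  have -> : bwd [ffun=> (o, o)] (ordS t) = vac by apply/ffunP => i; rewrite !ffunE.
  by rewrite eqxx.
move=> s sn; apply/eqP; apply: contraNT sn => /pathw_neq0 <-.
by apply/eqP/ffunP => v; rewrite !ffunE csupp0 inE.
Qed.

Lemma slices_sub F t (S : {set V}) : csup F \subset S ->
  lsupps (slice F t) \subset [set i | (i, t) \in S] :&: [set i | (i, ordS t) \in S].
Proof.
move=> FS; apply/subsetP => i /csup_slice/andP[h1 h2].
by rewrite !inE (subsetP FS _ h1) (subsetP FS _ h2).
Qed.

Lemma pathwM x F D s : [disjoint csup F & csup D] ->
  pathw x (F :|: D) s = pathw x F (rstp (csup F) s) * pathw x D (rstp (~: csup F) s).
Proof.
move=> dFD; rewrite /pathw mulrACA -!big_split /=; congr (_ * _).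
  apply: eq_bigr => v _; rewrite !ffunE inE.
  by case: ifP => _ /=; rewrite q1 ?mul1r ?mulr1.
apply: eq_bigr => t _.
have -> : slice (F :|: D) t = slice F t :|: slice D t by apply/setP => c; rewrite !inE.
set S := csup F.
have hD : csup D \subset ~: S by rewrite subsets_disjoint setCK disjoint_sym.
rewrite (@L2 _ _ [set i | (i, t) \in S] [set i | (i, ordS t) \in S]); last 2 first.
- exact: slices_sub.
- apply: subset_trans (slices_sub t hD) _; apply/subsetP => i; by rewrite !inE.
congr (L _ _ _ * L _ _ _); apply/ffunP => i; rewrite !ffunE ?inE; by case: ifP.
Qed.

(** Off the support of its cells a contributing path stays in the vacuum, so the paths of the union
    are the pairs of paths for [F] and for [D]. *)
Lemma layerWM x F D : [disjoint csup F & csup D] ->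
  layerW x (F :|: D) = layerW x F * layerW x D.
Proof.
move=> dFD; set S := csup F.
have hD : csup D \subset ~: S by rewrite subsets_disjoint setCK disjoint_sym.
have restr (G : {set Cell}) (T : {set V}) : csup G \subset T -> layerW x G = \sum_(s : path | rstp T s == s) pathw x G s.
  move=> GT; rewrite /layerW [RHS]big_mkcond /=; apply: eq_bigr => s _.
  case: ifPn => // sT; apply/eqP; apply: contraNT sT => /pathw_neq0 e.
  apply/eqP/ffunP => v; rewrite ffunE; case: ifPn => // vT; rewrite -e ffunE ifF //.
  by apply/negbTE; apply: contra vT; exact: (subsetP GT).
rewrite (restr F S) // (restr D (~: S)) // big_distrlr /= pair_big /=.
rewrite /layerW (eq_bigr _ (fun s _ => pathwM x s dFD)).
rewrite [RHS](reindex_onto (fun s => (rstp S s, rstp (~: S) s))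
  (fun u : path * path => [ffun v => if v \in S then u.1 v else u.2 v])) /=; last first.
  move=> [s1 s2] /andP[/eqP/ffunP e1 /eqP/ffunP e2] /=; congr pair; apply/ffunP => v.
    by have := e1 v; rewrite !ffunE; case: ifP.
  by have := e2 v; rewrite !ffunE !inE; case: (v \in S).
apply: eq_bigl => s; apply/esym/andP; split; last first.
  by apply/eqP/ffunP => v; rewrite !ffunE inE; case: (v \in S).
apply/andP; split; apply/eqP/ffunP => v; rewrite !ffunE ?inE; by case: (v \in S).
Qed.

(** At each vertex of the support, [m ^ 2] counts the pairs of states and [kap] bounds the factor
    [q]. *)
Definition cellz (c : Cell) : R := zeta c.1 * ((m ^ 2)%:R * kap) ^+ #|cellsupp c|.

Lemma cellz_ge0 c : 0 <= cellz c.
Proof. by rewrite /cellz mulr_ge0 // exprn_ge0 // mulr_ge0 ?ler0n // (le_trans _ kap1). Qed.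

Lemma layerW_le x F : nrm (layerW x F) <= \prod_(c in F) cellz c.
Proof.
set S := csup F; set M : R := (m ^ 2)%:R * kap.
have m1 : (1 : R) <= (m ^ 2)%:R by rewrite ler1n expn_gt0 (leq_ltn_trans _ (ltn_ord o)).
have M1 : 1 <= M by rewrite /M mulr_ege1.
pose b (v : V) (a : 'I_m * 'I_m) : R := if v \in S then kap else (a == (o, o))%:R.
have zF0 : 0 <= \prod_(c in F) zeta c.1 by apply: prodr_ge0.
apply: (@le_trans _ _ (\sum_(s : path) (\prod_v b v (s v)) * \prod_(c in F) zeta c.1)).
  apply: (le_trans (nrm_sum _ _ _)); apply: ler_sum => s _.
  have b0 v a : 0 <= b v a by rewrite /b; case: ifP => _; rewrite ?ler0n // (le_trans _ kap1).
  have [->|/pathw_neq0 e] := eqVneq (pathw x F s) 0.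
    by rewrite nrm0 mulr_ge0 // prodr_ge0.
  rewrite /pathw nrmM ler_pM ?nrm_ge0 ?nrm_prod //.
    apply: ler_prod => v _; rewrite nrm_ge0 /= /b; case: ifPn => [_|vS]; first exact: qk.
    by rewrite -e ffunE (negPf vS) /= q1 nrm1 eqxx.
  apply: (@le_trans _ _ (\prod_t \prod_(c in slice F t) zeta c)).
    by apply: ler_prod => t _; rewrite nrm_ge0 L3.
  rewrite (pair_big_dep xpredT (fun t c => c \in slice F t) (fun t c => zeta c)) /=.
  rewrite (reindex (fun c : Cell => (c.2, c.1))) /=; last first.
    by exists (fun c : 'I_N * LC => (c.2, c.1)) => -[].
  by rewrite (eq_bigl (fun c => c \in F)) // => -[c t]; rewrite inE.
rewrite -mulr_suml -(bigA_distr_bigA (fun v a => b v a)) /=.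
have -> : \prod_v \sum_a b v a = M ^+ #|S|.
  rewrite -prodr_const big_mkcond [RHS]big_mkcond /=; apply: eq_bigr => v _.
  rewrite /b; case: ifP => _; first by rewrite sumr_const card_prod card_ord -mulr_natl mulnn.
  by rewrite (bigD1 (o, o)) //= eqxx big1 ?addr0 // => a /negPf ->.
rewrite mulrC /cellz big_split /= ler_wpM2l //.
have -> : \prod_(c in F) M ^+ #|cellsupp c| = M ^+ \sum_(c in F) #|cellsupp c|.
  by elim/big_rec2: _ => [|c a c' _ ->]; rewrite ?expr0 // exprD.
by rewrite ler_weXn2l // leq_card_csupp.
Qed.

Definition layerT (B : {set I}) (x y : conf) : C := \sum_(G | lsupps G \subset B) L G x y.

(** Over all times above a fixed base, the cells of different slices are chosen independently, so
    the sum over sets of cells is a product over slices. *)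
Lemma layerZ_cylinder x (B : {set I}) :
  polyZ cellsupp layerW x (setX B setT) =
  \sum_(s : path) (\prod_v q x v (s v).1 (s v).2) * \prod_t layerT B (fwd s t) (bwd s (ordS t)).
Proof.
rewrite /polyZ /layerW exchange_big /=; apply: eq_bigr => s _.
rewrite /pathw -mulr_sumr; congr (_ * _).
rewrite /layerT bigA_distr_big_dep /=.
rewrite [RHS](reindex_onto (fun F : {set Cell} => [ffun t => slice F t])
  (fun f : {ffun 'I_N -> {set LC}} => [set c : Cell | c.1 \in f c.2])) /=; last first.
  by move=> f _; apply/ffunP => t; rewrite ffunE; apply/setP => c; rewrite !inE.
apply: eq_big => [F|F _]; last by apply: eq_bigr => t _; rewrite ffunE.
have -> : [set c : Cell | c.1 \in [ffun t => slice F t] c.2] == F.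
  by apply/eqP/setP => -[c t]; rewrite inE ffunE inE.
rewrite andbT; apply/idP/familyP.
  move=> FB t; change (lsupps ([ffun t => slice F t] t) \subset B); rewrite ffunE; apply/subsetP => i /csup_slice/andP[h _].
  by have := subsetP FB _ h; rewrite !inE andbT.
move=> h; apply/bigcupsP => -[c t] cF; apply/subsetP => -[i t']; rewrite !inE /= andbT => /andP[ic _].
have : lsupps ([ffun t => slice F t] t) \subset B := h t.
rewrite ffunE => /subsetP; apply.
by apply/bigcupP; exists c; rewrite ?inE.
Qed.

Variable q0 : X -> I -> 'I_m -> 'I_m -> C.
Hypothesis qE : forall x i t a b, q x (i, t) a b = if t == ord0 then q0 x i a b else (a == b)%:R.

Definition confmx (f : conf -> conf -> C) : 'M[C]_#|conf| :=
  \matrix_(i, j) f (enum_val i) (enum_val j).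

Lemma confmxM f g : confmx f *m confmx g = confmx (fun a b => \sum_c f a c * g c b).
Proof.
apply/matrixP => i j; rewrite !mxE.
rewrite [RHS](reindex (fun k : 'I_#|conf| => enum_val k)) /=; last first.
  by exists enum_rank => k _; rewrite ?enum_valK ?enum_rankK.
by apply: eq_bigr => k _; rewrite !mxE.
Qed.

Lemma layerZ_trace x (B : {set I}) :
  polyZ cellsupp layerW x (setX B setT) =
  \tr (confmx (fun a b => \prod_i q0 x i (a i) (b i)) *m confmx (layerT B) ^+ N).
Proof.
rewrite layerZ_cylinder.
pose Qt t (a b : conf) : C := \prod_i q x (i, t) (a i) (b i).
pose Bt t := confmx (Qt t) *m confmx (layerT B).
have -> : confmx (fun a b => \prod_i q0 x i (a i) (b i)) *m confmx (layerT B) ^+ N =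
    \prod_t Bt t.
  rewrite big_ord_recl exprS -!mulmxE mulmxA; congr (_ *m _ *m _).
    by apply/matrixP => i j; rewrite !mxE /Qt; apply: eq_bigr => k _; rewrite qE eqxx.
  rewrite (eq_bigr (fun=> confmx (layerT B))); first by rewrite prodr_const card_ord.
  move=> t _; rewrite /Bt (_ : confmx (Qt _) = 1%:M) ?mul1mx //.
  apply/matrixP => i j; rewrite !mxE /Qt -(inj_eq enum_val_inj).
  case: eqP => [->|ne]; first by rewrite big1 // => k _; rewrite qE eqxx.
  apply/eqP; rewrite prodf_seq_eq0; apply/hasP.
  have [k kne] : exists k, enum_val i k != enum_val j k.
    by apply/existsP; rewrite -negb_forall; apply/negP => /forallP h; apply: ne; apply/ffunP => k; apply/eqP.
  by exists k; rewrite ?mem_index_enum //= qE /= (negPf kne).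
rewrite -cyclic_chain.
(* [f] and [h] are the first and second components of the path; summing over [h] carries out the
   matrix products [Bt t]. *)
pose E (f : {ffun 'I_N -> conf}) : C := \sum_(h : {ffun 'I_N -> conf}) \prod_t (Qt t (f t) (h t) * layerT B (h t) (f (ordS t))).
transitivity (\sum_f E f).
  rewrite /E pair_big /=.
  rewrite (reindex (fun s : path => ([ffun t => bwd s t], [ffun t => fwd s t]))) /=; last first.
    exists (fun u : {ffun 'I_N -> conf} * {ffun 'I_N -> conf} => [ffun v : V => (u.1 v.2 v.1, u.2 v.2 v.1)]).
      by move=> s _; apply/ffunP => -[i t]; rewrite !ffunE; case: (s (i, t)).
    by move=> [f h] _ /=; congr pair; apply/ffunP => t; rewrite !ffunE; apply/ffunP => i; rewrite !ffunE.
  apply: eq_bigr => s _; rewrite big_split /=; congr (_ * _); last first.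
    by apply: eq_bigr => t _; rewrite !ffunE.
  rewrite /Qt exchange_big pair_big /=; apply: eq_bigr => -[i t] _.
  by rewrite !ffunE.
rewrite (reindex (fun f : {ffun 'I_N -> 'I_#|conf|} => [ffun t => enum_val (f t)] : {ffun 'I_N -> conf})) /=; last first.
  exists (fun f : {ffun 'I_N -> conf} => [ffun t => enum_rank (f t)]) => f _; apply/ffunP => t; rewrite !ffunE.
    by rewrite enum_valK.
  by rewrite enum_rankK.
apply: eq_bigr => f _; rewrite /E -(bigA_distr_bigA (fun t c => Qt t ([ffun t => enum_val (f t)] t) c * layerT B c ([ffun t => enum_val (f t)] (ordS t)))) /=.
by apply: eq_bigr => t _; rewrite /Bt confmxM mxE !ffunE.
Qed.

End LayerModel.

Section FinMatrix.
Import fintype boot.finset.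
Variables (R : realType) (T : finType).
Local Notation C := R[i].

Definition fmx (f : T -> T -> C) : 'M[C]_#|T| := \matrix_(i, j) f (enum_val i) (enum_val j).
Definition ce (M : 'M[C]_#|T|) (x y : T) : C := M (enum_rank x) (enum_rank y).

Lemma ce_fmx f x y : ce (fmx f) x y = f x y.
Proof. by rewrite /ce mxE !enum_rankK. Qed.

Lemma fmx_ce M : fmx (ce M) = M.
Proof. by apply/matrixP => i j; rewrite mxE /ce !enum_valK. Qed.

Lemma ceP (M M' : 'M[C]_#|T|) : (forall x y, ce M x y = ce M' x y) -> M = M'.
Proof. by move=> h; rewrite -(fmx_ce M) -(fmx_ce M'); apply/matrixP => i j; rewrite !mxE h. Qed.

Lemma sum_enum_rank (K : nmodType) (F : 'I_#|T| -> K) : \sum_k F k = \sum_z F (enum_rank z).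
Proof.
by rewrite (reindex (@enum_rank T)) //; exists enum_val => k _; rewrite ?enum_valK ?enum_rankK.
Qed.

Lemma ceM (M M' : 'M[C]_#|T|) x y : ce (M *m M') x y = \sum_z ce M x z * ce M' z y.
Proof. by rewrite /ce mxE sum_enum_rank. Qed.

Lemma ceXS (M : 'M[C]_#|T|) p x y : ce (M ^+ p.+1) x y = \sum_z ce M x z * ce (M ^+ p) z y.
Proof. by rewrite exprS -mulmxE ceM. Qed.

Lemma ceD (M M' : 'M[C]_#|T|) x y : ce (M + M') x y = ce M x y + ce M' x y.
Proof. by rewrite /ce mxE. Qed.
Lemma ceZ c (M : 'M[C]_#|T|) x y : ce (c *: M) x y = c * ce M x y.
Proof. by rewrite /ce mxE. Qed.

Lemma ce_sum (J : Type) (r : seq J) (P : pred J) (M : J -> 'M[C]_#|T|) x y :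
  ce (\sum_(j <- r | P j) M j) x y = \sum_(j <- r | P j) ce (M j) x y.
Proof. by rewrite /ce summxE. Qed.
Lemma ce0 x y : ce (0 : 'M[C]_#|T|) x y = 0. Proof. by rewrite /ce mxE. Qed.
Lemma ce1 x y : ce (1%:M : 'M[C]_#|T|) x y = (x == y)%:R.
Proof. by rewrite /ce mxE (inj_eq enum_rank_inj). Qed.
Lemma ce_adj (M : 'M[C]_#|T|) x y : ce (adj M) x y = (ce M y x)^*%C.
Proof. by rewrite /ce !mxE. Qed.
Lemma ce_tr (M : 'M[C]_#|T|) : \tr M = \sum_x ce M x x.
Proof. exact: sum_enum_rank. Qed.

Definition dproj (A : pred T) : 'M[C]_#|T| := fmx (fun x y => ((x == y) && A x)%:R).

Lemma ce_dprojl A M x y : ce (dproj A *m M) x y = (A x)%:R * ce M x y.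
Proof.
rewrite ceM (bigD1 x) //= ce_fmx eqxx /= big1 ?addr0 // => z /negPf zx.
by rewrite ce_fmx eq_sym zx mul0r.
Qed.

Lemma ce_dprojr A M x y : ce (M *m dproj A) x y = (A y)%:R * ce M x y.
Proof.
rewrite ceM (bigD1 y) //= ce_fmx eqxx /= mulrC big1 ?addr0 // => z /negPf zy.
by rewrite ce_fmx zy mulr0.
Qed.

Lemma dproj_idem A : dproj A *m dproj A = dproj A.
Proof.
apply: ceP => x y; rewrite ce_dprojl ce_fmx.
by case: (A x); rewrite ?andbF ?mul1r ?mul0r.
Qed.

Lemma adj_dproj A : adj (dproj A) = dproj A.
Proof.
apply: ceP => x y; rewrite ce_adj !ce_fmx rmorph_nat eq_sym.
by case: eqP => // ->.
Qed.

Lemma dproj_comm A M : (forall x y, ce M x y != 0 -> A x = A y) -> M *m dproj A = dproj A *m M.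
Proof.
move=> h; apply: ceP => x y; rewrite ce_dprojl ce_dprojr.
by have [->|/h->] := eqVneq (ce M x y) 0; rewrite ?mulr0.
Qed.

Lemma psdD n (A B : 'M[C]_n) : psd A -> psd B -> psd (A + B).
Proof. by move=> hA hB v; rewrite -/(qform _ v) qformD addr_ge0 //; [apply: hA|apply: hB]. Qed.

Lemma psd0 n : psd (0 : 'M[C]_n).
Proof. by move=> v; rewrite mulmx0 mul0mx mxE. Qed.

Lemma psd_sum n (J : Type) (r : seq J) (P : pred J) (A : J -> 'M[C]_n) :
  (forall j, P j -> psd (A j)) -> psd (\sum_(j <- r | P j) A j).
Proof.
move=> h; elim/big_ind: _; [exact: psd0|by move=> B D; exact: psdD|by move=> j /h].
Qed.

Lemma psd_dproj A (c : R) : 0 <= c -> psd (rc c *: dproj A).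
Proof.
move=> c0 v; rewrite -/(qform _ v) qformZ -dproj_idem qform_sq ?adj_dproj //.
by rewrite mulr_ge0 // /rc ler0c ?vn2_ge0.
Qed.

End FinMatrix.

Section MobUnion.
Import fintype boot.finset.
Variables (V : finType) (K : numDomainType).
Lemma mob_union (f f1 f2 : {set V} -> K) (A B : {set V}) : [disjoint A & B] ->
  (forall U1 U2 : {set V}, U1 \subset A -> U2 \subset B -> f (U1 :|: U2) = f1 U1 * f2 U2) ->
  mob f (A :|: B) = mob f1 A * mob f2 B.
Proof.
move=> dAB hf; rewrite /mob big_distrlr /= pair_big /=.
have IA (U1 U2 : {set V}) : U1 \subset A -> U2 \subset B -> (U1 :|: U2) :&: A = U1.
  move=> h1 h2; rewrite setIUl (setIidPl h1) (_ : U2 :&: A = set0) ?setU0 //.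
  by apply: disjoint_setI0; rewrite disjoint_sym; apply: disjointWr h2 dAB.
have IB (U1 U2 : {set V}) : U1 \subset A -> U2 \subset B -> (U1 :|: U2) :&: B = U2.
  move=> h1 h2; rewrite setIUl (setIidPl h2) (_ : U1 :&: B = set0) ?set0U //.
  by apply: disjoint_setI0; apply: disjointWl h1 dAB.
rewrite (reindex_onto (fun p : {set V} * {set V} => p.1 :|: p.2) (fun U => (U :&: A, U :&: B))) /=; last first.
  by move=> U UAB; rewrite -setIUr (setIidPl UAB).
apply: eq_big => [[U1 U2]|[U1 U2]] /=.
  apply/andP/andP => [[_ /eqP[e1 e2]]|[h1 h2]].
    by rewrite -e1 -e2 !subsetIr.
  by rewrite setUSS // IA // IB.
move=> /andP[_ /eqP[e1 e2]].
have h1 : U1 \subset A by rewrite -e1 subsetIr.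
have h2 : U2 \subset B by rewrite -e2 subsetIr.
rewrite hf // mulrACA -exprD; congr (_ ^+ _ * _).
rewrite -cardsUI (_ : (A :\: U1) :&: (B :\: U2) = set0).
  rewrite cards0 addn0; apply: eq_card => v; rewrite !inE negb_or.
  case vA : (v \in A); case vB : (v \in B); rewrite ?andbF ?andbT ?orbF //=.
  - by have := disjointFr dAB vA; rewrite vB.
  - rewrite (_ : v \in U2 = false) ?andbT //; apply/negbTE; apply: contraFN vB; exact: (subsetP h2).
  - rewrite (_ : v \in U1 = false) //; apply/negbTE; apply: contraFN vA; exact: (subsetP h1).
apply: disjoint_setI0; apply: disjointWl (subsetDl _ _) _; apply: disjointWr (subsetDl _ _) _; exact: dAB.
Qed.
End MobUnion.

(** * Operators acting in a set of sites *)

Section LocalOperators.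
Import fintype boot.finset.
Variables (R : realType) (I : finType) (m : nat) (o : 'I_m).
Local Notation C := R[i].
Local Notation conf := {ffun I -> 'I_m}.
Local Notation rs := (rst o).
Implicit Types (x y z : conf) (S T : {set I}) (A B : 'M[C]_#|conf|).

Definition exc x : {set I} := [set i | x i != o].

Lemma rst_id S x : exc x \subset S -> rs S x = x.
Proof.
move=> h; apply/ffunP => i; rewrite ffunE; case: ifPn => // iS.
by apply/eqP; rewrite eq_sym; apply: contraNT iS => xi; apply: (subsetP h); rewrite inE.
Qed.

Lemma exc_rst S x : exc (rs S x) = exc x :&: S.
Proof. by apply/setP => i; rewrite !inE ffunE; case: (i \in S); rewrite ?andbT ?andbF ?eqxx. Qed.

Lemma rst_eqP S x y : reflect (forall i, i \in S -> x i = y i) (rs S x == rs S y).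
Proof.
apply: (iffP eqP) => [/ffunP h i iS|h]; first by have := h i; rewrite !ffunE iS.
by apply/ffunP => i; rewrite !ffunE; case: ifP => // /h.
Qed.

(** The block of [A] on the states excited only inside [S], tensored with the identity on the
    complement. *)
Definition locop S A : 'M[C]_#|conf| :=
  fmx (fun x y => ce A (rs S x) (rs S y) * (rs (~: S) x == rs (~: S) y)%:R).

(** Invariance of the states that are in the vacuum outside [S]; it makes [locop S] commute with
    powers and exponentials. *)
Definition closedon S A := forall x y, exc x \subset S -> ce A x y != 0 -> exc y \subset S.

Lemma sum_block S (x : conf) (F : conf -> C) : (forall z, ~~ (exc z \subset S) -> F z = 0) ->
  \sum_z (rs (~: S) x == rs (~: S) z)%:R * F (rs S z) = \sum_z F z.
Proof.
move=> F0; rewrite [RHS](bigID (fun z => exc z \subset S)) /= [X in _ = _ + X]big1 // addr0.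
rewrite (bigID (fun z => rs (~: S) x == rs (~: S) z)) /= [X in _ + X]big1 ?addr0; last first.
  by move=> z /negPf ->; rewrite mul0r.
pose mk (w : conf) : conf := [ffun i => if i \in S then w i else x i].
rewrite (reindex_onto mk (rs S)) /=; last first.
  move=> z /rst_eqP h; apply/ffunP => i; rewrite !ffunE; have [iS //|iS] := boolP (i \in S).
  by rewrite h // inE.
apply: eq_big => [w|w /andP[/rst_eqP h /eqP e]]; last first.
  by rewrite e (_ : rs (~: S) x == _) ?mul1r //; apply/rst_eqP.
apply/andP/idP => [[_ /eqP <-]|wS]; first by rewrite exc_rst subsetIr.
split; first by apply/rst_eqP => i; rewrite inE ffunE => /negPf ->.
apply/eqP/ffunP => i; rewrite !ffunE; have [iS //|iS] := boolP (i \in S).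
by apply/eqP; rewrite eq_sym; apply: contraNT iS => wi; apply: (subsetP wS); rewrite inE.
Qed.

Lemma locopX S A p : closedon S A -> locop S A ^+ p = locop S (A ^+ p).
Proof.
move=> hA; elim: p => [|p IH].
  apply: ceP => x y; rewrite !expr0 -![1]/(1%:M) ce_fmx !ce1 -natrM mulnb; congr (_ %:R).
  congr nat_of_bool; apply/eqP/andP => [->|[/rst_eqP h1 /rst_eqP h2]]; first by rewrite !eqxx.
  by apply/ffunP => i; have [/h1//|iS] := boolP (i \in S); apply: h2; rewrite inE.
rewrite exprS IH; apply: ceP => x y; rewrite -mulmxE ceM ce_fmx ceXS.
have h z : ~~ (exc z \subset S) -> ce A (rs S x) z * ce (A ^+ p) z (rs S y) = 0.
  move=> zS; have [->|nz] := eqVneq (ce A (rs S x) z) 0; first by rewrite mul0r.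
  by have := hA (rs S x) z; rewrite exc_rst subsetIr nz (negPf zS) => /(_ isT isT).
rewrite -(sum_block x h) mulr_suml; apply: eq_bigr => z _; rewrite !ce_fmx.
have [->|_] := eqVneq (rs (~: S) x) (rs (~: S) z); last by rewrite mulr0 !mul0r.
by rewrite mulr1 mul1r mulrA.
Qed.

Lemma locop_mexp S A : closedon S A -> mexp (locop S A) = locop S (mexp A).
Proof.
move=> hA; apply: ceP => x y; rewrite ce_fmx.
have [e|ne] := eqVneq (rs (~: S) x) (rs (~: S) y).
  rewrite mulr1; apply: mexp_entry_eq => p.
  by rewrite locopX // -/(ce _ x y) ce_fmx e eqxx mulr1.
rewrite mulr0 /ce mexp_scalar_entry ?(inj_eq enum_rank_inj).
  by have [e|//] := eqVneq x y; rewrite e eqxx in ne.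
by move=> p; rewrite locopX // -/(ce _ x y) ce_fmx (negPf ne) mulr0.
Qed.

Lemma ce_locopM S T A B x y : [disjoint S & T] ->
  ce (locop S A *m locop T B) x y =
  ce A (rs S x) (rs S y) * ce B (rs T x) (rs T y) * (rs (~: (S :|: T)) x == rs (~: (S :|: T)) y)%:R.
Proof.
move=> dST; rewrite ceM; pose z : conf := [ffun i => if i \in S then y i else x i].
rewrite (bigD1 z) //= [X in _ + X]big1 ?addr0; last first.
  move=> w wz; rewrite !ce_fmx.
  have [/rst_eqP h1|_] := boolP (rs (~: S) x == rs (~: S) w); last by rewrite mulr0 mul0r.
  have [/rst_eqP h2|_] := boolP (rs (~: T) w == rs (~: T) y); last by rewrite !mulr0.
  case/eqP: wz; apply/ffunP => i; rewrite ffunE; case: ifPn => iS.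
    by rewrite h2 // inE (disjointFr dST).
  by rewrite h1 // inE.
rewrite !ce_fmx.
have -> : rs S z = rs S y by apply/eqP/rst_eqP => i iS; rewrite ffunE iS.
have -> : rs T z = rs T x by apply/eqP/rst_eqP => i iT; rewrite ffunE (disjointFl dST).
have -> : rs (~: S) x == rs (~: S) z by apply/rst_eqP => i; rewrite inE ffunE => /negPf->.
rewrite mulr1 mulrA; congr (_ * _ %:R); congr nat_of_bool; apply/rst_eqP/rst_eqP => h i; rewrite !inE.
  by rewrite negb_or => /andP[iS iT]; have := h i; rewrite !inE ffunE (negPf iS) => /(_ iT).
rewrite ffunE; case: ifPn => // iS iT; by apply: h; rewrite !inE negb_or iS.
Qed.

Lemma locop_comm S T A B : [disjoint S & T] ->
  locop S A *m locop T B = locop T B *m locop S A.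
Proof.
move=> dST; apply: ceP => x y; rewrite ce_locopM // ce_locopM; last by rewrite disjoint_sym.
by rewrite (setUC T) [ce A _ _ * _]mulrC.
Qed.

Lemma mexp_block S A B : closedon S A -> (forall x y, exc x \subset S -> ce A x y = ce B x y) ->
  forall x y, exc x \subset S -> ce (mexp A) x y = ce (mexp B) x y.
Proof.
move=> hA hAB x y xS; apply: mexp_entry_eq => p.
rewrite -[LHS]/(ce (A ^+ p) x y) -[RHS]/(ce (B ^+ p) x y).
elim: p x xS => [|p IH] x xS; first by rewrite !expr0.
apply: etrans (ceXS _ _ _ _) (etrans _ (esym (ceXS _ _ _ _))).
apply: eq_bigr => z _; rewrite -(hAB x z xS).
have [->|nz] := eqVneq (ce A x z) 0; first by rewrite !mul0r.
by congr (_ * _); apply: IH; exact: hA xS nz.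
Qed.

(** On states excited inside [S :|: T], [A] agrees with the sum of the commuting operators
    [locop S A1] and [locop T A2]. Invariance of these states carries the agreement over to the
    exponentials. *)
Lemma mexp_kron S T A A1 A2 x y : [disjoint S & T] ->
  closedon S A1 -> closedon T A2 -> closedon (S :|: T) A ->
  (forall x y, exc x \subset S :|: T -> exc y \subset S :|: T -> ce A x y =
     ce A1 (rs S x) (rs S y) * (rs T x == rs T y)%:R + (rs S x == rs S y)%:R * ce A2 (rs T x) (rs T y)) ->
  exc x \subset S :|: T -> exc y \subset S :|: T ->
  ce (mexp A) x y = ce (mexp A1) (rs S x) (rs S y) * ce (mexp A2) (rs T x) (rs T y).
Proof.
move=> dST c1 c2 cA hA xST yST.
have split x' y' : exc x' \subset S :|: T -> ce A x' y' = ce (locop S A1 + locop T A2) x' y'.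
  move=> x'ST; rewrite ceD !ce_fmx.
  have [y'ST|ny] := boolP (exc y' \subset S :|: T).
    rewrite hA //; congr (_ * _ %:R + _); last rewrite mulrC; last congr (_ * _ %:R);
      congr nat_of_bool; apply/rst_eqP/rst_eqP => h i.
    - rewrite inE => iS; have [/h//|iT] := boolP (i \in T).
      have iST : i \notin S :|: T by rewrite inE negb_or iS.
      have := contra (subsetP x'ST i) iST; have := contra (subsetP y'ST i) iST.
      by rewrite !inE !negbK => /eqP-> /eqP->.
    - by move=> iT; apply: h; rewrite inE (disjointFl dST).
    - rewrite inE => iT; have [/h//|iS] := boolP (i \in S).
      have iST : i \notin S :|: T by rewrite inE negb_or iS.
      have := contra (subsetP x'ST i) iST; have := contra (subsetP y'ST i) iST.
      by rewrite !inE !negbK => /eqP-> /eqP->.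
    - by move=> iS; apply: h; rewrite inE (disjointFr dST).
  have -> : ce A x' y' = 0.
    by have [//|nz] := eqVneq (ce A x' y') 0; have := cA _ _ x'ST nz; rewrite (negPf ny).
  move/subsetPn: ny => [ i ]; rewrite !inE negb_or => iy /andP[iS iT].
  have xi : x' i = o.
    have iST : i \notin S :|: T by rewrite inE negb_or iS.
    by have := contra (subsetP x'ST i) iST; rewrite inE negbK => /eqP.
  have -> : (rs (~: S) x' == rs (~: S) y') = false.
    by apply/negP => /rst_eqP/(_ i); rewrite inE iS xi => /(_ isT) e; rewrite -e eqxx in iy.
  have -> : (rs (~: T) x' == rs (~: T) y') = false.
    by apply/negP => /rst_eqP/(_ i); rewrite inE iT xi => /(_ isT) e; rewrite -e eqxx in iy.
  by rewrite !mulr0 addr0.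
apply: etrans (mexp_block cA split y xST) _.
have -> : mexp (locop S A1 + locop T A2) = locop S (mexp A1) *m locop T (mexp A2).
  by rewrite -(locop_mexp c1) -(locop_mexp c2); exact: (mexpD (locop_comm A1 A2 dST)).
apply: etrans (ce_locopM _ _ _ _ dST) _.
rewrite (_ : rs (~: (S :|: T)) x == rs (~: (S :|: T)) y) ?mulr1 //.
apply/rst_eqP => i; rewrite inE => iST.
have := contra (subsetP xST i) iST; have := contra (subsetP yST i) iST.
by rewrite !inE !negbK => /eqP-> /eqP->.
Qed.

End LocalOperators.

(** * One time slice: bonds and excited sites *)

Section GappedLayer.
Import fintype boot.finset.
Variables (R : realType) (I Bd : finType) (m : nat) (o : 'I_m).
Local Notation C := R[i].
Local Notation conf := {ffun I -> 'I_m}.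
Local Notation rs := (rst o).
Local Notation exc := (exc o).
Implicit Types (x y z : conf) (S T : {set I}) (U : {set Bd}).

Variables (nb : I -> {set I}) (H0 : 'M[C]_#|conf|) (g tau : R).
Variables (bs : Bd -> {set I}) (Vb : Bd -> 'M[C]_#|conf|) (vb : Bd -> R).
Local Notation LC := (Bd + I)%type.

Definition nbs S : {set I} := \bigcup_(i in S) nb i.

Hypothesis nb_refl : forall i, i \in nb i.
Hypothesis g0 : 0 <= g.
Hypothesis tau0 : 0 <= tau.
Hypothesis H0adj : adj H0 = H0.
Hypothesis H0exc : forall x y, ce H0 x y != 0 -> exc x = exc y.
Hypothesis H0vac : ce H0 (vac I o) (vac I o) = 0.
Hypothesis H0gap : forall S, psd (H0 *m dproj R (fun x => exc x == S)
  - rc (g * #|S|%:R) *: dproj R (fun x => exc x == S)).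
Hypothesis H0add : forall S T x y, [disjoint nbs S & nbs T] ->
  exc x \subset S :|: T -> exc y \subset S :|: T ->
  ce H0 x y = ce H0 (rs S x) (rs S y) * (rs T x == rs T y)%:R +
    (rs S x == rs S y)%:R * ce H0 (rs T x) (rs T y).
Hypothesis bs0 : forall b, bs b != set0.
Hypothesis Vbloc : forall b S x y, bs b \subset S ->
  ce (Vb b) x y = ce (Vb b) (rs S x) (rs S y) * (rs (~: S) x == rs (~: S) y)%:R.
Hypothesis Vbop : forall b, opb (Vb b) (vb b).

Definition hamU U : 'M[C]_#|conf| := H0 + \sum_(b in U) Vb b.
Definition genU U : 'M[C]_#|conf| := - rc tau *: hamU U.
Definition bsU U : {set I} := \bigcup_(b in U) bs b.

Definition lcore (c : LC) : {set I} := match c with inl b => bs b | inr i => [set i] end.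
(** The core is enlarged by the range of [H0], so that cells with disjoint supports do not interact,
    by [H0add]. *)
Definition llsupp (c : LC) : {set I} := nbs (lcore c).
Definition lbonds (F : {set LC}) : {set Bd} := [set b | inl b \in F].
Definition lsites (F : {set LC}) : {set I} := [set i | inr i \in F].
(** The factors of [mob_mexp_bound]: one for each bond of the coefficient, and the gap factor for
    each site excited away from the bonds. *)
Definition lzeta (c : LC) : R := match c with inl b => expR (2 * tau * vb b) - 1 | inr i => expR (- (tau * g)) end.

Definition excoff (X : {set I}) x : {set I} := exc x :\: X.

(** Bonds enter through a Moebius coefficient. Away from their support the set of excited sites is
    conserved, and the indicator asks it to be [lsites F] at both ends: the expansion stays exact
    and every listed site pays the gap. *)
Definition layerL (F : {set LC}) x y : C :=
  mob (fun U => ce (mexp (genU U)) x y) (lbonds F) *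
  [&& [disjoint lsites F & bsU (lbonds F)], excoff (bsU (lbonds F)) x == lsites F &
      excoff (bsU (lbonds F)) y == lsites F]%:R.

Lemma vb_ge0 b : 0 <= vb b. Proof. by case: (Vbop b). Qed.

Lemma lzeta_ge0 c : 0 <= lzeta c.
Proof.
case: c => [b|i] /=; last exact: expR_ge0.
by rewrite subr_ge0 -expR0 ler_expR !mulr_ge0 // vb_ge0.
Qed.

Lemma sub_nbs S : S \subset nbs S.
Proof. by apply/subsetP => i iS; apply/bigcupP; exists i. Qed.

Lemma core_sub (F : {set LC}) : bsU (lbonds F) :|: lsites F = \bigcup_(c in F) lcore c.
Proof.
apply/setP => i; rewrite !inE; apply/orP/bigcupP.
  move=> [/bigcupP[b]|iF]; first by rewrite inE => bF ib; exists (inl b).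
  by exists (inr i) => //=; rewrite inE.
move=> [[b|j] cF] /= h; first by left; apply/bigcupP; exists b; rewrite ?inE.
by right; move: h cF; rewrite inE => /eqP ->.
Qed.

Lemma lsuppsE F : lsupps llsupp F = nbs (bsU (lbonds F) :|: lsites F).
Proof.
rewrite core_sub; apply/setP => i; apply/bigcupP/bigcupP.
  move=> [c cF /bigcupP[j jc ij]]; exists j => //; apply/bigcupP; by exists c.
move=> [j /bigcupP[c cF jc] ij]; exists c => //; apply/bigcupP; by exists j.
Qed.

Lemma llsupp_neq0 c : llsupp c != set0.
Proof.
have [i ic] : exists i, i \in lcore c.
  by case: c => [b|i] /=; [apply/set0Pn|exists i; rewrite inE].
by apply/set0Pn; exists i; apply: (subsetP (sub_nbs _)).
Qed.

Lemma exc_vac : exc (vac I o) = set0.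
Proof. by apply/setP => i; rewrite !inE ffunE eqxx. Qed.

Lemma exc_eq0 x : (exc x == set0) = (x == vac I o).
Proof.
apply/eqP/eqP => [/setP h|->]; last exact: exc_vac.
by apply/ffunP => i; rewrite ffunE; have := h i; rewrite !inE => /negbFE/eqP.
Qed.

Lemma excoff_eq (X S : {set I}) x y : X \subset S -> rs (~: X) x == rs (~: X) y ->
  excoff X x = excoff X y.
Proof.
move=> XS /rst_eqP h; apply/setP => i; rewrite !inE; case: (boolP (i \in X)) => //= iX.
by rewrite h // inE.
Qed.

Lemma genU_exc U x y : ce (genU U) x y != 0 -> excoff (bsU U) x = excoff (bsU U) y.
Proof.
rewrite /genU /hamU ceZ mulf_eq0 negb_or => /andP[_]; rewrite ceD ce_sum.
have [h|h _] := eqVneq (ce H0 x y) 0; last by rewrite /excoff (H0exc h).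
rewrite h add0r; apply: contra_neq_eq => ne; rewrite big1 // => b bU.
apply/eqP; rewrite (Vbloc _ _ (bigcup_sup b bU : bs b \subset bsU U)).
case e : (rs _ x == rs _ y); last by rewrite mulr0.
by case/eqP: ne; exact: excoff_eq (subxx _) e.
Qed.

Lemma genU_closed U S : bsU U \subset S -> closedon o S (genU U).
Proof.
move=> US x y xS /genU_exc e; apply/subsetP => i iy.
have [iU|iU] := boolP (i \in bsU U); first exact: (subsetP US).
have : i \in excoff (bsU U) y by rewrite inE iU iy.
by rewrite -e inE => /andP[_ /(subsetP xS)].
Qed.

Lemma mexp_exc U x y : ce (mexp (genU U)) x y != 0 -> excoff (bsU U) x = excoff (bsU U) y.
Proof.
set P := dproj R (fun z => excoff (bsU U) z == excoff (bsU U) x).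
have cP : genU U *m P = P *m genU U.
  by apply: dproj_comm => z w /genU_exc ->.
have := congr1 (fun M => ce M x y) (mexp_comm cP).
rewrite ce_dprojl ce_dprojr eqxx mul1r => e nz.
by case: eqP e => // _ e; rewrite mul0r in e; rewrite -e eqxx in nz.
Qed.

Lemma layerL0 x y : layerL set0 x y = ((x == vac I o) && (y == vac I o))%:R.
Proof.
have b0 : lbonds set0 = set0 by apply/setP => b; rewrite !inE.
have s0 : lsites set0 = set0 by apply/setP => b; rewrite !inE.
have u0 : bsU set0 = set0 by rewrite /bsU big_set0.
rewrite /layerL b0 s0 u0 /excoff !setD0 !exc_eq0 -setI_eq0 setI0 eqxx /=.
have [->|_] := eqVneq x (vac I o); last by rewrite mulr0.
have [->|_] := eqVneq y (vac I o); last by rewrite mulr0.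
rewrite mulr1 /mob (big_pred1 set0) => [|U]; last by rewrite subset0.
rewrite setD0 cards0 expr0 mul1r /ce mexp_scalar_entry ?eqxx // => p.
rewrite -[LHS]/(ce (genU set0 ^+ p.+1) (vac I o) (vac I o)) ceXS big1 // => z _.
rewrite /genU /hamU big_set0 addr0 ceZ.
have [->|nz] := eqVneq (ce H0 (vac I o) z) 0; first by rewrite mulr0 mul0r.
have e := H0exc nz; have /eqP -> : z == vac I o by rewrite -exc_eq0 -e exc_vac.
by rewrite H0vac mulr0 mul0r.
Qed.

Lemma layerL_exc F x y : layerL F x y != 0 ->
  exc x \subset bsU (lbonds F) :|: lsites F /\ exc y \subset bsU (lbonds F) :|: lsites F.
Proof.
rewrite /layerL mulf_eq0 negb_or => /andP[_].
case: and3P => [[_ /eqP <- /eqP e] _|]; last by rewrite eqxx.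
split; first by apply/subsetP => i; rewrite !inE => ->; rewrite andbT orbN.
by rewrite -e; apply/subsetP => i; rewrite !inE => ->; rewrite andbT orbN.
Qed.

Lemma layerL1 F x y : layerL F x y != 0 ->
  (rs (lsupps llsupp F) x == x) && (rs (lsupps llsupp F) y == y).
Proof.
move=> /layerL_exc[hx hy]; rewrite lsuppsE.
by rewrite !rst_id ?eqxx //; apply: subset_trans (sub_nbs _).
Qed.

Lemma excoff_sub_union (X X' S S' Y Y' : {set I}) x : X \subset Y -> S \subset Y -> X' \subset Y' -> S' \subset Y' ->
  [disjoint Y & Y'] -> exc x \subset (X :|: S) :|: (X' :|: S') ->
  (excoff (X :|: X') x == S :|: S') = (excoff X (rs Y x) == S) && (excoff X' (rs Y' x) == S').
Proof.
move=> XY SY XY' SY' dY hx.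
have key1 i : i \in Y -> (i \in Y') = false by move=> iY; rewrite (disjointFr dY).
apply/eqP/andP.
  move=> /setP h; split; apply/eqP/setP => i; rewrite !inE ffunE; have := h i; rewrite !inE.
    have [iY|iY] := boolP (i \in Y).
      have nX' : (i \in X') = false by apply/negP => /(subsetP XY'); rewrite key1.
      have nS' : (i \in S') = false by apply/negP => /(subsetP SY'); rewrite key1.
      by rewrite nX' nS' !orbF.
    move=> _; rewrite eqxx andbF; apply/esym/negbTE; apply: contra iY; exact: (subsetP SY).
  have [iY|iY] := boolP (i \in Y').
    have nY : (i \in Y) = false by apply/negP => /key1; rewrite iY.
    have nX : (i \in X) = false by apply/negP => /(subsetP XY); rewrite nY.
    have nS : (i \in S) = false by apply/negP => /(subsetP SY); rewrite nY.
    by rewrite nX nS.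
  move=> _; rewrite eqxx andbF; apply/esym/negbTE; apply: contra iY; exact: (subsetP SY').
move=> [/eqP/setP h1 /eqP/setP h2]; apply/setP => i.
have := h1 i; have := h2 i; rewrite !inE !ffunE.
have := subsetP hx i; rewrite !inE.
have [iY|iY] := boolP (i \in Y).
  have nX' : (i \in X') = false by apply/negP => /(subsetP XY'); rewrite key1.
  have nS' : (i \in S') = false by apply/negP => /(subsetP SY'); rewrite key1.
  by rewrite nX' nS' !orbF.
have nX : (i \in X) = false by apply/negP => /(subsetP XY); rewrite (negPf iY).
have nS : (i \in S) = false by apply/negP => /(subsetP SY); rewrite (negPf iY).
rewrite nX nS /=; have [iY'|iY'] := boolP (i \in Y'); first by [].
have nX' : (i \in X') = false by apply/negP => /(subsetP XY'); rewrite (negPf iY').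
have nS' : (i \in S') = false by apply/negP => /(subsetP SY'); rewrite (negPf iY').
by rewrite nX' nS' /=; case: (x i == o) => // /(_ isT).
Qed.

Lemma bsUU U U' : bsU (U :|: U') = bsU U :|: bsU U'.
Proof. by rewrite /bsU bigcup_setU. Qed.

Lemma bsUS U U' : U \subset U' -> bsU U \subset bsU U'.
Proof. by move=> UU'; apply/bigcupsP => b bU; apply: bigcup_sup; exact: (subsetP UU'). Qed.

Lemma genU_split S T U U' x y : [disjoint nbs S & nbs T] -> bsU U \subset S -> bsU U' \subset T ->
  [disjoint U & U'] -> exc x \subset S :|: T -> exc y \subset S :|: T ->
  ce (genU (U :|: U')) x y = ce (genU U) (rs S x) (rs S y) * (rs T x == rs T y)%:R +
    (rs S x == rs S y)%:R * ce (genU U') (rs T x) (rs T y).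
Proof.
move=> dST US UT dU xST yST.
have dd : [disjoint S & T] by apply: disjointWl (sub_nbs S) _; apply: disjointWr (sub_nbs T) _.
have eqc (A B : {set I}) : A :|: B = S :|: T -> (rs (~: A) x == rs (~: A) y) -> rs B x == rs B y -> True by [].
have cmp (A B : {set I}) : [disjoint A & B] -> exc x \subset A :|: B -> exc y \subset A :|: B ->
    (rs (~: A) x == rs (~: A) y) = (rs B x == rs B y).
  move=> dAB xAB yAB; apply/rst_eqP/rst_eqP => h i.
    by move=> iB; apply: h; rewrite inE (disjointFl dAB).
  rewrite inE => iA; have [/h//|iB] := boolP (i \in B).
  have iAB : i \notin A :|: B by rewrite inE negb_or iA.
  have := contra (subsetP xAB i) iAB; have := contra (subsetP yAB i) iAB.
  by rewrite !inE !negbK => /eqP-> /eqP->.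
rewrite /genU /hamU !ceZ !ceD !ce_sum (H0add dST xST yST).
rewrite (eq_bigl (fun b => (b \in U) || (b \in U'))) => [|b]; last by rewrite inE.
rewrite bigU //= (eq_bigr (fun b => ce (Vb b) (rs S x) (rs S y) * (rs T x == rs T y)%:R)); last first.
  move=> b bU; rewrite -(cmp S T) //; apply: Vbloc.
  exact: subset_trans (bigcup_sup b bU) US.
rewrite [X in _ + (_ + X)](eq_bigr (fun b => (rs S x == rs S y)%:R * ce (Vb b) (rs T x) (rs T y))); last first.
  move=> b bU; rewrite -(cmp T S) 1?disjoint_sym 1?setUC // mulrC; apply: Vbloc.
  exact: subset_trans (bigcup_sup b bU) UT.
rewrite -mulr_suml -mulr_sumr; ring.
Qed.

Lemma lbondsU F D : lbonds (F :|: D) = lbonds F :|: lbonds D.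
Proof. by apply/setP => b; rewrite !inE. Qed.
Lemma lsitesU F D : lsites (F :|: D) = lsites F :|: lsites D.
Proof. by apply/setP => b; rewrite !inE. Qed.

Lemma rst_union_l z (A Y Y' : {set I}) : Y \subset A -> Y' \subset ~: A ->
  exc z \subset Y :|: Y' -> rs A z = rs Y z.
Proof.
move=> YA YA' zY; apply/ffunP => i; rewrite !ffunE; case: (boolP (i \in Y)) => iY; first by rewrite (subsetP YA).
case: ifP => // iA; apply/eqP; apply: contraT => zi.
have := subsetP zY i; rewrite !inE (negPf iY) => /(_ zi) iY'.
by have := subsetP YA' i iY'; rewrite inE iA.
Qed.

Lemma rst_union_r z (A Y Y' : {set I}) : Y \subset A -> Y' \subset ~: A ->
  exc z \subset Y :|: Y' -> rs (~: A) z = rs Y' z.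
Proof.
by move=> YA YA' zY; apply: (@rst_union_l _ _ _ Y); rewrite ?setCK // setUC.
Qed.

Lemma exc_split z (A Y Y' : {set I}) : exc (rs A z) \subset Y -> exc (rs (~: A) z) \subset Y' ->
  exc z \subset Y :|: Y'.
Proof.
move=> h1 h2; apply/subsetP => i iz; rewrite inE; have [iA|iA] := boolP (i \in A).
  by rewrite (subsetP h1) // exc_rst inE iz.
by rewrite (subsetP h2) ?orbT // exc_rst in_setI iz inE.
Qed.

(** Two cuts occur because the support of a set of cells may meet times [t] and [t + 1] in different
    sets of sites. The generators of the two parts add up by [H0add], their exponentials factor by
    [mexp_kron], and the coefficients by [mob_union]. *)
Lemma layerL2 F D (S S' : {set I}) x y : lsupps llsupp F \subset S :&: S' ->
  lsupps llsupp D \subset ~: S :&: ~: S' ->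
  layerL (F :|: D) x y =
  layerL F (rs S x) (rs S' y) * layerL D (rs (~: S) x) (rs (~: S') y).
Proof.
rewrite !lsuppsE => FS DS.
set X := bsU (lbonds F); set X' := bsU (lbonds D).
set Y := X :|: lsites F; set Y' := X' :|: lsites D.
have dn : [disjoint nbs Y & nbs Y'].
  rewrite -setI_eq0; apply/eqP/setP => i; rewrite !inE; apply/negP => /andP[/(subsetP FS) h1 /(subsetP DS)].
  by move: h1; rewrite !inE => /andP[-> _].
have dY : [disjoint Y & Y'] by apply: disjointWl (sub_nbs Y) _; apply: disjointWr (sub_nbs Y') _.
have YS : Y \subset S :&: S' by exact: subset_trans (sub_nbs Y) FS.
have YS' : Y' \subset ~: S :&: ~: S' by exact: subset_trans (sub_nbs Y') DS.
have [YSl YSr] : Y \subset S /\ Y \subset S' by move: YS; rewrite subsetI => /andP.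
have [YSl' YSr'] : Y' \subset ~: S /\ Y' \subset ~: S' by move: YS'; rewrite subsetI => /andP.
have rsY z A := @rst_union_l z A Y Y'; have rsY' z A := @rst_union_r z A Y Y'.
have [/andP[xY yY]|nxy] := boolP ((exc x \subset Y :|: Y') && (exc y \subset Y :|: Y')); last first.
  have -> : layerL (F :|: D) x y = 0.
    apply/eqP; apply: contraNT nxy => /layerL_exc[]; rewrite lbondsU lsitesU bsUU setUACA.
    by move=> -> ->.
  apply/esym/eqP; apply: contraNT nxy; rewrite mulf_eq0 negb_or => /andP[/layerL_exc[h1 h2] /layerL_exc[h3 h4]].
  by apply/andP; split; [apply: (exc_split h1 h3)|apply: (exc_split h2 h4)].
rewrite (rsY x S) // (rsY' x S) // (rsY y S') // (rsY' y S') //.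
have dB : [disjoint lbonds F & lbonds D].
  rewrite -setI_eq0; apply/eqP/setP => b; rewrite [RHS]inE in_setI; apply/negP => /andP[bF bD].
  have /set0Pn[i ib] := bs0 b.
  have iY : i \in Y by rewrite inE; apply/orP; left; apply/bigcupP; exists b.
  have iY' : i \in Y' by rewrite inE; apply/orP; left; apply/bigcupP; exists b.
  by have := disjointFr dY iY; rewrite iY'.
rewrite /layerL lbondsU lsitesU bsUU -/X -/X' mulrACA; congr (_ * _).
  apply: mob_union => // U U' UF UD.
  have UY : bsU U \subset Y by apply: subset_trans (bsUS UF) (subsetUl _ _).
  have UY' : bsU U' \subset Y' by apply: subset_trans (bsUS UD) (subsetUl _ _).
  apply: (mexp_kron dY) => //.
  - exact: genU_closed.
  - exact: genU_closed.
  - by apply: genU_closed; rewrite bsUU setUSS.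
  - move=> x' y' x'Y y'Y; apply: genU_split => //.
    by apply: disjointWl UF _; apply: disjointWr UD _.
rewrite -natrM mulnb; congr (_ %:R); congr nat_of_bool.
have sX : X \subset Y := subsetUl _ _. have sS : lsites F \subset Y := subsetUr _ _.
have sX' : X' \subset Y' := subsetUl _ _. have sS' : lsites D \subset Y' := subsetUr _ _.
rewrite !(excoff_sub_union sX sS sX' sS' dY) //.
have -> : [disjoint lsites F :|: lsites D & X :|: X'] = [disjoint lsites F & X] && [disjoint lsites D & X'].
  apply/idP/andP => [h|[h1 h2]].
    split; first by apply: disjointWl (subsetUl _ (lsites D)) _; apply: disjointWr (subsetUl X X') h.
    by apply: disjointWl (subsetUr (lsites F) _) _; apply: disjointWr (subsetUr X X') h.
  rewrite -setI_eq0; apply/eqP/setP => i; rewrite [RHS]inE !in_setI !in_setU; apply/negP.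
  move=> /andP[/orP[iF|iD] /orP[iX|iX]].
  - by have := disjointFr h1 iF; rewrite iX.
  - by have := disjointFr dY (subsetP sS _ iF); rewrite (subsetP sX' _ iX).
  - by have := disjointFr dY (subsetP sX _ iX); rewrite (subsetP sS' _ iD).
  - by have := disjointFr h2 iD; rewrite iX.
case: [disjoint _ & _]; case: [disjoint _ & _]; case: (_ == _); case: (_ == _); case: (_ == _); case: (_ == _) => //.
Qed.

(** [P] is the sum of the projections onto excited set [S'] over all [S'] with [S' :\: X = S], and
    [S] is contained in each of them, so each has gap at least [g * #|S|]. *)
Lemma gap_excoff (X S : {set I}) : let P := dproj R (fun x => excoff X x == S) in
  psd (H0 *m P - rc (g * #|S|%:R) *: P).
Proof.
move=> P.
have PE : P = \sum_(S' : {set I} | S' :\: X == S) dproj R (fun x => exc x == S').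
  apply: ceP => x y; rewrite ce_sum ce_fmx /excoff.
  rewrite (eq_bigr (fun S' => if exc x == S' then (x == y)%:R else 0)); last first.
    by move=> S' _; rewrite ce_fmx; case: (x == y); case: (exc x == S').
  rewrite -big_mkcondr /=; have [e|ne] := eqVneq (exc x :\: X) S.
    rewrite andbT (big_pred1 (exc x)) // => S' /=.
    have [<-|nS'] := eqVneq (exc x) S'; first by rewrite e !eqxx.
    by rewrite andbF.
  rewrite andbF big_pred0 // => S'; have [<-|nS'] := eqVneq (exc x) S'; rewrite ?andbF //.
  by rewrite (negPf ne).
have -> : H0 *m P - rc (g * #|S|%:R) *: P =
  \sum_(S' : {set I} | S' :\: X == S) ((H0 *m dproj R (fun x => exc x == S')
     - rc (g * #|S'|%:R) *: dproj R (fun x => exc x == S')) +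
     rc (g * #|S'|%:R - g * #|S|%:R) *: dproj R (fun x => exc x == S')).
  rewrite PE mulmx_sumr scaler_sumr -sumrB; apply: eq_bigr => S' _.
  by rewrite /rc rmorphB /= scalerBl addrA subrK.
apply: psd_sum => S' /eqP e; apply: psdD; first exact: H0gap.
apply: psd_dproj; rewrite -mulrBr mulr_ge0 // subr_ge0 ler_nat -e.
by rewrite subset_leq_card // subsetDl.
Qed.

Lemma prod_lzeta (F : {set LC}) : \prod_(c in F) lzeta c =
  expR (- (tau * (g * #|lsites F|%:R))) * \prod_(b in lbonds F) (expR (2 * tau * vb b) - 1).
Proof.
rewrite big_mkcond big_sumType /= mulrC; congr (_ * _).
  rewrite (_ : expR (- (tau * (g * #|lsites F|%:R))) = expR (- (tau * g)) ^+ #|lsites F|); last first.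
    by rewrite -expRM_natl; congr expR; ring.
  rewrite -prodr_const [RHS]big_mkcond /=; apply: eq_bigr => i _; by rewrite inE.
by rewrite [RHS]big_mkcond /=; apply: eq_bigr => b _; rewrite inE.
Qed.

Lemma layerL3 (F : {set LC}) x y : nrm (layerL F x y) <= \prod_(c in F) lzeta c.
Proof.
rewrite /layerL nrmM nrm_bool.
case: and3P => [[_ _ /eqP ey]|_]; last by rewrite mulr0 prodr_ge0 // => c _; exact: lzeta_ge0.
rewrite mulr1 prod_lzeta.
set P := dproj R (fun z => excoff (bsU (lbonds F)) z == lsites F).
apply: (@mob_mexp_bound R _ Bd H0 P Vb vb tau (g * #|lsites F|%:R)) => //.
- by rewrite mulr_ge0.
- exact: adj_dproj.
- exact: dproj_idem.
- by apply: dproj_comm => z w h; rewrite /excoff (H0exc h).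
- exact: gap_excoff.
- move=> b bF; apply: dproj_comm => z w h; congr (_ == _).
  apply: (excoff_eq (subxx _)); move: h.
  rewrite (Vbloc _ _ (bigcup_sup b bF : bs b \subset bsU (lbonds F))).
  by case: (rs _ z == rs _ w) => //; rewrite mulr0 eqxx.
- by move=> M; rewrite -[LHS]/(ce (M *m P) x y) ce_dprojr ey eqxx mul1r.
Qed.

Definition inner (B : {set I}) : {set I} := [set i | nb i \subset B].
Definition bonds_in (S : {set I}) : {set Bd} := [set b | bs b \subset S].

(** Summing over the bonds inverts the Moebius transform and restores every bond inside [inner B];
    for given bonds a single set of sites contributes. The set [inner B] arises because a cell fits
    in [B] when the balls around its core do. *)
Lemma layerL_sum (B : {set I}) x y :
  layerT llsupp layerL B x y =
  (exc x \subset inner B)%:R * ce (mexp (genU (bonds_in (inner B)))) x y.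
Proof.
rewrite /layerT.
have sub (F : {set LC}) : (lsupps llsupp F \subset B) = (lbonds F \subset bonds_in (inner B)) && (lsites F \subset inner B).
  rewrite lsuppsE; apply/idP/andP.
    move=> h; have h1 i : i \in bsU (lbonds F) :|: lsites F -> i \in inner B.
      by move=> ic; rewrite inE; apply: subset_trans h; exact: bigcup_sup.
    split; apply/subsetP => a aF; last by apply: h1; rewrite inE aF orbT.
    rewrite inE; apply/subsetP => i ia; apply: h1; rewrite inE; apply/orP; left.
    by apply/bigcupP; exists a.
  move=> [/subsetP h1 /subsetP h2]; apply/bigcupsP => i; rewrite inE => /orP[/bigcupP[b bF ib]|/h2].
    by have := h1 b bF; rewrite inE => /subsetP/(_ i ib); rewrite inE.
  by rewrite inE.
rewrite (eq_bigl _ _ sub).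
pose mk (U : {set Bd}) S : {set LC} := [set c : LC | match c with inl b => b \in U | inr i => i \in S end].
have mkb U S : lbonds (mk U S) = U by apply/setP => a; rewrite !inE.
have mks U S : lsites (mk U S) = S by apply/setP => a; rewrite !inE.
rewrite (reindex (fun p : {set Bd} * {set I} => mk p.1 p.2)) /=; last first.
  exists (fun F => (lbonds F, lsites F)) => [[U S] _|F _] /=; first by rewrite mkb mks.
  by apply/setP => -[b|i]; rewrite !inE.
rewrite (eq_bigl (fun p : {set Bd} * {set I} => (p.1 \subset bonds_in (inner B)) && (p.2 \subset inner B))); last first.
  by move=> p; rewrite mkb mks.
rewrite -(pair_big (fun U => U \subset bonds_in (inner B)) (fun S => S \subset inner B)
  (fun U S => layerL (mk U S) x y)) /=.
rewrite -(mobK (fun U => ce (mexp (genU U)) x y)) mulr_sumr.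
apply: eq_bigr => U UB; set X := bsU U.
have XB : X \subset inner B.
  by apply/bigcupsP => b bU; have := subsetP UB b bU; rewrite inE.
have [xB|xB] := boolP (exc x \subset inner B); last first.
  rewrite mul0r big1 // => S SB; rewrite /layerL mkb mks -/X.
  case: and3P => [[_ /eqP e _]|_]; last by rewrite mulr0.
  case/negP: xB; apply/subsetP => i ix; have [iX|iX] := boolP (i \in X); first exact: (subsetP XB).
  by apply: (subsetP SB); rewrite -e in_setD iX.
have S0B : excoff X x \subset inner B by apply: subset_trans xB; exact: subsetDl.
rewrite (bigD1 (excoff X x)) //= [X in _ + X]big1 ?addr0; last first.
  move=> S /andP[_ nS]; rewrite /layerL mkb mks -/X [_ == S]eq_sym (negPf nS) andbF mulr0 //.
rewrite /layerL mkb mks -/X eqxx mul1r.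
have -> : [disjoint excoff X x & X].
  rewrite -setI_eq0; apply/eqP/setP => i; rewrite in_setI in_setD [RHS]inE.
  by case: (i \in X); rewrite ?andbF.
have [e|ne] := eqVneq (excoff X y) (excoff X x); first by rewrite mulr1.
rewrite mulr0 /mob big1 // => U' U'U; apply/eqP; rewrite mulf_eq0; apply/orP; right.
apply: contraNT ne => /mexp_exc e; apply/eqP/setP => i; rewrite !in_setD.
have [//|iX] := boolP (i \in X).
have iX' : i \notin bsU U' by apply: contra iX; exact: (subsetP (bsUS U'U)).
by have /setP/(_ i) := e; rewrite !in_setD iX'.
Qed.

(** The projection commutes with the exponential of a slice, so powers keep one copy of it while the
    slice lengths add up. *)
Lemma layer_pow (B : {set I}) (n : nat) :
  confmx (layerT llsupp layerL B) ^+ n.+1 =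
  dproj R (fun x => exc x \subset inner B) *m mexp (- rc (n.+1%:R * tau) *: hamU (bonds_in (inner B))).
Proof.
set P := dproj R _; set E := mexp (genU (bonds_in (inner B))).
have US : bsU (bonds_in (inner B)) \subset inner B.
  by apply/bigcupsP => b; rewrite inE.
have cP : genU (bonds_in (inner B)) *m P = P *m genU (bonds_in (inner B)).
  apply: dproj_comm => x y nz; have e := genU_exc nz; apply/idP/idP.
    by move=> xS; exact: (genU_closed US xS nz).
  move=> yS; apply/subsetP => i ix; have [iX|iX] := boolP (i \in bsU (bonds_in (inner B))).
    exact: (subsetP US).
  by have /setP/(_ i) := e; rewrite !in_setD iX ix /= => /esym /(subsetP yS).
have TE : confmx (layerT llsupp layerL B) = P *m E.
  apply: ceP => x y; rewrite ce_dprojl -layerL_sum; exact: ce_fmx.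
have -> : mexp (- rc (n.+1%:R * tau) *: hamU (bonds_in (inner B))) = E ^+ n.+1.
  rewrite -mexp_muln; congr mexp; rewrite /genU -[RHS]scaler_nat scalerA; congr (_ *: _).
  by rewrite mulrN /rc rmorphM /= rmorph_nat.
rewrite TE; elim: n => [|n IH]; first by rewrite !expr1.
rewrite exprS IH [in RHS]exprS -!mulmxE !mulmxA; congr (_ *m _).
by rewrite -[P *m E *m P]mulmxA (mexp_comm cP) mulmxA dproj_idem.
Qed.

End GappedLayer.

(** * The finite-volume potential *)

(** Points at most [rho] apart cannot lie on opposite sides of an empty window of width [rho + 1];
    the two versions treat the two sides in [pl_spread]. *)
Lemma window_lo (d rho k p q : nat) : (d <= rho -> k.+1 * rho.+1 <= p -> q < k * rho.+1 ->
  p <= q + d -> p < k * rho.+1)%N.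
Proof. lia. Qed.

Lemma window_hi (d rho k p q : nat) : (d <= rho -> p < k * rho.+1 -> k.+1 * rho.+1 <= q ->
  q <= p + d -> k.+1 * rho.+1 <= p)%N.
Proof. lia. Qed.

Section FiniteVolume.
Import fintype boot.finset.
Variables (R : realType) (I Bd X : finType) (m N' : nat) (o : 'I_m) (x0 : X).
Local Notation C := R[i].
Local Notation conf := {ffun I -> 'I_m}.
Local Notation rs := (rst o).
Local Notation exc := (exc o).
Local Notation N := N'.+1.
Local Notation V := (I * 'I_N)%type.
Implicit Types (A B S : {set I}).

Variables (dist : I -> I -> nat) (rho : nat).
Hypothesis dist0 : forall i, dist i i = 0%N.
Hypothesis dist_tri : forall i j k, (dist i k <= dist i j + dist j k)%N.
Hypothesis dist_sym : forall i j, dist i j = dist j i.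
Definition nball (i : I) : {set I} := [set j | (dist i j <= rho)%N].
Local Notation w := rho.+1.

Variables (H0 : 'M[C]_#|conf|) (g tau : R).
Variables (bs : Bd -> {set I}) (Vb : Bd -> 'M[C]_#|conf|) (vb : Bd -> R).
Hypothesis g0 : 0 <= g.
Hypothesis tau0 : 0 <= tau.
Hypothesis H0adj : adj H0 = H0.
Hypothesis H0exc : forall x y, ce H0 x y != 0 -> exc x = exc y.
Hypothesis H0vac : ce H0 (vac I o) (vac I o) = 0.
Hypothesis H0gap : forall S, psd (H0 *m dproj R (fun x => exc x == S)
  - rc (g * #|S|%:R) *: dproj R (fun x => exc x == S)).
Hypothesis H0add : forall S T x y, [disjoint nbs nball S & nbs nball T] ->
  exc x \subset S :|: T -> exc y \subset S :|: T ->
  ce H0 x y = ce H0 (rs S x) (rs S y) * (rs T x == rs T y)%:R +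
    (rs S x == rs S y)%:R * ce H0 (rs T x) (rs T y).
Hypothesis bs0 : forall b, bs b != set0.
Hypothesis bs_conn : forall b i k s t, s \in bs b -> t \in bs b ->
  (dist i s < k)%N -> (k <= dist i t)%N -> exists2 u, u \in bs b & dist i u = k.
Hypothesis Vbloc : forall b S x y, bs b \subset S ->
  ce (Vb b) x y = ce (Vb b) (rs S x) (rs S y) * (rs (~: S) x == rs (~: S) y)%:R.
Hypothesis Vbop : forall b, opb (Vb b) (vb b).

Variables (q0 : X -> I -> 'I_m -> 'I_m -> C) (kap : R).
Hypothesis q0o : forall x i, q0 x i o o = 1.
Hypothesis q0k : forall x i a b, nrm (q0 x i a b) <= kap.
Hypothesis q0x0 : forall i a b, q0 x0 i a b = (a == b)%:R.
Hypothesis kap1 : 1 <= kap.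

Definition latq (x : X) (v : V) (a b : 'I_m) : C :=
  if v.2 == ord0 then q0 x v.1 a b else (a == b)%:R.

(* large enough to pay for distances: 2^(dist) <= xi^|C| as soon as dist <= 3 w |C| *)
Definition xi : R := 2 ^+ (3 * w).
Local Notation llsup := (llsupp nball bs).
Local Notation zet := (@lzeta R I Bd g tau vb).

Hypothesis small : forall i, \sum_(c | i \in llsup c)
   zet c * (((m ^ 2)%:R * kap) * (4 * xi)) ^+ (2 * #|llsup c|) <= 1 / 10.
Variable Cd : R.
Hypothesis lattice_sum : forall i, \sum_j 2 ^- dist i j <= Cd.

Local Notation cs := (@cellsupp I (Bd + I)%type N' llsup).
Local Notation LW := (@layerW R I (Bd + I)%type X m N' (layerL o H0 tau bs Vb) latq).
Local Notation cz := (@cellz R I (Bd + I)%type m N' llsup zet kap).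

Definition betaN : R := N%:R * tau.
(** Excitations and bonds are confined to [inner B]. For [B] the whole volume this is the full trace
    with the normalised one-site factors. *)
Definition Zvol (x : X) (B : {set I}) : C :=
  \tr (confmx (fun a b => \prod_i q0 x i (a i) (b i)) *m
    (dproj R (fun z => exc z \subset inner nball B) *m
     mexp (- rc betaN *: hamU H0 Vb (bonds_in bs (inner nball B))))).

Lemma nball_refl i : i \in nball i. Proof. by rewrite inE dist0. Qed.

Lemma xi1 : 1 <= xi. Proof. by rewrite /xi exprn_ege1 // ler1n. Qed.

Lemma latq1 x v : latq x v o o = 1.
Proof. by rewrite /latq; case: ifP => _; rewrite ?q0o ?eqxx. Qed.

Lemma latqk x v a b : nrm (latq x v a b) <= kap.
Proof.
rewrite /latq; case: ifP => _; first exact: q0k.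
by rewrite nrm_bool; case: (a == b); rewrite ?ler01 ?(le_trans _ kap1).
Qed.

Local Notation LL := (layerL o H0 tau bs Vb).

Let L0 x y : LL set0 x y = ((x == vac I o) && (y == vac I o))%:R.
Proof. exact: layerL0. Qed.
Let L1 (F : {set (Bd + I)%type}) x y : LL F x y != 0 ->
  (rs (lsupps llsup F) x == x) && (rs (lsupps llsup F) y == y).
Proof. by apply: layerL1; exact: nball_refl. Qed.
Let L2 (F D : {set (Bd + I)%type}) (S S' : {set I}) x y :
  lsupps llsup F \subset S :&: S' -> lsupps llsup D \subset ~: S :&: ~: S' ->
  LL (F :|: D) x y = LL F (rs S x) (rs S' y) * LL D (rs (~: S) x) (rs (~: S') y).
Proof. by move=> h1 h2; apply: (@layerL2 R I Bd m o nball H0 tau bs Vb) => //; exact: nball_refl. Qed.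
Let L3 (F : {set (Bd + I)%type}) x y : nrm (LL F x y) <= \prod_(c in F) zet c.
Proof. exact: layerL3. Qed.
Let ls0 c : llsup c != set0.
Proof. by apply: llsupp_neq0 => //; exact: nball_refl. Qed.
Let ze0 c : 0 <= zet c.
Proof. exact: (lzeta_ge0 g tau0 Vbop). Qed.

Lemma latW0 x : LW x set0 = 1.
Proof. exact: (layerW0 L0 L1 latq1). Qed.

Lemma latWM x F D : [disjoint csupp cs F & csupp cs D] -> LW x (F :|: D) = LW x F * LW x D.
Proof. exact: (layerWM L1 L2 latq1). Qed.

Lemma latW_le x F : nrm (LW x F) <= \prod_(c in F) cz c.
Proof. exact: (layerW_le L1 L3 latq1 kap1 latqk ze0). Qed.

Lemma cz_ge0 c : 0 <= cz c.
Proof. exact: cellz_ge0. Qed.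

Lemma cs_neq0 c : cs c != set0.
Proof. exact: cellsupp_neq0. Qed.

(** A vertex at time [t] meets the cells of slices [t] and [t - 1], so the bound 1/10 of [small] is
    used at most twice. A cell occupies at most two times, whence the exponent [2 * #|llsup c|]
    there. *)
Lemma cz_small v : \sum_(c | v \in cs c) cz c * (4 * xi) ^+ #|cs c| <= 1 / 5.
Proof.
case: v => i t; pose F (c : Bd + I) : R := zet c * (((m ^ 2)%:R * kap) * (4 * xi)) ^+ (2 * #|llsup c|).
have m1 : (1 : R) <= (m ^ 2)%:R by rewrite ler1n expn_gt0 (leq_ltn_trans _ (ltn_ord o)).
have M1 : 1 <= (m ^ 2)%:R * kap :> R by rewrite mulr_ege1.
have K1 : 1 <= 4 * xi by rewrite mulr_ege1 ?xi1 // ler1n.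
have F0 c : 0 <= F c by rewrite mulr_ge0 // exprn_ge0 // !mulr_ge0 ?ler0n ?(le_trans _ kap1) ?(le_trans _ xi1).
have cF c : cz c * (4 * xi) ^+ #|cs c| <= F c.1.
  rewrite /cz /cellz /F -mulrA -exprMn; apply: ler_wpM2l => //.
  apply: ler_weXn2l; first exact: mulr_ege1.
  rewrite cardsX mulnC leq_mul2r; apply/orP; right.
  by rewrite cards2; case: (_ != _).
apply: (@le_trans _ _ (\sum_(c : (Bd + I) * 'I_N | (i, t) \in cs c) F c.1)); first exact: ler_sum.
rewrite (eq_bigl (fun c : (Bd + I) * 'I_N => (i \in llsup c.1) && (c.2 \in [set t; ord_pred t]))); last first.
  move=> [c t']; rewrite !inE /=; congr (_ && (_ || _)); first by rewrite eq_sym.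
  by apply/eqP/eqP => [->|->]; rewrite ?ordSK ?ord_predK.
rewrite -(pair_big (fun c => i \in llsup c) (fun t' => t' \in [set t; ord_pred t]) (fun c _ => F c)) /=.
rewrite exchange_big /=; apply: (@le_trans _ _ (\sum_(t' in [set t; ord_pred t]) (1 / 10))).
  by apply: ler_sum => t' _; exact: small.
rewrite sumr_const cards2; case: (_ != _); rewrite /= ?mulr1n ?mulr2n; lra.
Qed.

Local Notation pZ := (polyZ cs LW).
Local Notation pl := (polylog cs LW).

Lemma ZvolE x B : Zvol x B = pZ x (setX B setT).
Proof.
have qE y i t a b : latq y (i, t) a b = if t == ord0 then q0 y i a b else (a == b)%:R by [].
apply/esym; apply: etrans (layerZ_trace llsup LL qE x B) _.
rewrite /Zvol; congr (\tr (_ *m _)).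
exact: (@layer_pow R I Bd m o nball H0 tau bs Vb H0exc Vbloc B N').
Qed.

Lemma Zvol_neq0 x B : Zvol x B != 0.
Proof.
by rewrite ZvolE; apply: (polyZ_nz xi1 latW0 latWM cz_ge0 latW_le cz_small cs_neq0).
Qed.

Definition ellvol x B : R := ln (nrm (Zvol x B) ^+ 2).

Definition spread (C : {set V}) : bool :=
  [forall u in C, forall v in C, (dist u.1 v.1 < w * #|C|)%N].

Lemma core_conn (c : Bd + I) i k s t : s \in lcore bs c -> t \in lcore bs c ->
  (dist i s < k)%N -> (k <= dist i t)%N -> exists2 u, u \in lcore bs c & dist i u = k.
Proof.
case: c => [b|j] /=; first exact: bs_conn.
by rewrite !inE => /eqP -> /eqP -> h1 h2; move: (leq_trans h1 h2); rewrite ltnn.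
Qed.

(** If some distance were at least [w * #|C|], one of the [#|C| + 1] windows of distances from [u]
    would contain no point of [C]. Cores are connected and supports extend them by only [rho < w],
    so no cell crosses that window and [polylog_mob_split] applies. *)
Lemma pl_spread x (C : {set V}) : mob (pl x) C != 0 -> spread C.
Proof.
move=> nz; apply/forall_inP => u uC; apply/forall_inP => v vC; rewrite ltnNge; apply/negP => wD.
pose f (c : V) : 'I_(#|C|.+1) := inord (dist u.1 c.1 %/ w).
suff h (k : 'I_(#|C|.+1)) : exists2 c, c \in C & (dist u.1 c.1 %/ w)%N = k.
  have : setT \subset f @: C.
    apply/subsetP => k _; have [c cC e] := h k; apply/imsetP; exists c => //.
    by apply: val_inj; rewrite /f /= e inordK.
  move/subset_leq_card; rewrite cardsT card_ord => /leq_trans /(_ (leq_imset_card _ _)).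
  by rewrite ltnn.
have kw : (k * w <= dist u.1 v.1)%N.
  by apply: leq_trans wD; rewrite mulnC leq_mul2l /= -ltnS ltn_ord.
have [/eqP e|k0] := eqVneq (k : nat) 0%N.
  by exists u => //; rewrite dist0 div0n (eqP e).
have [/existsP[c /andP[cC /eqP e]]|nex] := boolP [exists c, (c \in C) && ((dist u.1 c.1 %/ w)%N == k)].
  by exists c.
have nwin c : c \in C -> (dist u.1 c.1 < k * w)%N || (k.+1 * w <= dist u.1 c.1)%N.
  move=> cC; rewrite -leq_divRL // -ltn_divLR //.
  have : (dist u.1 c.1 %/ w)%N != k.
    by apply: contraNN nex => e; apply/existsP; exists c; rewrite cC.
  by rewrite neq_ltn.
pose A := [set c in C | (dist u.1 c.1 < k * w)%N].
pose B := [set c in C | (k.+1 * w <= dist u.1 c.1)%N].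
have CE : C = A :|: B.
  by apply/setP => c; rewrite !inE -andb_orr; apply/idP/andP => [cC|[]//]; split=> //; exact: nwin.
case/negP: nz; apply/eqP; rewrite CE.
apply: (polylog_mob_split xi1 latW0 latWM cz_ge0 latW_le cz_small cs_neq0).
- apply/set0Pn; exists u; rewrite inE uC dist0 muln_gt0 /= andbT lt0n //.
- apply/set0Pn; exists v; rewrite inE vC /=.
  by have := nwin v vC; rewrite ltnNge kw.
- rewrite -setI_eq0; apply/eqP/setP => c; rewrite !inE; apply/negP => /andP[/andP[_ h1] /andP[_ h2]].
  have := leq_ltn_trans h2 h1; rewrite ltn_mul2r /= => /ltnW; by rewrite ltnn.
move=> [c t]; rewrite -CE => cC.
have inC j : j \in llsup c -> (j, t) \in C.
  by move=> jc; apply: (subsetP cC); rewrite !inE /= jc eqxx.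
have coreC j : j \in lcore bs c -> (j, t) \in C.
  by move=> jc; apply: inC; apply: (subsetP (sub_nbs nball_refl _)).
have [i0 i0c] : exists i, i \in lcore bs c.
  by case: (c) => [b|i] /=; [apply/set0Pn|exists i; rewrite inE].
have same j : j \in lcore bs c -> (dist u.1 j < k * w)%N = (dist u.1 i0 < k * w)%N.
  have gen a b : a \in lcore bs c -> b \in lcore bs c -> (dist u.1 a < k * w)%N -> (dist u.1 b < k * w)%N.
    move=> ac bc ha; rewrite ltnNge; apply/negP => hb.
    have [x1 x1c e] := core_conn ac bc ha hb.
    have := nwin (x1, t) (coreC _ x1c); rewrite /= e ltnn /= leq_mul2r /=.
    by rewrite ltnn.
  by move=> jc; apply/idP/idP; apply: gen.
have near j : j \in llsup c -> exists2 a, a \in lcore bs c & (dist a j <= rho)%N.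
  by move=> /bigcupP[a ac]; rewrite inE => h; exists a.
have [lo|hi] := boolP (dist u.1 i0 < k * w)%N; apply/orP; [left|right];
  apply/subsetP => -[j t'] jc; have jC := subsetP cC _ jc; move: (jc); rewrite in_setX /= => /andP[jl _];
  have [a ac aj] := near j jl; rewrite inE jC /=; have := nwin _ jC => /= /orP[] // h.
  have la : (dist u.1 a < k * w)%N by rewrite same.
  exact: window_lo aj h la (dist_tri u.1 a j).
have ha : (k.+1 * w <= dist u.1 a)%N.
  by have := nwin _ (coreC a ac); rewrite /= same // (negPf hi).
rewrite dist_sym in aj; exact: window_hi aj h ha (dist_tri u.1 j a).
Qed.

Lemma pl_x0 x (C : {set V}) : (forall j, (j, ord0) \notin C) -> mob (pl x) C = mob (pl x0) C.
Proof.
move=> hC; apply: eq_mob => U UC; rewrite /polylog; do 3!congr (_ _).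
suff -> : pZ x U = pZ x0 U by [].
apply: eq_bigr => F FU; apply: eq_bigr => s _.
have [e|ne] := eqVneq (rstp o (csupp cs F) s) s.
  rewrite /pathw; congr (_ * _); apply: eq_bigr => v _.
  have [vF|vF] := boolP (v \in csupp cs F); last by rewrite -e ffunE (negPf vF) !latq1.
  rewrite /latq ifF ?ifF //; apply/negbTE; apply: contraNneq (hC v.1) => <-;
  by rewrite -surjective_pairing (subsetP UC) // (subsetP FU).
have z y : pathw LL latq y F s = 0.
  by apply/eqP; apply: contraNT ne => /(pathw_neq0 L1) ->.
by rewrite !z.
Qed.

(** Subtracting the reference [x0], where nothing is measured, cancels the coefficients that do not
    meet time 0; only this keeps the bounds independent of the number of slices. *)
Definition psivol x A : R := mob (fun B => ellvol x B - ellvol x0 B) A.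

Definition proj (C : {set V}) : {set I} := [set v.1 | v in C].

Lemma psivolE x A : psivol x A = \sum_(C : {set V} | proj C == A) (mob (pl x) C - mob (pl x0) C).
Proof.
apply: (mob_uniq (a := fun A => \sum_(C : {set V} | proj C == A) (mob (pl x) C - mob (pl x0) C))) => B.
have e y : ellvol y B = pl y (setX B setT) by rewrite /ellvol ZvolE.
rewrite !e -!mobK -sumrB.
rewrite (partition_big proj (fun A => A \subset B)) /=; last first.
  move=> C CB; apply/subsetP => i /imsetP[v vC ->].
  by have := subsetP CB v vC; rewrite !inE => /andP[].
apply: eq_bigr => A' AB; apply: eq_bigl => C; apply: andb_idl => /eqP e'.
apply/subsetP => -[i t] vC; rewrite !inE andbT; apply: (subsetP AB); rewrite -e'.
by apply/imsetP; exists (i, t).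
Qed.

(** A contributing [C] contains some [(j, ord0)] and, by [spread], [w * #|C|] exceeds both [r] and
    the distance from [i] to [j]. So xi^|C| pays for 2^r and for a factor summable in [j]. In the
    constant, one 2 stands for [x] and [x0], another for the bound of [polylog_mob_bound], and [xi]
    for the power missing there. *)
Theorem psivol_bound : exists b : {set I} -> R, [/\ forall A, 0 <= b A,
  forall x A, `|psivol x A| <= b A &
  forall i r, \sum_(A : {set I} | (i \in A) && [exists u in A, (r <= dist i u)%N]) b A <= 4 * xi * Cd * 2 ^- r].
Proof.
have /boolp.choice[G hG] := fun j : I => polylog_mob_bound xi1 latW0 latWM cz_ge0 latW_le cz_small cs_neq0 (j, ord0).
have G0 j C : 0 <= G j C by have [h _ _] := hG j.
have xi0 : 0 <= xi by rewrite (le_trans _ xi1).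
pose e (C : {set V}) : R := \sum_(j | (j, ord0) \in C) 2 * G j C.
have e0 C : 0 <= e C by apply: sumr_ge0 => j _; rewrite mulr_ge0.
exists (fun A => \sum_(C : {set V} | (proj C == A) && spread C) e C); split.
- by move=> A; apply: sumr_ge0.
- move=> x A; rewrite psivolE big_mkcondr; apply: (le_trans (ler_norm_sum _ _ _)).
  apply: ler_sum => C _; have [hs|ns] := boolP (spread C); last first.
    have z y : mob (pl y) C = 0 by apply/eqP; apply: contraNT ns; exact: pl_spread.
    by rewrite !z subrr normr0.
  have [/existsP[j jC]|nj] := boolP [exists j, (j, ord0) \in C].
    have [_ h _] := hG j; apply: (le_trans (ler_normB _ _)).
    apply: (@le_trans _ _ (2 * G j C)).
      by have := h x C jC; have := h x0 C jC; lra.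
    by rewrite /e (bigD1 j) //= lerDl; apply: sumr_ge0 => k _; rewrite mulr_ge0.
  rewrite pl_x0 ?subrr ?normr0 // => j; apply: contra nj => jC; by apply/existsP; exists j.
move=> i r; pose Q (A : {set I}) := (i \in A) && [exists u in A, (r <= dist i u)%N].
rewrite -/Q (_ : \sum_(A | Q A) _ = \sum_(C : {set V} | Q (proj C) && spread C) e C); last first.
  rewrite [RHS](partition_big proj Q) /=; last by move=> C /andP[].
  apply: eq_bigr => A QA; apply: eq_bigl => C; case: eqP => [->|]; by rewrite ?QA ?andbT ?andbF.
rewrite /e (exchange_big_dep xpredT) //=.
apply: (@le_trans _ _ (\sum_j 4 * xi * 2 ^- r * 2 ^- dist i j)); last first.
  rewrite -mulr_sumr mulrAC; apply: ler_wpM2r; first by rewrite invr_ge0 exprn_ge0.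
  by apply: ler_wpM2l; rewrite ?mulr_ge0.
apply: ler_sum => j _; have [_ _ h] := hG j.
apply: (@le_trans _ _ (2 * xi * 2 ^- r * 2 ^- dist i j * \sum_(C : {set V} | (j, ord0) \in C) xi ^+ #|C|.-1 * G j C)); last first.
  set p := _ * 2 ^- dist i j.
  have p0 : 0 <= p by rewrite !mulr_ge0 ?invr_ge0 ?exprn_ge0.
  have := ler_wpM2l p0 h; rewrite /p; lra.
rewrite mulr_sumr big_mkcond [leRHS]big_mkcond /=; apply: ler_sum => C _.
case jC : ((j, ord0) \in C); rewrite ?andbF // andbT; case: ifP => [|_]; last first.
  by rewrite !mulr_ge0 ?invr_ge0 ?exprn_ge0.
move=> /andP[/andP[/imsetP[v vC iv] /exists_inP[u /imsetP[v' vC' uv] ru]] /forall_inP sC].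
have d1 := forall_inP (sC v vC) _ jC; have d2 := forall_inP (sC v vC) _ vC'.
rewrite -iv /= in d1; rewrite -iv -uv in d2.
have C0 : (0 < #|C|)%N by apply/card_gt0P; exists (j, ord0).
have key : 1 <= xi * xi ^+ #|C|.-1 * 2 ^- r * 2 ^- dist i j.
  rewrite -exprS prednK // /xi -exprM -mulrA -invfM -exprD.
  rewrite ler_pdivlMr ?exprn_gt0 // mul1r ler_weXn2l ?ler1n //.
  rewrite (_ : (3 * w * #|C|)%N = (w * #|C| + (w * #|C| + w * #|C|))%N); last first.
    by rewrite -mulnA; move: (w * #|C|)%N => z0; lia.
  apply: leq_add; first exact: leq_trans ru (ltnW d2).
  by apply: leq_trans (ltnW d1) _; rewrite leq_addr.
rewrite [leRHS](_ : _ = (2 * G j C) * (xi * xi ^+ #|C|.-1 * 2 ^- r * 2 ^- dist i j)); last by ring.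
by rewrite ler_peMr // mulr_ge0.
Qed.

End FiniteVolume.

(** * Lattice regions and interactions *)

Section Lattice.
Variable d : nat.
Implicit Types (s t u : site d) (A B : {fset site d}).

Definition dst s t : nat := \sum_(i < d) absz (s ord0 i - t ord0 i)%R.

Lemma dst_refl s : dst s s = 0%N.
Proof. by rewrite /dst big1 // => i _; rewrite subrr. Qed.

Lemma dst_sym s t : dst s t = dst t s.
Proof. by apply: eq_bigr => i _; rewrite distnC. Qed.

Lemma dst_tri s t u : (dst s u <= dst s t + dst t u)%N.
Proof. by rewrite /dst -big_split /=; apply: leq_sum => i _; exact: leqD_dist. Qed.

Lemma dst_add s t u : dst (s + u) (t + u) = dst s t.
Proof. by apply: eq_bigr => i _; rewrite !mxE opprD addrACA subrr addr0. Qed.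

Lemma dst_adjacent s t : adjacent s t -> dst s t = 1%N.
Proof.
rewrite /adjacent /dst => /eqP h; apply/eqP; rewrite -eqz_nat; apply/eqP; rewrite -{}h.
by rewrite (big_morph Posz PoszD (erefl _)); apply: eq_bigr => i _; rewrite abszE.
Qed.

(** A discrete intermediate value theorem: the part of [A] closer than [k] has an outgoing edge,
    along which the distance grows by at most 1. *)
Lemma connected_dst A s t u k : connected_region A -> s \in A -> t \in A ->
  (dst u s < k)%N -> (k <= dst u t)%N -> exists2 v, v \in A & dst u v = k.
Proof.
move=> [_ hA] sA tA sk kt.
pose B := [fset v in A | (dst u v < k)%N]%fset.
have BA : (B `<=` A)%fset by apply/fsubsetP => v; rewrite !inE => /andP[].
have B0 : B != fset0 by apply/fset0Pn; exists s; rewrite !inE sA.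
have nBA : B != A.
  by apply/eqP => e; move: tA; rewrite -e !inE ltnNge kt andbF.
have [v [v' [vB vA' nvB adj]]] := hA B BA B0 nBA.
exists v' => //; move: vB nvB; rewrite !inE vA' /= -leqNgt => /andP[_ h1] h2.
apply/eqP; rewrite eqn_leq h2 andbT; apply: leq_trans (dst_tri u v v') _.
by rewrite (dst_adjacent adj) addn1.
Qed.

Lemma shiftP A a s : (s \in shift A a) = (s - a \in A).
Proof.
apply/imfsetP/idP => [[t tA ->]|h]; first by rewrite addrK.
by exists (s - a) => //; rewrite subrK.
Qed.

Lemma shiftD A a b : shift (shift A a) b = shift A (a + b).
Proof. by apply/fsetP => s; rewrite !shiftP opprD addrA addrAC. Qed.

Lemma shift0 A : shift A 0 = A.
Proof. by apply/fsetP => s; rewrite shiftP subr0. Qed.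

Lemma shiftK A a : shift (shift A a) (- a) = A.
Proof. by rewrite shiftD subrr shift0. Qed.

Lemma shift_inj a : injective (fun A => shift A a).
Proof. by move=> A B /(congr1 (fun S => shift S (- a))); rewrite !shiftK. Qed.

Lemma card_shift A a : #|` shift A a| = #|` A|.
Proof. by rewrite card_imfset //=; apply: addIr. Qed.

Lemma shift_sub A B a : (shift A a `<=` shift B a)%fset = (A `<=` B)%fset.
Proof.
apply/fsubsetP/fsubsetP => h s; last by rewrite !shiftP; exact: h.
by move=> sA; have := h (s + a); rewrite !shiftP addrK; apply.
Qed.

End Lattice.

Section LatticeSum.
Variables (R : realType) (d : nat).

Lemma geom_line (n : nat) : \sum_(c < 2 * n + 1) (2 : R) ^- absz ((c : nat)%:Z - n%:Z) <= 3.
Proof.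
rewrite -(big_mkord xpredT (fun c => (2 : R) ^- absz (c%:Z - n%:Z))).
have half k : \sum_(0 <= c < k) (2 : R) ^- c <= 2.
  suff -> : \sum_(0 <= c < k) (2 : R) ^- c = 2 - 2 * 2 ^- k.
    by rewrite gerBl mulr_ge0 // invr_ge0 exprn_ge0.
  elim: k => [|k IH]; first by rewrite big_nil expr0 invr1 mulr1 subrr.
  by rewrite big_nat_recr //= IH exprS invfM; field; rewrite expf_neq0.
rewrite (big_cat_nat _ (n := n)) //=; last by lia.
have e1 : \sum_(0 <= c < n) (2 : R) ^- absz (c%:Z - n%:Z) = \sum_(0 <= c < n) 2 ^- c.+1.
  rewrite big_nat_rev /= !add0n; apply: eq_big_nat => c cn.
  by congr (_ ^- _); lia.
have e2 : \sum_(n <= c < 2 * n + 1) (2 : R) ^- absz (c%:Z - n%:Z) = \sum_(0 <= c < n.+1) 2 ^- c.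
  rewrite -{1}(add0n n) (_ : 2 * n + 1 = n.+1 + n)%N; last by lia.
  rewrite big_addn addnK; apply: eq_big_nat => c cn; by congr (_ ^- _); lia.
rewrite e1 e2; have := half n.+1; rewrite big_nat_recl // expr0 invr1; lra.
Qed.

(** The sum is embedded into one over a cube around [i], which factors into [d] one-dimensional
    sums, each at most 3. *)
Lemma lattice_sum_le (L : {fset site d}) (i : site d) :
  \sum_(j : L) (2 : R) ^- dst i (fsval j) <= 3 ^+ d.
Proof.
pose n := \max_(j : L) dst i (fsval j).
have hn (j : L) c : (absz (i ord0 c - fsval j ord0 c)%R <= n)%N.
  apply: leq_trans (leq_bigmax j); rewrite /dst (bigD1 c) //=; exact: leq_addr.
have lt (j : L) c : (absz (fsval j ord0 c - i ord0 c + n%:Z)%R < 2 * n + 1)%N by have := hn j c; lia.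
pose f (j : L) : {ffun 'I_d -> 'I_(2 * n + 1)} := [ffun c => Ordinal (lt j c)].
have fE (j : L) c : ((f j c : nat)%:Z - n%:Z = fsval j ord0 c - i ord0 c)%R.
  rewrite ffunE /=; have h := hn j c; rewrite gez0_abs ?addrK //.
  by move: h; move: (fsval j ord0 c) (i ord0 c) => a b; lia.
pose F (h : {ffun 'I_d -> 'I_(2 * n + 1)}) : R := \prod_c 2 ^- absz ((h c : nat)%:Z - n%:Z)%R.
have F0 h : 0 <= F h by apply: prodr_ge0 => c _; rewrite invr_ge0 exprn_ge0.
have finj : injective f.
  move=> j j' e; apply: val_inj; apply/rowP => c.
  by have := fE j c; rewrite e fE => /addIr.
have dE (j : L) : (2 : R) ^- dst i (fsval j) = F (f j).
  rewrite /F /dst prodfV -expr_sum; congr (_ ^- _); apply: eq_bigr => c _.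
  by rewrite fE distnC.
apply: (@le_trans _ _ (\sum_h F h)).
  rewrite (eq_bigr _ (fun j _ => dE j)).
  have -> : \sum_(j : L) F (f j) = \sum_(h in [set f j | j in [set: L]%SET]%SET) F h.
    rewrite big_imset /=; last by move=> x y _ _; exact: finj.
    by apply: eq_bigl => j; rewrite boot.finset.in_setT.
  by rewrite [leRHS](bigID (fun h => h \in [set f j | j in [set: L]%SET]%SET)) /= lerDl; apply: sumr_ge0.
rewrite /F -(bigA_distr_bigA (fun (c : 'I_d) (k : 'I_(2 * n + 1)) => (2 : R) ^- absz ((k : nat)%:Z - n%:Z)%R)) /=.
apply: (@le_trans _ _ (\prod_(c < d) 3)); last by rewrite prodr_const card_ord.
apply: ler_prod => c _; rewrite geom_line andbT.
by apply: sumr_ge0 => k _; rewrite invr_ge0 exprn_ge0.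
Qed.

End LatticeSum.

(** * Configurations of finite regions and matrix elements of interactions *)

Section Regions.
Import fintype boot.finset.
Variables (R : realType) (d m : nat) (o : 'I_m).
Local Notation C := R[i].
Implicit Types (A L : {fset site d}) (s t : site d) (X Y : site d -> 'I_m).
Local Notation qc A := {ffun (A : {fset site d}) -> 'I_m}.

Definition res A X : qc A := [ffun a => X (fsval a)].
(** Extension by the vacuum state; on functions of the whole lattice, configurations of different
    regions can be compared directly. *)
Definition ext A (x : qc A) : site d -> 'I_m :=
  fun s => if insub s : option A is Some t then x t else o.

Lemma ext_in A (x : qc A) (t : A) : ext x (fsval t) = x t.
Proof. by rewrite /ext valK. Qed.

Lemma ext_out A (x : qc A) s : s \notin A -> ext x s = o.
Proof. by move=> sA; rewrite /ext insubN. Qed.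

Lemma res_ext A (x : qc A) : res A (ext x) = x.
Proof. by apply/ffunP => t; rewrite ffunE ext_in. Qed.

Lemma eq_res A X Y : (forall s, s \in A -> X s = Y s) -> res A X = res A Y.
Proof. by move=> h; apply/ffunP => t; rewrite !ffunE h // fsvalP. Qed.

Definition offeq A X Y : bool := `[< forall s, s \notin A -> X s = Y s >].

Lemma offeqP A X Y : reflect (forall s, s \notin A -> X s = Y s) (offeq A X Y).
Proof. exact: asboolP. Qed.

(** The matrix element of the term of [A] in any volume containing [A], written without that
    volume. *)
Definition tm (Phi : qinteraction R d m) A X Y : C :=
  ce (Phi A) (res A X) (res A Y) * (offeq A X Y)%:R.

Lemma agree_res L A (x : qc L) : (A `<=` L)%fset ->
  forall x' : qc A, agree x x' = (x' == res A (ext x)).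
Proof.
move=> /fsubsetP AL x'; apply/idP/eqP.
  move=> /forallP h; apply/ffunP => a; rewrite ffunE.
  have aL : fsval a \in L by apply: AL; exact: fsvalP.
  have /forallP/(_ [` aL]%fset) /= := h a; rewrite eqxx /= => /eqP ->.
  exact: (esym (ext_in x [` aL]%fset)).
move=> ->; apply/forallP => a; apply/forallP => b; apply/implyP => /eqP e.
by rewrite ffunE e ext_in.
Qed.

Lemma offeq_ext L A (x y : qc L) :
  [forall b : L, (fsval b \notin A) ==> (x b == y b)] = offeq A (ext x) (ext y).
Proof.
apply/idP/offeqP.
  move=> /forallP h s sA; have [sL|sL] := boolP (s \in L); last by rewrite !ext_out.
  by have /implyP/(_ sA)/eqP := h [` sL]%fset; rewrite -!ext_in.
move=> h; apply/forallP => b; apply/implyP => bA; rewrite -!ext_in; apply/eqP; exact: h.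
Qed.

Lemma ce_emb1 L A (M : op R m A) (x y : qc L) : (A `<=` L)%fset ->
  ce (emb L M) x y = ce M (res A (ext x)) (res A (ext y)) * (offeq A (ext x) (ext y))%:R.
Proof.
move=> AL; rewrite /emb; apply: etrans (ce_fmx _ _ _) _.
rewrite (big_pred1 (res A (ext x))) => [|x']; last exact: agree_res.
rewrite (big_pred1 (res A (ext y))) => [|x']; last exact: agree_res.
by rewrite offeq_ext mulrC.
Qed.

Lemma ce_emb (Phi : qinteraction R d m) L A (x y : qc L) : (A `<=` L)%fset ->
  ce (emb L (Phi A)) x y = tm Phi A (ext x) (ext y).
Proof. exact: ce_emb1. Qed.

Lemma ce_ham (Phi : qinteraction R d m) L (x y : qc L) :
  ce (ham Phi L) x y = \sum_(A <- fpowerset L) tm Phi A (ext x) (ext y).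
Proof.
rewrite /ham ce_sum big_seq [RHS]big_seq; apply: eq_bigr => A.
by rewrite fpowersetE; exact: ce_emb.
Qed.

Lemma tm_shift (Phi : qinteraction R d m) A (a : site d) X Y : qtransl_inv Phi ->
  tm Phi (shift A a) (fun s => X (s - a)) (fun s => Y (s - a)) = tm Phi A X Y.
Proof.
move=> hP; rewrite /tm; congr (_ * _ %:R).
  by apply: hP => s t e; rewrite !ffunE e addrK.
congr nat_of_bool; apply/offeqP/offeqP => h s sA; last by apply: h; rewrite -shiftP.
by have := h (s + a); rewrite shiftP addrK; apply.
Qed.

Lemma tm_off (Phi : qinteraction R d m) A X Y : ce (Phi A) (res A (fun=> o)) (res A (fun=> o)) = 0 ->
  (forall s, s \in A -> X s = o) -> (forall s, s \in A -> Y s = o) -> tm Phi A X Y = 0.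
Proof.
by move=> h hX hY; rewrite /tm (eq_res hX) (eq_res hY) h mul0r.
Qed.

End Regions.

Section Embedding.
Import fintype boot.finset.
Variables (R : realType) (d m : nat) (o : 'I_m).
Local Notation C := R[i].
Implicit Types (A L : {fset site d}).
Local Notation qc A := {ffun (A : {fset site d}) -> 'I_m}.

Lemma vn2_ce (T : finType) (v : 'cV[C]_#|T|) : vn2 v = \sum_x nrm (v (enum_rank x) ord0) ^+ 2.
Proof. exact: sum_enum_rank. Qed.

Lemma mulv_ce (T : finType) (M : 'M[C]_#|T|) (v : 'cV[C]_#|T|) x :
  (M *m v) (enum_rank x) ord0 = \sum_y ce M x y * v (enum_rank y) ord0.
Proof. by rewrite mxE sum_enum_rank. Qed.

Definition ovr L A (u : qc L) (x' : qc A) : qc L :=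
  [ffun t => if insub (fsval t) : option A is Some a then x' a else u t].

Lemma ovr_in L A (u : qc L) (x' : qc A) : (A `<=` L)%fset -> res A (ext o (ovr u x')) = x'.
Proof.
move=> /fsubsetP AL; apply/ffunP => a; rewrite ffunE.
have aL : fsval a \in L by apply: AL; exact: fsvalP.
by rewrite -[fsval a]/(fsval [` aL]%fset) ext_in ffunE /= valK.
Qed.

Lemma ovr_out L A (u : qc L) (x' : qc A) (t : L) : fsval t \notin A -> ovr u x' t = u t.
Proof. by move=> tA; rewrite ffunE insubN. Qed.

Definition outp L A (x : qc L) : qc L := [ffun t => if fsval t \in A then o else x t].

Lemma ovrK L A (x : qc L) : ovr (outp A x) (res A (ext o x)) = x.
Proof.
apply/ffunP => t; rewrite ffunE; case: insubP => [a _ e|tA].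
  by rewrite ffunE e ext_in.
by rewrite ffunE (negPf tA).
Qed.

Lemma outp_ovr L A (u : qc L) (x' : qc A) : outp A (ovr u x') = outp A u.
Proof.
by apply/ffunP => t; rewrite !ffunE; case: ifPn => // tA; rewrite insubN ?tA.
Qed.

Lemma sum_ovr L A (K : nmodType) (F : qc L -> K) : (A `<=` L)%fset ->
  \sum_x F x = \sum_(u : qc L | outp A u == u) \sum_(x' : qc A) F (ovr u x').
Proof.
move=> AL; rewrite pair_big_dep /=.
rewrite (reindex_onto (fun p : qc L * qc A => ovr p.1 p.2) (fun x => (outp A x, res A (ext o x)))) /=; last first.
  by move=> x _; exact: ovrK.
apply: eq_bigl => -[u x'] /=; rewrite andbT outp_ovr ovr_in //.
by apply/eqP/eqP => [[->]|->].
Qed.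

Lemma offeq_ovr L A (u : qc L) (x' y' : qc A) : (A `<=` L)%fset ->
  offeq A (ext o (ovr u x')) (ext o (ovr u y')).
Proof.
move=> AL; apply/offeqP => s sA; have [sL|sL] := boolP (s \in L); last by rewrite !ext_out.
by rewrite -[s]/(fsval [` sL]%fset) !ext_in !ovr_out.
Qed.

(** The embedded operator is block diagonal in the configuration outside [A], and each block is a
    copy of [M]. *)
Lemma opb_emb L A (M : op R m A) c : (A `<=` L)%fset -> opb M c -> opb (emb L M) c.
Proof.
move=> AL [c0 hM]; split=> // v.
rewrite !vn2_ce !(sum_ovr _ AL) mulr_sumr; apply: ler_sum => u /eqP hu.
pose vu : 'cV[C]_#|{: qc A}| := \col_k v (enum_rank (ovr u (enum_val k))) ord0.
have vuE y' : vu (enum_rank y') ord0 = v (enum_rank (ovr u y')) ord0 by rewrite mxE enum_rankK.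
have := hM vu; rewrite !vn2_ce.
rewrite (eq_bigr (fun x' => nrm ((emb L M *m v) (enum_rank (ovr u x')) ord0) ^+ 2)) => [h|x' _].
  by apply: le_trans h _; rewrite ler_wpM2l ?exprn_ge0 //; apply: ler_sum => y' _; rewrite vuE.
rewrite !mulv_ce; congr (nrm _ ^+ 2); rewrite (sum_ovr _ AL) (bigD1 u) /= ?hu //.
rewrite [X in _ = _ + X]big1 ?addr0 => [|u' /andP[/eqP hu' nu]].
  apply: eq_bigr => y' _; rewrite vuE; congr (_ * _).
  by apply/esym; apply: etrans (ce_emb1 o M _ _ AL) _; rewrite !ovr_in // offeq_ovr // mulr1.
rewrite big1 // => y' _; apply/eqP; rewrite mulf_eq0; apply/orP; left.
apply/eqP; apply: etrans (ce_emb1 o M _ _ AL) _.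
case: offeqP => [h|_]; last by rewrite mulr0.
case/eqP: nu; rewrite -hu -hu'; apply/ffunP => t; rewrite !ffunE; case: ifPn => // tA.
by have := h _ tA; rewrite !ext_in !ovr_out.
Qed.

Lemma opb_exists n (M : 'M[C]_n) : exists c, opb M c.
Proof.
have hd i j : opb (delta_mx i j : 'M[C]_n) 1.
  split => // v; rewrite expr1n mul1r /vn2 (bigD1 i) //= big1 ?addr0 => [|k /negPf ki].
    have -> : (delta_mx i j *m v) i ord0 = v j ord0.
      rewrite mxE (bigD1 j) //= mxE !eqxx mul1r big1 ?addr0 // => l /negPf lj.
      by rewrite mxE lj andbF mul0r.
    by rewrite [leRHS](bigD1 j) //= lerDl; apply: sumr_ge0 => l _; rewrite exprn_ge0 ?nrm_ge0.
  rewrite mxE big1 ?nrm0 ?expr0n // => l _; by rewrite mxE ki mul0r.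
exists (\sum_i \sum_j nrm (M i j) * 1).
rewrite [M](matrix_sum_delta M); apply: opb_sum => i _; apply: opb_sum => j _.
by rewrite -matrix_sum_delta; apply: opbZ.
Qed.

Lemma vn2Z n (c : C) (v : 'cV[C]_n) : vn2 (c *: v) = nrm c ^+ 2 * vn2 v.
Proof. by rewrite /vn2 mulr_sumr; apply: eq_bigr => i _; rewrite mxE nrmM exprMn. Qed.

Lemma opnorm_ub n (M : 'M[C]_n) (v : 'cV[C]_n) : vnorm v = 1 -> vnorm (M *m v) <= opnorm M.
Proof.
move=> v1; apply: sup_upper_bound; last by exists v.
split; first by exists (vnorm (M *m v)), v.
have [c [c0 hc]] := opb_exists M; exists c => _ [u u1 <-].
have u2 : vn2 u = 1.
  have := u1; rewrite /= vnormE => e; have := sqr_sqrtr (vn2_ge0 u); by rewrite e expr1n.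
rewrite vnormE -[c]ger0_norm // -sqrtr_sqr ler_wsqrtr //.
by have := hc u; rewrite u2 mulr1.
Qed.

Lemma opb_opnorm n (M : 'M[C]_n.+1) : opb M (opnorm M).
Proof.
have ex1 : exists v : 'cV[C]_n.+1, vnorm v = 1.
  exists (delta_mx ord0 ord0); rewrite vnormE /vn2 (bigD1 ord0) //= big1 => [|k /negPf k0].
    by rewrite mxE eqxx nrm1 expr1n addr0 sqrtr1.
  by rewrite mxE k0 nrm0 expr0n.
have on0 : 0 <= opnorm M.
  by have [v v1] := ex1; apply: le_trans (opnorm_ub M v1); rewrite vnormE sqrtr_ge0.
split => // v; have [v0|v0] := eqVneq (vn2 v) 0.
  by rewrite (vn2_eq0 (eq_ind_r (fun x => x <= 0) (lexx 0) v0)) mulmx0 /vn2 !big1 ?mulr0 // => i _; rewrite mxE nrm0 expr0n.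
have vp : 0 < vn2 v by rewrite lt_def v0 vn2_ge0.
pose a := (Num.sqrt (vn2 v))^-1.
have a2 : a ^+ 2 = (vn2 v)^-1 by rewrite exprVn sqr_sqrtr // ltW.
have n1 : vnorm (rc a *: v) = 1.
  by rewrite vnormE vn2Z nrm_rc real_normK ?num_real // a2 mulVf ?sqrtr1.
have := opnorm_ub M n1; rewrite vnormE -scalemxAr vn2Z nrm_rc real_normK ?num_real // a2 => h.
have h2 : (vn2 v)^-1 * vn2 (M *m v) <= opnorm M ^+ 2.
  rewrite -[leLHS]sqr_sqrtr ?mulr_ge0 ?invr_ge0 ?vn2_ge0 // lerXn2r ?nnegrE ?sqrtr_ge0 //.
by rewrite -ler_pdivrMr // mulrC.
Qed.

End Embedding.

Lemma prod_bool (K : comPzRingType) (I : finType) (B : pred I) :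
  \prod_i ((B i)%:R : K) = [forall i, B i]%:R.
Proof.
have -> : [forall i, B i] = \big[andb/true]_i B i by rewrite big_andE; apply: eq_forallb.
by elim/big_rec2: _ => // i b y _ ->; rewrite -natrM mulnb.
Qed.

(** * The gapped interaction in a basis containing the vacuum vector *)

Section NormalForm.
Import fintype boot.finset.
Variables (R : realType) (d m : nat) (o : 'I_m).
Local Notation C := R[i].
Implicit Types (A L : {fset site d}) (s t : site d) (X Y : site d -> 'I_m).
Local Notation qc A := {ffun (A : {fset site d}) -> 'I_m}.
Local Notation exc := (exc o).
Local Notation rs := (rst o).
Local Notation P0 := (delta_mx o o : 'M[C]_m).

Variables (Phi0 : qinteraction R d m) (r : nat) (g : R).
Hypothesis NF : assumption1 Phi0 r P0 g.

Definition dl L (i j : L) : nat := dst (fsval i) (fsval j).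
(** Range [r] bounds each coordinate difference, so a region carrying [Phi0] has diameter at most
    [d * r] for the distance [dst]. *)
Definition rho : nat := (d * r)%N.

Lemma proj_configE L (S : {set L}) :
  proj_config P0 L [fset fsval t | t in S]%fset = dproj R (fun x : qc L => exc x == S).
Proof.
apply: ceP => x y; rewrite [RHS]ce_fmx /proj_config /tens; apply: etrans (ce_fmx _ _ _) _.
have mem (t : L) : (fsval t \in [fset fsval t | t in S]%fset) = (t \in S).
  by apply/imfsetP/idP => [[u uS /val_inj ->//]|tS]; exists t.
rewrite (eq_bigr (fun t : L => ((x t == y t) && ((x t != o) == (t \in S)))%:R)) => [|t _]; last first.
  rewrite mem; case: (t \in S); rewrite !mxE.
    have [->|xy] := eqVneq (x t) (y t); last first.
      have [h|h] := eqVneq (x t) o; last by rewrite /= subr0.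
      by move: xy; rewrite h eq_sym => /negPf ->; rewrite subr0.
    by case: (y t == o); rewrite /= ?subrr ?subr0.
  have [->|xy] := eqVneq (x t) (y t); first by case: (y t == o).
  have [h|h] //= := eqVneq (x t) o.
  by move: xy; rewrite h eq_sym => /negPf ->.
rewrite prod_bool; congr (nat_of_bool _)%:R; apply/forallP/andP => [h|[/eqP -> /eqP <-] t].
  split; first by apply/eqP/ffunP => t; have /andP[/eqP ] := h t.
  by apply/eqP/setP => t; rewrite inE; have /andP[_ /eqP ] := h t.
by rewrite inE !eqxx.
Qed.

Lemma card_fsetS L (S : {set L}) : #|` [fset fsval t | t in S]%fset| = #|S|.
Proof. by rewrite card_imfset /=; [rewrite -cardE|exact: val_inj]. Qed.

Lemma NF_at L (S : {set L}) (D := dproj R (fun x : qc L => exc x == S)) :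
  [/\ ham Phi0 L *m D = D *m ham Phi0 L,
      ham Phi0 L *m dproj R (fun x : qc L => exc x == set0) = 0 &
      psd (ham Phi0 L *m D - rc (g * #|S|%:R) *: D)].
Proof.
case: NF => _ _ _ _ h.
have /h : ([fset fsval t | t in S] `<=` L)%fset.
  by apply/fsubsetP => s /imfsetP[t _ ->]; exact: fsvalP.
rewrite proj_configE card_fsetS => -[h1 h2 h3]; split => //.
rewrite -h2; congr (_ *m _); rewrite -proj_configE; congr proj_config.
apply/fsetP => s; rewrite [RHS](_ : _ = false) //; apply/imfsetP => -[t] /=; rewrite finset.inE => //.
Qed.

Lemma ham_exc L (x y : qc L) : ce (ham Phi0 L) x y != 0 -> exc x = exc y.
Proof.
move=> n0; have [h _ _] := NF_at (exc x); move: (congr1 (fun M => ce M x y) h).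
rewrite ce_dprojl ce_dprojr eqxx mul1r; have [//|_] := eqVneq (exc y) (exc x).
by rewrite mul0r => /esym/eqP; rewrite (negPf n0).
Qed.

Lemma excited_vac (I : finType) : exc (vac I o) = set0.
Proof. by apply/setP => i; rewrite !inE ffunE eqxx. Qed.

Lemma ham_vac L : ce (ham Phi0 L) (vac L o) (vac L o) = 0.
Proof.
have [_ h _] := NF_at (set0 : {set L}).
move: (congr1 (fun M => ce M (vac L o) (vac L o)) h).
by rewrite ce_dprojr excited_vac eqxx mul1r ce0.
Qed.

Lemma ext_vac L : ext o (vac L o) = (fun=> o).
Proof. by apply/funext => s; rewrite /ext; case: insub => // t; rewrite ffunE. Qed.

(** Induction on the size of the region: the vacuum element of [ham Phi0 A] is zero, and it is the
    sum of those of all subregions. *)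
Lemma Phi0_vac A : ce (Phi0 A) (res A (fun=> o)) (res A (fun=> o)) = 0.
Proof.
have tmE B : ce (Phi0 B) (res B (fun=> o)) (res B (fun=> o)) = tm Phi0 B (fun=> o) (fun=> o).
  by rewrite /tm (_ : offeq _ _ _ = true) ?mulr1 //; apply/offeqP.
have [n An] : exists n, (#|` A| < n)%N by exists #|` A|.+1.
elim: n A An => // n IH A; rewrite ltnS => An.
have := ham_vac A; rewrite (ce_ham o) ext_vac (big_fsetD1 A) /=; last by rewrite fpowersetE fsubset_refl.
rewrite tmE [X in _ + X = _]big_seq big1 ?addr0 // => B.
rewrite in_fsetD1 fpowersetE => /andP[nB BA]; rewrite -tmE; apply: IH; apply: leq_trans An.
by apply: fproper_ltn_card; rewrite fproperEneq nB.
Qed.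

Lemma ham_adj (Phi : qinteraction R d m) L : (forall A, hermitian (Phi A)) ->
  adj (ham Phi L) = ham Phi L.
Proof.
move=> hP; apply: ceP => x y; rewrite ce_adj !(ce_ham o) rmorph_sum; apply: eq_bigr => A _.
rewrite /tm rmorphM rmorph_nat; congr (_ * _).
  by have := congr1 (fun M => ce M (res A (ext o x)) (res A (ext o y))) (hP A); rewrite /= ce_adj.
by congr (nat_of_bool _)%:R; apply/offeqP/offeqP => h s /h.
Qed.

Lemma near_range A s t : Phi0 A != 0 -> s \in A -> t \in A -> (dst s t <= rho)%N.
Proof.
move=> n0 sA tA; case: NF => _ fr _ _ _.
rewrite /dst /rho -[X in (_ <= X * r)%N]card_ord -sum_nat_const; apply: leq_sum => i _.
rewrite leqNgt; apply/negP => lt; case/eqP: n0; apply: fr; exists s, t, i; split => //.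
Qed.

Definition cut (p : pred (site d)) X : site d -> 'I_m := fun s => if p s then X s else o.

Lemma tm_cut (Phi : qinteraction R d m) (p : pred (site d)) A X Y : (forall s, s \in A -> p s) ->
  tm Phi A X Y = tm Phi A (cut p X) (cut p Y) * `[< forall s, ~~ p s -> X s = Y s >]%:R.
Proof.
move=> hA; rewrite /tm -mulrA -natrM mulnb; congr (_ * (nat_of_bool _)%:R).
  by congr (ce _ _ _); apply: eq_res => s /hA; rewrite /cut => ->.
apply/offeqP/andP => [h|[/offeqP h1 /asboolP h2] s sA].
  split; last by apply/asboolP => s ps; apply: h; apply: contra ps => /hA.
  by apply/offeqP => s /h; rewrite /cut => ->.
by have := h1 s sA; rewrite /cut; case: ifP => // /negbT /h2.
Qed.

Definition fs L (S : {set L}) : {fset site d} := [fset fsval t | t in S]%fset.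

Lemma in_fs L (S : {set L}) (t : L) : (fsval t \in fs S) = (t \in S).
Proof. by apply/imfsetP/idP => [[u uS /val_inj ->//]|tS]; exists t. Qed.

Lemma fsP L (S : {set L}) s : reflect (exists2 t : L, t \in S & s = fsval t) (s \in fs S).
Proof. exact: imfsetP. Qed.

Lemma ext_rs L (S : {set L}) (x : qc L) : ext o (rs S x) = cut (mem (fs S)) (ext o x).
Proof.
apply/funext => s; rewrite /cut /=; have [sL|sL] := boolP (s \in L); last first.
  by rewrite !ext_out //; case: ifP.
by rewrite (_ : s = fsval [` sL]%fset) // !ext_in ffunE in_fs.
Qed.

Lemma ext_rsC L (S : {set L}) (x : qc L) : ext o (rs S x) = cut (fun s => s \notin fs (~: S)) (ext o x).
Proof.
apply/funext => s; rewrite /cut /=; have [sL|sL] := boolP (s \in L); last first.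
  by rewrite !ext_out //; case: ifP.
by rewrite (_ : s = fsval [` sL]%fset) // !ext_in ffunE in_fs inE negbK.
Qed.

Lemma rs_eq_asbool L (S : {set L}) (x y : qc L) :
  (rs S x == rs S y) = `[< forall s, s \in fs S -> ext o x s = ext o y s >].
Proof.
apply/rst_eqP/asboolP => [h s /fsP[t tS ->]|h t tS]; first by rewrite !ext_in h.
by rewrite -!(ext_in o); apply: h; rewrite in_fs.
Qed.

Lemma emb_loc (Phi : qinteraction R d m) L A (S : {set L}) (x y : qc L) : (A `<=` L)%fset ->
  (A `<=` fs S)%fset ->
  ce (emb L (Phi A)) x y =
  ce (emb L (Phi A)) (rs S x) (rs S y) * (rs (~: S) x == rs (~: S) y)%:R.
Proof.
move=> AL /fsubsetP AS; rewrite !(ce_emb o) // (tm_cut _ (p := fun s => s \notin fs (~: S))).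
  rewrite !ext_rsC rs_eq_asbool; congr (_ * (nat_of_bool _)%:R); apply: asbool_equiv_eq.
  by split=> h s; have := h s; rewrite negbK.
by move=> s /AS /fsP[t tS ->]; rewrite in_fs inE tS.
Qed.

Lemma tm_add L (S T : {set L}) A (x y : qc L) : [disjoint S & T] ->
  exc x \subset S :|: T -> exc y \subset S :|: T -> (forall s, s \in A -> s \notin fs T) ->
  tm Phi0 A (ext o x) (ext o y) =
    tm Phi0 A (ext o (rs S x)) (ext o (rs S y)) * (rs T x == rs T y)%:R +
    (rs S x == rs S y)%:R * tm Phi0 A (ext o (rs T x)) (ext o (rs T y)).
Proof.
move=> dST xS yS AT; rewrite [X in _ + _ * X](tm_off (o := o)) ?mulr0 ?addr0.
- have e z : exc z \subset S :|: T -> ext o (rs S z) = cut (fun s => s \notin fs T) (ext o z).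
    move=> /subsetP hz; apply/funext => s; rewrite ext_rs /cut /=.
    have [sS|sS] := boolP (s \in fs S).
      have [t tS ->] := fsP _ _ sS; rewrite in_fs.
      by move/pred0P: dST => /(_ t) /=; rewrite tS /= => ->.
    have [sT|sT] := boolP (s \in fs T) => //=.
    have [sL|sL] := boolP (s \in L); last by rewrite ext_out.
    rewrite (_ : s = fsval [` sL]%fset) // ext_in; apply/eqP; rewrite eq_sym; apply: contraNT sS => zs.
    have /hz : [` sL]%fset \in exc z by rewrite inE.
    rewrite inE -!in_fs => /orP[//|h]; by rewrite h in sT.
  rewrite !e // (tm_cut _ (p := fun s => s \notin fs T)) // rs_eq_asbool.
  congr (_ * (nat_of_bool _)%:R); apply: asbool_equiv_eq.
  by split=> h s; have := h s; rewrite negbK.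
- exact: Phi0_vac.
- by move=> s /AT /negPf h; rewrite ext_rs /cut /= h.
- by move=> s /AT /negPf h; rewrite ext_rs /cut /= h.
Qed.

Local Notation nb L := (nball (@dl L) rho).

(** A nonzero term of [Phi0] has diameter at most [rho], so it misses [S] or misses [T]. On a part
    that it misses it sees only the vacuum and contributes 0 by [Phi0_vac]. *)
Lemma ham_add L (S T : {set L}) (x y : qc L) : [disjoint nbs (nb L) S & nbs (nb L) T] ->
  exc x \subset S :|: T -> exc y \subset S :|: T ->
  ce (ham Phi0 L) x y = ce (ham Phi0 L) (rs S x) (rs S y) * (rs T x == rs T y)%:R +
    (rs S x == rs S y)%:R * ce (ham Phi0 L) (rs T x) (rs T y).
Proof.
move=> dn xS yS; rewrite !(ce_ham o) mulr_suml mulr_sumr -big_split /=.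
have nr (U : {set L}) (t : L) : t \in U -> t \in nbs (nb L) U.
  by move=> tU; apply/bigcupP; exists t => //; rewrite inE /dl dst_refl.
have dST : [disjoint S & T].
  by apply: disjointWl (disjointWr _ dn); apply/subsetP => t; exact: nr.
apply: eq_bigr => A _.
have [[s0 s0A s0T]|h] := pselect (exists2 s, s \in A & s \in fs T); last first.
  by apply: tm_add => // s sA; apply/negP => sT; apply: h; exists s.
have [z|n0] := eqVneq (Phi0 A) 0.
  by rewrite /tm z !ce0 !mul0r mulr0 addr0.
rewrite addrC mulrC [X in _ + X]mulrC; apply: tm_add; rewrite 1?disjoint_sym // 1?setUC // => s sA.
apply/negP => sS; have [t tS es] := fsP _ _ sS; have [t' tT es'] := fsP _ _ s0T.
have := near_range n0 sA s0A; rewrite es es' => dtt.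
move/pred0P: dn => /(_ t') /=; rewrite (nr T t' tT) andbT => /negP; apply.
by apply/bigcupP; exists t => //; rewrite inE.
Qed.

End NormalForm.

Section Relabel.
Import fintype boot.finset.
Variable R : realType.
Local Notation C := R[i].

Lemma opnorm_le n (M : 'M[C]_n) c : opb M c -> opnorm M <= c.
Proof.
move=> [c0 hM]; have [v0|v0] := pselect (exists v : 'cV[C]_n, vnorm v = 1); last first.
  rewrite /opnorm (_ : classical_sets.image _ _ = classical_sets.set0) ?sup0 //.
  by apply/seteqP; split => // y [v v1 _]; case: v0; exists v.
have [v v1] := v0; apply: ge_sup; first by exists (vnorm (M *m v)), v.
move=> _ [u u1 <-]; rewrite vnormE -[c]ger0_norm // -sqrtr_sqr ler_wsqrtr //.
have := hM u; rewrite (_ : vn2 u = 1) ?mulr1 //.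
by have := vn2_ge0 u; move: u1 => /=; rewrite vnormE => h /sqr_sqrtr <-; rewrite h expr1n.
Qed.

Lemma opnorm_ge0 n (M : 'M[C]_n) : 0 <= opnorm M.
Proof.
have [[v v1]|v0] := pselect (exists v : 'cV[C]_n, vnorm v = 1).
  by apply: le_trans (opnorm_ub M v1); rewrite vnormE sqrtr_ge0.
rewrite /opnorm (_ : classical_sets.image _ _ = classical_sets.set0) ?sup0 //.
by apply/seteqP; split => // y [v v1 _]; case: v0; exists v.
Qed.

Lemma opb_opnorm0 n (M : 'M[C]_n) : (0 < n)%N -> opb M (opnorm M).
Proof. by case: n M => // n M _; exact: opb_opnorm. Qed.

Lemma opb_relabel (T T' : finType) (f : T' -> T) (M : 'M[C]_#|T|) (M' : 'M[C]_#|T'|) c :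
  bijective f -> (forall x y, ce M' x y = ce M (f x) (f y)) -> opb M c -> opb M' c.
Proof.
move=> fb hM [c0 h]; split => // v; have [h' fK hK] := fb.
pose w : 'cV[C]_#|T| := \col_k v (enum_rank (h' (enum_val k))) ord0.
have wE x : w (enum_rank (f x)) ord0 = v (enum_rank x) ord0 by rewrite mxE enum_rankK fK.
suff [-> ->] : vn2 v = vn2 w /\ vn2 (M' *m v) = vn2 (M *m w) by exact: h.
rewrite !vn2_ce; split; rewrite [RHS](reindex f) /=; try by apply: onW_bij.
  by apply: eq_bigr => x _; rewrite wE.
apply: eq_bigr => x _; rewrite !mulv_ce [in RHS](reindex f) /=; last by apply: onW_bij.
by congr (nrm _ ^+ 2); apply: eq_bigr => y _; rewrite wE hM.
Qed.

End Relabel.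

(** * Bonds of the perturbation *)

Section Bonds.
Import fintype boot.finset.
Variables (R : realType) (d m : nat) (o : 'I_m).
Local Notation C := R[i].
Implicit Types (A L : {fset site d}) (s t : site d).
Local Notation qc A := {ffun (A : {fset site d}) -> 'I_m}.
Local Notation exc := (exc o).
Local Notation rs := (rst o).

Lemma qc_gt0 A : (0 < #|{: qc A}|)%N.
Proof. by apply/card_gt0P; exists [ffun=> o]. Qed.

Lemma opnorm_shift (Phi : qinteraction R d m) A (a : site d) : qtransl_inv Phi ->
  opnorm (Phi (shift A a)) <= opnorm (Phi A).
Proof.
move=> hP; apply: opnorm_le.
have mem (s : A) : (fsval s + a)%R \in shift A a by rewrite shiftP addrK; exact: fsvalP.
have mem' (t : shift A a) : (fsval t - a)%R \in A by rewrite -shiftP; exact: fsvalP.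
pose f (x : qc (shift A a)) : qc A := [ffun s => x [` mem s]%fset].
pose f' (x : qc A) : qc (shift A a) := [ffun t => x [` mem' t]%fset].
apply: (opb_relabel (f := f)) (opb_opnorm0 (Phi A) (qc_gt0 A)).
  exists f' => x; apply/ffunP => s; rewrite !ffunE; congr (x _); apply: val_inj => /=.
    by rewrite subrK.
  by rewrite addrK.
move=> x y; apply: hP => s t e; rewrite ffunE; congr (_ _); apply: val_inj => /=; exact: e.
Qed.

Variable Ups : qinteraction R d m.
Hypothesis hUps : is_interaction Ups.

(** Bonds range over connected regions: [Ups] vanishes on the others, and connectedness is what
    prevents a bond from jumping over a window in [pl_spread]. *)
Definition conreg L : {fset {fset site d}} :=
  [fset A in fpowerset L | `[< connected_region A >]]%fset.

Lemma conregP L A : (A \in conreg L) = (A `<=` L)%fset && `[< connected_region A >].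
Proof. by rewrite /conreg !finmap.inE fpowersetE. Qed.

Definition bsup L (b : conreg L) : {set L} := [set t | fsval t \in fsval b].
Definition bop L (b : conreg L) : op R m L := emb L (Ups (fsval b)).
Definition bnrm L (b : conreg L) : R := opnorm (Ups (fsval b)).

Lemma conreg_sub L (b : conreg L) : (fsval b `<=` L)%fset.
Proof. by have := fsvalP b; rewrite conregP => /andP[]. Qed.

Lemma conreg_conn L (b : conreg L) : connected_region (fsval b).
Proof. by have := fsvalP b; rewrite conregP => /andP[_ /asboolP]. Qed.

Lemma fs_bsup L (b : conreg L) : fs (bsup b) = fsval b.
Proof.
apply/fsetP => s; apply/fsP/idP => [[t tb ->]|sb]; first by rewrite inE in tb.
have sL := fsubsetP (conreg_sub b) _ sb.
by exists [` sL]%fset; rewrite // inE.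
Qed.

Lemma card_bsup L (b : conreg L) : #|bsup b| = #|` fsval b|.
Proof. by rewrite -fs_bsup card_fsetS. Qed.

Lemma bsup0 L (b : conreg L) : bsup b != set0.
Proof.
have [/fset0Pn[s sb] _] := conreg_conn b.
have sL := fsubsetP (conreg_sub b) _ sb.
by apply/set0Pn; exists [` sL]%fset; rewrite inE.
Qed.

Lemma bsup_conn L (b : conreg L) (i : L) k (s t : L) : s \in bsup b -> t \in bsup b ->
  (dl i s < k)%N -> (k <= dl i t)%N -> exists2 u, u \in bsup b & dl i u = k.
Proof.
rewrite !inE => sb tb sk kt.
have [v vb e] := connected_dst (conreg_conn b) sb tb sk kt.
have vL := fsubsetP (conreg_sub b) _ vb.
by exists [` vL]%fset; rewrite ?inE.
Qed.

Lemma bop_loc L (b : conreg L) (S : {set L}) (x y : qc L) : bsup b \subset S ->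
  ce (bop b) x y = ce (bop b) (rs S x) (rs S y) * (rs (~: S) x == rs (~: S) y)%:R.
Proof.
move=> bS; apply: emb_loc; first exact: conreg_sub.
apply/fsubsetP => s; rewrite -fs_bsup => /fsP[t tb ->].
by rewrite in_fs (subsetP bS).
Qed.

Lemma bop_opb L (b : conreg L) : opb (bop b) (bnrm b).
Proof. by apply: (opb_emb o); [exact: conreg_sub|apply: opb_opnorm0; exact: qc_gt0]. Qed.

Lemma hamU_ham (Phi0 : qinteraction R d m) L :
  hamU (ham Phi0 L) (@bop L) setT = ham (fun A => Phi0 A + Ups A) L.
Proof.
have -> : hamU (ham Phi0 L) (@bop L) setT = ham Phi0 L + ham Ups L.
  rewrite /hamU; congr (_ + _); rewrite (eq_bigl xpredT) => [|b]; last by rewrite inE.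
  rewrite -(big_seq_fsetE _ _ xpredT (fun A => emb L (Ups A))) /=.
  apply: big_fset_incl => [|A]; first by apply/fsubsetP => A; rewrite conregP fpowersetE => /andP[].
  rewrite fpowersetE => AL; rewrite conregP AL /= => /asboolP nc.
  by case: hUps => _ _ ->; rewrite //; apply: ceP => x y; rewrite (ce_emb1 o) // !ce0 mul0r.
apply: ceP => x y; rewrite ceD !(ce_ham o) -big_split; apply: eq_bigr => A _.
by rewrite /tm ceD mulrDl.
Qed.

Variable kappa : R.
Hypothesis hk : (kappa_norm kappa Ups <= 1)%E.

(** Translating the bonds through [u] by [- u] gives distinct regions containing the origin, so the
    sum is at most a partial sum of [kappa_norm]. *)
Lemma bond_sum L (u : L) :
  \sum_(b : conreg L | u \in bsup b) expR (kappa * #|bsup b|%:R) * bnrm b <= 1.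
Proof.
have hT : qtransl_inv Ups by case: hUps.
pose sh (b : conreg L) := shift (fsval b) (- fsval u).
pose F (A : {fset site d}) : R := expR (kappa * #|` A|%:R) * opnorm (Ups A).
apply: (@le_trans _ _ (\sum_(b : conreg L | u \in bsup b) F (sh b))).
  apply: ler_sum => b _; rewrite /F /sh card_shift card_bsup ler_wpM2l ?expR_ge0 //.
  rewrite /bnrm; have := opnorm_shift (shift (fsval b) (- fsval u)) (- - fsval u) hT.
  by rewrite shiftK.
rewrite -lee_fin; apply: le_trans hk; rewrite /kappa_norm; apply: esum_ge.
pose r := [seq sh b | b <- enum [pred b : conreg L | u \in bsup b]].
have ur : uniq r.
  by rewrite map_inj_uniq ?enum_uniq // => b b' /shift_inj /val_inj.
exists [set` r]%classic.
  split; first exact: finite_seq.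
  move=> A /= /mapP[b]; rewrite mem_enum inE => ub ->.
  by rewrite shiftP opprK add0r; move: ub; rewrite inE.
rewrite -fsbig_seq // sumEFin lee_fin big_map big_enum_cond /=.
by rewrite le_eqVlt; apply/orP; left; apply/eqP; apply: eq_bigl => b; rewrite andbT.
Qed.

End Bonds.

(** * Smallness of the activities *)

Section Smallness.
Import fintype boot.finset.
Variables (R : realType) (d m : nat) (o : 'I_m) (r : nat).
Local Notation C := R[i].
Implicit Types (L : {fset site d}).
Variables (Ups : qinteraction R d m) (kappa kap g tau tmax : R).
Hypothesis hUps : is_interaction Ups.
Hypothesis hk : (kappa_norm kappa Ups <= 1)%E.
Hypothesis kap1 : 1 <= kap.
Local Notation rho := (rho d r).
Local Notation nb L := (nball (@dl d L) rho).

(** A bound on the size of a ball of radius [rho]: each of its points contributes at least 2^-rho to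
    a lattice sum that is at most 3^d. *)
Definition bz : nat := (3 ^ d * 2 ^ rho)%N.
Definition bigK : R := ((m ^ 2)%:R * kap) * (4 * xi R rho).
(** Calibrated so that bonds contribute at most 1/20: it collects the at most [bz] sites through
    which a nearby bond may pass and the estimate exp(x) - 1 <= x exp(x) for the bond factor. *)
Definition bigE : R := 20 * bz%:R * (2 * tmax * expR (2 * tmax)) + 1.

Hypothesis tau_gt0 : 0 <= tau.
Hypothesis tau_max : tau <= tmax.
Hypothesis tau_gap : expR (- (tau * g)) * (bz%:R * bigK ^+ (2 * bz)) <= 1 / 20.
Hypothesis kappa_big : bigK ^+ (2 * bz) * bigE <= expR kappa.

Lemma bigK1 : 1 <= bigK.
Proof.
have m0 : (0 < m)%N by case: (m) o => // -[].
rewrite /bigK mulr_ege1 //; last by rewrite mulr_ege1 ?xi1 // ler1n.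
by rewrite mulr_ege1 // ler1n expn_gt0 m0.
Qed.

Lemma card_nball L (i : L) : (#|nb L i| <= bz)%N.
Proof.
rewrite -(ler_nat R) /bz natrM !natrX -ler_pdivrMr ?exprn_gt0 //.
apply: le_trans (lattice_sum_le R L (fsval i)); rewrite -sumr_const mulr_suml.
rewrite big_mkcond /=; apply: ler_sum => j _; case: ifP => [|_]; last by rewrite invr_ge0 exprn_ge0.
rewrite inE /dl mul1r => h; rewrite lef_pV2 ?posrE ?exprn_gt0 //.
by rewrite ler_weXn2l // ler1n.
Qed.

Lemma dl_sym L (i j : L) : dl i j = dl j i.
Proof. exact: dst_sym. Qed.

Lemma card_nbs L (S : {set L}) : (#|nbs (nb L) S| <= bz * #|S|)%N.
Proof.
rewrite mulnC -sum_nat_const; apply: (@leq_trans (\sum_(i in S) #|nb L i|)).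
  rewrite /nbs; elim/big_rec2: _ => [|i n A _ h]; first by rewrite cards0.
  by apply: leq_trans (leq_card_setU _ _) _; rewrite leq_add2l.
by apply: leq_sum => i _; exact: card_nball.
Qed.

Lemma bnrm_le1 L (b : conreg L) : bnrm Ups b <= 1.
Proof.
have /set0Pn[u ub] := bsup0 b.
have kappa0 : 0 <= kappa.
  rewrite -ler_expR expR0; apply: le_trans kappa_big; rewrite mulr_ege1 ?exprn_ege1 ?bigK1 //.
  rewrite /bigE lerDr !mulr_ge0 ?expR_ge0 //; exact: le_trans tau_max.
apply: le_trans (bond_sum o hUps hk u); rewrite (bigD1 b) //=.
apply: (@le_trans _ _ (expR (kappa * #|bsup b|%:R) * bnrm Ups b)).
  by rewrite ler_peMl ?opnorm_ge0 // -expR0 ler_expR mulr_ge0.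
by rewrite lerDl; apply: sumr_ge0 => b' _; rewrite mulr_ge0 ?expR_ge0 ?opnorm_ge0.
Qed.

Lemma expR_sub1 (x : R) : 0 <= x -> expR x - 1 <= x * expR x.
Proof.
move=> x0; have := expR_ge1Dx (- x); rewrite expRN => h.
have p := expR_gt0 x; have := ler_wpM2l (ltW p) h; rewrite mulfV ?gt_eqF //; lra.
Qed.

(** One half of 1/10 is spent on excited sites, by [tau_gap]. The other half goes to bonds, where
    [kappa_big] lets exp(kappa |b|) absorb both the weight of the support and a factor [bigE]. *)
Lemma lattice_small L (i : L) :
  \sum_(c : conreg L + L | i \in llsupp (nb L) (@bsup d L) c)
    lzeta g tau (@bnrm R d m Ups L) c * bigK ^+ (2 * #|llsupp (nb L) (@bsup d L) c|) <= 1 / 10.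
Proof.
have K1 := bigK1; have K0 : 0 <= bigK by apply: le_trans K1.
have bz0 : 0 < bz%:R :> R by rewrite ltr0n /bz muln_gt0 !expn_gt0.
have tm0 : 0 <= tmax by apply: le_trans tau_max.
have cE : 0 <= 2 * tmax * expR (2 * tmax) by rewrite !mulr_ge0 ?expR_ge0.
have E1 : 1 <= bigE by rewrite /bigE lerDr !mulr_ge0 ?expR_ge0 // ltW.
rewrite big_sumType /= (_ : 1 / 10 = 1 / 20 + 1 / 20 :> R); last by field.
apply: lerD; last first.
  have nbs1 (j : L) : nbs (nb L) [set j] = nb L j by rewrite /nbs big_set1.
  apply: le_trans tau_gap; rewrite /llsupp /=.
  apply: (@le_trans _ _ (\sum_(j in nb L i) expR (- (tau * g)) * bigK ^+ (2 * bz))).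
    rewrite big_mkcond [leRHS]big_mkcond /=; apply: ler_sum => j _.
    rewrite nbs1 !inE dl_sym; case: ifP => // _.
    by rewrite ler_wpM2l ?expR_ge0 // ler_weXn2l // leq_mul2l card_nball.
  rewrite sumr_const -(mulr_natl _ #|_|) mulrCA.
  rewrite ler_wpM2l ?expR_ge0 // ler_wpM2r ?exprn_ge0 // ler_nat; exact: card_nball.
pose G (b : conreg L) : R := expR (kappa * #|bsup b|%:R) * bnrm Ups b * (2 * tmax * expR (2 * tmax)) / bigE.
have G0 b : 0 <= G b.
  by rewrite /G !mulr_ge0 ?expR_ge0 ?opnorm_ge0 ?invr_ge0 // (le_trans _ E1).
have hG b : (expR (2 * tau * bnrm Ups b) - 1) * bigK ^+ (2 * #|llsupp (nb L) (@bsup d L) (inl b)|) <= G b.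
  have v0 : 0 <= bnrm Ups b := opnorm_ge0 _; have v1 := bnrm_le1 b.
  have h1 : expR (2 * tau * bnrm Ups b) - 1 <= 2 * tmax * expR (2 * tmax) * bnrm Ups b.
    apply: le_trans (expR_sub1 _) _; first by rewrite !mulr_ge0.
    have a0 : 0 <= 2 * tau * bnrm Ups b by rewrite !mulr_ge0.
    rewrite [leRHS]mulrAC; apply: ler_pM => //.
      by rewrite ler_wpM2r // ler_wpM2l.
    rewrite ler_expR; apply: le_trans (_ : 2 * tau * 1 <= _); first by rewrite ler_wpM2l ?mulr_ge0.
    by rewrite mulr1 ler_wpM2l.
  have h2 : bigK ^+ (2 * #|llsupp (nb L) (@bsup d L) (inl b)|) <= expR (kappa * #|bsup b|%:R) / bigE.
    have b0 : (0 < #|bsup b|)%N by rewrite card_gt0 bsup0.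
    apply: (@le_trans _ _ (bigK ^+ (2 * bz * #|bsup b|))).
      by rewrite ler_weXn2l // -mulnA leq_mul2l card_nbs.
    rewrite ler_pdivlMr ?(lt_le_trans _ E1) // expRM_natr.
    apply: (@le_trans _ _ ((bigK ^+ (2 * bz) * bigE) ^+ #|bsup b|)).
      rewrite (exprMn _ (bigK ^+ (2 * bz)) bigE) -exprM ler_wpM2l ?exprn_ge0 //.
      by rewrite -[leLHS]expr1 ler_weXn2l.
    by rewrite lerXn2r ?nnegrE ?mulr_ge0 ?exprn_ge0 ?expR_ge0 // (le_trans _ E1).
  apply: le_trans (ler_pM _ _ h1 h2) _; rewrite ?exprn_ge0 ?subr_ge0 //.
    by rewrite -expR0 ler_expR !mulr_ge0.
  by rewrite /G le_eqVlt; apply/orP; left; apply/eqP; ring.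
apply: (@le_trans _ _ (\sum_(u in nb L i) \sum_(b : conreg L | u \in bsup b) G b)).
  rewrite (exchange_big_dep xpredT) //= [leLHS]big_mkcond; apply: ler_sum => b _.
  case: ifP => [/bigcupP[u ub iu]|_]; last by apply: sumr_ge0.
  apply: le_trans (hG b) _; rewrite (bigD1 u) /=; last by rewrite inE dl_sym ub andbT; rewrite inE in iu.
  by rewrite lerDl; apply: sumr_ge0.
apply: (@le_trans _ _ (\sum_(u in nb L i) (2 * tmax * expR (2 * tmax)) / bigE)).
  apply: ler_sum => u _; rewrite /G -2!mulr_suml -mulrA ler_piMl ?mulr_ge0 ?invr_ge0 ?(le_trans _ E1) //.
  exact: bond_sum.
rewrite sumr_const -(mulr_natl _ #|_|).
apply: (@le_trans _ _ (bz%:R * (2 * tmax * expR (2 * tmax) / bigE))).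
  by rewrite ler_wpM2r ?ler_nat ?card_nball // mulr_ge0 ?invr_ge0 ?(le_trans _ E1).
rewrite mulrA ler_pdivrMr ?(lt_le_trans _ E1) // /bigE.
by rewrite -(mulrA 20); move: (bz%:R * (2 * tmax * expR (2 * tmax))) => z; lra.
Qed.

End Smallness.

(** * Volume-independent form of the partition functions *)

Section BlockTransport.
Import fintype boot.finset.
Variables (R : realType) (T T' : finType).
Local Notation C := R[i].
Variables (up : T' -> T) (dn : T -> T') (M : 'M[C]_#|T|) (M' : 'M[C]_#|T'|).
Local Notation inblock z := (up (dn z) == z).
Hypothesis upK : cancel up dn.
Hypothesis Mclosed : forall x z, ce M (up x) z != 0 -> inblock z.
Hypothesis MM' : forall x y, ce M (up x) (up y) = ce M' x y.

Lemma sum_up (F : T -> C) : \sum_(z | inblock z) F z = \sum_x F (up x).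
Proof.
rewrite (reindex_onto up dn) /=; last by move=> z /eqP.
by apply: eq_bigl => x; rewrite upK !eqxx.
Qed.

(** By [Mclosed] the block of states in the range of [up] is never left, so a power of [M] started
    there is a power of the block [M']. *)
Lemma block_exp p x : (forall y, ce (M ^+ p) (up x) (up y) = ce (M' ^+ p) x y) /\
  (forall z, ~~ inblock z -> ce (M ^+ p) (up x) z = 0).
Proof.
elim: p x => [|p IH] x.
  rewrite !expr0; split=> [y|z nz]; first by rewrite !ce1 (inj_eq (can_inj upK)).
  by rewrite ce1; case: eqP => // e; rewrite -e upK eqxx in nz.
have e z : ce (M ^+ p.+1) (up x) z = \sum_y ce M' x y * ce (M ^+ p) (up y) z.
  rewrite ceXS (bigID (fun z' => inblock z')) /= [X in _ + X]big1 ?addr0 => [|z' nz'].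
    by rewrite sum_up; apply: eq_bigr => y _; rewrite MM'.
  have [->|/Mclosed h] := eqVneq (ce M (up x) z') 0; first by rewrite mul0r.
  by rewrite h in nz'.
split=> [y|z nz]; rewrite e.
  by rewrite ceXS; apply: eq_bigr => z _; have [-> _] := IH z.
by apply: big1 => y _; have [_ ->] := IH y; rewrite ?mulr0.
Qed.

Lemma block_mexp x y : ce (mexp M) (up x) (up y) = ce (mexp M') x y.
Proof. by apply: mexp_entry_eq => p; have [h _] := block_exp p x; exact: h. Qed.

Lemma block_mexp0 x z : ~~ inblock z -> ce (mexp M) (up x) z = 0.
Proof.
move=> nz; apply: etrans (_ : (enum_rank (up x) == enum_rank z)%:R = _); last first.
  by rewrite (inj_eq enum_rank_inj); case: eqP => // e; rewrite -e upK eqxx in nz.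
by apply: mexp_scalar_entry => p; have [_ h] := block_exp p.+1 x; exact: h.
Qed.

End BlockTransport.

Section CanonicalBlock.
Import fintype boot.finset.
Variables (R : realType) (d m k : nat) (o : 'I_m) (r : nat) (g : R).
Local Notation C := R[i].
Implicit Types (A B D L : {fset site d}) (s t : site d).
Local Notation qc A := {ffun (A : {fset site d}) -> 'I_m}.
Local Notation exc := (exc o).
Local Notation rs := (rst o).
Local Notation rho := (rho d r).
Local Notation nb L := (nball (@dl d L) rho).
Local Notation P0 := (delta_mx o o : 'M[C]_m).
Variables (Phi0 Ups : qinteraction R d m) (Q : 'I_k.+1 -> 'M[C]_m).
Hypothesis NF : assumption1 Phi0 r P0 g.
Hypothesis hUps : is_interaction Ups.

Definition qn (w : option (Omega d k)) s (a b : 'I_m) : C :=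
  if w is Some w then Q (w s) a b / Q (w s) o o else (a == b)%:R.

(** The generator on states excited only in [D]: terms of [Phi0] inside [B], terms of [Ups] inside
    [D]. No surrounding volume occurs, which gives access to translations. *)
Definition blk D B : op R m D := fmx (fun x y : qc D =>
  \sum_(A <- fpowerset B) tm Phi0 A (ext o x) (ext o y) +
  \sum_(A <- fpowerset D) tm Ups A (ext o x) (ext o y)).

Definition Zcan (beta : R) (w : option (Omega d k)) D B : C :=
  \sum_(x : qc D) \sum_(y : qc D)
    (\prod_(s : D) qn w (fsval s) (y s) (x s)) * ce (mexp (- rc beta *: blk D B)) x y.

Lemma Zcan_local beta (w w' : Omega d k) D B : (forall s, s \in D -> w s = w' s) ->
  Zcan beta (Some w) D B = Zcan beta (Some w') D B.
Proof.
move=> h; apply: eq_bigr => x _; apply: eq_bigr => y _; congr (_ * _).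
by apply: eq_bigr => s _; rewrite /qn h // fsvalP.
Qed.

Lemma perm_fpowerset_shift B (a : site d) :
  perm_eq (fpowerset (shift B a)) [seq shift A a | A <- fpowerset B].
Proof.
apply: uniq_perm; rewrite ?map_inj_uniq ?fset_uniq //; first exact: shift_inj.
move=> A; apply/idP/mapP => [|[A' A'B ->]]; last by rewrite fpowersetE shift_sub -fpowersetE.
rewrite fpowersetE => h; exists (shift A (- a)); last by rewrite shiftD addNr shift0.
by rewrite fpowersetE -(shift_sub _ _ a) shiftD addNr shift0.
Qed.

Lemma Zcan_shift beta (w : option (Omega d k)) D B (a : site d) :
  Zcan beta w (shift D a) (shift B a) = Zcan beta (omap (fun v s => v (s + a)) w) D B.
Proof.
have mem (s : D) : (fsval s + a)%R \in shift D a by rewrite shiftP addrK; exact: fsvalP.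
have mem' (t : shift D a) : (fsval t - a)%R \in D by rewrite -shiftP; exact: fsvalP.
pose j (s : D) : shift D a := [` mem s]%fset.
pose j' (t : shift D a) : D := [` mem' t]%fset.
have jK : cancel j j' by move=> s; apply: val_inj => /=; rewrite addrK.
have j'K : cancel j' j by move=> s; apply: val_inj => /=; rewrite subrK.
pose f (x : qc (shift D a)) : qc D := [ffun s => x (j s)].
pose f' (x : qc D) : qc (shift D a) := [ffun t => x (j' t)].
have fK : cancel f f' by move=> x; apply/ffunP => t; rewrite !ffunE j'K.
have f'K : cancel f' f by move=> x; apply/ffunP => t; rewrite !ffunE jK.
have fb : bijective f by exists f'.
have extf x s : ext o x s = ext o (f x) (s - a).
  have [sD|sD] := boolP (s \in shift D a); last by rewrite !ext_out // -shiftP.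
  rewrite (_ : s = fsval [` sD]%fset) // ext_in.
  rewrite (_ : fsval [` sD]%fset - a = fsval (j' [` sD]%fset)) // ext_in ffunE.
  by rewrite j'K.
have bE : forall x y, ce (- rc beta *: blk D B) (f x) (f y) =
    ce (- rc beta *: blk (shift D a) (shift B a)) x y.
  move=> x y; rewrite !ceZ; congr (_ * _); apply: etrans (ce_fmx _ _ _) (esym _).
  apply: etrans (ce_fmx _ _ _) _.
  rewrite !(perm_big _ (perm_fpowerset_shift _ _)) /= !big_map.
  have extf' z : ext o z = (fun s => ext o (f z) (s - a)) by apply/funext => s; exact: extf.
  congr (_ + _); apply: eq_bigr => A _; rewrite [ext o x]extf' [ext o y]extf'; apply: tm_shift.
    by case: NF => -[].
  by case: hUps.
have ib z : f (f' z) == z by rewrite f'K.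
rewrite /Zcan [RHS](reindex f) /=; last exact: onW_bij.
apply: eq_bigr => x _; rewrite [RHS](reindex f) /=; last exact: onW_bij.
apply: eq_bigr => y _; congr (_ * _).
  rewrite (reindex j) /=; last by apply: onW_bij; exists j'.
  by apply: eq_bigr => s _; rewrite !ffunE; case: (w).
by apply/esym/(block_mexp (up := f) (dn := f')).
Qed.

Variable L : {fset site d}.

Definition q0L (x : option {ffun L -> 'I_k.+1}) (i : L) (a b : 'I_m) : C :=
  if x is Some w then Q (w i) a b / Q (w i) o o else (a == b)%:R.

Lemma prod_fsub D (F : site d -> C) : (D `<=` L)%fset ->
  (forall s, s \in L -> s \notin D -> F s = 1) -> \prod_(i : L) F (fsval i) = \prod_(i : D) F (fsval i).
Proof.
move=> DL h; rewrite -(big_seq_fsetE _ _ xpredT) /= -(big_seq_fsetE _ _ xpredT) /=.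
by apply/esym/big_fset_incl.
Qed.

Hypothesis Qo : forall j, Q j o o != 0.

Lemma hamU_closed (S : {set L}) (c : C) :
  closedon o S (c *: hamU (ham Phi0 L) (@bop R d m Ups L) (bonds_in (@bsup d L) S)).
Proof.
move=> x y xS; rewrite ceZ mulf_eq0 negb_or => /andP[_]; rewrite /hamU ceD => nz.
have [z|/(ham_exc NF) <- //] := eqVneq (ce (ham Phi0 L) x y) 0.
move: nz; rewrite z add0r ce_sum => nz.
suff [b] : exists b, (b \in bonds_in (@bsup d L) S) && (ce (bop Ups b) x y != 0).
  move=> /andP[]; rewrite inE => bS; rewrite (bop_loc o _ _ _ bS).
  case: (rst_eqP _ _ _ _) => [h _|_]; last by rewrite mulr0 eqxx.
  apply/subsetP => i; rewrite inE => yi; apply/negP => /negP iS.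
  have := h i; rewrite inE iS => /(_ isT) e; case/negP: iS; apply: (subsetP xS).
  by rewrite inE e.
apply/existsP; apply: contraNT nz => /existsPn h; apply/eqP/big1 => b bS.
by have := h b; rewrite bS /= negbK => /eqP.
Qed.

(** A term of [Phi0] not contained in [fs B] misses [D], since its diameter is at most [rho]; it
    sees only the vacuum and vanishes. The sites outside [D] contribute 1 by the normalisation in
    [q0L]. *)
Lemma Zvol_can N' tau (w : option (Omega d k)) (B : {set L}) (D := fs (inner (nb L) B)) :
  Zvol N' o (@dl d L) rho (ham Phi0 L) tau (@bsup d L) (@bop R d m Ups L) q0L
    (omap (fun v => res L v) w) B = Zcan (betaN N' tau) w D (fs B).
Proof.
set S := inner _ B in D *; set beta := betaN N' tau.
have DL : (D `<=` L)%fset by apply/fsubsetP => s /fsP[t _ ->]; exact: fsvalP.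
have BL : (fs B `<=` L)%fset by apply/fsubsetP => s /fsP[t _ ->]; exact: fsvalP.
pose up (x : qc D) : qc L := res L (ext o x).
pose dn (x : qc L) : qc D := res D (ext o x).
have ext_up x : ext o (up x) = ext o x.
  apply/funext => s; have [sL|sL] := boolP (s \in L).
    by rewrite (_ : s = fsval [` sL]%fset) // ext_in ffunE.
  by rewrite !ext_out //; apply: contra sL; exact: (fsubsetP DL).
have upK : cancel up dn by move=> x; rewrite /dn ext_up res_ext.
have ibE (z : qc L) : (up (dn z) == z) = (exc z \subset S).
  apply/eqP/subsetP => [<- i|h].
    rewrite inE ffunE; apply: contraR => iS; rewrite ext_out // /D in_fs //.
  apply/ffunP => i; rewrite ffunE; have [iS|iS] := boolP (i \in S).
    have iD : fsval i \in D by rewrite in_fs.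
    by rewrite (_ : fsval i = fsval [` iD]%fset) // ext_in ffunE ext_in.
  rewrite ext_out ?in_fs //; apply/eqP; rewrite eq_sym; apply: contraNT iS => zi.
  by apply: h; rewrite inE.
have excS x : exc (up x) \subset S by rewrite -ibE upK.
set M := - rc beta *: hamU (ham Phi0 L) (@bop R d m Ups L) (bonds_in (@bsup d L) S).
have cl x z : ce M (up x) z != 0 -> up (dn z) == z.
  by rewrite ibE; apply: hamU_closed.
have MM' x y : ce M (up x) (up y) = ce (- rc beta *: blk D (fs B)) x y.
  rewrite !ceZ; congr (_ * _); apply: etrans (esym (ce_fmx _ _ _)).
  rewrite /hamU ceD (ce_ham o) ce_sum !ext_up; congr (_ + _).
    apply/esym/big_fset_incl; first by apply/fsubsetP => A; rewrite !fpowersetE => h; apply: fsubset_trans h BL.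
    move=> A; rewrite !fpowersetE => AL nAB.
    have [z|n0] := eqVneq (Phi0 A) 0; first by rewrite /tm z ce0 mul0r.
    have nD s : s \in A -> s \notin D.
      move=> sA; apply: contra nAB => /fsP[t tS es]; apply/fsubsetP => u uA.
      have uL := fsubsetP AL _ uA; rewrite (_ : u = fsval [` uL]%fset) // in_fs.
      rewrite inE in tS; apply: (subsetP tS); rewrite inE /dl -es; exact: (near_range NF n0).
    by apply: (tm_off (o := o)); [exact: (Phi0_vac NF)| |] => s /nD h; rewrite ext_out.
  rewrite (eq_bigr (fun b : conreg L => tm Ups (fsval b) (ext o x) (ext o y))) => [|b _]; last first.
    by apply: etrans (ce_emb o _ _ _ (conreg_sub b)) _; rewrite !ext_up.
  rewrite (eq_bigl (fun b : conreg L => (fsval b `<=` D)%fset)) => [|b]; last first.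
    rewrite inE -[fsval b in RHS]fs_bsup; apply/subsetP/fsubsetP => h s.
      by move=> /fsP[t tb ->]; rewrite in_fs h.
    by rewrite -!in_fs; exact: h.
  rewrite -(big_seq_fsetE _ _ (fun A => (A `<=` D)%fset) (fun A => tm Ups A (ext o x) (ext o y))) /=.
  rewrite big_fset_condE; apply: big_fset_incl.
    by apply/fsubsetP => A; rewrite !finmap.inE fpowersetE => /andP[].
  move=> A; rewrite !finmap.inE !fpowersetE => AD; rewrite (fsubset_trans AD DL) AD andbT /= => /asboolP nc.
  by case: hUps => _ _ h; rewrite /tm h // ce0 mul0r.
rewrite /Zvol -/S -/M ce_tr.
rewrite (eq_bigr (fun a : qc L => \sum_(b : qc L) (\prod_i q0L (omap (fun v => res L v) w) i (a i) (b i)) *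
    ((exc b \subset S)%:R * ce (mexp M) b a))) => [|a _]; last first.
  rewrite ceM; apply: eq_bigr => b _; congr (_ * _); first exact: ce_fmx.
  by rewrite ce_dprojl.
rewrite exchange_big /= (bigID (fun b : qc L => up (dn b) == b)) /= [X in _ + X]big1 ?addr0 => [|b nb]; last first.
  by apply: big1 => a _; rewrite -ibE (negPf nb) mul0r mulr0.
rewrite (sum_up upK); apply: eq_bigr => x _.
rewrite (bigID (fun b : qc L => up (dn b) == b)) /= [X in _ + X]big1 ?addr0 => [|b nb]; last first.
  by rewrite (block_mexp0 upK cl MM') // !mulr0.
rewrite (sum_up upK); apply: eq_bigr => y _; rewrite excS mul1r (block_mexp upK cl MM'); congr (_ * _).
rewrite (eq_bigr (fun i : L => qn w (fsval i) (ext o y (fsval i)) (ext o x (fsval i)))) => [|i _].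
  rewrite (prod_fsub (F := fun s => qn w s (ext o y s) (ext o x s)) DL); first by apply: eq_bigr => i _; rewrite !ext_in.
  move=> s _ sD; rewrite !ext_out // /qn; case: (w) => [v|]; rewrite ?eqxx //.
  by rewrite mulfV.
by rewrite !ffunE /qn /q0L; case: (w) => [v|] //=; rewrite ffunE.
Qed.

End CanonicalBlock.

(** * From polymer coefficients to a classical potential *)

Section FinitePotential.
Import fintype boot.finset.
Variables (R : realType) (d m k : nat) (o : 'I_m) (r : nat) (g : R).
Local Notation C := R[i].
Implicit Types (A B D L : {fset site d}) (s t : site d).
Local Notation qc A := {ffun (A : {fset site d}) -> 'I_m}.
Local Notation rho := (rho d r).
Local Notation nb L := (nball (@dl d L) rho).
Local Notation P0 := (delta_mx o o : 'M[C]_m).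
Variables (Phi0 Ups : qinteraction R d m) (Q : 'I_k.+1 -> 'M[C]_m).
Variables (kappa kap tau tmax qmax : R) (N' : nat).
Hypothesis NF : assumption1 Phi0 r P0 g.
Hypothesis hUps : is_interaction Ups.
Hypothesis hk : (kappa_norm kappa Ups <= 1)%E.
Hypothesis kap1 : 1 <= kap.
Hypothesis tau_gt0 : 0 <= tau.
Hypothesis tau_max : tau <= tmax.
Hypothesis tau_gap : expR (- (tau * g)) * ((bz d r)%:R * bigK d m r kap ^+ (2 * bz d r)) <= 1 / 20.
Hypothesis kappa_big : bigK d m r kap ^+ (2 * bz d r) * bigE d r tmax <= expR kappa.
Hypothesis Qpos : forall j, 0 < Q j o o.
Hypothesis Qkap : forall j a b, nrm (Q j a b / Q j o o) <= kap.
Definition qq j : R := complex.Re (Q j o o).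
Hypothesis Qmax : forall j, `|ln (qq j)| <= qmax.

Local Notation Zl L := (Zvol N' o (@dl d L) rho (ham Phi0 L) tau (@bsup d L) (@bop R d m Ups L) (q0L o Q (L := L))).
Local Notation psil L := (psivol N' o None (@dl d L) rho (ham Phi0 L) tau (@bsup d L) (@bop R d m Ups L) (q0L o Q (L := L))).
Local Notation ell L := (ellvol N' o (@dl d L) rho (ham Phi0 L) tau (@bsup d L) (@bop R d m Ups L) (q0L o Q (L := L))).

Definition subS L A : {set L} := [set t | fsval t \in A].
(** The 1/2 undoes the square of the modulus in [ellvol]; the one-site term restores the factors
    [Q j o o] divided out in [q0L]. *)
Definition potS L (S : {set L}) (w : Omega d k) : R :=
  - (psil L (Some (res L w)) S / 2) - \sum_(i in S | #|S| == 1%N) ln (qq (w (fsval i))).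
Definition pot L A (w : Omega d k) : R := if (A `<=` L)%fset then potS (subS L A) w else 0.

Lemma fs_subS L A : (A `<=` L)%fset -> fs (subS L A) = A.
Proof.
move=> AL; apply/fsetP => s; apply/fsP/idP => [[t tb ->]|sb]; first by rewrite inE in tb.
have sL := fsubsetP AL _ sb.
by exists [` sL]%fset; rewrite // inE.
Qed.

Lemma subS_fs L (S : {set L}) : subS L (fs S) = S.
Proof. by apply/setP => t; rewrite inE in_fs. Qed.

Lemma fs_sub L (S : {set L}) : (fs S `<=` L)%fset.
Proof. by apply/fsubsetP => s /fsP[t _ ->]; exact: fsvalP. Qed.

Lemma sum_fpowerset (K : nmodType) L (F : {fset site d} -> K) :
  \sum_(A <- fpowerset L) F A = \sum_(S : {set L}) F (fs S).
Proof.
rewrite -[RHS]big_enum -(big_map (@fs d L) xpredT) /=; apply: perm_big.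
have fsI : injective (@fs d L) by move=> S T e; rewrite -(subS_fs S) e subS_fs.
apply: uniq_perm; rewrite ?fset_uniq ?(map_inj_uniq fsI) ?enum_uniq // => A.
rewrite fpowersetE; apply/idP/mapP => [AL|[S _ ->]]; last exact: fs_sub.
by exists (subS L A); rewrite ?fs_subS // mem_enum.
Qed.

Lemma Qo0 j : Q j o o != 0. Proof. by rewrite gt_eqF. Qed.

Lemma QoE j : Q j o o = rc (qq j).
Proof. by apply: (esym (RRe_real _)); rewrite ger0_real // ltW. Qed.

Lemma qq_gt0 j : 0 < qq j.
Proof. by have := Qpos j; rewrite QoE /rc ltcR. Qed.

Lemma kap_ok L x (i : L) a b : nrm (q0L o Q x i a b) <= kap.
Proof.
rewrite /q0L; case: x => [v|]; first exact: Qkap.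
by rewrite nrm_bool; case: (a == b); rewrite // (le_trans ler01).
Qed.

Lemma q0L1 L x (i : L) : q0L o Q x i o o = 1.
Proof. by rewrite /q0L; case: x => [v|]; rewrite ?eqxx // mulfV // Qo0. Qed.

Let dl0 L (i : L) : dl i i = 0%N. Proof. exact: dst_refl. Qed.
Let dl_tri L (i j l : L) : (dl i l <= dl i j + dl j l)%N. Proof. exact: dst_tri. Qed.
Let g0 : 0 <= g. Proof. by case: NF => _ _ _ /ltW. Qed.
Let Hadj L : adj (ham Phi0 L) = ham Phi0 L.
Proof. by apply: (ham_adj o); case: NF => -[]. Qed.
Let Hgap L (S : {set L}) : psd (ham Phi0 L *m dproj R (fun x => exc o x == S)
  - rc (g * #|S|%:R) *: dproj R (fun x => exc o x == S)).
Proof. by have [] := NF_at NF S. Qed.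

Lemma Zl_neq0 L x (B : {set L}) : Zl L x B != 0.
Proof.
exact: (@Zvol_neq0 R L (conreg L) (option {ffun L -> 'I_k.+1}) m N' o
  (@dl d L) rho (@dl0 L) (ham Phi0 L) g tau (@bsup d L) (@bop R d m Ups L)
  (@bnrm R d m Ups L) g0 tau_gt0 (Hadj L) (fun x y => ham_exc NF (x := x) (y := y)) (ham_vac NF L) (@Hgap L)
  (fun S T x y => ham_add NF (S := S) (T := T) (x := x) (y := y)) (@bsup0 d L)
  (fun b S x y => @bop_loc R d m o Ups L b S x y) (fun b => bop_opb o Ups b)
  (q0L o Q (L := L)) kap (@q0L1 L) (@kap_ok L) kap1
  (fun i => lattice_small o hUps hk kap1 tau_gt0 tau_max tau_gap kappa_big i)).
Qed.

Lemma single (I : finType) (S : {set I}) i : (i \in S) && (#|S| == 1%N) = (S == [set i]).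
Proof.
apply/andP/eqP => [[iS /cards1P[j e]]|->]; last by rewrite set11 cards1.
by move: iS; rewrite e inE => /eqP ->.
Qed.

Lemma pot_sum L w : \sum_(A <- fpowerset L) pot L A w =
  (ell L None setT - ell L (Some (res L w)) setT) / 2 - \sum_(i : L) ln (qq (w (fsval i))).
Proof.
rewrite sum_fpowerset (eq_bigr (fun S => potS S w)) => [|S _]; last first.
  by rewrite /pot fs_sub subS_fs.
rewrite /potS big_split /= !sumrN -mulr_suml; congr (_ - _).
  rewrite (eq_bigl (fun S : {set L} => S \subset setT)) => [|S]; last by rewrite subsetT.
  by rewrite mobK -mulNr opprB.
rewrite (exchange_big_dep xpredT) //=; apply: eq_bigr => i _.
rewrite (big_pred1 [set i]) // => S; exact: single.
Qed.

(** Half the constant of [psivol_bound] with lattice sum 3^d, plus a bound on the one-site term. *)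
Definition potc : R := 2 * xi R rho * 3 ^+ d + qmax.

Lemma pot_bound L : exists b : {fset site d} -> R, [/\ forall A, 0 <= b A,
  forall A w, `|pot L A w| <= b A &
  forall (F : {fset {fset site d}}) s n,
    (forall A, A \in F -> s \in A /\ exists2 u, u \in A & (n <= dst s u)%N) ->
    \sum_(A <- F) b A <= potc * 2 ^- n].
Proof.
have hs (i : L) : \sum_(j : L) (2 : R) ^- dl i j <= 3 ^+ d by exact: lattice_sum_le.
have [b [b0 hb tail]] := @psivol_bound R L (conreg L) (option {ffun L -> 'I_k.+1}) m N' o None
  (@dl d L) rho (@dl0 L) (@dl_tri L) (@dl_sym d L) (ham Phi0 L) g tau (@bsup d L) (@bop R d m Ups L)
  (@bnrm R d m Ups L) g0 tau_gt0 (Hadj L) (fun x y => ham_exc NF (x := x) (y := y)) (ham_vac NF L) (@Hgap L)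
  (fun S T x y => ham_add NF (S := S) (T := T) (x := x) (y := y)) (@bsup0 d L)
  (fun (b : conreg L) (i : L) n (s t : L) => @bsup_conn d L b i n s t)
  (fun b S x y => @bop_loc R d m o Ups L b S x y) (fun b => bop_opb o Ups b)
  (q0L o Q (L := L)) kap (@q0L1 L) (@kap_ok L) kap1
  (fun i => lattice_small o hUps hk kap1 tau_gt0 tau_max tau_gap kappa_big i) (3 ^+ d) hs.
pose one (S : {set L}) : R := \sum_(i in S | #|S| == 1%N) qmax.
have qm0 : 0 <= qmax by apply: le_trans (Qmax ord0).
have one0 S : 0 <= one S by apply: sumr_ge0.
pose bS S := b S / 2 + one S.
have bS0 S : 0 <= bS S by rewrite addr_ge0 // mulr_ge0.
exists (fun A => if (A `<=` L)%fset then bS (subS L A) else 0); split.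
- by move=> A; case: ifP.
- move=> A w; rewrite /pot; case: ifP => _; last by rewrite normr0.
  rewrite /potS; apply: le_trans (ler_normB _ _) _; rewrite normrN; apply: lerD.
    by rewrite normrM (@ger0_norm _ 2^-1) // ler_wpM2r.
  by apply: le_trans (ler_norm_sum _ _ _) _; apply: ler_sum => i _; exact: Qmax.
move=> F s n hF.
have pc0 : 0 <= potc by rewrite /potc addr_ge0 // !mulr_ge0 ?exprn_ge0 // (le_trans _ (xi1 R rho)).
have [sL|sL] := boolP (s \in L); last first.
  rewrite big_seq big1 ?mulr_ge0 ?invr_ge0 ?exprn_ge0 // => A /hF[sA _].
  by case: ifP => // /fsubsetP /(_ _ sA); rewrite (negPf sL).
pose i : L := [` sL]%fset.
pose PS (S : {set L}) := (i \in S) && [exists u : L in S, (n <= dl i u)%N].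
pose bb A : R := if (A `<=` L)%fset then bS (subS L A) else 0.
pose f A : R := if A \in F then bb A else 0.
rewrite -/bb; have bb0 A : 0 <= bb A by rewrite /bb; case: ifP.
apply: (@le_trans _ _ (\sum_(S : {set L} | PS S) bS S)).
  rewrite (_ : \sum_(A <- F) bb A = \sum_(A <- fpowerset L) f A).
    rewrite sum_fpowerset [leRHS]big_mkcond /=; apply: ler_sum => S _.
    rewrite /f; case: ifP => [/hF[sS [u uS nu]]|_]; last by case: ifP.
    rewrite /bb fs_sub subS_fs (_ : PS S) // /PS -in_fs sS /=.
    by have [t tS e] := fsP _ _ uS; apply/exists_inP; exists t => //; rewrite /dl -e.
  pose F' := [fset A in F | (A `<=` L)%fset]%fset.
  transitivity (\sum_(A <- F') f A).
    rewrite big_seq (eq_bigr f) => [|A AF]; last by rewrite /f AF.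
    rewrite -big_seq; apply/esym/big_fset_incl.
      by apply/fsubsetP => A; rewrite !finmap.inE => /andP[].
    by move=> A AF; rewrite !finmap.inE AF /= /f /bb => /negPf ->; case: ifP.
  apply: big_fset_incl; first by apply/fsubsetP => A; rewrite !finmap.inE fpowersetE => /andP[].
  by move=> A; rewrite !finmap.inE fpowersetE /f => ->; rewrite andbT => /negPf ->.
rewrite big_split /= -mulr_suml /potc mulrDl; apply: lerD.
  by have := tail i n; set X := \sum_(A | _) b A; lra.
rewrite /one (exchange_big_dep xpredT) //=.
(* A singleton reaches distance [n] only for [n = 0], so the one-site term does not spoil the
   decay. *)
have PS1 i' : PS [set i'] -> i' = i /\ n = 0%N.
  rewrite /PS inE => /andP[/eqP <- /exists_inP[u]]; rewrite inE => /eqP ->.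
  by rewrite dl0 leqn0 => /eqP.
rewrite (bigD1 i) //= [X in _ + X]big1 ?addr0 => [|i' ii']; last first.
  apply: big1 => S /andP[hS]; rewrite single => /eqP e; rewrite e in hS.
  by have [e' _] := PS1 _ hS; rewrite e' eqxx in ii'.
rewrite (eq_bigl (fun S => (S == [set i]) && PS [set i])) => [|S]; last first.
  rewrite single; apply/andP/andP => [[hS /eqP e]|[/eqP -> h]]; last by rewrite eqxx.
  by rewrite -e eqxx.
have [/PS1[_ ->]|ni] := boolP (PS [set i]); last first.
  by rewrite big1 ?mulr_ge0 ?invr_ge0 ?exprn_ge0 // => S; rewrite andbF.
by rewrite (eq_bigl _ _ (fun S => andbT _)) big_pred1_eq expr0 invr1 mulr1.
Qed.

Definition innr B : {fset site d} :=
  [fset s in B | `[< forall t, (dst s t <= rho)%N -> t \in B >]]%fset.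

Lemma innrP B s : reflect (forall t, (dst s t <= rho)%N -> t \in B) (s \in innr B).
Proof.
rewrite !finmap.inE /=; apply: (iffP andP) => [[_ /asboolP]//|h].
by split; [apply: h; rewrite dst_refl|apply/asboolP].
Qed.

Definition ellc (w : option (Omega d k)) B : R :=
  ln (nrm (Zcan o Phi0 Ups Q (betaN N' tau) w (innr B) B) ^+ 2).

(** The coefficients written without the volume. The subtraction of cardinals is exact because [B]
    is a subset of [A]. *)
Definition potcan A (w : Omega d k) : R :=
  - (\sum_(B <- fpowerset A) (-1) ^+ (#|` A| - #|` B|) * (ellc (Some w) B - ellc None B)) / 2
  - \sum_(s <- A | #|` A| == 1%N) ln (qq (w s)).

Definition far L A := forall s t, s \in A -> (dst s t <= rho)%N -> t \in L.

(** Once [L] contains the [rho]-neighbourhood of [A], the inner part of a subset of [A] is the same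
    in [L] as in the whole lattice, and [Zvol_can] applies. *)
Lemma pot_far L A w : far L A -> pot L A w = potcan A w.
Proof.
move=> hf; have AL : (A `<=` L)%fset by apply/fsubsetP => s sA; apply: hf sA _; rewrite dst_refl.
have cA : #|subS L A| = #|` A| by rewrite -[in RHS](fs_subS AL) /fs card_fsetS.
rewrite /pot AL /potS /potcan cA mulNr; congr (- (_ / 2) - _).
  rewrite /psivol /mob.
  transitivity (\sum_(B <- fpowerset L) if (B `<=` A)%fset then
      (-1) ^+ (#|` A| - #|` B|) * (ellc (Some w) B - ellc None B) else 0).
    rewrite sum_fpowerset [LHS]big_mkcond; apply: eq_bigr => U _ /=.
    rewrite (_ : (fs U `<=` A)%fset = (U \subset subS L A)); last first.
      apply/fsubsetP/subsetP => [h t tU|h s /fsP[t tU ->]]; first by rewrite inE h // in_fs.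
      by have := h t tU; rewrite inE.
    case: ifP => // UA; rewrite cardsD (setIidPr UA) cA -card_fsetS; congr (_ * _).
    have iE : fs (inner (nb L) U) = innr (fs U).
      apply/fsetP => s; apply/fsP/innrP => [[t]|h].
        rewrite inE => /subsetP ht -> u du.
        have tU : t \in U by apply: ht; rewrite inE dl0.
        have uL : u \in L.
          by apply: (hf (fsval t)) du; have := subsetP UA t tU; rewrite inE.
        by rewrite (_ : u = fsval [` uL]%fset) // in_fs; apply: ht; rewrite inE.
      have /fsP[t tU e] : s \in fs U by apply: h; rewrite dst_refl.
      exists t => //; rewrite inE; apply/subsetP => u; rewrite inE => du.
      by rewrite -in_fs; apply: h; rewrite e.
    have eE v : ell L (omap (fun v => res L v) v) U = ellc v (fs U).
      by rewrite /ellvol (Zvol_can NF hUps Qo0) iE.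
    by have := eE None; have := eE (Some w) => /= -> ->.
  rewrite [RHS]big_seq [RHS](eq_bigr (fun B => if (B `<=` A)%fset then
      (-1) ^+ (#|` A| - #|` B|) * (ellc (Some w) B - ellc None B) else 0)) => [|B]; last first.
    by rewrite fpowersetE => ->.
  rewrite -big_seq; apply/esym/big_fset_incl.
    by apply/fsubsetP => B; rewrite !fpowersetE => h; exact: fsubset_trans h AL.
  by move=> B _; rewrite fpowersetE => /negPf ->.
rewrite !big_mkcondr /=; case: (#|` A| == 1%N); last by rewrite !big1.
transitivity (\sum_(s <- L) if s \in A then ln (qq (w s)) else 0).
  rewrite big_mkcond (big_seq_fsetE _ L xpredT (fun s => if s \in A then ln (qq (w s)) else 0)) /=.
  by apply: eq_bigr => i _; rewrite inE.
rewrite [RHS]big_seq [RHS](eq_bigr (fun s => if s \in A then ln (qq (w s)) else 0)) => [|s ->//].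
rewrite -big_seq; apply/esym/big_fset_incl => // s _ /negPf -> //.
Qed.

Lemma pot_local L A w w' : (forall s, s \in A -> w s = w' s) -> pot L A w = pot L A w'.
Proof.
move=> h; rewrite /pot; case: ifP => // AL; rewrite /potS.
have -> : \sum_(i in subS L A | #|subS L A| == 1%N) ln (qq (w (fsval i))) =
    \sum_(i in subS L A | #|subS L A| == 1%N) ln (qq (w' (fsval i))).
  by apply: eq_bigr => i /andP[]; rewrite inE => /h ->.
suff -> : psil L (Some (res L w)) (subS L A) = psil L (Some (res L w')) (subS L A) by [].
apply: eq_mob => U /subsetP UA.
have e v : ell L (Some (res L v)) U = ln (nrm (Zcan o Phi0 Ups Q (betaN N' tau) (Some v) (fs (inner (nb L) U)) (fs U)) ^+ 2).
  by rewrite /ellvol -(Zvol_can NF hUps Qo0).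
rewrite !e (@Zcan_local _ _ _ _ _ _ _ _ _ w w') // => s /fsP[t]; rewrite inE => /subsetP ht ->.
by apply: h; have /UA := ht t (nball_refl _ (@dl0 L) t); rewrite inE.
Qed.

Lemma innr_shift B (a : site d) : innr (shift B a) = shift (innr B) a.
Proof.
apply/fsetP => s; rewrite shiftP; apply/innrP/innrP => h t dt.
  have := h (t + a); rewrite shiftP addrK; apply.
  by rewrite -(dst_add _ _ (- a)) addrK.
by rewrite shiftP; apply: h; rewrite dst_add.
Qed.

Lemma potcan_shift A (a : site d) w : potcan (shift A a) w = potcan A (fun s => w (s + a)).
Proof.
rewrite /potcan card_shift; congr (- _ / 2 - _); last first.
  by rewrite [in LHS]/shift big_mkcond big_imfset /=; [rewrite -big_mkcond|move=> s t _ _ /addIr].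
rewrite (perm_big _ (perm_fpowerset_shift A a)) /= big_map; apply: eq_bigr => B _.
by rewrite card_shift /ellc innr_shift !(Zcan_shift Q NF hUps).
Qed.

Lemma pot_shift L L' A (a : site d) w : far L A -> far L' (shift A a) ->
  pot L' (shift A a) w = pot L A (fun s => w (s + a)).
Proof. by move=> h h'; rewrite !pot_far // potcan_shift. Qed.

End FinitePotential.

(** * Gibbs weights of measured configurations *)

Section GibbsTrace.
Variable R : realType.
Local Notation C := R[i].

Lemma gibbs_trE n (beta : R) (H B : 'M[C]_n) :
  gibbs_tr beta H B = \tr (mexp (- rc beta *: H) *m B).
Proof.
have h := mexp_trace (- rc beta *: H) B.
rewrite (_ : (fun k => _) = fun k => \sum_(j < k) rc ((- beta) ^+ j / (j`!)%:R) * \tr (H ^+ j *m B)) in h.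
  exact: (limCE h).
apply/funext => k; apply: eq_bigr => j _.
rewrite mxexprZ -scalemxAl mxtraceZ mulrA; congr (_ * _).
by rewrite /rc -rmorphN -rmorphXn -rmorphM mulrC.
Qed.

Lemma adjX n (A : 'M[C]_n) p : adj A = A -> adj (A ^+ p) = A ^+ p.
Proof.
move=> hA; elim: p => [|p IH]; first by rewrite expr0 -[1]/(1%:M) adj1.
by rewrite {1}exprSr -mulmxE adjM IH hA mulmxE -exprS.
Qed.

Lemma adj_mexp n (A : 'M[C]_n) : adj A = A -> adj (mexp A) = mexp A.
Proof.
move=> hA; apply/matrixP => i j; rewrite mxE mxE; apply: cvgC_uniq (mexp_series A i j).
have := mexp_series A j i; rewrite /cvgC => h.
suff -> : (fun k => nrm (\sum_(p < k) rc (p`!%:R^-1) * (A ^+ p) i j - (mexp A j i)^*%C)) =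
  (fun k => nrm (\sum_(p < k) rc (p`!%:R^-1) * (A ^+ p) j i - mexp A j i)) by [].
apply/funext => k /=; rewrite -[RHS]nrm_conj rmorphB rmorph_sum; congr (nrm (_ - _)).
apply: eq_bigr => p _; rewrite rmorphM -[in LHS](adjX p hA) !mxE; congr (_ * _).
exact: (esym (conjc_real _)).
Qed.

Lemma tr_sq_ge0 n (B : 'M[C]_n) : 0 <= \tr (adj B *m B).
Proof.
apply: sumr_ge0 => i _; rewrite mxE; apply: sumr_ge0 => j _.
by rewrite !mxE mulrC -rc_nrm2 /rc ler0c sqr_ge0.
Qed.

End GibbsTrace.

Section Tensors.
Import fintype boot.finset.
Variables (R : realType) (d m k : nat) (o : 'I_m).
Local Notation C := R[i].
Implicit Types (L V : {fset site d}).
Local Notation qc A := {ffun (A : {fset site d}) -> 'I_m}.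
Local Notation cc A := {ffun (A : {fset site d}) -> 'I_k.+1}.

Lemma ce_tens L (F : L -> 'M[C]_m) (x y : qc L) : ce (tens F) x y = \prod_(s : L) F s (x s) (y s).
Proof. exact: ce_fmx. Qed.

Lemma tens_mul L (F G : L -> 'M[C]_m) : tens F *m tens G = tens (fun s => F s *m G s).
Proof.
apply: ceP => x y; rewrite ceM ce_tens.
rewrite (eq_bigr (fun s => \sum_c F s (x s) c * G s c (y s))) => [|s _]; last by rewrite mxE.
rewrite bigA_distr_bigA /=; apply: eq_bigr => z _; rewrite !ce_tens -big_split.
by [].
Qed.

Lemma adj_tens L (F : L -> 'M[C]_m) : adj (tens F) = tens (fun s => adj (F s)).
Proof.
apply: ceP => x y; rewrite ce_adj !ce_tens rmorph_prod.
by apply: eq_bigr => s _; rewrite !mxE.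
Qed.

Lemma tens1 L : tens (fun s : L => 1%:M : 'M[C]_m) = 1%:M.
Proof.
apply: ceP => x y; rewrite ce_tens ce1 (eq_bigr (fun s => (x s == y s)%:R)) => [|s _]; last by rewrite mxE.
rewrite prod_bool; congr (nat_of_bool _)%:R; apply/forallP/eqP => [h|-> s //].
by apply/ffunP => s; apply/eqP.
Qed.

Variable Q : 'I_k.+1 -> 'M[C]_m.
Hypothesis Q1 : \sum_j Q j = 1%:M.

Definition exk L (y : cc L) : Omega d k := fun s => if insub s : option L is Some t then y t else ord0.

Lemma exk_in L (y : cc L) (t : L) : exk y (fsval t) = y t.
Proof. by rewrite /exk valK. Qed.

(** Inserting the resolution of the identity [Q1] at the sites outside [V] produces the sum over all
    extensions of [x]. *)
Lemma emb_tens V L (x : cc V) : (V `<=` L)%fset ->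
  emb L (tens (fun s : V => Q (x s))) =
  \sum_(y : cc L | res V (exk y) == x) tens (fun s : L => Q (y s)).
Proof.
move=> VL; apply: ceP => a b; rewrite ce_sum; apply: etrans (ce_emb1 o _ _ _ VL) _.
rewrite ce_tens.
pose xx s : option 'I_k.+1 := omap x (insub s : option V).
have xx_in (t : V) : xx (fsval t) = Some (x t) by rewrite /xx valK.
have xx_out s : s \notin V -> xx s = None by move=> h; rewrite /xx insubN.
pose ok s j := if xx s is Some j' then j == j' else true.
pose G s j := Q j (ext o a s) (ext o b s).
rewrite (eq_bigl (fun y : cc L => y \in family (fun s : L => ok (fsval s)))) => [|y]; last first.
  apply/eqP/familyP => [h s|h].
    rewrite /in_mem /= /ok; have [sV|sV] := boolP (fsval s \in V); last by rewrite xx_out.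
    rewrite (_ : fsval s = fsval [` sV]%fset) // xx_in.
    by rewrite -h ffunE /= exk_in.
  apply/ffunP => t; rewrite ffunE; have tL := fsubsetP VL _ (fsvalP t).
  have := h [` tL]%fset; rewrite /in_mem /= /ok xx_in => /eqP <-.
  exact: (exk_in y [` tL]%fset).
rewrite [RHS](eq_bigr (fun y : cc L => \prod_(s : L) G (fsval s) (y s))) => [|y _]; last first.
  by rewrite ce_tens; apply: eq_bigr => s _; rewrite /G !ext_in.
rewrite -(bigA_distr_big_dep (fun s : L => ok (fsval s)) (fun s j => G (fsval s) j)) /=.
have gE s : \sum_(j | ok s j) G s j = if xx s is Some j then G s j else (ext o a s == ext o b s)%:R.
  rewrite /ok; case: (xx s) => [j|]; first by rewrite big_pred1_eq.
  by have := congr1 (fun M : 'M[C]_m => M (ext o a s) (ext o b s)) Q1; rewrite summxE mxE.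
rewrite (eq_bigr (fun s : L => if xx (fsval s) is Some j then G (fsval s) j else
   (ext o a (fsval s) == ext o b (fsval s))%:R)) => [|s _]; last exact: gE.
have [h|nh] := offeqP V (ext o a) (ext o b).
  rewrite mulr1 (prod_fsub (D := V) (F := fun s => if xx s is Some j then G s j else
     (ext o a s == ext o b s)%:R) VL) => [|s sL sV]; last by rewrite xx_out // h ?eqxx.
  by apply: eq_bigr => t _; rewrite xx_in /G !ffunE.
rewrite mulr0; apply/esym.
have [s sV ns] : exists2 s, s \notin V & ext o a s != ext o b s.
  apply: contrapT => hs; apply: nh => s sV; apply/eqP; apply: contrapT => ns.
  by apply: hs; exists s => //; apply/negP.
have sL : s \in L by apply: contraNT ns => sL; rewrite !ext_out.
by rewrite (bigD1 [` sL]%fset) //= xx_out // (negPf ns) mul0r.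
Qed.

End Tensors.

Section Weights.
Import fintype boot.finset.
Variables (R : realType) (d m k : nat) (o : 'I_m) (r : nat) (g : R).
Local Notation C := R[i].
Implicit Types (L V : {fset site d}).
Local Notation cc A := {ffun (A : {fset site d}) -> 'I_k.+1}.
Variables (Phi0 Ups : qinteraction R d m) (Q : 'I_k.+1 -> 'M[C]_m) (tau : R) (N' : nat).
Hypothesis NF : assumption1 Phi0 r (delta_mx o o : 'M[C]_m) g.
Hypothesis hUps : is_interaction Ups.
Hypothesis Qpos : forall j, 0 < Q j o o.
Hypothesis Qherm : forall j, adj (Q j) = Q j.
Hypothesis Qidem : forall j, Q j *m Q j = Q j.
Hypothesis Q1 : \sum_j Q j = 1%:M.
Local Notation Phi := (fun A => Phi0 A + Ups A).
Local Notation beta := (betaN N' tau).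
Local Notation Zl L := (Zvol N' o (@dl d L) (rho d r) (ham Phi0 L) tau (@bsup d L) (@bop R d m Ups L) (q0L o Q (L := L))).
Local Notation ell L := (ellvol N' o (@dl d L) (rho d r) (ham Phi0 L) tau (@bsup d L) (@bop R d m Ups L) (q0L o Q (L := L))).
Hypothesis Znz : forall L x (B : {set L}), Zl L x B != 0.

Definition wt L (y : cc L) : C := \tr (mexp (- rc beta *: ham Phi L) *m tens (fun s : L => Q (y s))).
Definition potw L (y : cc L) : R :=
  expR (- \sum_(A <- fpowerset L) pot o r Phi0 Ups Q tau N' L A (exk y)).

(** Writing exp(- beta H) as the square of a self-adjoint [mexp G], and using T^2 = T for the
    product projector, the trace becomes that of an operator times its adjoint. *)
Lemma wt_ge0 L (y : cc L) : 0 <= wt y.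
Proof.
rewrite /wt; set T := tens _; set H := ham _ _.
have Ha : adj H = H.
  apply: (ham_adj o) => A; rewrite /hermitian adjD; congr (_ + _); last by case: hUps => h _ _; exact: h.
  by case: NF => -[h _ _] *; exact: h.
have Ta : adj T = T.
  by rewrite /T adj_tens; congr tens; apply/funext => s; exact: Qherm.
have TT : T *m T = T.
  by rewrite /T tens_mul; congr tens; apply/funext => s; exact: Qidem.
pose G := - rc (beta / 2) *: H.
have Ga : adj G = G by rewrite /G /rc -rmorphN adjZ Ha.
have -> : - rc beta *: H = G *+ 2.
  rewrite mulr2n /G -scalerDl; congr (_ *: _); rewrite -opprD /rc -rmorphD; congr (- _).
  by congr (_%:C)%C; lra.
rewrite mexp_muln expr2 -mulmxE -TT mulmxA mxtrace_mulC.
have := tr_sq_ge0 (mexp G *m T); rewrite adjM adj_mexp // Ta.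
by rewrite !mulmxA.
Qed.

Lemma Zl_wt L (y : cc L) : Zl L (Some y) setT * \prod_(i : L) rc (qq o Q (y i)) = wt y.
Proof.
have iT : inner (nball (@dl d L) (rho d r)) setT = setT.
  by apply/setP => i; rewrite [LHS]inE [RHS]inE; apply: subsetT.
have bT : bonds_in (@bsup d L) setT = setT by apply/setP => b; rewrite [LHS]inE [RHS]inE; apply: subsetT.
have dT : dproj R (fun z => exc o z \subset (setT : {set L})) = 1%:M.
  by apply: ceP => a b; rewrite ce1 [LHS]ce_fmx subsetT andbT.
rewrite /Zvol iT bT dT mul1mx (hamU_ham o hUps) mulrC -mxtraceZ scalemxAl mxtrace_mulC.
rewrite /wt; congr (\tr (_ *m _)); apply: ceP => a b; rewrite ceZ ce_tens.
rewrite [X in _ * X](ce_fmx _ a b) -big_split; apply: eq_bigr => i _ /=.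
by rewrite -(QoE Qpos) mulrC mulfVK // Qo0.
Qed.

(** The trace is nonnegative, so it equals its modulus. By [pot_sum] the logarithm of that modulus
    is minus the total potential, up to the constant of the unmeasured trace. *)
Lemma wt_exp L (y : cc L) : wt y = rc (expR (ell L None setT / 2) * potw y).
Proof.
have z0 := Znz (Some y) setT.
have h0 := wt_ge0 y.
have e : wt y = rc (complex.Re (wt y)) by apply: esym (RRe_real _); rewrite ger0_real.
have r0 : 0 <= complex.Re (wt y) by move: h0; rewrite {1}e /rc ler0c.
have wE : wt y = rc (nrm (wt y)) by rewrite [in RHS]e nrm_rc ger0_norm.
rewrite wE -Zl_wt nrmM nrm_prod; congr rc.
have yE : res L (exk y) = y by apply/ffunP => t; rewrite ffunE exk_in.
rewrite /potw pot_sum yE opprB -expRD.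
have -> : ell L None setT / 2 + (\sum_(i : L) ln (qq o Q (exk y (fsval i))) -
  (ell L None setT - ell L (Some y) setT) / 2) = ell L (Some y) setT / 2 + \sum_(i : L) ln (qq o Q (y i)).
  rewrite (eq_bigr (fun i => ln (qq o Q (y i)))) => [|i _]; last by rewrite exk_in.
  by set S := \sum_(i : L) _; lra.
rewrite expRD expR_sum; congr (_ * _); last first.
  apply: eq_bigr => i _; rewrite nrm_rc lnK ?posrE ?(qq_gt0 Qpos) //.
  by rewrite ger0_norm // ltW // (qq_gt0 Qpos).
have p : 0 < nrm (Zl L (Some y) setT) by rewrite lt_def nrm_ge0 nrm_eq0 z0.
have -> : ell L (Some y) setT / 2 = ln (nrm (Zl L (Some y) setT)).
  by rewrite /ellvol lnXn //; set z := ln _; rewrite mulr2n; lra.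
by rewrite lnK ?posrE.
Qed.

(** The common factor of [wt_exp] cancels in the quotient, which leaves the marginals of a classical
    finite-volume Gibbs measure with potential [pot]. *)
Lemma fv_marginal_pot n V (x : cc V) : (V `<=` box d n)%fset ->
  fv_marginal Q beta Phi n x =
  (\sum_(y : cc (box d n) | res V (exk y) == x) potw y) / \sum_(y : cc (box d n)) potw y.
Proof.
move=> VL; rewrite /fv_marginal /gibbs_state !gibbs_trE (emb_tens o Q1 _ VL).
set c := expR (ell (box d n) None setT / 2).
have sE (P : pred (cc (box d n))) : \tr (mexp (- rc beta *: ham Phi (box d n)) *m
    \sum_(y | P y) tens (fun s => Q (y s))) = rc (c * \sum_(y | P y) potw y).
  rewrite mulmx_sumr raddf_sum /= mulr_sumr /rc rmorph_sum; apply: eq_bigr => y _.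
  exact: wt_exp.
have -> : (1 : op R m (box d n)) = \sum_(y : cc (box d n)) tens (fun s => Q (y s)).
  rewrite -[LHS]/(1%:M) -tens1.
  have e0 := emb_tens o Q1 (V := fset0) (L := box d n) [ffun=> ord0] (fsub0set _).
  apply: etrans (_ : _ = emb (box d n) (tens (fun s : (fset0 : {fset site d}) => Q ([ffun=> ord0] s)))) _.
    apply: ceP => a b; rewrite ce_tens (ce_emb1 o) ?fsub0set // ce_tens.
    rewrite [X in _ = X * _]big_pred0 ?mul1r; last by move=> s; have := fsvalP s; rewrite in_fset0.
    rewrite (eq_bigr (fun s => (a s == b s)%:R)) => [|s _]; last by rewrite mxE.
    rewrite prod_bool; congr (nat_of_bool _)%:R; apply/forallP/offeqP => [h s _|h s].
      have [sL|sL] := boolP (s \in box d n); last by rewrite !ext_out.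
      by rewrite (_ : s = fsval [` sL]%fset) // !ext_in; apply/eqP.
    by rewrite -!(ext_in o); apply/eqP/h; rewrite in_fset0.
  rewrite e0; apply: eq_bigl => y; apply/eqP/ffunP => s.
  by have := fsvalP s; rewrite in_fset0.
rewrite !sE /rc -fmorphV -rmorphM /= invfM mulrACA mulfV ?mul1r // gt_eqF //.
exact: expR_gt0.
Qed.

End Weights.

(** * Limits of potentials and DLR equations *)

Section FilterLimits.
Local Open Scope classical_set_scope.
Variables (R : realType) (T : Type) (F : set_system T).
Hypothesis FP : ProperFilter F.

Lemma ler_flim (f h : T -> R) (l l' : R) : f @ F --> l -> h @ F --> l' ->
  (\forall t \near F, f t <= h t) -> l <= l'.
Proof.
move=> fl hl fh; rewrite -subr_ge0; apply: (cvgr_to_ge (cvgB hl fl)).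
by apply: filterS fh => t; rewrite subr_ge0.
Qed.

Lemma cvg_fsum (I : Type) (r : seq I) (P : pred I) (u : I -> T -> R) (l : I -> R) :
  (forall i, P i -> u i @ F --> l i) ->
  (fun t => \sum_(i <- r | P i) u i t) @ F --> \sum_(i <- r | P i) l i.
Proof.
move=> h; elim: r => [|i r IH].
  by rewrite big_nil; under eq_fun do rewrite big_nil; exact: cvg_cst.
rewrite big_cons; under eq_fun do rewrite big_cons.
by case: ifP => // Pi; apply: cvgD => //; exact: h.
Qed.

End FilterLimits.

Section UltraLimit.
Local Open Scope classical_set_scope.
Variables (R : realType) (T : Type) (F : set_system T).
Hypothesis FU : UltraFilter F.
Local Instance FP : ProperFilter F := ultra_proper.
Implicit Types u v : T -> R.

Definition ulim u : R := lim (u @ F).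

Lemma image_ultra u : UltraFilter (u @ F).
Proof.
split=> [|G GP FG]; first exact: fmap_proper_filter.
apply/seteqP; split=> // S GS; have [//|FS] := in_ultra_setVsetC (u @^-1` S) FU.
have GC : G (~` S) by apply: FG.
by have := filter_ex (filterI GS GC) => -[x []].
Qed.

(** Compactness of a segment. One ultrafilter serves all regions and configurations at once, where
    subsequences would call for a diagonal argument. *)
Lemma ulim_cvg u c : (forall t, `|u t| <= c) -> u @ F --> ulim u.
Proof.
move=> uc; have /= := @segment_compact R (- c) c; rewrite compact_ultra => /(_ _ (image_ultra u)).
case=> [|l [_ ul]]; last by apply/cvg_ex; exists l.
by apply: nearW => t /=; rewrite in_itv /= -ler_norml.
Qed.

Lemma ulimE u l : u @ F --> l -> ulim u = l.
Proof. by move=> /(cvg_lim (@Rhausdorff R)). Qed.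

Lemma ulim_norm u v c : (forall t, `|u t| <= v t) -> (forall t, v t <= c) -> `|ulim u| <= ulim v.
Proof.
move=> uv vc; have v0 t : `|v t| <= c by rewrite ger0_norm // (le_trans _ (uv t)).
have uc t : `|u t| <= c by apply: le_trans (vc t).
have hu : (fun t => `|u t|) @ F --> `|ulim u| by apply: cvg_norm; exact: (ulim_cvg uc).
apply: (@ler_flim R T F FP _ _ _ _ hu (ulim_cvg v0)); exact: nearW.
Qed.

Lemma ulim_sum_le (I : Type) (r : seq I) (u : I -> T -> R) c :
  (forall i, exists c', forall t, `|u i t| <= c') ->
  (forall t, \sum_(i <- r) u i t <= c) -> \sum_(i <- r) ulim (u i) <= c.
Proof.
move=> hu hc; apply: (ler_flim FP (f := fun t => \sum_(i <- r) u i t) (h := cst c)); last exact: nearW.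
  by apply: (cvg_fsum FP) => i _; have [c' hc'] := hu i; exact: ulim_cvg hc'.
exact: cvg_cst.
Qed.

End UltraLimit.

Section SummableFamilies.
Local Open Scope classical_set_scope.
Variables (R : realType) (d : nat).
Implicit Types (S : set {fset site d}) (f : {fset site d} -> R) (G H : {fset {fset site d}}).

Lemma esum_fin_le S (f : {fset site d} -> R) c : (forall A, 0 <= f A) ->
  (forall G, [set` G] `<=` S -> \sum_(A <- G) f A <= c) ->
  (\esum_(A in S) (f A)%:E <= c%:E)%E.
Proof.
move=> f0 hc; apply: ge_ereal_sup => _ [X [finX XS] <-].
have [G XG] := finite_fsetP.1 finX; rewrite XG in XS *.
by rewrite -fsbig_seq ?fset_uniq // sumEFin lee_fin hc.
Qed.

Lemma esum_split S f G c : (forall A, 0 <= f A) -> [set` G] `<=` S ->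
  (forall H, [set` H] `<=` S -> [disjoint G & H]%fset -> \sum_(A <- H) f A <= c) ->
  exists e, [/\ (\esum_(A in S) (f A)%:E)%E = (\sum_(A <- G) f A + e)%:E, 0 <= e & e <= c].
Proof.
move=> f0 GS hc; have f0' A : (0 <= (f A)%:E)%E by rewrite lee_fin.
rewrite (esumID [set` G]) // (setIidr GS).
rewrite esum_fset // -fsbig_seq ?fset_uniq // sumEFin.
have lec : (\esum_(A in S `&` ~` [set` G]) (f A)%:E <= c%:E)%E.
  apply: esum_fin_le => // H HS; apply: hc; first by move=> A /HS[].
  by apply/fdisjointP => A AG; apply/negP => /HS[_]; apply.
have ge0 : (0 <= \esum_(A in S `&` ~` [set` G]) (f A)%:E)%E by apply: esum_ge0.
move: lec ge0; case: (\esum_(A in _) _)%E => // e; rewrite !lee_fin => lec ge0.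
by exists e; rewrite EFinD.
Qed.

(** The remainders of the positive and of the negative parts both lie between 0 and [c], hence so
    does the modulus of their difference. *)
Lemma rsum_approx S f G c : [set` G] `<=` S ->
  (forall H, [set` H] `<=` S -> [disjoint G & H]%fset -> \sum_(A <- H) `|f A| <= c) ->
  `|rsum S f - \sum_(A <- G) f A| <= c.
Proof.
move=> GS hc.
have p0 A : 0 <= Num.max (f A) 0 by rewrite le_max lexx orbT.
have n0 A : 0 <= Num.max (- f A) 0 by rewrite le_max lexx orbT.
have [p [hp p0' pc]] : exists e, [/\ (\esum_(A in S) (Num.max (f A) 0)%:E)%E =
    (\sum_(A <- G) Num.max (f A) 0 + e)%:E, 0 <= e & e <= c].
  apply: esum_split => // H HS dH; apply: le_trans (hc H HS dH); apply: ler_sum => A _.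
  by rewrite ge_max ler_norm normr_ge0.
have [n [hn n0' nc]] : exists e, [/\ (\esum_(A in S) (Num.max (- f A) 0)%:E)%E =
    (\sum_(A <- G) Num.max (- f A) 0 + e)%:E, 0 <= e & e <= c].
  apply: esum_split => // H HS dH; apply: le_trans (hc H HS dH); apply: ler_sum => A _.
  by rewrite ge_max normr_ge0 -normrN ler_norm.
rewrite /rsum hp hn /=.
have -> : \sum_(A <- G) f A = \sum_(A <- G) Num.max (f A) 0 - \sum_(A <- G) Num.max (- f A) 0.
  rewrite -sumrB; apply: eq_bigr => A _.
  have [h|] := boolP (0 <= f A); first by rewrite max_l // max_r ?oppr_le0 ?subr0.
  by rewrite -ltNge => h; rewrite max_r ?ltW // max_l ?oppr_ge0 ?ltW // sub0r opprK.
by rewrite ler_norml; move: p0' pc n0' nc; set a := \sum_(A <- G) _; set b := \sum_(A <- G) _; lra.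
Qed.

End SummableFamilies.

Lemma absz_shift_lt (z : int) (n : nat) : (absz z <= n)%N -> (absz (z + n%:Z)%R < 2 * n + 1)%N.
Proof. lia. Qed.

Lemma absz_shiftK (z : int) (n : nat) : (absz z <= n)%N -> ((absz (z + n%:Z)%R)%:Z - n%:Z)%R = z.
Proof. lia. Qed.

Section Neighbourhoods.
Variable d : nat.
Implicit Types (L V A : {fset site d}) (s t : site d).

Lemma in_box n t : (dst 0 t <= n)%N -> t \in box d n.
Proof.
move=> h; have hc c : (absz (t ord0 c) <= n)%N.
  apply: leq_trans h; rewrite /dst (bigD1 c) //= mxE sub0r abszN; exact: leq_addr.
have lt c : (absz (t ord0 c + n%:Z)%R < 2 * n + 1)%N := absz_shift_lt (hc c).
apply/imfsetP; exists [ffun c => Ordinal (lt c)] => //=.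
by apply/rowP => c; rewrite mxE ffunE /= absz_shiftK.
Qed.

Definition nbh n L : {fset site d} := (\bigcup_(s <- L) shift (box d n) s)%fset.

Lemma in_nbh n L s t : s \in L -> (dst s t <= n)%N -> t \in nbh n L.
Proof.
move=> sL h; apply/bigfcupP; exists s; first by rewrite sL.
by rewrite shiftP in_box // -(dst_add _ _ s) add0r subrK.
Qed.

Lemma box_sub V : exists n0, forall n, (n0 <= n)%N -> (V `<=` box d n)%fset.
Proof.
exists (\max_(s : V) dst 0 (fsval s)) => n hn; apply/fsubsetP => s sV; apply: in_box.
apply: leq_trans hn; exact: (@leq_bigmax _ (fun s : V => dst 0 (fsval s)) [` sV]%fset).
Qed.

Definition hits A L : bool := [exists s : A, fsval s \in L].

Lemma hitsP A L : reflect (exists2 s, s \in A & s \in L) (hits A L).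
Proof.
apply: (iffP existsP) => [[s sL]|[s sA sL]]; first by exists (fsval s); rewrite ?fsvalP.
by exists [` sA]%fset.
Qed.

Definition localregs n L : {fset {fset site d}} := [fset A in fpowerset (nbh n L) | hits A L]%fset.

Lemma in_localregs n L A : (A \in localregs n L) = (A `<=` nbh n L)%fset && hits A L.
Proof. by rewrite /localregs !finmap.inE fpowersetE. Qed.

End Neighbourhoods.

Section RegionSums.
Variables (R : realType) (d : nat) (b : {fset site d} -> R) (c : R).
Hypothesis b0 : forall A, 0 <= b A.
Hypothesis btail : forall (F : {fset {fset site d}}) s n,
  (forall A, A \in F -> s \in A /\ exists2 u, u \in A & (n <= dst s u)%N) ->
  \sum_(A <- F) b A <= c * 2 ^- n.

(** A region that meets [L] at [s] without being local contains a site at distance at least [n] from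
    [s]; a union bound over the sites of [L] then uses [btail]. *)
Lemma tail_sum (L : {fset site d}) n (H : {fset {fset site d}}) :
  (forall A, A \in H -> hits A L) -> [disjoint localregs n L & H]%fset ->
  \sum_(A <- H) b A <= #|` L|%:R * (c * 2 ^- n).
Proof.
move=> HL dH.
pose Hs s : {fset {fset site d}} := [fset A in H | s \in A]%fset.
apply: (@le_trans _ _ (\sum_(s <- L) \sum_(A <- Hs s) b A)).
  rewrite (eq_bigr (fun s => \sum_(A <- H) if s \in A then b A else 0)) => [|s _]; last first.
    by rewrite -big_mkcond [RHS]big_fset_condE.
  rewrite exchange_big /= big_seq [leRHS]big_seq; apply: ler_sum => A AH.
  have /hitsP[s sA sL] := HL A AH.
  rewrite (big_fsetD1 s) //= sA lerDl; apply: sumr_ge0 => s' _; by case: ifP.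
have -> : #|` L|%:R * (c * 2 ^- n) = \sum_(s <- L) c * 2 ^- n.
  by rewrite big_const_seq count_predT iter_addr addr0 mulr_natl.
rewrite big_seq [leRHS]big_seq; apply: ler_sum => s sL; apply: (btail (s := s)) => A.
rewrite !finmap.inE /= => /andP[AH sA]; split => //.
have /fdisjointP_sym /(_ A AH) := dH; rewrite in_localregs (HL A AH) andbT => /fsubsetPn[u uA un].
exists u => //; rewrite leqNgt; apply: contra un => lt; exact: in_nbh sL (ltnW lt).
Qed.

End RegionSums.

(** * DLR equations along an ultrafilter *)

Section DLR.
Local Open Scope classical_set_scope.
Variables (R : realType) (d k : nat) (mu : probability (OmegaM d k) R).
Variables (T : Type) (FF : set_system T).
Hypothesis FU : UltraFilter FF.
Local Instance FPr : ProperFilter FF := ultra_proper.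
Local Notation cc A := {ffun (A : {fset site d}) -> 'I_k.+1}.
Implicit Types (A L U V : {fset site d}) (s : site d) (w : Omega d k).

Variables (Ls : T -> {fset site d}) (pt : T -> cpotential R d k) (b : T -> {fset site d} -> R) (c : R).
Hypothesis Ls_ev : forall V, \forall t \near FF, (V `<=` Ls t)%fset.
Hypothesis ploc : forall t, cpot_local (pt t).
Hypothesis b0 : forall t A, 0 <= b t A.
Hypothesis pb : forall t A w, `|pt t A w| <= b t A.
Hypothesis btail : forall t (F : {fset {fset site d}}) s n,
  (forall A, A \in F -> s \in A /\ exists2 u, u \in A & (n <= dst s u)%N) ->
  \sum_(A <- F) b t A <= c * 2 ^- n.
Hypothesis pshift : forall A (a : site d) w,
  \forall t \near FF, pt t (shift A a) w = pt t A (fun s => w (s + a)%R).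

Definition pe t (y : cc (Ls t)) : R := expR (- \sum_(A <- fpowerset (Ls t)) pt t A (exk y)).
Definition pm t V (x : cc V) : R :=
  (\sum_(y : cc (Ls t) | res V (exk y) == x) pe y) / \sum_(y : cc (Ls t)) pe y.
Hypothesis pcvg : forall V (x : cc V), (fun t => pm t x) @ FF --> fine (mu (cyl x)).

(* the empty region is excluded because the tail bounds say nothing about its (irrelevant) constant *)
Definition Psi : cpotential R d k := fun A w => if A == fset0 then 0 else ulim FF (fun t => pt t A w).
Definition Bl A : R := if A == fset0 then 0 else ulim FF (fun t => b t A).

Lemma b_le t A : A != fset0 -> b t A <= c.
Proof.
move=> /fset0Pn[s sA]; have := @btail t [fset A]%fset s 0%N; rewrite big_seq_fset1 expr0 invr1 mulr1; apply.
by move=> B; rewrite finmap.inE => /eqP ->; split => //; exists s.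
Qed.

Lemma c_ge0 : 0 <= c.
Proof.
have [t _] := filter_ex (filterT : FF setT).
have := @btail t fset0 0 0%N; rewrite big_seq_fset0 expr0 invr1 mulr1; apply.
by move=> A; rewrite in_fset0.
Qed.

Lemma b_norm t A : A != fset0 -> `|b t A| <= c.
Proof. by move=> A0; rewrite ger0_norm ?b_le. Qed.

Lemma Psi_cvg A w : A != fset0 -> (fun t => pt t A w) @ FF --> Psi A w.
Proof.
move=> A0; rewrite /Psi (negPf A0); apply: (ulim_cvg FU (c := c)) => t.
exact: le_trans (pb t A w) (b_le t A0).
Qed.

Lemma Bl_ge0 A : 0 <= Bl A.
Proof.
rewrite /Bl; case: ifPn => // A0.
have h : (fun t => b t A) @ FF --> ulim FF (fun t => b t A).
  by apply: (ulim_cvg FU (c := c)) => t; exact: b_norm.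
by apply: (ler_flim FPr (cvg_cst 0) h); exact: nearW.
Qed.

Lemma Psi_bound A w : `|Psi A w| <= Bl A.
Proof.
rewrite /Psi /Bl; case: ifPn => [_|A0]; first by rewrite normr0.
by apply: (ulim_norm FU (c := c)) => t; [exact: pb|exact: b_le].
Qed.

Lemma Bl_tail (F : {fset {fset site d}}) s n :
  (forall A, A \in F -> s \in A /\ exists2 u, u \in A & (n <= dst s u)%N) ->
  \sum_(A <- F) Bl A <= c * 2 ^- n.
Proof.
move=> hF; have F0 A : A \in F -> A != fset0.
  by move=> /hF[sA _]; apply/fset0Pn; exists s.
pose bb A t := if A == fset0 then 0 else b t A.
have bbE A : Bl A = ulim FF (bb A).
  by rewrite /Bl /bb; case: ifP => // _; apply/esym/ulimE; exact: cvg_cst.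
rewrite (eq_bigr (fun A => ulim FF (bb A))) => [|A _]; last exact: bbE.
apply: (ulim_sum_le FU) => [A|t].
  exists c => t; rewrite /bb; case: ifPn => [_|A0]; [by rewrite normr0 c_ge0|exact: b_norm].
rewrite big_seq (eq_bigr (b t)) => [|A /F0 /negPf h]; last by rewrite /bb h.
by rewrite -big_seq; exact: (@btail t F s n hF).
Qed.

Lemma Psi_local : cpot_local Psi.
Proof.
move=> A w w' h; rewrite /Psi; case: ifP => // _; congr (ulim _ _); apply/funext => t; exact: ploc.
Qed.

Lemma Psi_transl : cpot_transl_inv Psi.
Proof.
move=> A a w; have [->|A0] := eqVneq A fset0.
  by rewrite /Psi (_ : shift fset0 a = fset0) ?eqxx //; apply/fsetP => s; rewrite shiftP !in_fset0.
have A0' : shift A a != fset0 by rewrite -cardfs_eq0 card_shift cardfs_eq0.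
have h := Psi_cvg (w := fun s => w (s + a)%R) A0; rewrite [LHS]/Psi (negPf A0').
by apply: ulimE; apply: cvg_trans h; apply: near_eq_cvg; apply: filterS (pshift A a w) => t /esym.
Qed.

Lemma Psi_summable : cpot_summable Psi.
Proof.
have ub A : ubound (range (fun w => `|Psi A w|)) (Bl A) by move=> _ [w _ <-]; exact: Psi_bound.
have ne A : range (fun w => `|Psi A w|) !=set0 by exists `|Psi A point|, point.
rewrite /cpot_summable; apply: (@le_lt_trans _ _ c%:E); last exact: ltry.
apply: esum_fin_le => [A|G GS].
  apply: le_trans (normr_ge0 (Psi A point)) _; apply: ub_le_sup; last by exists point.
  by exists (Bl A).
apply: (@le_trans _ _ (\sum_(A <- G) Bl A)); first by apply: ler_sum => A _; exact: ge_sup.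
have := @Bl_tail G 0 0%N; rewrite expr0 invr1 mulr1; apply => A AG.
by have := GS _ AG; split => //; exists 0.
Qed.

(** Two tails, one for [Psi] and one for the finite-volume potential, plus the error in the finitely
    many local terms. *)
Definition eps L n : R := 2 * (#|` L|%:R * (c * 2 ^- n)) + 2 ^- n.

Lemma energy_approx L n w :
  `|energy Psi L w - \sum_(A <- localregs n L) Psi A w| <= #|` L|%:R * (c * 2 ^- n).
Proof.
rewrite /energy; apply: rsum_approx.
  move=> A; rewrite /= in_localregs => /andP[_ /hitsP h]; exact: h.
move=> H HS dH; apply: (@le_trans _ _ (\sum_(A <- H) Bl A)).
  by apply: ler_sum => A _; exact: Psi_bound.
by apply: (tail_sum Bl_ge0 Bl_tail) => // A /HS /= /hitsP.
Qed.

Definition Et t L w : R := \sum_(A <- fpowerset (Ls t) | hits A L) pt t A w.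

Lemma Et_approx t L n w : (nbh n L `<=` Ls t)%fset ->
  `|Et t L w - \sum_(A <- localregs n L) pt t A w| <= #|` L|%:R * (c * 2 ^- n).
Proof.
move=> nL; rewrite /Et (bigID (fun A => A \in localregs n L)) /=.
rewrite (_ : \sum_(A <- fpowerset (Ls t) | hits A L && (A \in localregs n L)) pt t A w =
   \sum_(A <- localregs n L) pt t A w).
  rewrite addrAC subrr add0r [X in `|X|]big_fset_condE /=.
  apply: le_trans (ler_norm_sum _ _ _) _.
  apply: (@le_trans _ _ (\sum_(A <- [fset A in fpowerset (Ls t) | hits A L && (A \notin localregs n L)]%fset) b t A)).
    by apply: ler_sum => A _; exact: pb.
  apply: (tail_sum (b0 t) (@btail t)) => [A|].
    by rewrite !finmap.inE /= => /and3P[].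
  by apply/fdisjointP => A; rewrite in_localregs => Al; rewrite !finmap.inE /= !fpowersetE Al !andbF.
rewrite big_fset_condE /=; congr (\sum_(A <- _) _); congr enum_fset; apply/fsetP => A.
rewrite !finmap.inE /= !fpowersetE; case: (hits A L); rewrite ?andbF ?andbT //=.
apply/andP/idP => [[] //|Al]; split => //; exact: fsubset_trans Al nL.
Qed.

(** Local terms see only finitely many configurations of [nbh n L], so their convergence is uniform
    in [w]; the tails are uniform by assumption. *)
Lemma Et_unif L n : \forall t \near FF, (nbh n L `<=` Ls t)%fset /\
  forall w w', (forall s, s \in nbh n L -> w s = w' s) -> `|Et t L w - energy Psi L w'| <= eps L n.
Proof.
have h (z : cc (nbh n L)) : \forall t \near FF,
    `|\sum_(A <- localregs n L) pt t A (exk z) - \sum_(A <- localregs n L) Psi A (exk z)| <= 2 ^- n.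
  have hc : (fun t => \sum_(A <- localregs n L) pt t A (exk z)) @ FF --> \sum_(A <- localregs n L) Psi A (exk z).
    rewrite big_seq; under eq_fun do rewrite big_seq.
    apply: (cvg_fsum FPr) => A; rewrite in_localregs => /andP[_ /hitsP[s sA _]].
    by apply: Psi_cvg; apply/fset0Pn; exists s.
  have e0 : 0 < (2 : R) ^- n by rewrite invr_gt0 exprn_gt0.
  move/cvgrPdist_le : hc => /(_ _ e0); apply: filterS => t; by rewrite distrC.
have hall := filter_forall (f := fun z t => _) _ h.
near=> t; split; first by near: t; exact: Ls_ev.
move=> w w' ww'.
have nL : (nbh n L `<=` Ls t)%fset by near: t; exact: Ls_ev.
have ht : forall z : cc (nbh n L), `|\sum_(A <- localregs n L) pt t A (exk z) -
   \sum_(A <- localregs n L) Psi A (exk z)| <= 2 ^- n by near: t; exact: hall.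
pose z := res (nbh n L) w'.
have zE s : s \in nbh n L -> exk z s = w' s.
  by move=> sn; rewrite (_ : s = fsval [` sn]%fset) // exk_in ffunE.
have e1 : \sum_(A <- localregs n L) pt t A (exk z) = \sum_(A <- localregs n L) pt t A w.
  rewrite big_seq [RHS]big_seq; apply: eq_bigr => A; rewrite in_localregs => /andP[/fsubsetP Al _].
  by apply: ploc => s /Al sn; rewrite zE // ww'.
have e2 : \sum_(A <- localregs n L) Psi A (exk z) = \sum_(A <- localregs n L) Psi A w'.
  rewrite big_seq [RHS]big_seq; apply: eq_bigr => A; rewrite in_localregs => /andP[/fsubsetP Al _].
  by apply: Psi_local => s /Al sn; rewrite zE.
have := ht z; have := Et_approx w nL; have := energy_approx L n w'.
rewrite e1 e2 /eps !ler_norml.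
set a1 := energy _ _ _; set a2 := \sum_(A <- _) Psi _ _; set a3 := Et _ _ _; set a4 := \sum_(A <- _) pt _ _ _.
by set a5 := _%:R * _; set a6 := _ ^- n; lra.
Unshelve. all: by end_near. Qed.

Definition gl t L (x : cc L) (y : cc (Ls t)) : cc (Ls t) := res (Ls t) (glue x (exk y)).

Lemma glue_in L (x : cc L) w (s : L) : glue x w (fsval s) = x s.
Proof. by rewrite /glue valK. Qed.

Lemma glue_out L (x : cc L) w s : s \notin L -> glue x w s = w s.
Proof. by move=> h; rewrite /glue insubN. Qed.

Lemma exk_res L (w : Omega d k) s : s \in L -> exk (res L w) s = w s.
Proof. by move=> sL; rewrite (_ : s = fsval [` sL]%fset) // exk_in ffunE. Qed.

Definition prest t L (y : cc (Ls t)) : R :=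
  expR (- \sum_(A <- fpowerset (Ls t) | ~~ hits A L) pt t A (exk y)).

Lemma pe_gl t L (x : cc L) (y : cc (Ls t)) : (L `<=` Ls t)%fset ->
  pe (gl x y) = expR (- Et t L (glue x (exk y))) * prest L y.
Proof.
move=> LL.
have e1 : \sum_(A <- fpowerset (Ls t) | hits A L) pt t A (exk (gl x y)) = Et t L (glue x (exk y)).
  rewrite /Et big_seq_cond [RHS]big_seq_cond; apply: eq_bigr => A /andP[]; rewrite fpowersetE => /fsubsetP AL _.
  by apply: ploc => s /AL sL; rewrite exk_res.
have e2 : \sum_(A <- fpowerset (Ls t) | ~~ hits A L) pt t A (exk (gl x y)) =
    \sum_(A <- fpowerset (Ls t) | ~~ hits A L) pt t A (exk y).
  rewrite big_seq_cond [RHS]big_seq_cond; apply: eq_bigr => A /andP[]; rewrite fpowersetE => /fsubsetP AL nm.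
  apply: ploc => s sA; rewrite exk_res ?AL // glue_out //; apply: contra nm => sL.
  by apply/hitsP; exists s.
by rewrite /pe (bigID (fun A => hits A L)) /= e1 e2 opprD expRD.
Qed.

Lemma gibbs_kernel_den L w : 0 < \sum_(y : cc L) expR (- energy Psi L (glue y w)).
Proof.
rewrite (bigD1 [ffun=> ord0]) //=; apply: ltr_pwDl; first exact: expR_gt0.
by apply: sumr_ge0 => y _; exact: expR_ge0.
Qed.

Lemma kernel_ge0 L (x : cc L) w : 0 <= gibbs_kernel Psi x w.
Proof. by rewrite divr_ge0 ?expR_ge0 // ltW // gibbs_kernel_den. Qed.

Lemma kernel_le1 L (x : cc L) w : gibbs_kernel Psi x w <= 1.
Proof.
rewrite /gibbs_kernel ler_pdivrMr ?gibbs_kernel_den // mul1r (bigD1 x) //= lerDl.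
by apply: sumr_ge0 => y _; exact: expR_ge0.
Qed.

(* exact finite-volume DLR equation, up to the factor [exp (2 e)] coming from the energy error [e] *)
Lemma pe_ratio t L (x : cc L) (y : cc (Ls t)) w (e : R) : (L `<=` Ls t)%fset -> gl x y = y ->
  (forall x' : cc L, `|Et t L (glue x' (exk y)) - energy Psi L (glue x' w)| <= e) ->
  gibbs_kernel Psi x w * \sum_(x' : cc L) pe (gl x' y) <= expR (2 * e) * pe y /\
  pe y <= expR (2 * e) * (gibbs_kernel Psi x w * \sum_(x' : cc L) pe (gl x' y)).
Proof.
move=> LL gy h; rewrite -{2 3}gy (eq_bigr (fun x' : cc L => expR (- Et t L (glue x' (exk y))) * prest L y)) => [|x' _]; last exact: pe_gl.
rewrite pe_gl // -mulr_suml.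
have r0 : 0 < prest L y by exact: expR_gt0.
have D0 := gibbs_kernel_den L w; rewrite /gibbs_kernel.
set D := \sum_(x' : cc L) expR (- energy Psi L _) in D0 *.
pose S := \sum_(x' : cc L) expR (- Et t L (glue x' (exk y))).
have up (x' : cc L) : expR (- Et t L (glue x' (exk y))) <= expR e * expR (- energy Psi L (glue x' w)).
  by rewrite -expRD ler_expR; have := h x'; rewrite ler_norml; lra.
have dn (x' : cc L) : expR (- energy Psi L (glue x' w)) <= expR e * expR (- Et t L (glue x' (exk y))).
  by rewrite -expRD ler_expR; have := h x'; rewrite ler_norml; lra.
have SD : S <= expR e * D by rewrite /S /D mulr_sumr; apply: ler_sum.
have DS : D <= expR e * S by rewrite /S /D mulr_sumr; apply: ler_sum.
have e2 : expR (2 * e) = expR e * expR e by rewrite -expRD; congr expR; lra.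
have E0 : 0 < expR e by exact: expR_gt0.
rewrite -/S e2; set a := expR (- energy Psi L (glue x w)); set a' := expR (- Et t L (glue x (exk y))).
have a0 : 0 <= a by exact: expR_ge0.
have a0' : 0 <= a' by exact: expR_ge0.
have S0 : 0 <= S by apply: sumr_ge0 => x' _; exact: expR_ge0.
split.
  rewrite mulrA (mulrA _ a') ler_wpM2r ?(ltW r0) // mulrAC ler_pdivrMr //.
  apply: le_trans (ler_pM a0 S0 (dn x) SD) _; rewrite -/a'.
  by rewrite le_eqVlt; apply/orP; left; apply/eqP; ring.
rewrite mulrA (mulrA (_ * _)) ler_wpM2r ?(ltW r0) // mulrA mulrAC ler_pdivlMr //.
apply: le_trans (ler_pM a0' (ltW D0) (up x) DS) _; rewrite -/a.
by rewrite le_eqVlt; apply/orP; left; apply/eqP; ring.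
Qed.

Section FiniteDLR.
Variables (t : T) (L U : {fset site d}).
Hypotheses (LL : (L `<=` Ls t)%fset) (UL : (U `<=` Ls t)%fset) (dLU : [disjoint L & U]%fset).
Implicit Types (x : cc L) (y : cc (Ls t)).

Lemma exk_gl x y s : s \in Ls t -> exk (gl x y) s = glue x (exk y) s.
Proof. by move=> sL; rewrite exk_res. Qed.

Lemma resU_gl x y : res U (exk (gl x y)) = res U (exk y).
Proof.
apply: eq_res => s sU; rewrite exk_gl ?(fsubsetP UL) // glue_out //.
by apply/negP => sL; move/fdisjointP: dLU => /(_ s sL); rewrite sU.
Qed.

Lemma resL_gl x y : res L (exk (gl x y)) = x.
Proof. by apply/ffunP => s; rewrite ffunE exk_gl ?glue_in // (fsubsetP LL) // fsvalP. Qed.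

Lemma gl_gl x x' y : gl x (gl x' y) = gl x y.
Proof.
apply/ffunP => s; rewrite !ffunE; have [sL|sL] := boolP (fsval s \in L).
  by rewrite (_ : fsval s = fsval [` sL]%fset) // !glue_in.
by rewrite !glue_out // exk_gl ?fsvalP // glue_out.
Qed.

Lemma gl_id x y : (gl x y == y) = (res L (exk y) == x).
Proof.
apply/eqP/eqP => [<-|<-]; first exact: resL_gl.
apply/ffunP => s; rewrite ffunE; have [sL|sL] := boolP (fsval s \in L).
  by rewrite (_ : fsval s = fsval [` sL]%fset) // glue_in ffunE /= exk_in.
by rewrite glue_out // exk_in.
Qed.

(** Resampling on [L]: every configuration arises exactly once by gluing some [x'] into a
    configuration equal to [x] on [L]. *)
Lemma gl_sum x (z : cc U) (F : cc (Ls t) -> R) :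
  \sum_(y | res U (exk y) == z) F y =
  \sum_(y | (res U (exk y) == z) && (res L (exk y) == x)) \sum_(x' : cc L) F (gl x' y).
Proof.
rewrite pair_big_dep /= (reindex_onto (fun p : cc (Ls t) * cc L => gl p.2 p.1)
  (fun y => (gl x y, res L (exk y)))) /=; last first.
  by move=> y _; rewrite gl_gl; apply/eqP; rewrite gl_id.
apply: eq_bigl => -[y x'] /=; rewrite resU_gl gl_gl resL_gl andbT; congr (_ && _).
by rewrite xpair_eqE eqxx andbT gl_id.
Qed.

End FiniteDLR.

Definition join L U (x : cc L) (z : cc U) : cc (L `|` U)%fset := res (L `|` U)%fset (glue x (exk z)).

Lemma res_join L U (x : cc L) (z : cc U) w : [disjoint L & U]%fset ->
  (res (L `|` U)%fset w == join x z) = (res U w == z) && (res L w == x).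
Proof.
move=> /fdisjointP dLU; apply/eqP/andP => [h|[/eqP hz /eqP hx]].
  split; apply/eqP/ffunP => s; rewrite ffunE.
    have sU := fsvalP s; have sLU : fsval s \in (L `|` U)%fset by rewrite in_fsetU sU orbT.
    have := congr1 (fun f : cc (L `|` U)%fset => f [` sLU]%fset) h; rewrite !ffunE /= => ->.
    rewrite glue_out ?exk_in //; apply/negP => sL; by have := dLU _ sL; rewrite sU.
  have sL := fsvalP s; have sLU : fsval s \in (L `|` U)%fset by rewrite in_fsetU sL.
  by have := congr1 (fun f : cc (L `|` U)%fset => f [` sLU]%fset) h; rewrite !ffunE /= glue_in.
apply/ffunP => s; rewrite !ffunE -hx -hz; have [sL|sL] := boolP (fsval s \in L).
  by rewrite (_ : fsval s = fsval [` sL]%fset) // glue_in ffunE.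
rewrite glue_out // exk_res //.
by have := fsvalP s; rewrite in_fsetU (negPf sL).
Qed.

Lemma cylP V (x : cc V) w : cyl x w <-> res V w == x.
Proof.
split=> [h|/eqP <- s]; last by rewrite ffunE.
by apply/eqP/ffunP => s; rewrite ffunE; exact: h.
Qed.

Lemma cyl_join L U (x : cc L) (z : cc U) : [disjoint L & U]%fset ->
  cyl (join x z) = cyl x `&` cyl z.
Proof.
move=> dLU; apply/seteqP; split => w; rewrite /= !cylP res_join //; first by move=> /andP[].
by move=> [-> ->].
Qed.

(** The condition [z] fixes the neighbourhood of [L] outside [L], so the infinite-volume kernel at
    the single point [w] controls all finite-volume configurations compatible with [z]. *)
Lemma pm_ratio n L U (x : cc L) (z : cc U) w : [disjoint L & U]%fset ->
  (nbh n L `<=` L `|` U)%fset -> cyl z w -> \forall t \near FF,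
  gibbs_kernel Psi x w * pm t z <= expR (2 * eps L n) * pm t (join x z) /\
  pm t (join x z) <= expR (2 * eps L n) * (gibbs_kernel Psi x w * pm t z).
Proof.
move=> dLU nLU wz; near=> t.
have [_ hE] : (nbh n L `<=` Ls t)%fset /\
  forall w w', (forall s, s \in nbh n L -> w s = w' s) -> `|Et t L w - energy Psi L w'| <= eps L n.
  by near: t; exact: Et_unif.
have LUt : (L `|` U `<=` Ls t)%fset by near: t; exact: Ls_ev.
have LL : (L `<=` Ls t)%fset by apply: fsubset_trans LUt; exact: fsubsetUl.
have UL : (U `<=` Ls t)%fset by apply: fsubset_trans LUt; exact: fsubsetUr.
have Z0 : 0 <= (\sum_(y : cc (Ls t)) pe y)^-1.
  by rewrite invr_ge0; apply: sumr_ge0 => y _; exact: expR_ge0.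
have e : \sum_(y : cc (Ls t) | res (L `|` U)%fset (exk y) == join x z) pe y =
    \sum_(y : cc (Ls t) | (res U (exk y) == z) && (res L (exk y) == x)) pe y.
  by apply: eq_bigl => y; exact: res_join.
rewrite /pm e.
rewrite (gl_sum LL UL dLU x).
have key (y : cc (Ls t)) : (res U (exk y) == z) && (res L (exk y) == x) ->
    gibbs_kernel Psi x w * \sum_(x' : cc L) pe (gl x' y) <= expR (2 * eps L n) * pe y /\
    pe y <= expR (2 * eps L n) * (gibbs_kernel Psi x w * \sum_(x' : cc L) pe (gl x' y)).
  move=> /andP[/eqP yz yx]; apply: pe_ratio => // [|x']; first by apply/eqP; rewrite gl_id.
  apply: hE => s /(fsubsetP nLU); rewrite in_fsetU; have [sL _|sL /= sU] := boolP (s \in L).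
    by rewrite (_ : s = fsval [` sL]%fset) // !glue_in.
  rewrite !glue_out // (_ : s = fsval [` sU]%fset) // wz -yz ffunE //.
move: key; set K := gibbs_kernel Psi x w; move: K => K key; rewrite !mulrA.
split.
  rewrite ler_wpM2r // [leLHS]mulr_sumr [leRHS]mulr_sumr.
  by apply: ler_sum => y hy; have [h _] := key y hy.
rewrite ler_wpM2r // -mulrA.
rewrite mulr_sumr mulr_sumr; apply: ler_sum => y hy; have [_ h] := key y hy.
exact: h.
Unshelve. all: by end_near. Qed.

Lemma mu_ratio n L U (x : cc L) (z : cc U) w : [disjoint L & U]%fset ->
  (nbh n L `<=` L `|` U)%fset -> cyl z w ->
  gibbs_kernel Psi x w * fine (mu (cyl z)) <= expR (2 * eps L n) * fine (mu (cyl (join x z))) /\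
  fine (mu (cyl (join x z))) <= expR (2 * eps L n) * (gibbs_kernel Psi x w * fine (mu (cyl z))).
Proof.
move=> dLU nLU wz; have := pm_ratio x dLU nLU wz.
move: (gibbs_kernel Psi x w) (expR (2 * eps L n)) => K rr h.
have c1 a : (fun t => a * pm t z) @ FF --> a * fine (mu (cyl z)) by apply: cvgMr; exact: pcvg.
have c2 a : (fun t => a * pm t (join x z)) @ FF --> a * fine (mu (cyl (join x z))).
  by apply: cvgMr; exact: pcvg.
have c3 : (fun t => pm t (join x z)) @ FF --> fine (mu (cyl (join x z))) by exact: pcvg.
split.
  by apply: (ler_flim FPr (c1 _) (c2 _)); apply: filterS h => t [].
rewrite mulrA; apply: (ler_flim FPr c3 (c1 _)).
by apply: filterS h => t [_]; rewrite mulrA.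
Qed.

End DLR.

From mathcomp Require Import measurable_realfun.

(** * From ratio bounds on cylinders to conditional probabilities *)

Section KernelMeasure.
Local Open Scope classical_set_scope.
Variables (R : realType) (d k : nat) (mu : probability (OmegaM d k) R).
Local Notation cc A := {ffun (A : {fset site d}) -> 'I_k.+1}.
Implicit Types (A L U V : {fset site d}) (s : site d) (w : Omega d k).
Variables (Psi : cpotential R d k) (c : R).
Hypothesis Ploc : cpot_local Psi.
Hypothesis Papx : forall L n w,
  `|energy Psi L w - \sum_(A <- localregs n L) Psi A w| <= #|` L|%:R * (c * 2 ^- n).
Local Notation eps L n := (2 * (#|` L|%:R * (c * 2 ^- n)) + 2 ^- n).
Local Notation K := (gibbs_kernel Psi).
Hypothesis Pratio : forall n L U (x : cc L) (z : cc U) w, [disjoint L & U]%fset ->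
  (nbh n L `<=` L `|` U)%fset -> cyl z w ->
  K x w * fine (mu (cyl z)) <= expR (2 * eps L n) * fine (mu (cyl x `&` cyl z)) /\
  fine (mu (cyl x `&` cyl z)) <= expR (2 * eps L n) * (K x w * fine (mu (cyl z))).
Hypothesis K0 : forall L (x : cc L) w, 0 <= K x w.
Hypothesis K1 : forall L (x : cc L) w, K x w <= 1.

Definition outgen L : set (set (Omega d k)) :=
  [set B | exists V (x : cc V), B = cyl x /\ forall s, s \in V -> s \notin L].

Lemma local_meas L U (f : Omega d k -> R) : [disjoint L & U]%fset ->
  (forall w w', (forall s, s \in U -> w s = w' s) -> f w = f w') ->
  measurable_fun [set: g_sigma_algebraType (outgen L)] (f : g_sigma_algebraType (outgen L) -> R).
Proof.
move=> dLU hf.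
have -> : f = (fun w => \sum_(z : cc U) f (exk z) * \1_(cyl z) w).
  apply/funext => w; rewrite (bigD1 (res U w)) //= big1 ?addr0 => [|z nz].
    rewrite indicE mem_set ?mulr1; last by apply/cylP.
    by apply: hf => s sU; rewrite exk_res.
  rewrite indicE memNset ?mulr0 //; move/cylP => h; move: nz.
  by rewrite eq_sym h.
apply: measurable_sum => z; apply: measurable_funM; first exact: measurable_cst.
apply: measurable_indic; apply: sub_sigma_algebra; exists U, z; split => // s sU.
by apply/negP => sL; move/fdisjointP: dLU => /(_ s sL); rewrite sU.
Qed.

Lemma half_cvg : (fun n : nat => (2 : R) ^- n) @ \oo --> (0 : R).
Proof.
under eq_fun do rewrite -exprVn.
apply: cvg_expr; rewrite ger0_norm ?invr_ge0 // invf_lt1 // ltr1n //.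
Qed.

Lemma energy_cvg L w : (fun n => \sum_(A <- localregs n L) Psi A w) @ \oo --> energy Psi L w.
Proof.
apply/cvgrPdist_le => e e0.
have h : (fun n => #|` L|%:R * (c * 2 ^- n)) @ \oo --> (0 : R).
  rewrite -[X in _ --> X](mulr0 #|` L|%:R); apply: cvgMr.
  by rewrite -[X in _ --> X](mulr0 c); apply: cvgMr; exact: half_cvg.
have hh : \forall n \near \oo, #|` L|%:R * (c * 2 ^- n) < e by apply: (cvgr_lt _ h).
apply: filterS hh => n hn; by apply: le_trans (Papx L n w) (ltW hn).
Qed.

Definition Kn n L (x : cc L) w : R :=
  expR (- \sum_(A <- localregs n L) Psi A (glue x w)) /
  \sum_(y : cc L) expR (- \sum_(A <- localregs n L) Psi A (glue y w)).

Lemma Kn_cvg L (x : cc L) w : (fun n => Kn n x w) @ \oo --> K x w.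
Proof.
have h (y : cc L) : (fun n => expR (- \sum_(A <- localregs n L) Psi A (glue y w))) @ \oo -->
    expR (- energy Psi L (glue y w)).
  apply: continuous_cvg; first exact: continuous_expR.
  by apply: cvgN; exact: energy_cvg.
have hD : (fun n => \sum_(y : cc L) expR (- \sum_(A <- localregs n L) Psi A (glue y w))) @ \oo -->
    \sum_(y : cc L) expR (- energy Psi L (glue y w)).
  by apply: (cvg_fsum _) => y _; exact: h.
have D0 : \sum_(y : cc L) expR (- energy Psi L (glue y w)) != 0.
  rewrite gt_eqF // (bigD1 x) //=; apply: ltr_pwDl; first exact: expR_gt0.
  by apply: sumr_ge0 => y _; exact: expR_ge0.
exact: (cvgM (h x) (cvgV D0 hD)).
Qed.

(** The kernel is the pointwise limit of the [Kn], each of which depends on finitely many sites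
    outside [L]. *)
Lemma kernel_meas L (x : cc L) :
  measurable_fun [set: g_sigma_algebraType (outgen L)] (K x : g_sigma_algebraType (outgen L) -> R).
Proof.
pose TL := g_sigma_algebraType (outgen L).
apply: (@measurable_fun_cvg _ TL R setT (fun n => (Kn n x : TL -> R))) => [n|w _]; last exact: Kn_cvg.
apply: (@local_meas L (nbh n L `\` L)%fset).
  by apply/fdisjointP => s sL; rewrite in_fsetD sL.
move=> w w' ww'.
have e (y : cc L) : \sum_(A <- localregs n L) Psi A (glue y w) = \sum_(A <- localregs n L) Psi A (glue y w').
  rewrite big_seq [RHS]big_seq; apply: eq_bigr => A; rewrite in_localregs => /andP[/fsubsetP An _].
  apply: Ploc => s /An sn; have [sL|sL] := boolP (s \in L).
    by rewrite (_ : s = fsval [` sL]%fset) // !glue_in.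
  by rewrite !glue_out // ww' // in_fsetD sL.
by rewrite /Kn e; congr (_ / _); apply: eq_bigr => y _; rewrite e.
Qed.

Lemma cyl_measurable V (z : cc V) : measurable (cyl z : set (OmegaM d k)).
Proof. by apply: sub_sigma_algebra; exists V, z. Qed.

Lemma out_measurable L B : outside_sigma L B -> measurable (B : set (OmegaM d k)).
Proof. by apply: sub_sigma_algebra2 => C [V [z [-> _]]]; exists V, z. Qed.

Lemma kernel_measT L (x : cc L) (D : set (OmegaM d k)) : measurable D ->
  measurable_fun D (fun w : OmegaM d k => (K x w)%:E).
Proof.
move=> mD; apply/measurable_EFinP; apply: measurable_funS (subsetT D) _ => //.
move=> _ Y mY; rewrite setTI; apply: (@out_measurable L).
have h := kernel_meas x measurableT mY; rewrite setTI in h; exact: h.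
Qed.

Lemma indic_measT (A D : set (OmegaM d k)) : measurable A ->
  measurable_fun D (fun w : OmegaM d k => (\1_A w : R)%:E).
Proof. by move=> mA; apply/measurable_EFinP; exact: measurable_indic. Qed.

Lemma mu_fin (A : set (OmegaM d k)) : measurable A -> (fine (mu A))%:E = mu A.
Proof. by move=> mA; rewrite fineK // fin_num_measure. Qed.

Lemma int_le1 (f : OmegaM d k -> R) (D : set (OmegaM d k)) : measurable D ->
  measurable_fun D (fun w => (f w)%:E) -> (forall w, 0 <= f w) -> (forall w, f w <= 1) ->
  (\int[mu]_(w in D) (f w)%:E)%E \is a fin_num.
Proof.
move=> mD mf f0 f1; rewrite ge0_fin_numE; last by apply: integral_ge0 => w _; rewrite lee_fin.
apply: (@le_lt_trans _ _ (\int[mu]_(w in D) (cst 1%E) w)%E); last first.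
  by rewrite integral_cst // mul1e; apply: (le_lt_trans (probability_le1 mu mD)); exact: ltry.
by apply: ge0_le_integral => // w _; rewrite lee_fin.
Qed.

Lemma piece n L U (x : cc L) (z : cc U) : [disjoint L & U]%fset -> (nbh n L `<=` L `|` U)%fset ->
  ((\int[mu]_(w in cyl z) (K x w)%:E) <= (expR (2 * eps L n))%:E * mu (cyl x `&` cyl z) /\
   mu (cyl x `&` cyl z) <= (expR (2 * eps L n))%:E * \int[mu]_(w in cyl z) (K x w)%:E)%E.
Proof.
move=> dLU nLU; have hr := @Pratio n L U x z _ dLU nLU.
have mz := cyl_measurable z; have mx := cyl_measurable x.
have mxz := measurableI _ _ mx mz.
rewrite -(mu_fin mxz); move: hr; set rr := expR _; set M1 := fine (mu (_ `&` _)); set M0 := fine (mu (cyl z)) => hr.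
have r0 : 0 < rr by exact: expR_gt0.
have M00 : 0 <= M0 by rewrite fine_ge0.
have M10 : 0 <= M1 by rewrite fine_ge0.
have cE q : (\int[mu]_(w in cyl z) (cst q%:E) w)%E = (q * M0)%:E.
  by rewrite integral_cst // EFinM mu_fin.
have mK := kernel_measT x mz.
have zw : cyl z (exk z) by move=> s; rewrite exk_in.
(* On a null cylinder the pointwise bounds cannot be divided by the mass, but there both sides
   vanish. *)
have [M0e|M0n] := eqVneq M0 0.
  have M1e : M1 = 0 by apply/eqP; rewrite eq_le M10 andbT; have [_] := hr _ zw; rewrite M0e !mulr0.
  have I0 : (\int[mu]_(w in cyl z) (K x w)%:E <= 0)%E.
    apply: (@le_trans _ _ (\int[mu]_(w in cyl z) (cst 1%:E) w)%E); last by rewrite cE M0e mulr0.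
    by apply: ge0_le_integral => // w _; rewrite lee_fin.
  rewrite M1e mule0; split=> //; apply: mule_ge0; first by rewrite lee_fin ltW.
  by apply: integral_ge0 => w _; rewrite lee_fin.
have Mp : 0 < M0 by rewrite lt_def M0n.
split.
  apply: (@le_trans _ _ (\int[mu]_(w in cyl z) (cst (rr * M1 / M0)%:E) w)%E).
    apply: ge0_le_integral => // w zw'; rewrite lee_fin //.
    by rewrite ler_pdivlMr //; have [] := hr w zw'.
  by rewrite cE mulfVK // EFinM.
have h : ((M1 / rr)%:E <= \int[mu]_(w in cyl z) (K x w)%:E)%E.
  apply: (@le_trans _ _ (\int[mu]_(w in cyl z) (cst (M1 / rr / M0)%:E) w)%E).
    by rewrite cE mulfVK.
  apply: ge0_le_integral => // w zw'; rewrite lee_fin; first by rewrite !divr_ge0 // ltW.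
  by rewrite !ler_pdivrMr // (mulrC _ rr); have [_ hw] := hr w zw'; exact: hw.
have e : M1%:E = (rr%:E * (M1 / rr)%:E)%E by rewrite -EFinM mulrC mulfVK // gt_eqF.
by rewrite {1}e; apply: lee_wpmul2l; rewrite // lee_fin ltW.
Qed.

Lemma cyl_part U V (z : cc V) : (V `<=` U)%fset ->
  cyl z = \big[setU/set0]_(y <- enum [pred y : cc U | res V (exk y) == z]) cyl y.
Proof.
move=> /fsubsetP VU; rewrite -bigcup_seq; apply/seteqP; split => w.
  move=> zw; exists (res U w); last by apply/cylP.
  rewrite /= mem_enum inE; apply/eqP/ffunP => s; rewrite ffunE exk_res ?VU ?fsvalP //.
move=> [y]; rewrite /= mem_enum inE => /eqP yz yw; rewrite -yz => s.
have sU : fsval s \in U by apply: VU; exact: fsvalP.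
by rewrite ffunE (_ : fsval s = fsval [` sU]%fset) // exk_in; exact: yw.
Qed.

(** The cylinder is split into finer ones whose base contains the neighbourhood of [L] outside [L],
    so that [piece] applies to each. *)
Lemma cyl_integral n L V (x : cc L) (z : cc V) : [disjoint L & V]%fset ->
  (\int[mu]_(w in cyl z) (K x w)%:E <= (expR (2 * eps L n))%:E * \int[mu]_(w in cyl z) (\1_(cyl x) w)%:E /\
   \int[mu]_(w in cyl z) (\1_(cyl x) w)%:E <= (expR (2 * eps L n))%:E * \int[mu]_(w in cyl z) (K x w)%:E)%E.
Proof.
move=> dLV; pose U := ((nbh n L `|` V) `\` L)%fset.
have VU : (V `<=` U)%fset.
  apply/fsubsetP => s sV; rewrite in_fsetD in_fsetU sV orbT andbT.
  by apply/negP => sL; move/fdisjointP: dLV => /(_ s sL); rewrite sV.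
have dLU : [disjoint L & U]%fset by apply/fdisjointP => s sL; rewrite in_fsetD sL.
have nLU : (nbh n L `<=` L `|` U)%fset.
  by apply/fsubsetP => s sn; rewrite in_fsetU in_fsetD in_fsetU sn /= andbT orbN.
have mx := cyl_measurable x.
have tr : trivIset [set` enum [pred y : cc U | res V (exk y) == z]] (fun y : cc U => cyl y).
  by apply/trivIsetP => y y' _ _ ny; apply/seteqP; split=> // w [/cylP/eqP h /cylP/eqP h']; case/eqP: ny; rewrite -h -h'.
have mU (y : cc U) := cyl_measurable y.
have mD : measurable (\big[setU/set0]_(y <- enum [pred y : cc U | res V (exk y) == z]) cyl y : set (OmegaM d k)).
  by apply: bigsetU_measurable => y _; exact: mU.
rewrite (cyl_part z VU) !ge0_integral_bigsetU ?enum_uniq //; try by [apply: kernel_measT|apply: indic_measT|move=> w _; rewrite lee_fin].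
have h (y : cc U) : (\int[mu]_(w in cyl y) (\1_(cyl x) w)%:E = mu (cyl x `&` cyl y))%E by exact: integral_indic.
split; rewrite ge0_sume_distrr; try by move=> y _; apply: integral_ge0 => w _; rewrite lee_fin.
  by apply: lee_sum => y _; rewrite h; have [] := piece x y dLU nLU.
by apply: lee_sum => y _; rewrite h; have [] := piece x y dLU nLU.
Qed.

Lemma rr_cvg L : (fun n => expR (2 * eps L n)) @ \oo --> (1 : R).
Proof.
rewrite -[X in _ --> X]expR0; apply: continuous_cvg; first exact: continuous_expR.
rewrite -[X in _ --> X](mulr0 2); apply: cvgMr.
rewrite -[X in _ --> X](addr0 0); apply: cvgD; last exact: half_cvg.
rewrite -[X in _ --> X](mulr0 2); apply: cvgMr.
rewrite -[X in _ --> X](mulr0 #|` L|%:R); apply: cvgMr.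
by rewrite -[X in _ --> X](mulr0 c); apply: cvgMr; exact: half_cvg.
Qed.

(** The factor of [cyl_integral] tends to 1 as [n] grows, while the two integrals do not depend on
    [n]. *)
Lemma cyl_integral_eq L V (x : cc L) (z : cc V) : [disjoint L & V]%fset ->
  (\int[mu]_(w in cyl z) (\1_(cyl x) w)%:E = \int[mu]_(w in cyl z) (K x w)%:E)%E.
Proof.
move=> dLV; have h n := @cyl_integral n L V x z dLV.
have mz := cyl_measurable z; have mx := cyl_measurable x.
have f1 : (\int[mu]_(w in cyl z) (\1_(cyl x) w : R)%:E)%E \is a fin_num.
  apply: (int_le1 mz); first exact: indic_measT.
    by move=> w; rewrite indicE.
  by move=> w; rewrite indicE lern1 leq_b1.
have f2 : (\int[mu]_(w in cyl z) (K x w)%:E)%E \is a fin_num.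
  by apply: (int_le1 mz) => //; exact: kernel_measT.
move: h f1 f2; case: (\int[mu]_(w in _) (\1_ _ _)%:E)%E => // a; case: (\int[mu]_(w in _) _)%E => // b0 h _ _.
congr (_%:E).
have c1 : (fun n => expR (2 * eps L n) * a) @ \oo --> a.
  by rewrite -[X in _ --> X]mul1r; apply: cvgMl; exact: rr_cvg.
have c2 : (fun n => expR (2 * eps L n) * b0) @ \oo --> b0.
  by rewrite -[X in _ --> X]mul1r; apply: cvgMl; exact: rr_cvg.
apply/eqP; rewrite eq_le; apply/andP; split.
  by apply: (ler_flim _ (cvg_cst a) c2); apply: nearW => n; have [_] := h n; rewrite -EFinM lee_fin.
by apply: (ler_flim _ (cvg_cst b0) c1); apply: nearW => n; have [] := h n; rewrite -EFinM lee_fin.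
Qed.

Lemma cylI U V (x : cc U) (z : cc V) : cyl x `&` cyl z = set0 \/
  exists y : cc (U `|` V)%fset, cyl x `&` cyl z = cyl y.
Proof.
have [[w [xw zw]]|ne] := pselect (exists w, (cyl x `&` cyl z) w); last first.
  by left; apply/seteqP; split => // w hw; apply: ne; exists w.
right; exists (res (U `|` V)%fset w); apply/seteqP; split => w'.
  move=> [xw' zw'] s; rewrite ffunE; have := fsvalP s; rewrite in_fsetU => /orP[sU|sV].
    by rewrite (_ : fsval s = fsval [` sU]%fset) // xw' xw.
  by rewrite (_ : fsval s = fsval [` sV]%fset) // zw' zw.
move=> h; split => s.
  have sU : fsval s \in (U `|` V)%fset by rewrite in_fsetU fsvalP.
  by rewrite -xw; have := h [` sU]%fset; rewrite ffunE.
have sV : fsval s \in (U `|` V)%fset by rewrite in_fsetU fsvalP orbT.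
by rewrite -zw; have := h [` sV]%fset; rewrite ffunE.
Qed.

(** Dynkin induction. Two incompatible cylinders have empty intersection, so the empty set is added
    to the generators to obtain a pi-system. *)
Lemma out_integral L (x : cc L) B : outside_sigma L B ->
  (\int[mu]_(w in B) (\1_(cyl x) w)%:E = \int[mu]_(w in B) (K x w)%:E)%E.
Proof.
pose G := outgen L `|` [set set0].
have mx := cyl_measurable x.
have GL : <<s G >> `<=` <<s outgen L >>.
  apply: smallest_sub; first exact: smallest_sigma_algebra.
  by move=> C [hC|->]; [exact: sub_sigma_algebra|exact: sigma_algebra0].
have f10 w : (0 <= (\1_(cyl x) w : R)%:E)%E by rewrite lee_fin.
have f20 w : (0 <= (K x w)%:E)%E by rewrite lee_fin.
have f1fin (D : set (OmegaM d k)) : measurable D -> (\int[mu]_(w in D) (\1_(cyl x) w : R)%:E)%E \is a fin_num.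
  move=> mD; apply: (int_le1 mD); first exact: indic_measT.
    by move=> w; rewrite indicE.
  by move=> w; rewrite indicE lern1 leq_b1.
move=> sB; have {sB} : <<s G >> B.
  by apply: sub_sigma_algebra2 sB => C hC; left.
have mG (S : set (g_sigma_algebraType G)) : measurable S -> measurable (S : set (OmegaM d k)).
  by move=> /GL; exact: out_measurable.
pose P (D : set (Omega d k)) := (\int[mu]_(w in D) (\1_(cyl x) w)%:E = \int[mu]_(w in D) (K x w)%:E)%E.
apply: (@dynkin_induction _ (g_sigma_algebraType G) G P) => //.
- move=> C D [[U [y [-> hU]]]|->] [[V [z [-> hV]]]|->]; rewrite ?set0I ?setI0; try by right.
  have [->|[u ->]] := cylI y z; [by right|left; exists (U `|` V)%fset, u; split => // s].
  by rewrite in_fsetU => /orP[/hU|/hV].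
- have -> : [set: g_sigma_algebraType G] = cyl ([ffun=> ord0] : cc fset0).
    by apply/seteqP; split=> // w _ s; have := fsvalP s; rewrite in_fset0.
  by apply: cyl_integral_eq; exact: fdisjointX0.
- move=> C [[V [z [-> hV]]]|->]; last by rewrite /P !integral_set0.
  apply: cyl_integral_eq; apply/fdisjointP => s sL; apply/negP => sV.
  by have := hV s sV; rewrite sL.
- move=> S /mG mS PS; have mC := measurableC mS.
  have PT : P setT.
    have -> : [set: Omega d k] = cyl ([ffun=> ord0] : cc fset0).
      by apply/seteqP; split=> // w _ s; have := fsvalP s; rewrite in_fset0.
    by apply: cyl_integral_eq; exact: fdisjointX0.
  have dS : [disjoint S & ~` S] by apply/disj_setPCl.
  have mSS := measurableU _ _ mS mC.
  move: PT; rewrite /P -(setUv S).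
  rewrite (ge0_integral_setU mu mS mC (indic_measT mx)) //.
  rewrite (ge0_integral_setU mu mS mC (kernel_measT x mSS)) //.
  rewrite -PS; have := f1fin S mS; have := f1fin _ mC.
  by case: (\int[mu]_(w in ~` S) (\1_ _ _)%:E)%E => // a _; case: (\int[mu]_(w in S) _)%E => // a' _;
    case: (\int[mu]_(w in ~` S) _)%E => // a'' [] /addrI ->.
- move=> F mF tF PF; rewrite /P.
  have mF' i : measurable (F i : set (OmegaM d k)) by apply: mG.
  have mFF : measurable (\bigcup_i F i : set (OmegaM d k)) by exact: bigcupT_measurable.
  rewrite (ge0_integral_bigcup mu mF' (indic_measT mx)) //.
  rewrite (ge0_integral_bigcup mu mF' (kernel_measT x mFF)) //.
  by congr (limn _); apply/funext => n; apply: eq_bigr => i _; exact: PF.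
Qed.

Lemma kernel_gibbs L (x : cc L) :
  (forall Y : set R, measurable Y -> outside_sigma L (K x @^-1` Y)) /\
  (forall B : set (Omega d k), outside_sigma L B ->
     mu (cyl x `&` B) = (\int[mu]_(w in B) (K x w)%:E)%E).
Proof.
split=> [Y mY|B oB].
  have h := kernel_meas x measurableT mY; rewrite setTI in h; exact: h.
rewrite -(out_integral x oB) integral_indic //; first exact: out_measurable oB.
exact: cyl_measurable.
Qed.

End KernelMeasure.

Section DLRConclusion.
Local Open Scope classical_set_scope.

Lemma dlr_gibbsian (R : realType) (d k : nat) (mu : probability (OmegaM d k) R)
  (T : Type) (FF : set_system T) (FU : UltraFilter FF)
  (Ls : T -> {fset site d}) (pt : T -> cpotential R d k) (b : T -> {fset site d} -> R) (c : R) :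
  (forall V, \forall t \near FF, (V `<=` Ls t)%fset) ->
  (forall t, cpot_local (pt t)) ->
  (forall t A, 0 <= b t A) ->
  (forall t A w, `|pt t A w| <= b t A) ->
  (forall t (F : {fset {fset site d}}) s n,
    (forall A, A \in F -> s \in A /\ exists2 u, u \in A & (n <= dst s u)%N) ->
    \sum_(A <- F) b t A <= c * 2 ^- n) ->
  (forall A (a : site d) w, \forall t \near FF, pt t (shift A a) w = pt t A (fun s => w (s + a)%R)) ->
  (forall V (x : {ffun (V : {fset site d}) -> 'I_k.+1}),
    (fun t => pm Ls pt t x) @ FF --> fine (mu (cyl x))) ->
  gibbsian mu.
Proof.
move=> h1 h2 h3 h4 h5 h6 h7; exists (Psi FF pt); split.
- by eapply Psi_local; eassumption.
- by eapply Psi_transl; eassumption.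
- by eapply Psi_summable; eassumption.
move=> L x; apply: (kernel_gibbs (c := c)).
- by eapply Psi_local; eassumption.
- by move=> L' n w; eapply energy_approx; eassumption.
- move=> n L' U x' z w dLU nLU zw; rewrite -(cyl_join x' z dLU).
  by eapply mu_ratio; eassumption.
- by move=> L' x' w; apply: kernel_ge0.
- by move=> L' x' w; apply: kernel_le1.
Qed.

End DLRConclusion.

(** * Choice of constants and passage to the limit *)

Section NormalFormTheorem.
Local Open Scope classical_set_scope.
Variables (R : realType) (d m k : nat) (o : 'I_m) (r : nat) (g : R).
Local Notation C := R[i].
Variables (Phi0 : qinteraction R d m) (Q : 'I_k.+1 -> 'M[C]_m).
Hypothesis NF : assumption1 Phi0 r (delta_mx o o : 'M[C]_m) g.
Hypothesis Qpos : forall j, 0 < Q j o o.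
Hypothesis Qherm : forall j, adj (Q j) = Q j.
Hypothesis Qidem : forall j, Q j *m Q j = Q j.
Hypothesis Q1 : \sum_j Q j = 1%:M.

Definition nkap : R := 1 + \sum_j \sum_a \sum_b nrm (Q j a b / Q j o o).
Definition nqmax : R := \sum_j `|ln (qq o Q j)|.
Definition nN0 : R := (bz d r)%:R * bigK d m r nkap ^+ (2 * bz d r).
(** The solution of exp(- tau g) nN0 = 1/20, the threshold asked for by [tau_gap]. *)
Definition ntau0 : R := ln (20 * nN0) / g.
Definition nkmin : R := ln (bigK d m r nkap ^+ (2 * bz d r) * bigE d r (2 * ntau0)).

Lemma nkap1 : 1 <= nkap.
Proof.
by rewrite lerDl; do 3![apply: sumr_ge0 => ? _]; exact: nrm_ge0.
Qed.

Lemma nkap_le j a b : nrm (Q j a b / Q j o o) <= nkap.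
Proof.
rewrite /nkap (bigD1 j) //= (bigD1 a) //= (bigD1 b) //=.
set n1 := nrm _; set s1 := \sum_(_ | _) _; set s2 := \sum_(_ | _) _; set s3 := \sum_(_ | _) _.
have h1 : 0 <= s1 by apply: sumr_ge0 => ? _; exact: nrm_ge0.
have h2 : 0 <= s2 by do 2![apply: sumr_ge0 => ? _]; exact: nrm_ge0.
have h3 : 0 <= s3 by do 3![apply: sumr_ge0 => ? _]; exact: nrm_ge0.
by lra.
Qed.

Lemma nqmax_le j : `|ln (qq o Q j)| <= nqmax.
Proof. by rewrite /nqmax (bigD1 j) //= lerDl; apply: sumr_ge0 => i _; exact: normr_ge0. Qed.

Lemma g_gt0 : 0 < g. Proof. by case: NF. Qed.

Lemma nN0_ge1 : 1 <= nN0.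
Proof.
rewrite /nN0 mulr_ege1 //; last by rewrite exprn_ege1 // (bigK1 d o) ?nkap1.
by rewrite ler1n /bz muln_gt0 !expn_gt0.
Qed.

Lemma ntau0_gt0 : 0 < ntau0.
Proof. by rewrite divr_gt0 ?g_gt0 // ln_gt0 //; have := nN0_ge1; lra. Qed.

Lemma ntau_gap tau : ntau0 <= tau -> expR (- (tau * g)) * nN0 <= 1 / 20.
Proof.
move=> ht; have N1 := nN0_ge1; have p : 0 < 20 * nN0 by lra.
have : expR (- (tau * g)) <= expR (- (ntau0 * g)).
  by rewrite ler_expR lerN2 ler_wpM2r // ltW // g_gt0.
have -> : expR (- (ntau0 * g)) = (20 * nN0)^-1.
  by rewrite /ntau0 mulfVK ?gt_eqF ?g_gt0 // expRN lnK ?posrE.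
have n0 : 0 <= nN0 by lra.
move=> /(ler_wpM2r n0) /le_trans; apply; rewrite invfM -mulrA mulVf ?mulr1 ?div1r //.
by rewrite gt_eqF //; lra.
Qed.

Lemma nbigE1 : 1 < bigE d r (2 * ntau0).
Proof.
have t0 := ntau0_gt0; have b0 : 0 < (bz d r)%:R :> R by rewrite ltr0n /bz muln_gt0 !expn_gt0.
have e0 : 0 < expR (2 * (2 * ntau0)) by exact: expR_gt0.
rewrite /bigE ltrDr; apply: mulr_gt0; first by apply: mulr_gt0.
by apply: mulr_gt0 => //; apply: mulr_gt0 => //; apply: mulr_gt0.
Qed.

Lemma nprod_gt1 : 1 < bigK d m r nkap ^+ (2 * bz d r) * bigE d r (2 * ntau0).
Proof.
have K1 : 1 <= bigK d m r nkap ^+ (2 * bz d r) by rewrite exprn_ege1 // (bigK1 d o) ?nkap1.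
apply: lt_le_trans nbigE1 _; rewrite ler_peMl // ltW // (lt_trans ltr01) // nbigE1.
by [].
Qed.

Lemma nkmin_gt0 : 0 < nkmin.
Proof. by rewrite ln_gt0 // nprod_gt1. Qed.

Lemma nkappa_big kappa : nkmin <= kappa ->
  bigK d m r nkap ^+ (2 * bz d r) * bigE d r (2 * ntau0) <= expR kappa.
Proof.
rewrite -ler_expR /nkmin lnK // posrE; apply: lt_trans nprod_gt1; exact: ltr01.
Qed.

(** The number of slices is the integer part of [beta / ntau0], which is at least 1, so the slice
    length is at most twice [ntau0]. Since [betaN] counts one slice more than its argument, the
    witness is the predecessor. *)
Lemma beta_split beta : ntau0 <= beta ->
  exists p : nat * R, betaN p.1 p.2 = beta /\ ntau0 <= p.2 <= 2 * ntau0.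
Proof.
move=> hb; have t0 := ntau0_gt0; have b0 : 0 <= beta / ntau0 by rewrite divr_ge0 ?(le_trans (ltW t0) hb) // ltW.
have /andP[h1 h2] := truncn_itv b0; move: h1 h2; set n := Num.truncn _.
rewrite ler_pdivlMr // ltr_pdivrMr //.
case: n => [|n] h1 h2; first by move: h2; rewrite mul1r ltNge hb.
have n0 : (0 : R) < n.+1%:R by rewrite ltr0n.
exists (n, beta / n.+1%:R); split; first by rewrite /betaN mulrC mulfVK // gt_eqF.
rewrite /= ler_pdivlMr // mulrC h1 /= ler_pdivrMr //.
apply: le_trans (ltW h2) _; rewrite -[n.+2]addn1 natrD mulrDl mul1r.
have : ntau0 <= ntau0 * n.+1%:R by rewrite ler_peMr ?(ltW t0) // ler1n.
by rewrite (mulrC n.+1%:R); lra.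
Qed.

Variables (kappa : R) (Ups : qinteraction R d m).
Hypothesis hkappa : nkmin <= kappa.
Hypothesis hUps : is_interaction Ups.
Hypothesis hk : (kappa_norm kappa Ups <= 1)%E.
Local Notation Phi := (fun A => Phi0 A + Ups A).

Lemma far_nbh (L A : {fset site d}) : (nbh (rho d r) A `<=` L)%fset ->
  forall s t, s \in A -> (dst s t <= rho d r)%N -> t \in L.
Proof. by move=> /fsubsetP h s t sA st; apply: h; exact: in_nbh sA st. Qed.

(** A common core for both temperatures regimes: a pair is an index into the inverse temperatures
    [be] together with a box size, and all bounds are uniform in both. *)
Lemma nf_core (mu : probability (OmegaM d k) R) (be : nat -> R) (F0 : set_system (nat * nat)) :
  ProperFilter F0 -> (forall j, ntau0 <= be j) ->
  (forall V : {fset site d}, \forall t \near F0, (V `<=` box d t.2)%fset) ->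
  (forall V (x : {ffun (V : {fset site d}) -> 'I_k.+1}),
    (fun t => fv_marginal Q (be t.1) Phi t.2 x) @ F0 --> fine (mu (cyl x))) ->
  gibbsian mu.
Proof.
move=> F0P hbe hbox hcvg; have [G [GU F0G]] := ultraFilterLemma F0P.
have [p hp] := choice (fun j => beta_split (hbe j)).
have pE j : betaN (p j).1 (p j).2 = be j by case: (hp j).
have p1 j : ntau0 <= (p j).2 by case: (hp j) => _ /andP[].
have p2 j : (p j).2 <= 2 * ntau0 by case: (hp j) => _ /andP[].
have p0 j : 0 <= (p j).2 by apply: le_trans (p1 j); rewrite ltW // ntau0_gt0.
pose pt (t : nat * nat) : cpotential R d k := pot o r Phi0 Ups Q (p t.1).2 (p t.1).1 (box d t.2).
have hb (t : nat * nat) := pot_bound (p t.1).1 NF hUps hk nkap1 (p0 t.1) (p2 t.1) (ntau_gap (p1 t.1))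
   (nkappa_big hkappa) Qpos nkap_le nqmax_le (box d t.2).
have [b hb'] := choice hb.
apply: (@dlr_gibbsian R d k mu _ G GU (fun t => box d t.2) pt b (potc d r nqmax)).
- by move=> V; apply: F0G; exact: hbox.
- by move=> t A w w' h; apply: (pot_local _ _ NF hUps Qpos).
- by move=> t; case: (hb' t).
- by move=> t; case: (hb' t).
- by move=> t; case: (hb' t).
- move=> A a w; apply: F0G.
  apply: filterS2 (hbox (nbh (rho d r) A)) (hbox (nbh (rho d r) (shift A a))) => t h h'.
  by apply: (pot_shift _ _ NF hUps Qpos); exact: far_nbh.
move=> V x.
have hc : (fun t => fv_marginal Q (be t.1) Phi t.2 x) @ G --> fine (mu (cyl x)).
  by move=> S hS; apply: F0G; exact: hcvg hS.
apply: cvg_trans hc; apply: near_eq_cvg; apply: F0G; apply: filterS (hbox V) => t Vt.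
rewrite -(pE t.1) (fv_marginal_pot NF hUps Qpos Qherm Qidem Q1) //.
move=> L y B; exact: (Zl_neq0 (p t.1).1 NF hUps hk nkap1 (p0 t.1) (p2 t.1) (ntau_gap (p1 t.1))
   (nkappa_big hkappa) Qpos nkap_le).
Qed.

Lemma nf_eq beta (mu : probability (OmegaM d k) R) : ntau0 <= beta ->
  is_restriction_eq Q beta Phi mu -> gibbsian mu.
Proof.
move=> hb hmu; apply: (@nf_core mu (fun=> beta) ((fun n => (0%N, n)) @ \oo)) => [j|V|V x].
- exact: hb.
- have [n0 hn] := box_sub V; have h : \forall n \near \oo, (V `<=` box d n)%fset.
    by exists n0 => // n /= /hn.
  exact: h.
- exact: hmu.
Qed.

(** The filter of the iterated limit, volume first. It differs from the product filter in that the
    threshold on [n] may depend on [j]. *)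
Definition iterF : set_system (nat * nat) :=
  [set S | \forall j \near \oo, \forall n \near \oo, S (j, n)].

Local Instance iterF_proper : ProperFilter iterF.
Proof.
have FI : Filter iterF; last first.
  split=> // h; have h' : \forall j \near \oo, \forall n \near \oo, False := h.
  by have [j hj] := filter_ex h'; have [] := filter_ex hj.
split.
- by apply: nearW => j; apply: nearW.
- move=> S S' hS hS'; have h1 : \forall j \near \oo, \forall n \near \oo, S (j, n) := hS.
  have h2 : \forall j \near \oo, \forall n \near \oo, S' (j, n) := hS'.
  have h3 : \forall j \near \oo, \forall n \near \oo, (S `&` S') (j, n).
    by apply: filterS2 h1 h2 => j h h'; apply: filterS2 h h' => n; split.
  exact: h3.
- move=> S S' SS' hS; have h1 : \forall j \near \oo, \forall n \near \oo, S (j, n) := hS.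
  have h3 : \forall j \near \oo, \forall n \near \oo, S' (j, n).
    by apply: filterS h1 => j h; apply: filterS h => n; exact: SS'.
  exact: h3.
Qed.

Lemma nf_gs (mu : probability (OmegaM d k) R) : is_restriction_gs Q Phi mu -> gibbsian mu.
Proof.
move=> hmu; pose be (j : nat) : R := ntau0 + j%:R.
have be_near (S : set R) : (\forall beta \near +oo, S beta) -> \forall j \near \oo, S (be j).
  case=> M [_ hM]; exists (Num.truncn `|M|).+1 => // j /= hj; apply: hM.
  have /andP[_ h] := truncn_itv (normr_ge0 M).
  apply: le_lt_trans (ler_norm M) _; apply: lt_le_trans h _.
  apply: (@le_trans _ _ j%:R); first by rewrite ler_nat.
  by rewrite lerDr ltW // ntau0_gt0.
apply: (@nf_core mu be iterF iterF_proper) => [j|V|V x].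
- by rewrite lerDl.
- have h : \forall j \near \oo, \forall n \near \oo, (V `<=` box d n)%fset.
    by apply: nearW => j; have [n0 hn] := box_sub V; exists n0 => // n /= /hn.
  exact: h.
have [Gb [h1 h2]] := hmu V x; apply/cvgrPdist_le => e e0.
change (\forall j \near \oo, \forall n \near \oo, `|fine (mu (cyl x)) - fv_marginal Q (be j) Phi n x| <= e).
have e20 : 0 < e / 2 by rewrite divr_gt0.
have g1 := be_near _ h1.
have g2 : \forall j \near \oo, `|fine (mu (cyl x)) - Gb (be j)| <= e / 2.
  apply: (be_near (fun beta => `|fine (mu (cyl x)) - Gb beta| <= e / 2)).
  by move/cvgrPdist_le : h2 => /(_ _ e20).
apply: filterS2 g1 g2 => j hj1 hj2.
have hn : \forall n \near \oo, `|Gb (be j) - fv_marginal Q (be j) Phi n x| <= e / 2.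
  by move/cvgrPdist_le : hj1 => /(_ _ e20).
apply: filterS hn => n hn /=.
apply: le_trans (ler_distD (Gb (be j)) _ _) _.
by rewrite (splitr e); exact: lerD.
Qed.

End NormalFormTheorem.

(** * Change of basis *)

From mathcomp Require Import sesquilinear spectral.

Section RankOne.
Variables (R : realType) (m : nat).
Local Notation C := R[i].
Local Open Scope sesquilinear_scope.

Lemma adjE (n p : nat) (M : 'M[C]_(n, p)) : adj M = M ^t*.
Proof. by apply/matrixP => i j; rewrite !mxE. Qed.

(** The spectral theorem diagonalises [P], idempotence makes its eigenvalues 0 or 1, and rank one
    leaves exactly one eigenvalue 1. *)
Lemma rank_one_diag (P : 'M[C]_m) : rank_one_proj P ->
  exists (o : 'I_m) (S : 'M[C]_m), S *m adj S = 1%:M /\ S *m P *m adj S = delta_mx o o.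
Proof.
move=> [hP PP rP].
have nP : P \is normalmx.
  by apply/normalmxP; rewrite -adjE hP.
pose S := spectralmx P; have uS : S \is unitarymx := spectral_unitarymx P.
have SS : S *m adj S = 1%:M by rewrite adjE; apply/unitarymxP.
have iS : invmx S = adj S by rewrite adjE invmx_unitary.
have := orthomx_spectralP nP; rewrite -/S iS; set D := diag_mx _ => PE.
have SPS : S *m P *m adj S = D.
  by rewrite PE !mulmxA SS mul1mx -mulmxA SS mulmx1.
have SS' : adj S *m S = 1%:M by exact: mulmx1C.
have DD : D *m D = D.
  by rewrite -SPS !mulmxA -(mulmxA _ (adj S) S) SS' mulmx1 -(mulmxA _ P P) PP.
have rD : \rank D = 1%N.
  rewrite -SPS mxrankMfree; last by rewrite row_free_unit -iS unitmx_inv unitarymx_unit.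
  by rewrite eqmxMfull // row_full_unit unitarymx_unit.
have D01 i : D i i = 0 \/ D i i = 1.
  have := congr1 (fun M : 'M[C]_m => M i i) DD; rewrite mxE (bigD1 i) //= big1 ?addr0 => [|j ji].
    move=> h; have : D i i * (D i i - 1) = 0 by rewrite mulrBr mulr1 h subrr.
    by move/eqP; rewrite mulf_eq0 subr_eq0 => /orP[]/eqP; [left|right].
  by rewrite /D !mxE eq_sym (negPf ji) mulr0n mul0r.
(* The 2 by 2 minors of a rank one matrix vanish, by its factorisation into a column times a row. *)
have minor i j : D i i * D j j = D i j * D j i.
  have e a b : D a b = col_base D a (cast_ord (esym rD) ord0) * row_base D (cast_ord (esym rD) ord0) b.
    rewrite -[in LHS](mulmx_base D) mxE (bigD1 (cast_ord (esym rD) ord0)) //= big1 ?addr0 // => l.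
    case/eqP; apply: val_inj => /=; case: l => l /=; rewrite rD; by case: l.
  by rewrite !e; set x1 := col_base _ _ _; set x2 := row_base _ _ _; rewrite mulrACA [RHS]mulrACA mulrC mulrACA mulrC; ring.
have [ o1 ho1 ] : exists o1 : 'I_m, D o1 o1 = 1.
  apply: contrapT => hn; move: rD; rewrite (_ : D = 0) ?mxrank0 //.
  apply/matrixP => i j; rewrite [RHS]mxE; have [<-|ij] := eqVneq i j.
    by case: (D01 i) => // h; case: hn; exists i.
  by rewrite /D mxE (negPf ij) mulr0n.
exists o1, S; split => //; rewrite SPS; apply/matrixP => i j; rewrite [RHS]mxE.
have [<-|ij] := eqVneq i j; last first.
  by rewrite /D mxE (negPf ij) mulr0n; case: eqP => //= ei; case: eqP => // ej; rewrite ei ej eqxx in ij.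
have [->|io] := eqVneq i o1; first by rewrite ho1.
have := minor i o1; rewrite ho1 mulr1 => ->.
by rewrite /D !mxE (negPf io) mulr0n mul0r.
Qed.

End RankOne.

Section BasisChange.
Import fintype boot.finset.
Variables (R : realType) (d m : nat) (o : 'I_m) (S : 'M[R[i]]_m).
Local Notation C := R[i].
Local Notation qc A := {ffun (A : {fset site d}) -> 'I_m}.
Implicit Types (A L V : {fset site d}).
Hypothesis SS : S *m adj S = 1%:M.

Let SS' : adj S *m S = 1%:M. Proof. exact: mulmx1C. Qed.

Definition TS A : op R m A := tens (fun _ : A => S).
Definition cj A (M : op R m A) : op R m A := TS A *m M *m adj (TS A).

Lemma TSV A : TS A *m adj (TS A) = 1%:M.
Proof. by rewrite /TS adj_tens tens_mul -tens1; congr tens; apply/funext => s. Qed.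

Lemma TSV' A : adj (TS A) *m TS A = 1%:M.
Proof. exact: mulmx1C (TSV A). Qed.

Lemma cj_tens A (F : A -> 'M[C]_m) : cj (tens F) = tens (fun s => S *m F s *m adj S).
Proof. by rewrite /cj /TS adj_tens !tens_mul. Qed.

Lemma cjD A (M N : op R m A) : cj (M + N) = cj M + cj N.
Proof. by rewrite /cj mulmxDr mulmxDl. Qed.

Lemma cjZ A c (M : op R m A) : cj (c *: M) = c *: cj M.
Proof. by rewrite /cj -scalemxAr -scalemxAl. Qed.

Lemma cjN A (M : op R m A) : cj (- M) = - cj M.
Proof. by rewrite /cj mulmxN mulNmx. Qed.

Lemma cj0 A : cj (0 : op R m A) = 0.
Proof. by rewrite /cj mulmx0 mul0mx. Qed.

Lemma cj_sum A (J : Type) (s : seq J) (P : pred J) (F : J -> op R m A) :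
  cj (\sum_(j <- s | P j) F j) = \sum_(j <- s | P j) cj (F j).
Proof. by rewrite /cj mulmx_sumr mulmx_suml. Qed.

Lemma cjM A (M N : op R m A) : cj (M *m N) = cj M *m cj N.
Proof. by rewrite /cj !mulmxA -(mulmxA _ (adj _) (TS A)) TSV' mulmx1. Qed.

Lemma adj_cj A (M : op R m A) : adj (cj M) = cj (adj M).
Proof. by rewrite /cj !adjM adjK mulmxA. Qed.

Lemma tr_cj A (M : op R m A) : \tr (cj M) = \tr M.
Proof. by rewrite /cj mxtrace_mulC mulmxA TSV' mul1mx. Qed.

Lemma emb_tensF L A (F : site d -> 'M[C]_m) : (A `<=` L)%fset ->
  emb L (tens (fun s : A => F (fsval s))) = tens (fun s : L => if fsval s \in A then F (fsval s) else 1%:M).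
Proof.
move=> AL; apply: ceP => x y; apply: etrans (ce_emb1 o _ _ _ AL) _; rewrite !ce_tens.
pose G s := (if s \in A then F s else 1%:M) (ext o x s) (ext o y s).
rewrite [RHS](eq_bigr (fun s : L => G (fsval s))) => [|s _]; last by rewrite /G !ext_in.
have [h|nh] := offeqP A (ext o x) (ext o y).
  rewrite mulr1 (prod_fsub (D := A) (F := G) AL) => [|s sL sA]; last by rewrite /G (negPf sA) mxE h ?eqxx.
  by apply: eq_bigr => s _; rewrite /G fsvalP !ffunE.
rewrite mulr0; apply/esym.
have [s sV ns] : exists2 s, s \notin A & ext o x s != ext o y s.
  apply: contrapT => hs; apply: nh => s sV; apply/eqP; apply: contrapT => ns.
  by apply: hs; exists s => //; apply/negP.
have sL : s \in L by apply: contraNT ns => sL; rewrite !ext_out.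
by rewrite (bigD1 [` sL]%fset) //= /G (negPf sV) mxE (negPf ns) mul0r.
Qed.

Lemma tens_span A (M : op R m A) :
  M = \sum_(x : qc A) \sum_(y : qc A) ce M x y *: tens (fun s : A => delta_mx (ext o x (fsval s)) (ext o y (fsval s))).
Proof.
apply: ceP => a b; rewrite ce_sum.
have e x y : ce (tens (fun s : A => delta_mx (ext o x (fsval s)) (ext o y (fsval s)) : 'M[C]_m)) a b =
    ((a == x) && (b == y))%:R.
  rewrite ce_tens (eq_bigr (fun s : A => ((a s == x s) && (b s == y s))%:R)) => [|s _]; last by rewrite mxE !ext_in.
  rewrite prod_bool; congr (nat_of_bool _)%:R; apply/forallP/andP => [h|[/eqP -> /eqP ->] s]; last by rewrite !eqxx.
  by split; apply/eqP/ffunP => s; have /andP[/eqP ? /eqP ?] := h s.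
rewrite (bigD1 a) //= [X in _ = _ + X]big1 ?addr0 => [|x xa]; last first.
  by rewrite ce_sum big1 // => y _; rewrite ceZ e eq_sym (negPf xa) mulr0.
rewrite ce_sum (bigD1 b) //= big1 ?addr0 => [|y yb]; first by rewrite ceZ e !eqxx mulr1.
by rewrite ceZ e (eq_sym b) (negPf yb) andbF mulr0.
Qed.

Lemma embD L A (M N : op R m A) : (A `<=` L)%fset -> emb L (M + N) = emb L M + emb L N.
Proof. by move=> AL; apply: ceP => x y; rewrite ceD !(ce_emb1 o) // ceD mulrDl. Qed.

Lemma embZ L A c (M : op R m A) : (A `<=` L)%fset -> emb L (c *: M) = c *: emb L M.
Proof. by move=> AL; apply: ceP => x y; rewrite ceZ !(ce_emb1 o) // ceZ mulrA. Qed.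

Lemma emb0 L A : (A `<=` L)%fset -> emb L (0 : op R m A) = 0.
Proof. by move=> AL; apply: ceP => x y; rewrite (ce_emb1 o) // !ce0 mul0r. Qed.

Lemma emb_sum L A (J : Type) (s : seq J) (P : pred J) (F : J -> op R m A) : (A `<=` L)%fset ->
  emb L (\sum_(j <- s | P j) F j) = \sum_(j <- s | P j) emb L (F j).
Proof.
by move=> AL; apply: (big_morph (fun M : op R m A => emb L M)); [move=> M N; exact: embD|exact: emb0].
Qed.

(** By linearity and [tens_span] it suffices to treat product operators, where the factors outside
    [A] are conjugated identities and hence identities. *)
Lemma emb_cj L A (M : op R m A) : (A `<=` L)%fset -> emb L (cj M) = cj (emb L M).
Proof.
move=> AL; rewrite {1}(tens_span M) [in RHS](tens_span M) cj_sum !emb_sum // cj_sum.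
apply: eq_bigr => x _; rewrite cj_sum !emb_sum // cj_sum; apply: eq_bigr => y _.
rewrite cjZ !embZ // cjZ; congr (_ *: _); rewrite cj_tens.
rewrite (emb_tensF (fun s => S *m delta_mx (ext o x s) (ext o y s) *m adj S) AL).
rewrite (emb_tensF (fun s => delta_mx (ext o x s) (ext o y s)) AL) cj_tens.
by congr tens; apply/funext => s; case: ifP => // _; rewrite mulmx1 SS.
Qed.

Definition cjI (Phi : qinteraction R d m) : qinteraction R d m := fun A => cj (Phi A).

Lemma ham_cj Phi L : ham (cjI Phi) L = cj (ham Phi L).
Proof.
rewrite /ham cj_sum big_seq [RHS]big_seq; apply: eq_bigr => A.
by rewrite fpowersetE => AL; exact: emb_cj.
Qed.

Lemma cj_transl Phi : qtransl_inv Phi -> qtransl_inv (cjI Phi).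
Proof.
move=> hP A a x0 y0 x y hx hy.
have mem (s : A) : (fsval s + a)%R \in shift A a by rewrite shiftP addrK; exact: fsvalP.
have mem' (t : shift A a) : (fsval t - a)%R \in A by rewrite -shiftP; exact: fsvalP.
pose j (s : A) : shift A a := [` mem s]%fset.
pose j' (t : shift A a) : A := [` mem' t]%fset.
have jK : cancel j j' by move=> s; apply: val_inj => /=; rewrite addrK.
have j'K : cancel j' j by move=> s; apply: val_inj => /=; rewrite subrK.
have jb : bijective j by exists j'.
pose f (z : qc (shift A a)) : qc A := [ffun s => z (j s)].
pose f' (z : qc A) : qc (shift A a) := [ffun t => z (j' t)].
have fb : bijective f.
  by exists f' => z; apply/ffunP => s; rewrite !ffunE ?jK ?j'K.
have hf z : qshifted (f z) z.
  move=> s t e; rewrite ffunE; congr (z _); apply: val_inj; exact: e.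
have fx z z0 : qshifted z0 z -> f z = z0.
  by move=> h; apply/ffunP => s; rewrite ffunE (h s (j s)).
have TE z w : ce (TS (shift A a)) z w = ce (TS A) (f z) (f w).
  rewrite /TS !ce_tens (reindex j) /=; last exact: onW_bij.
  by apply: eq_bigr => s _; rewrite !ffunE.
rewrite -(fx _ _ hx) -(fx _ _ hy) -[LHS]/(ce (cj (Phi (shift A a))) x y) -[RHS]/(ce (cj (Phi A)) (f x) (f y)).
rewrite /cj !ceM [RHS](reindex f) /=; last exact: onW_bij.
apply: eq_bigr => w _; rewrite !ce_adj TE; congr (_ * _).
rewrite !ceM [RHS](reindex f) /=; last exact: onW_bij.
by apply: eq_bigr => z _; rewrite TE; congr (_ * _); exact: hP.
Qed.

Lemma cj_interaction Phi : is_interaction Phi -> is_interaction (cjI Phi).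
Proof.
move=> [h1 h2 h3]; split; first by move=> A; rewrite /Defs.hermitian adj_cj h1.
  exact: cj_transl.
by move=> A /h3 e; rewrite /cjI e cj0.
Qed.

Lemma psd_cj A (M : op R m A) : psd M -> psd (cj M).
Proof.
move=> h v; have := h (adj (TS A) *m v).
by rewrite adjM adjK /cj !mulmxA.
Qed.

Lemma opb_unitary n (U : 'M[C]_n) : adj U *m U = 1%:M -> opb U 1.
Proof.
move=> UU; split => // v; rewrite expr1n mul1r.
have e (w : 'cV[C]_n) : rc (vn2 w) = (adj w *m w) ord0 ord0.
  rewrite mxE /vn2 /rc rmorph_sum; apply: eq_bigr => i _.
  by apply: etrans (rc_nrm2 _) _; rewrite !mxE mulrC.
suff : rc (vn2 (U *m v)) = rc (vn2 v) by move=> /complexI ->.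
by rewrite !e adjM mulmxA -(mulmxA (adj v)) UU mulmx1.
Qed.

Lemma opnorm_cj A (M : op R m A) : opnorm (cj M) <= opnorm M.
Proof.
apply: opnorm_le; rewrite -[opnorm M]mulr1 -[opnorm M]mul1r.
apply: opbM; last by apply: opb_unitary; rewrite adjK TSV.
by apply: opbM; [apply: opb_unitary; exact: TSV'|apply: opb_opnorm0; exact: (qc_gt0 o)].
Qed.

Lemma kappa_cj kappa Phi : (kappa_norm kappa (cjI Phi) <= kappa_norm kappa Phi)%E.
Proof.
apply: le_esum => A _; rewrite lee_fin ler_wpM2l ?expR_ge0 //; exact: opnorm_cj.
Qed.

Lemma assumption1_cj Phi r P g : S *m P *m adj S = delta_mx o o ->
  assumption1 Phi r P g -> assumption1 (cjI Phi) r (delta_mx o o : 'M[C]_m) g.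
Proof.
move=> SP [h1 h2 h3 h4 h5].
have dE (i j : 'I_m) : (delta_mx o o : 'M[C]_m) i j = ((i == o) && (j == o))%:R by rewrite mxE.
have pE L V : proj_config (delta_mx o o : 'M[C]_m) L V = cj (proj_config P L V).
  rewrite /proj_config cj_tens; congr tens; apply/funext => s; case: ifP => _; last by rewrite SP.
  by rewrite mulmxBr mulmx1 mulmxBl SS SP.
split.
- exact: cj_interaction.
- by move=> A hA; rewrite /cjI h2 // cj0.
- split; last by rewrite mxrank_delta.
    by apply/matrixP => i j; rewrite !mxE rmorph_nat andbC.
  by rewrite mul_delta_mx.
- exact: h4.
move=> L V VL; have [a1 a2 a3] := h5 L V VL; rewrite !pE !ham_cj -!cjM; split.
- by rewrite a1.
- by rewrite a2 cj0.
by have := psd_cj a3; rewrite cjD cjN cjZ.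
Qed.

Variables (k : nat) (Q : 'I_k.+1 -> 'M[C]_m).
Definition cjQ j : 'M[C]_m := S *m Q j *m adj S.

Lemma fv_marginal_cj beta Phi n V (x : {ffun V -> 'I_k.+1}) : (V `<=` box d n)%fset ->
  fv_marginal cjQ beta (cjI Phi) n x = fv_marginal Q beta Phi n x.
Proof.
move=> VL; rewrite /fv_marginal /gibbs_state.
have trE (B : op R m (box d n)) :
    gibbs_tr beta (ham (cjI Phi) (box d n)) (cj B) = gibbs_tr beta (ham Phi (box d n)) B.
  have e M : mexp (cj M) = cj (mexp M) by apply: mexp_conj; exact: TSV'.
  by rewrite !gibbs_trE ham_cj -cjZ e -cjM tr_cj.
have e1 : cj (1 : op R m (box d n)) = 1 by rewrite /cj -[1]/(1%:M) mulmx1 TSV.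
have e2 : emb (box d n) (tens (fun s : V => cjQ (x s))) = cj (emb (box d n) (tens (fun s : V => Q (x s)))).
  by rewrite -emb_cj // cj_tens.
by rewrite e2 trE; have := trE 1; rewrite e1 => ->.
Qed.

End BasisChange.

Lemma mxtrace_mul_delta (K : comPzRingType) (m : nat) (M : 'M[K]_m) (o : 'I_m) :
  \tr (M *m delta_mx o o) = M o o.
Proof.
rewrite /mxtrace (bigD1 o) //= big1 ?addr0 => [|i io]; last first.
  by rewrite mxE big1 // => l _; rewrite mxE (negPf io) andbF mulr0.
rewrite mxE (bigD1 o) //= big1 ?addr0 => [|l lo]; first by rewrite mxE !eqxx mulr1.
by rewrite mxE (negPf lo) mulr0.
Qed.

Local Open Scope classical_set_scope.
Local Open Scope ring_scope.

Theorem theorem2 (R : realType) (d m k : nat)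
    (X P : 'M[R[i]]_m) (ev : 'I_k.+1 -> R) (Q : 'I_k.+1 -> 'M[R[i]]_m)
    (Phi0 : qinteraction R d m) (r : nat) (g : R) :
  (0 < d)%N ->
  assumption1 Phi0 r P g ->
  assumption2 X P ev Q ->
  exists kappa_min beta_min : R,
    [/\ 0 < kappa_min, 0 < beta_min &
      forall (kappa : R) (Ups : qinteraction R d m),
        kappa_min <= kappa ->
        is_interaction Ups ->
        (kappa_norm kappa Ups <= 1)%E ->
        let Phi : qinteraction R d m := fun A => Phi0 A + Ups A in
        (forall beta : R, beta_min <= beta ->
           forall mu : probability (OmegaM d k) R,
             is_restriction_eq Q beta Phi mu -> gibbsian mu) /\
        (forall mu : probability (OmegaM d k) R,
             is_restriction_gs Q Phi mu -> gibbsian mu)].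
Proof.
move=> _ A1 [[_ hQ _ Q1 _] hpos].
have rP : rank_one_proj P by case: A1.
have [ o [S [SS SPS] ] ] := rank_one_diag rP.
have SS' : adj S *m S = 1%:M by exact: mulmx1C.
have A1' := assumption1_cj SS SPS A1.
have PE : P = adj S *m delta_mx o o *m S.
  by rewrite -SPS !mulmxA SS' mul1mx -mulmxA SS' mulmx1.
(* In the new basis the trace of the second assumption is the vacuum entry, the one by which the
   one-site factors are divided. *)
have Qpos j : 0 < cjQ S Q j o o.
  rewrite -mxtrace_mul_delta /cjQ; have := hpos j.
  by rewrite PE !mulmxA mxtrace_mulC !mulmxA.
have Qherm j : adj (cjQ S Q j) = cjQ S Q j.
  by have [h _ _] := hQ j; rewrite /cjQ !adjM adjK mulmxA h.
have Qidem j : cjQ S Q j *m cjQ S Q j = cjQ S Q j.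
  have [_ h _] := hQ j; rewrite /cjQ !mulmxA -(mulmxA _ (adj S) S) SS' mulmx1.
  by rewrite -(mulmxA _ (Q j) (Q j)) h.
have Q1' : \sum_j cjQ S Q j = 1%:M.
  by rewrite /cjQ -mulmx_suml -mulmx_sumr Q1 mulmx1.
exists (nkmin d o r g (cjQ S Q)), (ntau0 d o r g (cjQ S Q)); split.
- exact: nkmin_gt0 A1'.
- exact: ntau0_gt0 A1'.
move=> kappa Ups hk hU hn Phi.
have hU' := cj_interaction S hU.
have hn' : (kappa_norm kappa (cjI S Ups) <= 1)%E by apply: le_trans hn; exact: (kappa_cj o SS).
have PhiE : cjI S Phi = (fun A => cjI S Phi0 A + cjI S Ups A).
  by apply: functional_extensionality_dep => A; rewrite /cjI /Phi cjD.
(* The conjugated marginals agree with the original ones once the box contains [V], hence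
   eventually, which is enough for the limits. *)
have mE beta V (x : {ffun (V : {fset site d}) -> 'I_k.+1}) : \forall n \near \oo,
    fv_marginal Q beta Phi n x = fv_marginal (cjQ S Q) beta (cjI S Phi) n x.
  have [n0 hn0] := box_sub V.
  have hV : \forall n \near \oo, (V `<=` box d n)%fset by exists n0 => // n /= /hn0.
  apply: filterS hV => n VL; apply: esym.
  exact: (fv_marginal_cj o SS Q beta Phi x VL).
split=> [beta hb mu hmu|mu hmu].
  have h : is_restriction_eq (cjQ S Q) beta (cjI S Phi) mu.
    by move=> V x; apply: cvg_trans (hmu V x); apply: near_eq_cvg; exact: mE.
  rewrite PhiE in h; exact: (nf_eq A1' Qpos Qherm Qidem Q1' hk hU' hn' hb h).
have h : is_restriction_gs (cjQ S Q) (cjI S Phi) mu.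
  move=> V x; have [G [h1 h2]] := hmu V x; exists G; split; last exact: h2.
  apply: filterS h1 => beta hb.
  by apply: cvg_trans hb; apply: near_eq_cvg; exact: mE.
rewrite PhiE in h; exact: (nf_gs A1' Qpos Qherm Qidem Q1' hk hU' hn' h).
Qed.
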